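(* Let $X$ be a quasi-compact scheme, let $r,n\ge1$, and let $(P;A_1,\ldots,A_n)\in\mathrm{Aut}^n(\mathcal{P}(X))$, i.e. $P$ is a locally free $\mathcal{O}_X$-module of finite rank and $A_1,\ldots,A_n$ are pairwise commuting automorphisms of $P$. Then, in $K_n(X)$, \[\lambda^r[P;A_1,\ldots,A_n]=\sum_{i=1}^r(-1)^{i-1}\bigl[\mathrm{cr}_i\Lambda^r(P,\ldots,P);B_1,\ldots,B_n\bigr],\] where, in the $i$-th summand, $B_1=\mathrm{cr}_i\Lambda^r(A_1,1,\ldots,1)$ and $B_j=\mathrm{cr}_i\Lambda^r(A_j,\ldots,A_j)$ for $j=2,\ldots,n$.
   Context: **Binary multicomplexes.** Let $X$ be a quasi-compact scheme and $\mathcal{P}(X)$ the exact category of locally free $\mathcal{O}_X$-modules of finite rank. For an exact category $\mathcal{E}$, an acyclic binary complex $(P_*,d,\tilde d)$ in $\mathcal{E}$ is a graded object $P_*$ in $\mathcal{E}$ supported on a finite subset of $[0,\infty)$ together with two degree $-1$ maps $d,\tilde d:P_*\to P_*$ such that both $(P_*,d)$ and $(P_*,\tilde d)$ are acyclic chain complexes. Morphisms are degree $0$ maps that are chain maps for both differentials; a sequence is short exact if it is so in each degree. This gives an exact category $B^{\mathrm q}_{\mathrm b}(\mathcal{E})$. Put $\mathcal{B}^0(X)=\mathcal{P}(X)$ and $\mathcal{B}^n(X)=B^{\mathrm q}_{\mathrm b}(\mathcal{B}^{n-1}(X))$ (acyclic binary multicomplexes of dimension $n$). Explicitly, an object of $\mathcal{B}^n(X)$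 is a $\mathbb{Z}_{\ge0}^n$-graded object with two acyclic differentials $d^i,\tilde d^i$ in each direction $1\le i\le n$, where differentials in different directions commute; the $i$-th coordinate corresponds to the $i$-th application of $B^{\mathrm q}_{\mathrm b}$. It is called diagonal if $d^i=\tilde d^i$ for at least one $i$. **$K$-groups.** $K_n(X)$ is the quotient of the Grothendieck group $K_0(\mathcal{B}^n(X))$ obtained by declaring the classes of diagonal multicomplexes to be zero. (By Grayson, this is naturally isomorphic to Quillen's $K_n(X)$.) **Exterior power operations** (Harris–Köck–Taelman). Let $\Gamma$ and $N$ be the Dold–Kan functors between non-negatively graded chain complexes and simplicial objects: $\Gamma(C)_k=\bigoplus_{\eta:[k]\twoheadrightarrow[p]}C_p$, where for $\alpha:[l]\to[k]$ one factors $\eta\alpha=\varepsilon\eta'$ with $\eta'$ surjective and $\varepsilon:[q]\hookrightarrow[p]$ injective, and $\alpha^*$ maps the $\eta$-summand to the $\eta'$-summand by the identity if $\varepsilon=\mathrm{id}$, by the differential $d$ if $q=p-1$ and $\varepsilon$ misses only $0$, and by $0$ otherwise; $N(S)_k=\bigcap_{i=1}^k\ker(d_i)$ with differential $d_0$. If $F$ is a functor with $F(0)=0$, the graded object underlying $NF\Gamma(P_*,d)$ depends only on $P_*$ and not on $d$; so, for a binary complex, applying $NF\Gamma$ separately to $(P_*,d)$ and $(P_*,\tilde d)$ gives again a binary complex, denoted $NF\Gamma(P_*,d,\tilde d)$. Define $\Lambda^r_0=\Lambda^r$ (the usual $r$-th exterior power on $\mathcal{P}(X)$) and inductively $\Lambda^r_n=N\Lambda^r_{n-1}\Gamma:\mathcal{B}^n(X)\to\mathcal{B}^n(X)$,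 where $\Lambda^r_{n-1}$ is applied levelwise. It is known that $\Lambda^r_n$ does take values in $\mathcal{B}^n(X)$ and that, for $r,n\ge1$, there is a well-defined group homomorphism $\lambda^r:K_n(X)\to K_n(X)$ with $\lambda^r([\mathbb{P}])=[\Lambda^r_n(\mathbb{P})]$ for all $\mathbb{P}\in\mathcal{B}^n(X)$. **Automorphism cubes.** $\mathrm{Aut}^n(\mathcal{P}(X))$ is the category of tuples $(P;A_1,\ldots,A_n)$ with $P\in\mathcal{P}(X)$ and pairwise commuting automorphisms $A_1,\ldots,A_n$ of $P$. To such a tuple one associates the object $[P;A_1,\ldots,A_n]\in\mathcal{B}^n(X)$ whose entry is $P$ at every place in $\{0,1\}^n$ and $0$ elsewhere, and all of whose non-trivial edges in direction $i$ (from coordinate $1$ to coordinate $0$) have $d^i=A_i$ and $\tilde d^i=1$. The same symbol denotes its class in $K_n(X)$. **Cross-effects.** Let $F:\mathcal{P}\to\mathcal{M}$ be a functor from an additive category to an idempotent-complete additive category with $F(0)=0$. The cross-effect functors $\mathrm{cr}_iF:\mathcal{P}^i\to\mathcal{M}$ are defined inductively: $\mathrm{cr}_1F=F$, and $\mathrm{cr}_iF(P_1,\ldots,P_i)$ is the canonical direct-sum complement of $\mathrm{cr}_{i-1}F(P_1,P_3,\ldots,P_i)\oplus\mathrm{cr}_{i-1}F(P_2,P_3,\ldots,P_i)$ in $\mathrm{cr}_{i-1}F(P_1\oplus P_2,P_3,\ldots,P_i)$, i.e. the kernel of the map to this direct sum induced by the two projections $P_1\oplus P_2\to P_1$, $P_1\oplus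 P_2\to P_2$. For $F=\Lambda^r$ on $\mathcal{P}(X)$ this gives, for example, $\mathrm{cr}_2\Lambda^3(P_1,P_2)=\Lambda^2(P_1)\otimes P_2\oplus P_1\otimes\Lambda^2(P_2)$ and $\mathrm{cr}_r\Lambda^r(P_1,\ldots,P_r)=P_1\otimes\cdots\otimes P_r$. *)

(* Defs.v *)
From HB Require Import structures.
From mathcomp Require Import all_boot all_order all_algebra.
From mathcomp Require Import zify.
From mathcomp Require Import boolp classical_sets topology.

Set Implicit Arguments.
Unset Strict Implicit.
Unset Printing Implicit Defensive.

Import GRing.Theory.
Local Open Scope ring_scope.

Record category := Category {
  cob :> Type;
  chom : cob -> cob -> Type;
  cid1 : forall A, chom A A;
  ccomp : forall A B D, chom B D -> chom A B -> chom A D;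
  ccompA : forall A B D E (h : chom D E) (g : chom B D) (f : chom A B),
    ccomp h (ccomp g f) = ccomp (ccomp h g) f;
  ccomp1f : forall A B (f : chom A B), ccomp (cid1 B) f = f;
  ccompf1 : forall A B (f : chom A B), ccomp f (cid1 A) = f }.

Arguments chom {c}.
Arguments cid1 {c}.
Arguments ccomp {c A B D}.

Notation "g \oc f" := (ccomp g f) (at level 40, left associativity).

Definition is_iso (C : category) (A B : C) (f : chom A B) : Prop :=
  exists g : chom B A, g \oc f = cid1 A /\ f \oc g = cid1 B.

Record functor (C D : category) := Functor {
  fob :> C -> D;
  fmap : forall A B, chom A B -> chom (fob A) (fob B);
  fmap1 : forall A, fmap (cid1 A) = cid1 (fob A);
  fmapM : forall A B E (g : chom B E) (f : chom A B),
    fmap (g \oc f) = fmap g \oc fmap f }.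

Arguments fmap {C D} _ {A B}.

Section ProdCat.
Variables C D : category.

Definition prod_cat : category.
Proof.
refine (@Category (C * D)%type (fun A B => (chom A.1 B.1 * chom A.2 B.2)%type)
  (fun A => (cid1 A.1, cid1 A.2))
  (fun A B E g f => (g.1 \oc f.1, g.2 \oc f.2)) _ _ _).
- by move=> *; rewrite /= !ccompA.
- by move=> A B [f g]; rewrite /= !ccomp1f.
- by move=> A B [f g]; rewrite /= !ccompf1.
Defined.

End ProdCat.

Definition unit_cat : category :=
  @Category unit (fun _ _ => unit) (fun=> tt) (fun _ _ _ _ _ => tt)
    (fun _ _ _ _ _ _ _ => erefl) (fun _ _ 'tt => erefl) (fun _ _ 'tt => erefl).

Fixpoint pow_cat (C : category) (i : nat) : category :=
  if i is j.+1 then prod_cat C (pow_cat C j) else unit_cat.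

Fixpoint diag_ob (C : category) i (A : C) : pow_cat C i :=
  if i is j.+1 then (A, diag_ob j A) else tt.

Fixpoint diag_hom (C : category) i (A B : C) (f : chom A B) :
    chom (diag_ob i A) (diag_ob i B) :=
  if i is j.+1 then (f, diag_hom j f) else tt.

Lemma diag_hom1 (C : category) i (A : C) : diag_hom i (cid1 A) = cid1 (diag_ob i A).
Proof. by elim: i => //= i ->. Qed.

Lemma diag_homM (C : category) i (A B D : C) (g : chom B D) (f : chom A B) :
  diag_hom i (g \oc f) = diag_hom i g \oc diag_hom i f.
Proof. by elim: i => //= i ->. Qed.

Record pacat := PACat {
  pacat_cat :> category;
  hzero : forall A B : pacat_cat, chom A B;
  hopp : forall A B : pacat_cat, chom A B -> chom A B;
  hadd : forall A B : pacat_cat, chom A B -> chom A B -> chom A B;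
  haddA : forall A B, associative (@hadd A B);
  haddC : forall A B, commutative (@hadd A B);
  hadd0f : forall A B, left_id (@hzero A B) (@hadd A B);
  haddNf : forall A B, left_inverse (@hzero A B) (@hopp A B) (@hadd A B);
  hcompDl : forall (A B D : pacat_cat) (g h : chom B D) (f : chom A B),
    hadd g h \oc f = hadd (g \oc f) (h \oc f);
  hcompDr : forall (A B D : pacat_cat) (g : chom B D) (f h : chom A B),
    g \oc hadd f h = hadd (g \oc f) (g \oc h) }.

HB.instance Definition _ (C : pacat) (A B : C) := gen_eqMixin (@chom C A B).
HB.instance Definition _ (C : pacat) (A B : C) := gen_choiceMixin (@chom C A B).
HB.instance Definition _ (C : pacat) (A B : C) :=
  GRing.isZmodule.Build (@chom C A B)
    (@haddA C A B) (@haddC C A B) (@hadd0f C A B) (@haddNf C A B).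

Section PreadditiveTheory.
Variable C : pacat.
Implicit Types A B D : C.

Lemma compDl A B D (g h : chom B D) (f : chom A B) :
  (g + h) \oc f = g \oc f + h \oc f.
Proof. exact: hcompDl. Qed.

Lemma compDr A B D (g : chom B D) (f h : chom A B) :
  g \oc (f + h) = g \oc f + g \oc h.
Proof. exact: hcompDr. Qed.

Lemma comp0f A B D (f : chom A B) : (0 : chom B D) \oc f = 0.
Proof. by apply: (@addIr _ (0 \oc f)); rewrite -compDl !add0r. Qed.

Lemma compf0 A B D (g : chom B D) : g \oc (0 : chom A B) = 0.
Proof. by apply: (@addIr _ (g \oc 0)); rewrite -compDr !add0r. Qed.

Lemma compNf A B D (g : chom B D) (f : chom A B) : (- g) \oc f = - (g \oc f).
Proof. by apply: (@addIr _ (g \oc f)); rewrite -compDl !addNr comp0f. Qed.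

Lemma compfN A B D (g : chom B D) (f : chom A B) : g \oc (- f) = - (g \oc f).
Proof. by apply: (@addIr _ (g \oc f)); rewrite -compDr !addNr compf0. Qed.

Lemma comp_suml A B D (I : finType) (P : pred I) (g : I -> chom B D)
    (f : chom A B) :
  (\sum_(i | P i) g i) \oc f = \sum_(i | P i) (g i \oc f).
Proof.
elim/big_rec2: _ => [|i y x _ <-]; first exact: comp0f.
exact: compDl.
Qed.

Lemma comp_sumr A B D (I : finType) (P : pred I) (g : chom B D)
    (f : I -> chom A B) :
  g \oc (\sum_(i | P i) f i) = \sum_(i | P i) (g \oc f i).
Proof.
elim/big_rec2: _ => [|i y x _ <-]; first exact: compf0.
exact: compDr.
Qed.

Definition is_zero A : Prop := cid1 A = 0.

End PreadditiveTheory.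

(* The direct sums bip and the kernels ker are part of the data. *)
Record acat := ACat {
  acat_pacat :> pacat;
  bip : forall I : finType, (I -> acat_pacat) -> acat_pacat;
  bin : forall (I : finType) (A : I -> acat_pacat) i, chom (A i) (bip A);
  bpr : forall (I : finType) (A : I -> acat_pacat) i, chom (bip A) (A i);
  bpr_bin : forall (I : finType) (A : I -> acat_pacat) i,
    bpr A i \oc bin A i = cid1 (A i);
  bpr_bin0 : forall (I : finType) (A : I -> acat_pacat) i j,
    i <> j -> bpr A j \oc bin A i = 0;
  bin_bpr : forall (I : finType) (A : I -> acat_pacat),
    \sum_i (bin A i \oc bpr A i) = cid1 (bip A);
  ker : forall A B : acat_pacat, chom A B -> acat_pacat;
  kin : forall (A B : acat_pacat) (f : chom A B), chom (ker f) A;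
  kin0 : forall (A B : acat_pacat) (f : chom A B), f \oc kin f = 0;
  klift : forall (A B : acat_pacat) (f : chom A B) (D : acat_pacat)
    (g : chom D A), f \oc g = 0 -> chom D (ker f);
  kliftK : forall (A B : acat_pacat) (f : chom A B) (D : acat_pacat)
    (g : chom D A) (fg0 : f \oc g = 0), kin f \oc klift fg0 = g;
  kin_mono : forall (A B : acat_pacat) (f : chom A B) (D : acat_pacat)
    (u v : chom D (ker f)), kin f \oc u = kin f \oc v -> u = v }.

Arguments bip {a I}.
Arguments bin {a I}.
Arguments bpr {a I}.
Arguments ker {a A B}.
Arguments kin {a A B}.
Arguments klift {a A B f D g}.

Section AdditiveTheory.
Variable C : acat.
Implicit Types A B D : C.

Definition zob : C := bip (fun i : void => match i with end).

Definition bmap (I : finType) (A B : I -> C) (f : forall i, chom (A i) (B i)) :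
    chom (bip A) (bip B) :=
  \sum_i (bin B i \oc f i \oc bpr A i).

Definition bmx (I J : finType) (A : I -> C) (B : J -> C)
    (M : forall i j, chom (A i) (B j)) : chom (bip A) (bip B) :=
  \sum_i \sum_j (bin B j \oc M i j \oc bpr A i).

Definition bpair (I : finType) (A : C) (B : I -> C)
    (f : forall i, chom A (B i)) : chom A (bip B) :=
  \sum_i (bin B i \oc f i).

Lemma zob_zero : is_zero zob.
Proof. by rewrite /is_zero /zob -bin_bpr big_pred0 // => -[]. Qed.

Lemma bpr_binE (I : finType) (A : I -> C) (D : C) (F : forall i, chom D (A i)) j :
  \sum_i (bpr A j \oc bin A i \oc F i) = F j.
Proof.
rewrite (bigD1 j) //= bpr_bin ccomp1f big1 ?addr0 // => i /eqP ij.
by rewrite bpr_bin0 // comp0f.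
Qed.

Lemma bpr_bpair (I : finType) A (B : I -> C) (f : forall i, chom A (B i)) j :
  bpr B j \oc bpair f = f j.
Proof.
rewrite /bpair comp_sumr -[RHS](bpr_binE f).
by apply: eq_bigr => i _; rewrite ccompA.
Qed.

Lemma bip_ext (I : finType) A (B : I -> C) (f g : chom A (bip B)) :
  (forall i, bpr B i \oc f = bpr B i \oc g) -> f = g.
Proof.
move=> fg; rewrite -(ccomp1f f) -(ccomp1f g) -bin_bpr !comp_suml.
by apply: eq_bigr => i _; rewrite -!ccompA fg.
Qed.

Lemma bpr_bmap (I : finType) (A B : I -> C) (f : forall i, chom (A i) (B i)) j :
  bpr B j \oc bmap f = f j \oc bpr A j.
Proof.
rewrite /bmap comp_sumr -[RHS](bpr_binE (fun i => f i \oc bpr A i)).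
by apply: eq_bigr => i _; rewrite !ccompA.
Qed.

Lemma bmap1 (I : finType) (A : I -> C) :
  bmap (fun i => cid1 (A i)) = cid1 (bip A).
Proof. by apply: bip_ext => i; rewrite bpr_bmap ccomp1f ccompf1. Qed.

Lemma bmapM (I : finType) (A B D : I -> C) (g : forall i, chom (B i) (D i))
    (f : forall i, chom (A i) (B i)) :
  bmap (fun i => g i \oc f i) = bmap g \oc bmap f.
Proof.
by apply: bip_ext => i; rewrite bpr_bmap ccompA bpr_bmap -!ccompA bpr_bmap.
Qed.

Lemma bpr_bmx (I J : finType) (A : I -> C) (B : J -> C)
    (M : forall i j, chom (A i) (B j)) j :
  bpr B j \oc bmx M = \sum_i (M i j \oc bpr A i).
Proof.
rewrite /bmx comp_sumr; apply: eq_bigr => i _; rewrite comp_sumr.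
rewrite -[RHS](bpr_binE (fun j => M i j \oc bpr A i)).
by apply: eq_bigr => k _; rewrite !ccompA.
Qed.

Lemma bmxM (I J K : finType) (A : I -> C) (B : J -> C) (D : K -> C)
    (N : forall j k, chom (B j) (D k)) (M : forall i j, chom (A i) (B j)) :
  bmx N \oc bmx M = bmx (fun i k => \sum_j (N j k \oc M i j)).
Proof.
apply: bip_ext => k; rewrite ccompA !bpr_bmx comp_suml.
under eq_bigr => j _ do rewrite -ccompA bpr_bmx comp_sumr.
rewrite exchange_big; apply: eq_bigr => i _; rewrite comp_suml.
by apply: eq_bigr => j _; rewrite ccompA.
Qed.

Lemma bmx_bmap (I J : finType) (A A' : I -> C) (B B' : J -> C)
    (M : forall i j, chom (A i) (B j)) (M' : forall i j, chom (A' i) (B' j))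
    (f : forall i, chom (A i) (A' i)) (g : forall j, chom (B j) (B' j)) :
  (forall i j, M' i j \oc f i = g j \oc M i j) ->
  bmx M' \oc bmap f = bmap g \oc bmx M.
Proof.
move=> fg; apply: bip_ext => j.
rewrite !ccompA bpr_bmx bpr_bmap -ccompA bpr_bmx comp_suml comp_sumr.
by apply: eq_bigr => i _; rewrite -ccompA bpr_bmap !ccompA fg.
Qed.

Lemma bpair_eq0 (I : finType) A (B : I -> C) (f : forall i, chom A (B i))
    D (g : chom D A) :
  (forall i, f i \oc g = 0) -> bpair f \oc g = 0.
Proof.
by move=> fg; apply: bip_ext => i; rewrite ccompA bpr_bpair fg compf0.
Qed.

Lemma bpair_kin (I : finType) A (B : I -> C) (f : forall i, chom A (B i)) i :
  f i \oc kin (bpair f) = 0.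
Proof. by rewrite -(bpr_bpair f) -ccompA kin0 compf0. Qed.

End AdditiveTheory.

Section BinaryComplexes.
Variable C : acat.

Record bcx := BCx {
  gr :> nat -> C;
  bd : forall k, chom (gr k.+1) (gr k);
  bt : forall k, chom (gr k.+1) (gr k);
  bd2 : forall k, bd k \oc bd k.+1 = 0;
  bt2 : forall k, bt k \oc bt k.+1 = 0 }.

Record bhom (P Q : bcx) := BHom {
  bh :> forall k, chom (P k) (Q k);
  bh_d : forall k, bh k \oc bd P k = bd Q k \oc bh k.+1;
  bh_t : forall k, bh k \oc bt P k = bt Q k \oc bh k.+1 }.

Lemma bhomP (P Q : bcx) (f g : bhom P Q) : (forall k, f k = g k) -> f = g.
Proof.
case: f g => [f fd ft] [g gd gt] /= fg.
have {fg} E : f = g by apply: functional_extensionality_dep.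
by rewrite -{}E in gd gt *; congr BHom; apply: Prop_irrelevance.
Qed.

Definition bhom1 (P : bcx) : bhom P P.
Proof.
by exists (fun k => cid1 (P k)) => k; rewrite ccomp1f ccompf1.
Defined.

Definition bhomM (P Q R : bcx) (g : bhom Q R) (f : bhom P Q) : bhom P R.
Proof.
exists (fun k => g k \oc f k) => k.
- by rewrite -ccompA bh_d !ccompA bh_d.
- by rewrite -ccompA bh_t !ccompA bh_t.
Defined.

Definition bcx_cat : category.
Proof.
refine (@Category bcx bhom bhom1 bhomM _ _ _) => *; apply: bhomP => k /=.
- exact: ccompA.
- exact: ccomp1f.
- exact: ccompf1.
Defined.

Definition bhom0 (P Q : bcx) : bhom P Q.
Proof. by exists (fun k => 0) => k; rewrite comp0f compf0. Defined.

Definition bhomN (P Q : bcx) (f : bhom P Q) : bhom P Q.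
Proof.
by exists (fun k => - f k) => k; rewrite compNf compfN (bh_d, bh_t).
Defined.

Definition bhomD (P Q : bcx) (f g : bhom P Q) : bhom P Q.
Proof.
by exists (fun k => f k + g k) => k; rewrite compDl compDr !(bh_d, bh_t).
Defined.

Definition bcx_pacat : pacat.
Proof.
refine (@PACat bcx_cat bhom0 bhomN bhomD _ _ _ _ _ _).
- by move=> P Q f g h; apply: bhomP => k /=; rewrite addrA.
- by move=> P Q f g; apply: bhomP => k /=; rewrite addrC.
- by move=> P Q f; apply: bhomP => k /=; rewrite add0r.
- by move=> P Q f; apply: bhomP => k /=; rewrite addNr.
- by move=> P Q R g h f; apply: bhomP => k /=; rewrite compDl.
- by move=> P Q R g f h; apply: bhomP => k /=; rewrite compDr.
Defined.

Lemma bh_sum (P Q : bcx_pacat) (I : finType) (f : I -> chom P Q) k :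
  bh (\sum_i f i) k = \sum_i bh (f i) k.
Proof. exact: (big_morph (fun f : chom P Q => bh f k)). Qed.

Definition bcx_bip (I : finType) (P : I -> bcx) : bcx.
Proof.
refine (@BCx (fun k => bip (fun i => P i k))
  (fun k => bmap (fun i => bd (P i) k)) (fun k => bmap (fun i => bt (P i) k))
  _ _) => k; rewrite -bmapM; apply: bip_ext => i; rewrite bpr_bmap.
- by rewrite bd2 comp0f compf0.
- by rewrite bt2 comp0f compf0.
Defined.

Lemma bmap_bin (I : finType) (A B : I -> C) (f : forall i, chom (A i) (B i)) i :
  bmap f \oc bin A i = bin B i \oc f i.
Proof.
apply: bip_ext => j; rewrite !ccompA bpr_bmap -ccompA.
have [<-|ij] := pselect (i = j); first by rewrite !bpr_bin ccomp1f ccompf1.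
by rewrite !bpr_bin0 // compf0 comp0f.
Qed.

Definition bcx_bin (I : finType) (P : I -> bcx) i : bhom (P i) (bcx_bip P).
Proof.
by exists (fun k => bin (fun i => P i k) i) => k; rewrite /= bmap_bin.
Defined.

Definition bcx_bpr (I : finType) (P : I -> bcx) i : bhom (bcx_bip P) (P i).
Proof.
by exists (fun k => bpr (fun i => P i k) i) => k; rewrite /= bpr_bmap.
Defined.

Section Kernel.
Variables (P Q : bcx) (f : bhom P Q).

Lemma bcx_ker_d k : f k \oc (bd P k \oc kin (f k.+1)) = 0.
Proof. by rewrite ccompA bh_d -ccompA kin0 compf0. Qed.

Lemma bcx_ker_t k : f k \oc (bt P k \oc kin (f k.+1)) = 0.
Proof. by rewrite ccompA bh_t -ccompA kin0 compf0. Qed.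

Definition bcx_ker : bcx.
Proof.
refine (@BCx (fun k => ker (f k)) (fun k => klift (bcx_ker_d k))
  (fun k => klift (bcx_ker_t k)) _ _) => k; apply: kin_mono;
  rewrite compf0 ccompA kliftK -ccompA kliftK ccompA.
- by rewrite bd2 comp0f.
- by rewrite bt2 comp0f.
Defined.

Definition bcx_kin : bhom bcx_ker P.
Proof. by exists (fun k => kin (f k)) => k; rewrite /= kliftK. Defined.

Lemma bcx_klift0 (R : bcx) (g : bhom R P) :
  bhomM f g = bhom0 R Q -> forall k, f k \oc g k = 0.
Proof. by move=> fg k; apply: (congr1 (fun h : bhom R Q => h k) fg). Qed.

Definition bcx_klift (R : bcx) (g : bhom R P) (fg : bhomM f g = bhom0 R Q) :
  bhom R bcx_ker.
Proof.
exists (fun k => klift (bcx_klift0 fg k)) => k; apply: kin_mono;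
  rewrite /= !ccompA !kliftK -ccompA kliftK.
- exact: bh_d.
- exact: bh_t.
Defined.

End Kernel.

Definition bcx_acat : acat.
Proof.
refine (@ACat bcx_pacat bcx_bip bcx_bin bcx_bpr _ _ _
  bcx_ker bcx_kin _ bcx_klift _ _).
- by move=> I P i; apply: bhomP => k /=; rewrite bpr_bin.
- by move=> I P i j ij; apply: bhomP => k /=; rewrite bpr_bin0.
- by move=> I P; apply: bhomP => k; rewrite bh_sum /= bin_bpr.
- by move=> P Q f; apply: bhomP => k /=; rewrite kin0.
- by move=> P Q f R g fg; apply: bhomP => k /=; rewrite kliftK.
- move=> P Q f R u v uv; apply: bhomP => k; apply: kin_mono.
  exact: (congr1 (fun h : bhom R P => h k) uv).
Defined.

End BinaryComplexes.

(* An exact category, given as a full subcategory ex_in of an additive category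
   with kernels together with its admissible short exact sequences
   A -> B -> D; ex_ses is only ever used between objects of ex_in. *)
Record excat := ExCat {
  ex_cat :> acat;
  ex_in : ex_cat -> Prop;
  ex_ses : forall A B D : ex_cat, chom A B -> chom B D -> Prop }.

Arguments ex_ses {e A B D}.

(* (P, d) is acyclic: d k : P (k+1) -> P k factors as P (k+1) ->> Z k >-> P k
   with Z (k+1) >-> P (k+1) ->> Z k short exact; as P (-1) = 0, in degree 0 this
   means that Z 0 >-> P 0 is an isomorphism. *)
Definition acyclic (E : excat) (P : nat -> E) (d : forall k, chom (P k.+1) (P k)) :
    Prop :=
  exists (Z : nat -> E) (i : forall k, chom (Z k) (P k))
    (p : forall k, chom (P k.+1) (Z k)),
    [/\ forall k, ex_in (Z k),
        forall k, d k = i k \oc p k,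
        is_iso (i 0%N)
      & forall k, ex_ses (i k.+1) (p k)].

Definition Bq (E : excat) : excat := {|
  ex_cat := bcx_acat E;
  ex_in := fun P : bcx E =>
    [/\ forall k, ex_in (P k),
        exists N, forall k, (N <= k)%N -> is_zero (P k),
        acyclic (bd P) & acyclic (bt P)];
  ex_ses := fun (A B D : bcx E) (f : bhom A B) (g : bhom B D) =>
    forall k, ex_ses (f k) (g k) |}.

Fixpoint Bn (E : excat) (n : nat) : excat :=
  if n is m.+1 then Bq (Bn E m) else E.

(* Directions are numbered from 0; the last direction is the outermost. *)
Fixpoint diagonal_dir (E : excat) (n : nat) : nat -> Bn E n -> Prop :=
  match n with
  | 0 => fun _ _ => False
  | m.+1 => fun i (P : bcx (Bn E m)) =>
      if i == m then forall k, bd P k = bt P k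
      else forall k, diagonal_dir i (P k)
  end.

Definition diagonal (E : excat) n (P : Bn E n) : Prop :=
  exists2 i, (i < n)%N & diagonal_dir i P.

Definition monotone k l (f : 'I_k.+1 -> 'I_l.+1) : bool :=
  [forall i : 'I_k.+1, forall j : 'I_k.+1, (i <= j)%N ==> (f i <= f j)%N].

Definition surjective k l (f : 'I_k.+1 -> 'I_l.+1) : bool :=
  [forall y, exists x, f x == y].

(* The surjections eta : [k] ->> [p] of the simplex category; p <= k. *)
Definition surj (k : nat) : finType :=
  {p : 'I_k.+1 &
    {f : {ffun 'I_k.+1 -> 'I_p.+1} | monotone f && surjective f}}.

Definition surj_dim k (s : surj k) : nat := tag s.
Definition surj_fun k (s : surj k) (j : 'I_k.+1) : nat := sval (tagged s) j.

Lemma surjP k (s : surj k) :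
  [/\ forall i j : 'I_k.+1, (i <= j)%N -> (surj_fun s i <= surj_fun s j)%N,
      forall y, (y <= surj_dim s)%N -> exists x, surj_fun s x = y
    & forall x, (surj_fun s x <= surj_dim s)%N].
Proof.
case: s => p [f mfs]; rewrite /surj_fun /surj_dim /=.
move/andP: (mfs) => [mf sf]; split.
- by move=> i j ij; move/forallP: mf => /(_ i) /forallP/(_ j); rewrite ij.
- move=> y yp; move/forallP: sf => /(_ (Ordinal (yp : (y < p.+1)%N))).
  by case/existsP=> x /eqP fx; exists x; rewrite fx.
- by move=> x; rewrite -ltnS.
Qed.

Lemma surj_inj k (s t : surj k) :
  surj_dim s = surj_dim t ->
  (forall x, surj_fun s x = surj_fun t x) -> s = t.
Proof.
case: s t => p [f mf] [q [g mg]]; rewrite /surj_fun /surj_dim /=.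
move/val_inj=> E; move: f mf; rewrite {}E => f mf fg.
congr Tagged; apply: val_inj => /=.
by apply/ffunP => x; apply: val_inj; apply: fg.
Qed.

Lemma surj_exists k (p : nat) (f : 'I_k.+1 -> nat) :
  (forall i j : 'I_k.+1, (i <= j)%N -> (f i <= f j)%N) ->
  (forall x, (f x <= p)%N) ->
  (forall y, (y <= p)%N -> exists x, f x = y) ->
  exists2 s : surj k, surj_dim s = p & forall x, surj_fun s x = f x.
Proof.
move=> mf fp sf.
have pk : (p < k.+1)%N.
  pose g := fun y : 'I_p.+1 => projT1 (cid (sf y (ltn_ord y))).
  have gK y : f (g y) = y by apply: (projT2 (cid (sf y (ltn_ord y)))).
  have gi : injective g.
    by move=> y z /(congr1 f); rewrite !gK => /val_inj.
  by have := leq_card _ gi; rewrite !card_ord.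
pose g : {ffun 'I_k.+1 -> 'I_(Ordinal pk).+1} :=
  [ffun x => Ordinal (fp x : (f x < (Ordinal pk).+1)%N)].
have mg : monotone g && surjective g.
  apply/andP; split.
    apply/forallP => i; apply/forallP => j; apply/implyP => ij.
    by rewrite !ffunE; apply: mf.
  apply/forallP => y; apply/existsP; have [x fx] := sf y (ltn_ord y).
  by exists x; apply/eqP/val_inj; rewrite ffunE.
exists (Tagged (fun p : 'I_k.+1 =>
  {f : {ffun 'I_k.+1 -> 'I_p.+1} | monotone f && surjective f})
  (exist _ g mg)) => // x.
by rewrite /surj_fun /= ffunE.
Qed.

Section DoldKan.
Variable C : acat.

Section Gamma.
Variables (P : nat -> C) (d : forall k, chom (P k.+1) (P k)).

(* The identity P p -> P q if p = q, and 0 otherwise *)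
Definition gid p q : chom (P p) (P q) :=
  if @eqP _ p q is ReflectT e then ecast q (chom (P p) (P q)) e (cid1 (P p))
  else 0.

(* The differential P p -> P q if p = q + 1, and 0 otherwise *)
Definition gdiff p q : chom (P p) (P q) := d q \oc gid p q.+1.

Definition Gam k : C := bip (fun s : surj k => P (surj_dim s)).

(* The component of alpha^* from the eta-summand to the eta'-summand, in terms of
   a = eta alpha and b = eta'. As eta' is surjective, a = b (as maps to nat) means
   eta alpha = eps eta' for an initial inclusion eps : [q] -> [p], and gid p q
   vanishes unless eps is the identity; similarly a = b + 1 means that eps is
   t |-> t + 1, which misses only 0 precisely when p = q + 1. *)
Definition gentry m p q (a b : 'I_m.+1 -> nat) : chom (P p) (P q) :=
  if [forall j, a j == b j] then gid p q
  else if [forall j, a j == (b j).+1] then gdiff p q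
  else 0.

Definition Gam_entry k l (alpha : 'I_l.+1 -> 'I_k.+1) (eta : surj k)
    (eta' : surj l) : chom (P (surj_dim eta)) (P (surj_dim eta')) :=
  gentry _ _ (fun j => surj_fun eta (alpha j)) (fun j => surj_fun eta' j).

Definition Gam_act k l (alpha : 'I_l.+1 -> 'I_k.+1) : chom (Gam k) (Gam l) :=
  bmx (Gam_entry alpha).

Lemma gid1 p : gid p p = cid1 (P p).
Proof. by rewrite /gid; case: eqP => // e; rewrite (eq_irrelevance e erefl). Qed.

Lemma gid_neq p q : p <> q -> gid p q = 0.
Proof. by rewrite /gid; case: eqP. Qed.

Lemma gdiffE p : gdiff p.+1 p = d p.
Proof. by rewrite /gdiff gid1 ccompf1. Qed.

Lemma gdiff_neq p q : p <> q.+1 -> gdiff p q = 0.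
Proof. by move=> h; rewrite /gdiff gid_neq // compf0. Qed.

Lemma gentry_id m p q (a b : 'I_m.+1 -> nat) :
  (forall j, a j = b j) -> gentry p q a b = gid p q.
Proof. by move=> e; rewrite /gentry ifT //; apply/forallP => j; apply/eqP. Qed.

Lemma gentry_d m p q (a b : 'I_m.+1 -> nat) :
  (forall j, a j = (b j).+1) -> gentry p q a b = gdiff p q.
Proof.
move=> e; rewrite /gentry ifF ?ifT //.
  by apply/forallP => j; apply/eqP.
by apply/negbTE/negP => /forallP/(_ ord0); rewrite e eqn_leq ltnn.
Qed.

Lemma gentry_0 m p q (a b : 'I_m.+1 -> nat) :
  ~ (forall j, a j = b j) -> ~ (forall j, a j = (b j).+1) -> gentry p q a b = 0.
Proof.
move=> e1 e2; rewrite /gentry ifF; last first.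
  by apply/negbTE/negP => /forallP e; apply: e1 => j; apply/eqP.
by rewrite ifF //; apply/negbTE/negP => /forallP e; apply: e2 => j; apply/eqP.
Qed.

Lemma gentryP m p q (a b : 'I_m.+1 -> nat) :
  [\/ gentry p q a b = 0, (forall j, a j = b j) /\ p = q
     | (forall j, a j = (b j).+1) /\ p = q.+1].
Proof.
have [e|e1] := pselect (forall j, a j = b j).
  rewrite gentry_id //; have [h|/eqP h] := eqVneq p q; first by apply: Or32.
  by apply: Or31; apply: gid_neq.
have [e|e2] := pselect (forall j, a j = (b j).+1).
  rewrite gentry_d //; have [h|/eqP h] := eqVneq p q.+1; first by apply: Or33.
  by apply: Or31; apply: gdiff_neq.
by apply: Or31; apply: gentry_0.
Qed.

Hypothesis d2 : forall k, d k \oc d k.+1 = 0.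

Lemma gdiff_gdiff p q r : gdiff q r \oc gdiff p q = 0.
Proof.
have [->|/eqP h] := eqVneq q r.+1; last by rewrite gdiff_neq // comp0f.
have [->|/eqP h] := eqVneq p r.+2; last by rewrite [X in _ \oc X]gdiff_neq // compf0.
by rewrite !gdiffE d2.
Qed.

Lemma Gam_act_comp k l m (alpha : 'I_l.+1 -> 'I_k.+1) (beta : 'I_m.+1 -> 'I_l.+1) :
  monotone alpha ->
  Gam_act beta \oc Gam_act alpha = Gam_act (alpha \o beta).
Proof.
move=> /forallP ma; rewrite /Gam_act bmxM; congr bmx.
apply: functional_extensionality_dep => s.
apply: functional_extensionality_dep => u /=.
have [ms ss bs] := surjP s; have [mu su bu] := surjP u.
have mono_s : forall i j : 'I_l.+1, (i <= j)%N ->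
    (surj_fun s (alpha i) <= surj_fun s (alpha j))%N.
  by move=> i j ij; apply: ms; move: (ma i) => /forallP/(_ j); rewrite ij.
have [onto|nonto] := pselect (forall y, (y <= surj_dim s)%N ->
    exists x, surj_fun s (alpha x) = y :> nat).
  have [t dt ft] := surj_exists mono_s (fun x => bs (alpha x)) onto.
  rewrite (bigD1 t) //= big1 ?addr0; last first.
    move=> t' /eqP tt'; rewrite [Gam_entry alpha s t']/Gam_entry.
    case: (gentryP (surj_dim s) (surj_dim t') (fun j => surj_fun s (alpha j))
      (fun j => surj_fun t' j)) => [->|[e1 e2]|[e1 e2]]; first exact: compf0.
      by case: tt'; apply: surj_inj => [|x]; rewrite -?e2 ?dt // -e1 ft.
    by have [x fx] := onto 0%N (leq0n _); move: (e1 x); rewrite fx.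
  rewrite /Gam_entry [X in _ \oc X]gentry_id; last by move=> j; rewrite ft.
  have -> : (fun j => surj_fun t (beta j) : nat) =
      (fun j => surj_fun s (alpha (beta j)) : nat).
    by apply: functional_extensionality_dep => j; rewrite ft.
  by rewrite dt gid1 ccompf1.
have [[shift s0]|nshift] := pselect ((forall y, (0 < y <= surj_dim s)%N ->
    exists x, surj_fun s (alpha x) = y :> nat) /\ (0 < surj_dim s)%N).
  have pos x : (0 < surj_fun s (alpha x))%N.
    rewrite lt0n; apply/eqP => sx; apply: nonto => -[_|y yp]; first by exists x.
    exact: shift.
  have [||y yp|t dt ft] := @surj_exists l (surj_dim s).-1
      (fun x => (surj_fun s (alpha x)).-1).
  - by move=> i j ij; rewrite -!subn1 leq_sub2r // mono_s.
  - by move=> x; rewrite -!subn1 leq_sub2r.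
  - have [|x sx] := shift y.+1; first by rewrite -(prednK s0).
    by exists x; rewrite sx.
  have ft' x : surj_fun s (alpha x) = (surj_fun t x).+1 :> nat.
    by rewrite ft prednK.
  rewrite (bigD1 t) //= big1 ?addr0; last first.
    move=> t' /eqP tt'; rewrite [Gam_entry alpha s t']/Gam_entry.
    case: (gentryP (surj_dim s) (surj_dim t') (fun j => surj_fun s (alpha j))
      (fun j => surj_fun t' j)) => [->|[e1 e2]|[e1 e2]]; first exact: compf0.
      case: nonto => y; rewrite e2 => yp; have [_ /(_ y yp) [x tx] _] := surjP t'.
      by exists x; rewrite e1.
    case: tt'; apply: surj_inj => [|x]; first by rewrite dt e2.
    by rewrite ft e1.
  rewrite /Gam_entry [X in _ \oc X]gentry_d //.
  have -> : (fun j => surj_fun s ((alpha \o beta) j) : nat) =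
      (fun j => (surj_fun t (beta j)).+1).
    by apply: functional_extensionality_dep => j; rewrite /= ft'.
  rewrite -(prednK s0) -dt.
  have nid : ~ forall j, (surj_fun t (beta j)).+1 = surj_fun u j.
    by have [x ux] := su 0%N (leq0n _); move=> /(_ x); rewrite ux.
  have [e1|ne1] := pselect (forall j, surj_fun t (beta j) = surj_fun u j :> nat).
    rewrite gentry_id // gentry_d; last by move=> j; rewrite e1.
    have [<-|/eqP tu] := eqVneq (surj_dim t) (surj_dim u).
      by rewrite gid1 ccomp1f.
    by rewrite gid_neq // comp0f gdiff_neq // => -[].
  rewrite [RHS]gentry_0 //; last by move=> h; apply: ne1 => j; case: (h j).
  have [e2|ne2] := pselect (forall j, surj_fun t (beta j) = (surj_fun u j).+1 :> nat).
    by rewrite gentry_d // gdiff_gdiff.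
  by rewrite gentry_0 // comp0f.
have H (v : nat) (h : (surj_dim u + v = surj_dim s)%N) :
    (forall j, surj_fun s (alpha (beta j)) = surj_fun u j + v)%N -> (v <= 1)%N ->
    False.
  move=> e v1.
  have im y : (v <= y <= surj_dim s)%N -> exists x, surj_fun s (alpha x) = y :> nat.
    case/andP=> vy ys; have [|x ux] := su (y - v)%N; first by rewrite leq_subLR addnC h.
    by exists (beta x); rewrite e ux subnK.
  case: v v1 h e im => [|[|//]] _ h e im.
    by apply: nonto => y yp; apply: im.
  by apply: nshift; split; [exact: im | rewrite -h addn1].
rewrite big1 => [|t _].
  rewrite /Gam_entry; case: (gentryP (surj_dim s) (surj_dim u)
    (fun j => surj_fun s ((alpha \o beta) j)) (fun j => surj_fun u j))
    => [//|[e1 e2]|[e1 e2]].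
    by case: (H 0%N) => // [|j]; rewrite ?addn0 // e1.
  by case: (H 1%N) => // [|j]; rewrite ?addn1 // e1.
rewrite [X in _ \oc X]/Gam_entry.
case: (gentryP (surj_dim s) (surj_dim t) (fun j => surj_fun s (alpha j))
      (fun j => surj_fun t j)) => [->|[e1 e2]|[e1 e2]]; first exact: compf0.
  case: nonto => y; rewrite e2 => yt; have [_ /(_ y yt) [x tx] _] := surjP t.
  by exists x; rewrite e1.
case: nshift; rewrite e2; split=> // -[//|y] /= yt.
by have [_ /(_ y yt) [x tx] _] := surjP t; exists x; rewrite e1 tx.
Qed.

End Gamma.

Lemma Gam_act_bmap (P Q : nat -> C) (dP : forall k, chom (P k.+1) (P k))
    (dQ : forall k, chom (Q k.+1) (Q k)) (f : forall k, chom (P k) (Q k))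
    k l (alpha : 'I_l.+1 -> 'I_k.+1) :
  (forall k, f k \oc dP k = dQ k \oc f k.+1) ->
  Gam_act dQ alpha \oc bmap (fun s => f (surj_dim s)) =
  bmap (fun s => f (surj_dim s)) \oc Gam_act dP alpha.
Proof.
move=> fd; apply: bmx_bmap => s t.
have fid p q : gid Q p q \oc f p = f q \oc gid P p q.
  have [->|/eqP pq] := eqVneq p q; first by rewrite !gid1 ccomp1f ccompf1.
  by rewrite !gid_neq // comp0f compf0.
rewrite /Gam_entry /gentry; case: ifP => _; first exact: fid.
case: ifP => _; last by rewrite comp0f compf0.
by rewrite /gdiff -ccompA fid !ccompA fd.
Qed.

Lemma surj_fun0 k (s : surj k) : surj_fun s ord0 = 0%N.
Proof.
have [ms /(_ 0%N (leq0n _)) [x sx] _] := surjP s.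
by apply/eqP; rewrite -leqn0 -sx ms.
Qed.

Lemma Gam_act_indep (P : nat -> C) (d d' : forall k, chom (P k.+1) (P k))
    k l (alpha : 'I_l.+1 -> 'I_k.+1) :
  alpha ord0 = ord0 -> Gam_act d alpha = Gam_act d' alpha.
Proof.
move=> a0; congr bmx; apply: functional_extensionality_dep => s.
apply: functional_extensionality_dep => t.
rewrite /Gam_entry /gentry; case: ifP => // _; case: ifP => // /forallP/(_ ord0).
by rewrite a0 surj_fun0.
Qed.

(* The injection [k-1] -> [k] that misses i, for 0 < k and i <= k *)
Definition face k i (j : 'I_k.-1.+1) : 'I_k.+1 := inord (bump i j).

Lemma faceE k i (j : 'I_k.+1) : face (k := k.+1) i j = bump i j :> nat.
Proof.
rewrite /face inordK // ltnS /bump; apply: (@leq_add _ _ 1 k); first exact: leq_b1.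
by rewrite -ltnS.
Qed.

Lemma face_monotone k i : monotone (face (k := k) i).
Proof.
case: k => [|k]; apply/forallP => x; apply/forallP => y; apply/implyP.
  by rewrite (ord1 x) (ord1 y).
have face_le (u v : 'I_k.+1) :
    (u <= v)%N -> (face (k := k.+1) i u <= face (k := k.+1) i v)%N.
  by rewrite !faceE /bump; lia.
exact: face_le.
Qed.

Lemma face_comp k i (j : 'I_k.+1) :
  face (k := k.+2) 0 (face (k := k.+1) i j) =
  face (k := k.+2) i.+1 (face (k := k.+1) 0 j).
Proof.
by apply: ord_inj; rewrite !faceE /bump; lia.
Qed.

Lemma face0 k i : face (k := k) i.+1 ord0 = ord0.
Proof.
by apply: ord_inj; case: k => [|k]; [rewrite ord1 | rewrite faceE].
Qed.

Section Moore.
Variable F : functor C C.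

Section Objects.
Variable P : nat -> C.

(* The map d_(i+1) of the simplicial object F (Gamma P); as it does not involve
   the differential of P (see Gam_act_indep), the latter is taken to be 0. *)
Definition Nface k (i : 'I_k) : chom (F (Gam P k)) (F (Gam P k.-1)) :=
  fmap F (Gam_act (fun=> 0) (face (k := k) i.+1)).

(* The intersection of the kernels of d_1, ..., d_k *)
Definition Nob k : C := ker (bpair (@Nface k)).

Section Differential.
Variable d : forall k, chom (P k.+1) (P k).
Hypothesis d2 : forall k, d k \oc d k.+1 = 0.

Definition Nface0 k : chom (F (Gam P k.+1)) (F (Gam P k)) :=
  fmap F (Gam_act d (face (k := k.+1) 0)).

Lemma NfaceE k i : Nface i = fmap F (Gam_act d (face (k := k) i.+1)).
Proof. by congr fmap; apply: Gam_act_indep; apply: face0. Qed.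

Lemma Nface_kin k (i : 'I_k) : Nface i \oc kin (bpair (@Nface k)) = 0.
Proof. exact: bpair_kin. Qed.

Lemma Ndiff_subproof k :
  bpair (@Nface k) \oc (Nface0 k \oc kin (bpair (@Nface k.+1))) = 0.
Proof.
apply: bpair_eq0 => i; rewrite ccompA NfaceE /Nface0 -fmapM.
case: k i => [[]//|k] i.
rewrite (Gam_act_comp d2); last exact: (@face_monotone k.+2).
have -> : (face (k := k.+2) 0 \o face (k := k.+1) i.+1) =
    (face (k := k.+2) i.+2 \o face (k := k.+1) 0).
  by apply: functional_extensionality_dep => j /=; rewrite face_comp.
rewrite -(Gam_act_comp d2); last exact: (@face_monotone k.+2).
rewrite fmapM -ccompA.
by rewrite -(NfaceE (k := k.+2) (lift ord0 i)) Nface_kin compf0.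
Qed.

Definition Ndiff k : chom (Nob k.+1) (Nob k) := klift (Ndiff_subproof k).

Lemma NdiffE k : kin _ \oc Ndiff k = Nface0 k \oc kin _.
Proof. exact: kliftK. Qed.

Lemma Ndiff2 k : Ndiff k \oc Ndiff k.+1 = 0.
Proof.
apply: kin_mono; rewrite compf0 ccompA NdiffE -ccompA NdiffE ccompA -fmapM.
rewrite (Gam_act_comp d2); last exact: (@face_monotone k.+2).
have -> : (face (k := k.+2) 0 \o face (k := k.+1) 0) =
    (face (k := k.+2) 1 \o face (k := k.+1) 0).
  by apply: functional_extensionality_dep => j /=; rewrite face_comp.
rewrite -(Gam_act_comp d2); last exact: (@face_monotone k.+2).
rewrite fmapM -ccompA.
by rewrite -(NfaceE (k := k.+2) ord0) Nface_kin compf0.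
Qed.

End Differential.
End Objects.

(* N F Gamma is applied separately to (P, d) and to (P, d~); both complexes have
   the underlying graded object Nob P. *)
Definition NFGam_ob (P : bcx C) : bcx C := {|
  gr := Nob P;
  bd := Ndiff (@bd2 C P);
  bt := Ndiff (@bt2 C P);
  bd2 := Ndiff2 (@bd2 C P);
  bt2 := Ndiff2 (@bt2 C P) |}.

Section Morphisms.
Variables (P Q : nat -> C) (f : forall k, chom (P k) (Q k)).

Definition Gam_map k : chom (Gam P k) (Gam Q k) :=
  bmap (fun s => f (surj_dim s)).

Lemma Nmap_subproof k :
  bpair (@Nface Q k) \oc (fmap F (Gam_map k) \oc kin (bpair (@Nface P k))) = 0.
Proof.
apply: bpair_eq0 => i; rewrite ccompA -fmapM (@Gam_act_bmap _ _ (fun=> 0)).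
  by rewrite fmapM -ccompA Nface_kin compf0.
by move=> j; rewrite comp0f compf0.
Qed.

Definition Nmap k : chom (Nob P k) (Nob Q k) := klift (Nmap_subproof k).

Lemma NmapE k : kin _ \oc Nmap k = fmap F (Gam_map k) \oc kin _.
Proof. exact: kliftK. Qed.

Lemma Nmap_diff (dP : forall k, chom (P k.+1) (P k))
    (dQ : forall k, chom (Q k.+1) (Q k))
    (dP2 : forall k, dP k \oc dP k.+1 = 0) (dQ2 : forall k, dQ k \oc dQ k.+1 = 0) :
  (forall k, f k \oc dP k = dQ k \oc f k.+1) ->
  forall k, Nmap k \oc Ndiff dP2 k = Ndiff dQ2 k \oc Nmap k.+1.
Proof.
move=> fd k; apply: kin_mono; rewrite !ccompA NmapE NdiffE -!ccompA NmapE NdiffE.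
by rewrite !ccompA -!fmapM (Gam_act_bmap _ fd).
Qed.

End Morphisms.

Definition NFGam_map (P Q : bcx C) (f : bhom P Q) :
    bhom (NFGam_ob P) (NFGam_ob Q) :=
  @BHom C (NFGam_ob P) (NFGam_ob Q) (Nmap f)
    (Nmap_diff (@bd2 C P) (@bd2 C Q) (@bh_d C P Q f))
    (Nmap_diff (@bt2 C P) (@bt2 C Q) (@bh_t C P Q f)).

Definition NFGam : functor (bcx_acat C) (bcx_acat C).
Proof.
refine (@Functor (bcx_acat C) (bcx_acat C) NFGam_ob NFGam_map _ _).
- move=> P; apply: bhomP => k; apply: kin_mono.
  by rewrite /= NmapE /Gam_map /= bmap1 fmap1 ccomp1f ccompf1.
- move=> P Q R g f; apply: bhomP => k; apply: kin_mono.
  rewrite /= NmapE ccompA NmapE -ccompA NmapE ccompA -fmapM.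
  by rewrite /Gam_map /= bmapM.
Defined.

End Moore.
End DoldKan.

(* Lambda^r_n, for F = Lambda^r *)
Fixpoint iter_NFGam (E : excat) (F : functor E E) (n : nat) :
    functor (Bn E n) (Bn E n) :=
  if n is m.+1 then NFGam (iter_NFGam F m) else F.

Section CrossEffects.
Variable C : acat.

Definition bool_fam (A B : C) (b : bool) : C := if b then A else B.

Definition biprod (A B : C) : C := bip (bool_fam A B).

Definition bpr1 (A B : C) : chom (biprod A B) A := bpr (bool_fam A B) true.
Definition bpr2 (A B : C) : chom (biprod A B) B := bpr (bool_fam A B) false.

Definition bool_map (A B A' B' : C) (f : chom A A') (g : chom B B') (b : bool) :
    chom (bool_fam A B b) (bool_fam A' B' b) :=
  if b return chom (bool_fam A B b) (bool_fam A' B' b) then f else g.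

Definition biprod_map (A B A' B' : C) (f : chom A A') (g : chom B B') :
    chom (biprod A B) (biprod A' B') :=
  bmap (bool_map f g).

Definition pairing (D A B : C) (f : chom D A) (g : chom D B) :
    chom D (biprod A B) :=
  bpair (fun b => if b return chom D (bool_fam A B b) then f else g).

Lemma biprod_map1 (A B : C) : biprod_map (cid1 A) (cid1 B) = cid1 (biprod A B).
Proof.
rewrite -(bmap1 (bool_fam A B)); congr bmap.
by apply: functional_extensionality_dep => -[].
Qed.

Lemma biprod_mapM (A B A' B' A'' B'' : C) (f' : chom A' A'') (g' : chom B' B'')
    (f : chom A A') (g : chom B B') :
  biprod_map (f' \oc f) (g' \oc g) = biprod_map f' g' \oc biprod_map f g.
Proof.
rewrite /biprod_map -bmapM; congr bmap.
by apply: functional_extensionality_dep => -[].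
Qed.

Lemma bpr1_map (A B A' B' : C) (f : chom A A') (g : chom B B') :
  bpr1 A' B' \oc biprod_map f g = f \oc bpr1 A B.
Proof. exact: (bpr_bmap (bool_map f g) true). Qed.

Lemma bpr2_map (A B A' B' : C) (f : chom A A') (g : chom B B') :
  bpr2 A' B' \oc biprod_map f g = g \oc bpr2 A B.
Proof. exact: (bpr_bmap (bool_map f g) false). Qed.

Lemma pairing_eq0 (D E A B : C) (f : chom D A) (g : chom D B) (h : chom E D) :
  f \oc h = 0 -> g \oc h = 0 -> pairing f g \oc h = 0.
Proof. by move=> fh gh; apply: bpair_eq0 => -[]. Qed.

Lemma pairing_kin1 (D A B : C) (f : chom D A) (g : chom D B) :
  f \oc kin (pairing f g) = 0.
Proof.
exact: (bpair_kin (fun b => if b return chom D (bool_fam A B b) then f else g) true).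
Qed.

Lemma pairing_kin2 (D A B : C) (f : chom D A) (g : chom D B) :
  g \oc kin (pairing f g) = 0.
Proof.
exact: (bpair_kin (fun b => if b return chom D (bool_fam A B b) then f else g) false).
Qed.

Section Step.
(* T collects the variables other than the first one of the functor G. *)
Variables (T : category) (G : functor (prod_cat C T) C).

Let CT2 := prod_cat C (prod_cat C T).

Definition cr_mor (X : CT2) :
    chom (G (biprod X.1 X.2.1, X.2.2))
      (biprod (G (X.1, X.2.2)) (G (X.2.1, X.2.2))) :=
  pairing
    (@fmap _ _ G (biprod X.1 X.2.1, X.2.2) (X.1, X.2.2) (bpr1 X.1 X.2.1, cid1 X.2.2))
    (@fmap _ _ G (biprod X.1 X.2.1, X.2.2) (X.2.1, X.2.2) (bpr2 X.1 X.2.1, cid1 X.2.2)).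

Definition cr_ob (X : CT2) : C := ker (cr_mor X).

Definition cr_sum (X Y : CT2) (f : chom X Y) :
    chom (G (biprod X.1 X.2.1, X.2.2)) (G (biprod Y.1 Y.2.1, Y.2.2)) :=
  @fmap _ _ G (biprod X.1 X.2.1, X.2.2) (biprod Y.1 Y.2.1, Y.2.2)
    (biprod_map f.1 f.2.1, f.2.2).

Lemma cr_subproof (X Y : CT2) (f : chom X Y) :
  cr_mor Y \oc (cr_sum f \oc kin (cr_mor X)) = 0.
Proof.
apply: pairing_eq0; rewrite ccompA /cr_sum -fmapM /= (bpr1_map, bpr2_map) ccomp1f.
- have -> : (f.1 \oc bpr1 X.1 X.2.1, f.2.2) =
    @ccomp (prod_cat C T) (biprod X.1 X.2.1, X.2.2) (X.1, X.2.2) (Y.1, Y.2.2)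
      (f.1, f.2.2) (bpr1 X.1 X.2.1, cid1 X.2.2) by rewrite /= ccompf1.
  by rewrite fmapM -ccompA pairing_kin1 compf0.
- have -> : (f.2.1 \oc bpr2 X.1 X.2.1, f.2.2) =
    @ccomp (prod_cat C T) (biprod X.1 X.2.1, X.2.2) (X.2.1, X.2.2) (Y.2.1, Y.2.2)
      (f.2.1, f.2.2) (bpr2 X.1 X.2.1, cid1 X.2.2) by rewrite /= ccompf1.
  by rewrite fmapM -ccompA pairing_kin2 compf0.
Qed.

Definition cr_map (X Y : CT2) (f : chom X Y) : chom (cr_ob X) (cr_ob Y) :=
  klift (cr_subproof f).

Lemma cr_mapE (X Y : CT2) (f : chom X Y) : kin _ \oc cr_map f = cr_sum f \oc kin _.
Proof. exact: kliftK. Qed.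

Definition cr_step : functor CT2 C.
Proof.
refine (@Functor CT2 C cr_ob cr_map _ _).
- move=> X; apply: kin_mono; rewrite cr_mapE ccompf1 /cr_sum /= biprod_map1.
  by rewrite (fmap1 G) ccomp1f.
- move=> X Y Z g f; apply: kin_mono; rewrite cr_mapE ccompA cr_mapE -ccompA cr_mapE.
  rewrite ccompA; congr (_ \oc _); rewrite /cr_sum -fmapM /=.
  by rewrite biprod_mapM.
Defined.

End Step.

Variable F : functor C C.

Definition cr_base : functor (prod_cat C unit_cat) C.
Proof.
refine (@Functor (prod_cat C unit_cat) C (fun X => F X.1) (fun X Y f => fmap F f.1) _ _).
- by move=> X; rewrite fmap1.
- by move=> X Y Z g f; rewrite fmapM.
Defined.

(* cross_effect i is cr_(i+1) F, a functor of i + 1 variables. *)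
Fixpoint cross_effect i : functor (pow_cat C i.+1) C :=
  if i is j.+1 then @cr_step (pow_cat C j) (cross_effect j) else cr_base.

End CrossEffects.

Record autn (C : category) (n : nat) := Autn {
  aut_ob :> C;
  aut : 'I_n -> chom aut_ob aut_ob;
  aut_comm : forall i j, aut i \oc aut j = aut j \oc aut i;
  aut_iso : forall i, is_iso (aut i) }.

Section AutCat.
Variables (C : category) (n : nat).

Record authom (P Q : autn C n) := AutHom {
  ah :> chom P Q;
  ah_comm : forall i, ah \oc aut P i = aut Q i \oc ah }.

Lemma authomP (P Q : autn C n) (f g : authom P Q) : f = g :> chom P Q -> f = g.
Proof.
case: f g => [f fc] [g gc] /= E; rewrite -{}E in gc *.
by congr AutHom; apply: Prop_irrelevance.
Qed.

Definition authom1 (P : autn C n) : authom P P.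
Proof. by exists (cid1 _) => i; rewrite ccomp1f ccompf1. Defined.

Definition authomM (P Q R : autn C n) (g : authom Q R) (f : authom P Q) :
  authom P R.
Proof. by exists (g \oc f) => i; rewrite -ccompA ah_comm !ccompA ah_comm. Defined.

Definition autn_cat : category.
Proof.
refine (@Category (autn C n) authom authom1 authomM _ _ _) => *;
  apply: authomP => /=; [exact: ccompA | exact: ccomp1f | exact: ccompf1].
Defined.

End AutCat.

(* (P; A_1, ..., A_n) and A_(n+1) as an endomorphism of it *)
Section AutRestrict.
Variables (C : category) (n : nat).

Definition aut_init (P : autn C n.+1) : autn C n :=
  @Autn C n P (fun i => aut P (widen_ord (leqnSn n) i))
    (fun i j => aut_comm P _ _) (fun i => aut_iso P _).

Definition aut_last (P : autn C n.+1) : authom (aut_init P) (aut_init P) :=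
  @AutHom C n (aut_init P) (aut_init P) (aut P ord_max)
    (fun i => aut_comm P _ _).

Definition aut_init_map (P Q : autn C n.+1) (f : authom P Q) :
    authom (aut_init P) (aut_init Q) :=
  @AutHom C n (aut_init P) (aut_init Q) f (fun i => ah_comm f (widen_ord (leqnSn n) i)).

Lemma aut_last_comm (P Q : autn C n.+1) (f : authom P Q) :
  authomM (aut_init_map f) (aut_last P) = authomM (aut_last Q) (aut_init_map f).
Proof. by apply: authomP; exact: (ah_comm f ord_max). Qed.

End AutRestrict.

Section TwoTerm.
Variable C : acat.

(* The binary complex a, 1 : Q -> Q in degrees 1 and 0 *)
Definition two_gr (Q : C) (k : nat) : C := if k is k'.+2 then zob C else Q.

Definition two_d (Q : C) (a : chom Q Q) (k : nat) :
    chom (two_gr Q k.+1) (two_gr Q k) :=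
  if k is k'.+1 then 0 else a.

Lemma two_d2 (Q : C) (a : chom Q Q) k : two_d a k \oc two_d a k.+1 = 0.
Proof. exact: compf0. Qed.

Definition two_term (Q : C) (a : chom Q Q) : bcx C := {|
  gr := two_gr Q;
  bd := two_d a;
  bt := two_d (cid1 Q);
  bd2 := two_d2 a;
  bt2 := two_d2 (cid1 Q) |}.

Definition two_map (Q R : C) (f : chom Q R) (k : nat) :
    chom (two_gr Q k) (two_gr R k) :=
  if k is k'.+2 then cid1 (zob C) else f.

Lemma two_map_d (Q R : C) (f : chom Q R) (a : chom Q Q) (b : chom R R) :
  f \oc a = b \oc f ->
  forall k, two_map f k \oc two_d a k = two_d b k \oc two_map f k.+1.
Proof. by move=> fa [|k] //=; rewrite comp0f compf0. Qed.

Lemma two_map_1 (Q R : C) (f : chom Q R) k :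
  two_map f k \oc two_d (cid1 Q) k = two_d (cid1 R) k \oc two_map f k.+1.
Proof. by apply: two_map_d; rewrite ccomp1f ccompf1. Qed.

Definition two_term_map (Q R : C) (a : chom Q Q) (b : chom R R) (f : chom Q R)
    (fab : f \oc a = b \oc f) : bhom (two_term a) (two_term b) :=
  @BHom C (two_term a) (two_term b) (two_map f) (two_map_d fab) (two_map_1 f).

End TwoTerm.

Section Cube.
Variable E : excat.

Section CubeStep.
Variables (n : nat) (G : functor (autn_cat E n) (Bn E n)).

Definition cube_step_ob (P : autn E n.+1) : Bn E n.+1 :=
  two_term (@fmap (autn_cat E n) _ G _ _ (aut_last P)).

Lemma cube_step_subproof (P Q : autn E n.+1) (f : authom P Q) :
  @fmap (autn_cat E n) _ G _ _ (aut_init_map f) \oc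
    @fmap (autn_cat E n) _ G _ _ (aut_last P) =
  @fmap (autn_cat E n) _ G _ _ (aut_last Q) \oc
    @fmap (autn_cat E n) _ G _ _ (aut_init_map f).
Proof. by rewrite -!fmapM; congr fmap; apply: aut_last_comm. Qed.

Definition cube_step : functor (autn_cat E n.+1) (Bn E n.+1).
Proof.
refine (@Functor (autn_cat E n.+1) (Bn E n.+1) cube_step_ob
  (fun P Q f => two_term_map (cube_step_subproof f)) _ _).
- move=> P; apply: bhomP => -[|[|k]] //=; rewrite -(fmap1 G);
    by congr fmap; apply: authomP.
- move=> P Q R g f; apply: bhomP => -[|[|k]] /=; rewrite ?ccomp1f // -fmapM;
    by congr fmap; apply: authomP.
Defined.

End CubeStep.

Definition cube_base : functor (autn_cat E 0) (Bn E 0).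
Proof. by refine (@Functor (autn_cat E 0) E (fun P => P) (fun P Q f => f) _ _). Defined.

(* cube n (P; A_1, ..., A_n) is [P; A_1, ..., A_n]. *)
Fixpoint cube n : functor (autn_cat E n) (Bn E n) :=
  if n is m.+1 then cube_step (cube m) else cube_base.

End Cube.

Lemma is_iso1 (C : category) (A : C) : is_iso (cid1 A).
Proof. by exists (cid1 A); rewrite ccomp1f. Qed.

Lemma functor_iso (C D : category) (F : functor C D) (A B : C) (f : chom A B) :
  is_iso f -> is_iso (fmap F f).
Proof.
by case=> g [gf fg]; exists (fmap F g); rewrite -!fmapM gf fg !fmap1.
Qed.

Lemma zero_iso (C : acat) (A B : C) (f : chom A B) :
  is_zero A -> is_zero B -> is_iso f.
Proof.
move=> A0 B0; exists 0; rewrite A0 B0 compf0 comp0f; split; by [].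
Qed.

(* Zero objects belong to the category and 0 -> B -> D -> 0 is short exact for
   every isomorphism B -> D. *)
Definition ex_proper (E : excat) : Prop :=
  (forall Z : E, is_zero Z -> ex_in Z) /\
  (forall (Z B D : E) (f : chom Z B) (g : chom B D),
    is_zero Z -> is_iso g -> ex_ses f g).

Lemma Bq_zero (E : excat) (P : Bq E) : is_zero P -> forall k, is_zero (gr P k).
Proof. by move=> P0 k; exact: (congr1 (fun f : bhom P P => f k) P0). Qed.

Lemma Bq_proper (E : excat) : ex_proper E -> ex_proper (Bq E).
Proof.
case=> Ez Es; split=> [P /Bq_zero P0|Z B D f g /Bq_zero Z0 [h [hg gh]] k].
  have ac (d : forall k, chom (gr P k.+1) (gr P k)) : acyclic (E := E) d.
    exists (gr P), (fun k => cid1 (gr P k)), d; split=> [k|k||k].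
    - exact: Ez.
    - by rewrite ccomp1f.
    - exact: is_iso1.
    - by apply: Es => //; apply: zero_iso.
  by split=> //; [move=> k; apply: Ez | exists 0%N].
apply: Es => //; exists (bh (h : bhom D B) k); split.
- exact: (congr1 (fun f : bhom B B => f k) hg).
- exact: (congr1 (fun f : bhom D D => f k) gh).
Qed.

Lemma two_term_acyclic (E : excat) (Q : E) (a : chom Q Q) :
  ex_proper E -> ex_in Q -> is_iso a -> acyclic (E := E) (two_d a).
Proof.
case=> Ez Es Q_in ai; have z0 := zob_zero E.
exists (fun k => if k is k'.+1 then zob E else Q),
  (fun k => if k is k'.+1 return
     chom (if k is k'.+1 then zob E else Q) (two_gr Q k) then 0 else cid1 Q),
  (fun k => if k is k'.+1 return
     chom (two_gr Q k.+1) (if k is k'.+1 then zob E else Q) then 0 else a).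
split=> [[|k]|[|k]||[|k]] //=.
- exact: Ez.
- by rewrite ccomp1f.
- by rewrite comp0f.
- exact: is_iso1.
- exact: Es.
- by apply: Es => //; apply: zero_iso.
Qed.

Lemma cube_in (E : excat) n (P : autn E n) :
  ex_proper E -> ex_in (aut_ob P) -> ex_in (cube E n P).
Proof.
move=> EP; elim: n P => [//|n IH] P P_in.
have EnP : ex_proper (Bn E n) by elim: (n) => [//|m IHm]; apply: Bq_proper.
have Q_in : ex_in (cube E n (aut_init P)) by apply: IH.
have ai : is_iso (@fmap (autn_cat E n) _ (cube E n) _ _ (aut_last P)).
  apply: functor_iso; have [b [bA Ab]] := aut_iso P ord_max.
  have bc i : b \oc aut (aut_init P) i = aut (aut_init P) i \oc b.
    rewrite -[LHS]ccompf1 -Ab -!ccompA; rewrite [in X in _ \oc X]ccompA.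
    rewrite (aut_comm P (widen_ord (leqnSn n) i) ord_max) !ccompA bA ccomp1f.
    by [].
  by exists (@AutHom _ _ (aut_init P) (aut_init P) b bc); split; apply: authomP.
split.
- case=> [|[|k]] //; apply: EnP.1; exact: zob_zero.
- by exists 2 => -[|[|k]] // _; exact: zob_zero.
- exact: two_term_acyclic.
- by apply: two_term_acyclic => //; apply: is_iso1.
Qed.

(* Modules over a ring are zmodTypes, so a group generated by the objects of a
   category of modules lives in too large a universe to be a zmodType. *)
Record abgroup := AbGroup {
  ab_sort :> Type;
  ab0 : ab_sort;
  abN : ab_sort -> ab_sort;
  abD : ab_sort -> ab_sort -> ab_sort;
  abDA : associative abD;
  abDC : commutative abD;
  ab0D : left_id ab0 abD;
  abND : left_inverse ab0 abN abD }.

Arguments ab0 {_}.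

HB.instance Definition _ (G : abgroup) :=
  Monoid.isComLaw.Build G ab0 (@abD G) (@abDA G) (@abDC G) (@ab0D G).

Section KGroup.
Variables (E : excat) (n : nat).

Record Bobj := BObj { bobj :> Bn E n; bobj_in : ex_in bobj }.

Inductive kexp : Type :=
  | Kgen of Bobj
  | Kzero
  | Kopp of kexp
  | Kadd of kexp & kexp.

(* The congruence presenting K_0(B^n) modulo the classes of diagonal objects *)
Inductive krel : kexp -> kexp -> Prop :=
  | krel_refl x : krel x x
  | krel_sym x y : krel x y -> krel y x
  | krel_trans x y z : krel x y -> krel y z -> krel x z
  | krel_opp x x' : krel x x' -> krel (Kopp x) (Kopp x')
  | krel_add x x' y y' : krel x x' -> krel y y' -> krel (Kadd x y) (Kadd x' y')
  | krel_addA x y z : krel (Kadd x (Kadd y z)) (Kadd (Kadd x y) z)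
  | krel_addC x y : krel (Kadd x y) (Kadd y x)
  | krel_add0 x : krel (Kadd Kzero x) x
  | krel_addN x : krel (Kadd (Kopp x) x) Kzero
  | krel_ses (A B D : Bobj) (f : chom (bobj A) (bobj B))
      (g : chom (bobj B) (bobj D)) :
      ex_ses f g -> krel (Kgen B) (Kadd (Kgen A) (Kgen D))
  | krel_diag (P : Bobj) : diagonal (bobj P) -> krel (Kgen P) Kzero.

Definition Kset : Type := {c : kexp -> Prop | exists x, c = krel x}.

Definition Kcl (x : kexp) : Kset := exist _ (krel x) (ex_intro _ x erefl).

Definition Krep (c : Kset) : kexp := projT1 (cid (svalP c)).

Lemma Kset_inj (a b : Kset) : sval a = sval b -> a = b.
Proof.
case: a b => [a aP] [b bP] /= E1; rewrite -{}E1 in bP *.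
by congr exist; apply: Prop_irrelevance.
Qed.

Lemma Krep_cl c : Kcl (Krep c) = c.
Proof. by apply: Kset_inj; rewrite /= /Krep; case: (cid _). Qed.

Lemma Kcl_eq x y : Kcl x = Kcl y <-> krel x y.
Proof.
split=> [/(congr1 sval) /= E1|xy].
  by rewrite E1; apply: krel_refl.
apply: Kset_inj => /=; apply: functional_extensionality_dep => z.
apply: propext; split=> h; first exact: krel_trans (krel_sym xy) h.
exact: krel_trans xy h.
Qed.

Lemma Krep_rel x : krel (Krep (Kcl x)) x.
Proof. by apply/Kcl_eq; rewrite Krep_cl. Qed.

Definition KN (a : Kset) : Kset := Kcl (Kopp (Krep a)).
Definition KD (a b : Kset) : Kset := Kcl (Kadd (Krep a) (Krep b)).

Definition K : abgroup.
Proof.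
refine (@AbGroup Kset (Kcl Kzero) KN KD _ _ _ _).
- move=> a b c; apply/Kcl_eq.
  apply: (krel_trans (krel_add (krel_refl _) (Krep_rel _))).
  apply: (krel_trans (krel_addA _ _ _)).
  exact: krel_add (krel_sym (Krep_rel _)) (krel_refl _).
- by move=> a b; apply/Kcl_eq; apply: krel_addC.
- move=> a; rewrite -[RHS]Krep_cl; apply/Kcl_eq.
  exact: krel_trans (krel_add (Krep_rel _) (krel_refl _)) (krel_add0 _).
- move=> a; apply/Kcl_eq.
  exact: krel_trans (krel_add (Krep_rel _) (krel_refl _)) (krel_addN _).
Defined.

Definition Kclass (P : Bn E n) (P_in : ex_in P) : K := Kcl (Kgen (BObj P_in)).

(* The endomorphism of K_n determined by lambda [P] = [F P], where F maps B^n to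
   itself *)
Definition is_lambda (F : functor (Bn E n) (Bn E n)) (lambda : K -> K) : Prop :=
  (forall x y, lambda (abD x y) = abD (lambda x) (lambda y)) /\
  (forall (P : Bn E n) (P_in : ex_in P),
    exists FP_in : ex_in (F P), lambda (Kclass P_in) = Kclass FP_in).

End KGroup.

Local Open Scope classical_set_scope.

Record opens (T : topologicalType) := Opens {
  oset :> set T;
  oset_open : open oset }.

Definition is_sheaf (T : topologicalType) (F : opens T -> Type)
    (res : forall U V : opens T, V `<=` U -> F U -> F V) : Prop :=
  forall (U : opens T) (I : Type) (V : I -> opens T) (VU : forall i, V i `<=` U),
    (forall x, oset U x -> exists i, oset (V i) x) ->
  forall s : forall i, F (V i),
    (forall i j (W : opens T) (Wi : W `<=` V i) (Wj : W `<=` V j),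
      res _ _ Wi (s i) = res _ _ Wj (s j)) ->
  exists! t : F U, forall i, res _ _ (VU i) t = s i.

Record ringed_space := RingedSpace {
  pts :> topologicalType;
  sring : opens pts -> comPzRingType;
  rres : forall U V : opens pts, V `<=` U -> {rmorphism sring U -> sring V};
  rres_id : forall (U : opens pts) (UU : U `<=` U) s, rres UU s = s;
  rres_comp : forall (U V W : opens pts) (VU : V `<=` U) (WV : W `<=` V)
    (WU : W `<=` U) s, rres WV (rres VU s) = rres WU s;
  rres_sheaf : is_sheaf (fun U V VU => rres VU : sring U -> sring V) }.

Definition prime_ideal (A : comPzRingType) (p : set A) : Prop :=
  [/\ p 0, forall a b, p a -> p b -> p (a + b), forall a b, p b -> p (a * b),
      ~ p 1 & forall a b, p (a * b) -> p a \/ p b].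

(* B is the localisation A_f of A *)
Definition is_localization (A B : comPzRingType) (phi : A -> B) (f : A) : Prop :=
  [/\ exists g, phi f * g = 1,
      forall b, exists a m, phi f ^+ m * b = phi a
    & forall a, phi a = 0 -> exists m, f ^+ m * a = 0].

(* (U, O|_U) is isomorphic to Spec A: x |-> p x is a homeomorphism from U to the
   prime spectrum of A with its Zariski topology, and alpha : A -> O(U) induces
   isomorphisms from A_f = O_(Spec A)(D(f)) to the sections of O over the preimage
   of D(f). *)
Definition is_affine (X : ringed_space) (U : opens X) : Prop :=
  exists (A : comPzRingType) (alpha : {rmorphism A -> sring U}) (p : X -> set A),
  let D f := [set x | oset U x /\ ~ p x f] in
  [/\ forall x, oset U x -> prime_ideal (p x),
      forall q, prime_ideal q -> exists! x, oset U x /\ p x = q,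
      forall V : set X, V `<=` U ->
        (open V <-> forall x, V x -> exists2 f, D f x & D f `<=` V)
    & forall f (V : opens X) (VU : V `<=` U), oset V = D f ->
        is_localization (fun a => rres VU (alpha a)) f].

Record scheme := Scheme {
  scheme_rs :> ringed_space;
  scheme_affine : forall x : scheme_rs, exists2 U : opens scheme_rs, oset U x & is_affine U }.

Section Modules.
Variable X : ringed_space.

Record omod := OMod {
  msec :> forall U : opens X, lmodType (sring U);
  mres : forall U V : opens X, V `<=` U -> msec U -> msec V;
  mres_lin : forall (U V : opens X) (VU : V `<=` U) a s t,
    mres VU (a *: s + t) = rres VU a *: mres VU s + mres VU t;
  mres_id : forall (U : opens X) (UU : U `<=` U) s, mres UU s = s;
  mres_comp : forall (U V W : opens X) (VU : V `<=` U) (WV : W `<=` V)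
    (WU : W `<=` U) s, mres WV (mres VU s) = mres WU s;
  mres_sheaf : is_sheaf mres }.

Record ohom (E F : omod) := OHom {
  oh :> forall U, E U -> F U;
  oh_lin : forall U a (s t : E U), oh (a *: s + t) = a *: oh s + oh t;
  oh_res : forall (U V : opens X) (VU : V `<=` U) (s : E U),
    oh (mres VU s) = mres VU (oh s) }.

Arguments oh {E F} _ U _.

Section OmodTheory.
Implicit Types E F G : omod.

Lemma ohomP E F (f g : ohom E F) : (forall U s, f U s = g U s) -> f = g.
Proof.
case: f g => [f fl fr] [g gl gr'] /= fg.
have {fg} E1 : f = g.
  by do 2! (apply: functional_extensionality_dep => ?).
by rewrite -{}E1 in gl gr' *; congr OHom; apply: Prop_irrelevance.
Qed.

Lemma mresD E (U V : opens X) (VU : V `<=` U) (s t : E U) :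
  mres VU (s + t) = mres VU s + mres VU t.
Proof. by rewrite -[s in LHS]scale1r mres_lin rmorph1 scale1r. Qed.

Lemma mres0 E (U V : opens X) (VU : V `<=` U) : mres VU (0 : E U) = 0.
Proof. by apply: (@addIr _ (mres VU 0)); rewrite -mresD !add0r. Qed.

Lemma mresN E (U V : opens X) (VU : V `<=` U) (s : E U) :
  mres VU (- s) = - mres VU s.
Proof. by apply: (@addIr _ (mres VU s)); rewrite -mresD !addNr mres0. Qed.

Lemma ohD E F (f : ohom E F) U (s t : E U) : f U (s + t) = f U s + f U t.
Proof. by rewrite -[s in LHS]scale1r oh_lin scale1r. Qed.

Lemma oh0 E F (f : ohom E F) U : f U 0 = 0.
Proof. by apply: (@addIr _ (f U 0)); rewrite -ohD !add0r. Qed.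

Definition ohom1 E : ohom E E.
Proof. by exists (fun U s => s). Defined.

Definition ohomM E F G (g : ohom F G) (f : ohom E F) : ohom E G.
Proof.
by exists (fun U s => g U (f U s)) => *; rewrite !(oh_lin, oh_res).
Defined.

Definition omod_cat : category.
Proof.
by refine (@Category omod ohom ohom1 ohomM _ _ _) => *; apply: ohomP.
Defined.

Definition ohom_zero E F : ohom E F.
Proof.
by exists (fun U s => 0) => *; rewrite ?mres0 // scaler0 addr0.
Defined.

Definition ohom_opp E F (f : ohom E F) : ohom E F.
Proof.
exists (fun U s => - f U s) => [U a s t|U V VU s].
- by rewrite oh_lin opprD scalerN.
- by rewrite oh_res mresN.
Defined.

Definition ohom_add E F (f g : ohom E F) : ohom E F.
Proof.
exists (fun U s => f U s + g U s) => [U a s t|U V VU s].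
- by rewrite !oh_lin scalerDr addrACA.
- by rewrite !oh_res mresD.
Defined.

Definition omod_pacat : pacat.
Proof.
refine (@PACat omod_cat ohom_zero ohom_opp ohom_add _ _ _ _ _ _).
- by move=> E F f g h; apply: ohomP => U s /=; rewrite addrA.
- by move=> E F f g; apply: ohomP => U s /=; rewrite addrC.
- by move=> E F f; apply: ohomP => U s /=; rewrite add0r.
- by move=> E F f; apply: ohomP => U s /=; rewrite addNr.
- by move=> E F G f g h; apply: ohomP.
- by move=> E F G f g h; apply: ohomP => U s /=; rewrite ohD.
Defined.

Lemma oh_sum (E F : omod_pacat) (I : finType) (f : I -> chom E F) U s :
  oh (\sum_i f i) U s = \sum_i oh (f i) U s.
Proof. exact: (big_morph (fun f : chom E F => oh f U s)). Qed.

End OmodTheory.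
End Modules.

Arguments oh {X E F} _ U _.
Arguments mres {X o U V}.

Section ModuleConstructions.
Variable R : pzRingType.

Definition pi_mod (I : Type) (M : I -> lmodType R) : Type := forall i, M i.

Section Product.
Variables (I : Type) (M : I -> lmodType R).

HB.instance Definition _ := gen_eqMixin (pi_mod M).
HB.instance Definition _ := gen_choiceMixin (pi_mod M).

Definition pi_zero : pi_mod M := fun i => 0.
Definition pi_opp (s : pi_mod M) : pi_mod M := fun i => - s i.
Definition pi_add (s t : pi_mod M) : pi_mod M := fun i => s i + t i.
Definition pi_scale (a : R) (s : pi_mod M) : pi_mod M := fun i => a *: s i.

Fact pi_addA : associative pi_add.
Proof. by move=> s t u; apply: functional_extensionality_dep => i; apply: addrA. Qed.
Fact pi_addC : commutative pi_add.
Proof. by move=> s t; apply: functional_extensionality_dep => i; apply: addrC. Qed.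
Fact pi_add0 : left_id pi_zero pi_add.
Proof. by move=> s; apply: functional_extensionality_dep => i; apply: add0r. Qed.
Fact pi_addN : left_inverse pi_zero pi_opp pi_add.
Proof. by move=> s; apply: functional_extensionality_dep => i; apply: addNr. Qed.

HB.instance Definition _ :=
  GRing.isZmodule.Build (pi_mod M) pi_addA pi_addC pi_add0 pi_addN.

Fact pi_scaleA a b s : pi_scale a (pi_scale b s) = pi_scale (a * b) s.
Proof. by apply: functional_extensionality_dep => i; apply: scalerA. Qed.
Fact pi_scale1 : left_id 1 pi_scale.
Proof. by move=> s; apply: functional_extensionality_dep => i; apply: scale1r. Qed.
Fact pi_scaleDr : right_distributive pi_scale +%R.
Proof. by move=> a s t; apply: functional_extensionality_dep => i; apply: scalerDr. Qed.
Fact pi_scaleDl s : {morph pi_scale^~ s : a b / a + b}.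
Proof. by move=> a b; apply: functional_extensionality_dep => i; apply: scalerDl. Qed.

HB.instance Definition _ :=
  GRing.Zmodule_isLmodule.Build R (pi_mod M) pi_scaleA pi_scale1 pi_scaleDr pi_scaleDl.

End Product.

Section Kernel.
Variables (M N : lmodType R) (f : M -> N).

Record ker_mod : Type := KerMod { kval : M; kvalP : f kval = 0 }.

Lemma kval_inj s t : kval s = kval t -> s = t.
Proof.
case: s t => [s fs] [t ft] /= st; rewrite -{}st in ft *.
by congr KerMod; apply: Prop_irrelevance.
Qed.

End Kernel.

Section KernelInst.
Variables (M N : lmodType R) (f : M -> N).
Hypothesis f_lin : forall a s t, f (a *: s + t) = a *: f s + f t.

(* An alias that carries the proof of linearity needed by the instances *)
Definition kermod (_ : forall a s t, f (a *: s + t) = a *: f s + f t) : Type :=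
  ker_mod f.
Local Notation Ker := (kermod f_lin).

HB.instance Definition _ := gen_eqMixin Ker.
HB.instance Definition _ := gen_choiceMixin Ker.

Fact ker_zero_subproof : f 0 = 0.
Proof.
apply: (@addIr _ (f 0)); rewrite add0r -[X in X + _]scale1r -f_lin.
by rewrite scale1r addr0.
Qed.
Fact ker_scale_subproof a (s : Ker) : f (a *: kval s) = 0.
Proof. by rewrite -[_ *: _]addr0 f_lin kvalP scaler0 ker_zero_subproof addr0. Qed.
Fact ker_add_subproof (s t : Ker) : f (kval s + kval t) = 0.
Proof. by rewrite -[kval s]scale1r f_lin !kvalP scaler0 addr0. Qed.
Fact ker_opp_subproof (s : Ker) : f (- kval s) = 0.
Proof. by rewrite -scaleN1r ker_scale_subproof. Qed.

Definition ker_zero : Ker := KerMod ker_zero_subproof.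
Definition ker_opp (s : Ker) : Ker := KerMod (ker_opp_subproof s).
Definition ker_add (s t : Ker) : Ker := KerMod (ker_add_subproof s t).
Definition ker_scale (a : R) (s : Ker) : Ker := KerMod (ker_scale_subproof a s).

Fact ker_addA : associative ker_add.
Proof. by move=> s t u; apply: kval_inj => /=; apply: addrA. Qed.
Fact ker_addC : commutative ker_add.
Proof. by move=> s t; apply: kval_inj => /=; apply: addrC. Qed.
Fact ker_add0 : left_id ker_zero ker_add.
Proof. by move=> s; apply: kval_inj => /=; apply: add0r. Qed.
Fact ker_addN : left_inverse ker_zero ker_opp ker_add.
Proof. by move=> s; apply: kval_inj => /=; apply: addNr. Qed.

HB.instance Definition _ :=
  GRing.isZmodule.Build Ker ker_addA ker_addC ker_add0 ker_addN.

Fact ker_scaleA a b s : ker_scale a (ker_scale b s) = ker_scale (a * b) s.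
Proof. by apply: kval_inj => /=; apply: scalerA. Qed.
Fact ker_scale1 : left_id 1 ker_scale.
Proof. by move=> s; apply: kval_inj => /=; apply: scale1r. Qed.
Fact ker_scaleDr : right_distributive ker_scale +%R.
Proof. by move=> a s t; apply: kval_inj => /=; apply: scalerDr. Qed.
Fact ker_scaleDl s : {morph ker_scale^~ s : a b / a + b}.
Proof. by move=> a b; apply: kval_inj => /=; apply: scalerDl. Qed.

HB.instance Definition _ :=
  GRing.Zmodule_isLmodule.Build R Ker ker_scaleA ker_scale1 ker_scaleDr ker_scaleDl.

End KernelInst.
End ModuleConstructions.

Section ModuleCategory.
Variable X : ringed_space.
Implicit Types E F G : omod X.

Definition omod_bip (I : finType) (E : I -> omod X) : omod X.
Proof.
refine (@OMod X (fun U => pi_mod (fun i => E i U))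
  (fun U V VU s i => mres VU (s i)) _ _ _ _).
- move=> U V VU a s t; apply: functional_extensionality_dep => i.
  exact: mres_lin.
- by move=> U UU s; apply: functional_extensionality_dep => i; apply: mres_id.
- move=> U V W VU WV WU s; apply: functional_extensionality_dep => i.
  exact: mres_comp.
- move=> U J V VU cov s s_eq.
  have comp i : exists! t : E i U, forall j, mres (VU j) t = s j i.
    apply: mres_sheaf => // j k W Wj Wk.
    exact: (congr1 (fun t : forall i, E i W => t i) (s_eq j k W Wj Wk)).
  exists (fun i => projT1 (cid (comp i))); split.
    move=> j; apply: functional_extensionality_dep => i.
    by case: (cid _) => t [tE _] /=.
  move=> t tE; apply: functional_extensionality_dep => i.
  case: (cid _) => u [_ uU] /=; apply: uU => j.
  exact: (congr1 (fun t : forall i, E i (V j) => t i) (tE j)).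
Defined.

(* The identity E i (U) -> E j (U) if i = j, and 0 otherwise *)
Definition delta_sec (I : finType) (E : I -> omod X) i j (U : opens X)
    (s : E i U) : E j U :=
  if @eqP _ i j is ReflectT e then ecast j (E j U) e s else 0.

Lemma delta_sec_id (I : finType) (E : I -> omod X) i U (s : E i U) :
  delta_sec (E := E) i s = s.
Proof.
by rewrite /delta_sec; case: eqP => // e; rewrite (eq_irrelevance e erefl).
Qed.

Lemma delta_sec_neq (I : finType) (E : I -> omod X) i j U (s : E i U) :
  i <> j -> delta_sec (E := E) j s = 0.
Proof. by rewrite /delta_sec; case: eqP. Qed.

Definition omod_bin (I : finType) (E : I -> omod X) i : ohom (E i) (omod_bip E).
Proof.
exists (fun U (s : E i U) j => delta_sec (E := E) j s).
- move=> U a s t; apply: functional_extensionality_dep => j.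
  suff : delta_sec (E := E) j (a *: s + t) =
      a *: delta_sec (E := E) j s + delta_sec (E := E) j t by [].
  have [<-|/eqP ij] := eqVneq i j; first by rewrite !delta_sec_id.
  by rewrite !delta_sec_neq // scaler0 addr0.
- move=> U V VU s; apply: functional_extensionality_dep => j /=.
  have [<-|/eqP ij] := eqVneq i j; first by rewrite !delta_sec_id.
  by rewrite !delta_sec_neq // mres0.
Defined.

Definition omod_bpr (I : finType) (E : I -> omod X) i : ohom (omod_bip E) (E i).
Proof. by exists (fun U (s : omod_bip E U) => s i). Defined.

Section Kernel.
Variables (E F : omod X) (f : ohom E F).

Lemma omod_ker_res (U V : opens X) (VU : V `<=` U) (s : kermod (@oh_lin X E F f U)) :
  f V (mres VU (kval s)) = 0.
Proof. by rewrite oh_res kvalP mres0. Qed.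

Definition omod_ker : omod X.
Proof.
refine (@OMod X (fun U => kermod (@oh_lin X E F f U))
  (fun U V VU s => KerMod (omod_ker_res VU s)) _ _ _ _).
- by move=> U V VU a s t; apply: kval_inj => /=; apply: mres_lin.
- by move=> U UU s; apply: kval_inj => /=; apply: mres_id.
- by move=> U V W VU WV WU s; apply: kval_inj => /=; apply: mres_comp.
- move=> U J V VU cov s s_eq.
  have [||t [tE tU]] := @mres_sheaf X E U J V VU _ (fun j => kval (s j)) => //.
    by move=> i j W Wi Wj; exact: (congr1 (@kval _ _ _ _) (s_eq i j W Wi Wj)).
  have ft : f U t = 0.
    have [|u [_ uU]] := @mres_sheaf X F U J V VU cov (fun j => 0).
      by move=> *; rewrite !mres0.
    rewrite -(uU (f U t)) ?(uU 0) // => j; rewrite ?mres0 //.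
    by rewrite -oh_res tE kvalP.
  exists (KerMod ft); split; first by move=> j; apply: kval_inj; apply: tE.
  move=> u uE; apply: kval_inj => /=; apply: tU => j.
  exact: (congr1 (@kval _ _ _ _) (uE j)).
Defined.

Definition omod_kin : ohom omod_ker E.
Proof. by exists (fun U (s : omod_ker U) => kval s). Defined.

Lemma omod_klift_subproof G (g : ohom G E) (fg : ohomM f g = ohom_zero G F) U s :
  f U (g U s) = 0.
Proof. exact: (congr1 (fun h : ohom G F => h U s) fg). Qed.

Definition omod_klift G (g : ohom G E) (fg : ohomM f g = ohom_zero G F) :
  ohom G omod_ker.
Proof.
exists (fun U s => KerMod (omod_klift_subproof fg s) : omod_ker U) => *;
  apply: kval_inj => /=; [exact: oh_lin | exact: oh_res].
Defined.

End Kernel.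

Lemma omod_bip_sum (I : finType) (E : I -> omod X) U (J : finType)
    (s : J -> omod_bip E U) i :
  (\sum_j s j : omod_bip E U) i = \sum_j s j i.
Proof. exact: (big_morph (fun t : omod_bip E U => t i)). Qed.

Definition omod_acat : acat.
Proof.
refine (@ACat (omod_pacat X) omod_bip omod_bin omod_bpr _ _ _
  omod_ker omod_kin _ omod_klift _ _).
- by move=> I E i; apply: ohomP => U s /=; rewrite delta_sec_id.
- by move=> I E i j ij; apply: ohomP => U s /=; rewrite delta_sec_neq.
- move=> I E; apply: ohomP => U s; rewrite oh_sum /=.
  apply: functional_extensionality_dep => i; rewrite omod_bip_sum.
  rewrite (bigD1 i) //= delta_sec_id big1 ?addr0 // => j /eqP ji.
  by rewrite delta_sec_neq.
- by move=> E F f; apply: ohomP => U s /=; apply: kvalP.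
- by move=> E F f G g fg; apply: ohomP.
- move=> E F f G u v uv; apply: ohomP => U s; apply: kval_inj.
  exact: (congr1 (fun h : ohom G E => h U s) uv).
Defined.

(* Locally isomorphic to O^m: the sections e form a basis of E over all V in U. *)
Definition locally_free (E : omod X) : Prop :=
  forall x : X, exists2 U : opens X, oset U x &
  exists (m : nat) (e : 'I_m -> E U), forall (V : opens X) (VU : V `<=` U) (s : E V),
    exists! a : 'I_m -> sring V, s = \sum_i a i *: mres VU (e i).

(* Exactness of 0 -> E -> F -> G -> 0 as sheaves *)
Definition short_exact (E F G : omod X) (f : ohom E F) (g : ohom F G) : Prop :=
  [/\ forall U, injective (f U),
      forall U (s : F U), g U s = 0 <-> exists t, f U t = s
    & forall U (s : G U) x, oset U x ->
        exists (V : opens X) (VU : V `<=` U) (t : F V),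
          oset V x /\ g V t = mres VU s].

(* P(X) as a full subcategory of all modules. The kernels occurring in the functor
   NFGam and in cross-effects of functors preserving P(X) are direct summands, so
   it does not matter that they are taken among all modules. *)
Definition PX : excat := {|
  ex_cat := omod_acat;
  ex_in := locally_free;
  ex_ses := short_exact |}.

Lemma PX_proper : ex_proper PX.
Proof.
split=> [Z Z0 x|Z B D f g Z0 [h [hg gh]]].
  have Z0' U (s : (Z : omod X) U) : s = 0.
    exact: (congr1 (fun k : ohom Z Z => k U s) Z0).
  exists (Opens openT) => //; exists 0%N, (fun i => 0) => V VU s.
  exists (fun i => 0); split; first by rewrite big_ord0; apply: Z0'.
  by move=> a _; apply: functional_extensionality_dep => -[].
have Z0' U (s : (Z : omod X) U) : s = 0.
  exact: (congr1 (fun k : ohom Z Z => k U s) Z0).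
have hg' U (s : (B : omod X) U) : oh h U (oh g U s) = s.
  exact: (congr1 (fun k : ohom B B => k U s) hg).
have gh' U (s : (D : omod X) U) : oh g U (oh h U s) = s.
  exact: (congr1 (fun k : ohom D D => k U s) gh).
split=> [U s t _|U s|U s x Ux]; first by rewrite (Z0' U s) (Z0' U t).
- split=> [gs0|[t <-]]; last by rewrite (Z0' U t) !oh0.
  by exists 0; rewrite oh0 -(hg' U s) gs0 oh0.
- have UU : U `<=` U by [].
  by exists U, UU, (oh h U s); rewrite gh' mres_id.
Qed.

Section ExteriorPower.
Variable r : nat.

Definition replace (T : Type) (x : 'I_r -> T) (i : 'I_r) (u : T) : 'I_r -> T :=
  fun k => if k == i then u else x k.

(* Alternating O-multilinear morphisms E^r -> G *)
Record alt_map (E G : omod X) := AltMap {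
  am :> forall U : opens X, ('I_r -> E U) -> G U;
  am_lin : forall (U : opens X) (x : 'I_r -> E U) i a u v,
    am (replace x i (a *: u + v)) = a *: am (replace x i u) + am (replace x i v);
  am_alt : forall (U : opens X) (x : 'I_r -> E U) i j,
    i <> j -> x i = x j -> am x = 0;
  am_res : forall (U V : opens X) (VU : V `<=` U) (x : 'I_r -> E U),
    am (fun k => mres VU (x k)) = mres VU (am x) }.

Arguments am {E G} _ U _.

(* An exterior power of E: a module with a universal alternating map from E^r *)
Record ext_power (E : omod X) := ExtPower {
  ext :> omod X;
  wedge : alt_map E ext;
  ext_lift : forall G, alt_map E G -> ohom ext G;
  ext_liftE : forall G (w : alt_map E G) U x, ext_lift w U (wedge U x) = w U x;
  ext_uniq : forall G (f g : ohom ext G),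
    (forall U x, f U (wedge U x) = g U (wedge U x)) -> f = g }.

Definition alt_comp (E F G : omod X) (w : alt_map F G) (f : ohom E F) : alt_map E G.
Proof.
exists (fun U x => w U (fun k => f U (x k))).
- move=> U x i a u v.
  have fr y : (fun k => f U (replace x i y k)) =
      replace (fun k => f U (x k)) i (f U y).
    by apply: functional_extensionality_dep => k; rewrite /replace; case: ifP.
  by rewrite !fr oh_lin am_lin.
- by move=> U x i j ij xij; apply: (am_alt _ ij); rewrite xij.
- move=> U V VU x; rewrite -am_res; congr am.
  by apply: functional_extensionality_dep => k; rewrite oh_res.
Defined.

Variable L : forall E : omod X, ext_power E.

(* The r-th exterior power functor: L f (x_1 /\ ... /\ x_r) = f x_1 /\ ... /\ f x_r *)
Definition ext_map (E F : omod X) (f : ohom E F) : ohom (L E) (L F) :=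
  ext_lift (L E) (alt_comp (wedge (L F)) f).

Definition ext_functor : functor PX PX.
Proof.
refine (@Functor PX PX (fun E => ext (L E)) ext_map _ _).
- by move=> E; apply: ext_uniq => U x; rewrite /ext_map ext_liftE.
- by move=> E F G g f; apply: ext_uniq => U x; rewrite /= /ext_map !ext_liftE.
Defined.

End ExteriorPower.

End ModuleCategory.

Section CrossEffectCubes.
Variables (C : acat) (F : functor C C) (n : nat) (P : autn C n) (i : nat).

Definition cr_diag : C := cross_effect F i (diag_ob i.+1 (aut_ob P)).

(* For the automorphism A_j of P: cr_(i+1) F (A_j, 1, ..., 1) for the first
   direction j = 0 and cr_(i+1) F (A_j, ..., A_j) for the other ones *)
Definition cr_arg (j : 'I_n) : chom (diag_ob i.+1 (aut_ob P)) (diag_ob i.+1 (aut_ob P)) :=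
  if j == 0%N :> nat then (aut P j, diag_hom i (cid1 (aut_ob P)))
  else diag_hom i.+1 (aut P j).

Definition cr_aut (j : 'I_n) : chom cr_diag cr_diag := fmap (cross_effect F i) (cr_arg j).

Lemma cr_aut_comm j k : cr_aut j \oc cr_aut k = cr_aut k \oc cr_aut j.
Proof.
rewrite /cr_aut -!fmapM /cr_arg; congr fmap.
by case: ifP => _; case: ifP => _; rewrite /= (aut_comm P j k) -!diag_homM
  ?ccomp1f ?ccompf1 ?(aut_comm P j k).
Qed.

Lemma cr_aut_iso j : is_iso (cr_aut j).
Proof.
apply: functor_iso; have [b [bA Ab]] := aut_iso P j; rewrite /cr_arg.
case: ifP => _.
  exists ((b, diag_hom i (cid1 (aut_ob P))) :
    chom (diag_ob i.+1 (aut_ob P)) (diag_ob i.+1 (aut_ob P))).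
  by rewrite /= bA Ab -!diag_homM ccomp1f diag_hom1.
by exists (diag_hom i.+1 b); rewrite -!diag_homM bA Ab diag_hom1.
Qed.

Definition cr_autn : autn C n := Autn cr_aut_comm cr_aut_iso.

End CrossEffectCubes.

(* The class of [P; A_1, ..., A_n] in K_n(X) *)
Definition cube_class (X : ringed_space) n (P : autn (PX X) n)
    (P_lf : locally_free (aut_ob P)) : K (PX X) n :=
  Kclass (cube_in (@PX_proper X) P_lf).

Definition ab_sign (G : abgroup) (i : nat) (x : G) : G := if odd i then abN x else x.

(* Main.v *)
(* An additive invariant chi of binary complexes that vanishes on diagonal ones satisfies
   chi (a c) = chi (a) + chi (c) on two-term complexes Q -> Q with differentials a and 1, by
   a suitable three-term complex. Filtering the normalisation of F (Gamma (Q -> Q)) by the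
   summands of Q^(k+1) = Gamma_k, its i-th graded piece is a shifted two-term complex on
   cr_(i+1) F (Q, ..., Q), with the automorphism acting through the first variable. So
   chi (N F Gamma [Q; a]) is the alternating sum of the classes of the cross-effects, which
   are also the iterated differences of k |-> chi [F (Q^(k+1)); F (a + 1 + ... + 1)]. This is
   the case n = 1.

   For n > 1, all is done for objects with further commuting automorphisms. If F itself is
   of the form N F'' Gamma and Q is a two-term complex, then the iterated differences vanish,
   so that N F Gamma [Q; a] has the class of [F (Q); F (a)]: this strips off the outer
   directions one at a time, and the case n = 1 remains. *)

From HB Require Import structures.
From mathcomp Require Import all_boot all_order all_algebra.
From mathcomp Require Import zify.
From mathcomp Require Import boolp classical_sets topology.
Require Import Defs.

Set Implicit Arguments.
Unset Strict Implicit.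
Unset Printing Implicit Defensive.

Import GRing.Theory.
Local Open Scope ring_scope.

(** * Exact categories closed under retracts *)

(** The obstacle is membership: $\Lambda^r_n$ is known to map $\mathcal{B}^n$ to itself, but
    subobjects of its values could leave the exact category. The filtration is therefore cut out by
    idempotents on the fixed objects [F (pw Q k.+1)]. Their images are retracts, and the acyclicity
    of the pieces comes from explicit contractions. This is why closure under retracts is carried
    along, from locally free modules up to $\mathcal{B}^n$.

    The alternating sum is Newton's formula at $-1$: for $g(k) = \chi[F(Q^{k+1}); F(a+1+\dots+1)]$
    it is the extrapolated value $g(-1)$. The sum stops at $r$ because $f \mapsto F(f)$ is
    polynomial of degree at most $r$, a property that passes from $F$ to $NF\Gamma$. The iterated
    differences vanish in higher dimensions for the same reason: replacing $Q$ by $Q^{k+1}$ turns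
    $l$ into $(k+1)(l+1)-1$, and this reparametrisation fixes $-1$. *)

Section CategoryBasics.
Variable C : category.
Implicit Types A B D : C.

(** Lets an equation [f \oc g = h] rewrite inside a composite that is associated to the left. *)
Lemma comp_eqr A B D E (f : chom B D) (g : chom A B) (h : chom A D) :
  f \oc g = h -> forall x : chom D E, x \oc f \oc g = x \oc h.
Proof. by move=> <- x; rewrite ccompA. Qed.

Definition retract A B := exists (s : chom A B) (p : chom B A), p \oc s = cid1 A.

Lemma iso_comp A B D (g : chom B D) (f : chom A B) :
  is_iso g -> is_iso f -> is_iso (g \oc f).
Proof.
move=> [g' [g'g gg']] [f' [f'f ff']]; exists (f' \oc g'); split.
- by rewrite ccompA (comp_eqr g'g) ccompf1.
- by rewrite ccompA (comp_eqr ff') ccompf1.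
Qed.

(** Reverses the horizontal arrows [a], [b] of a commuting square; this is how inverses of chain
    maps and of equivariant maps are seen to be compatible with the structure. *)
Lemma iso_square A B A' B' (f : chom A B) (f' : chom A' B') (a : chom A A')
    (b : chom B B') (a' : chom A' A) (b' : chom B' B) :
  a \oc a' = cid1 A' -> b' \oc b = cid1 B -> f' \oc a = b \oc f ->
  f \oc a' = b' \oc f'.
Proof.
move=> aa bb fab; rewrite -[f in LHS]ccomp1f -bb -(ccompA b') -fab ccompA.
by rewrite -ccompA aa ccompf1.
Qed.

End CategoryBasics.

Section Zero.
Variable C : acat.
Implicit Types A B : C.

Lemma zero_to A B (f : chom A B) : is_zero B -> f = 0.
Proof. by move=> B0; rewrite -(ccomp1f f) B0 comp0f. Qed.

Lemma zero_from A B (f : chom A B) : is_zero A -> f = 0.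
Proof. by move=> A0; rewrite -(ccompf1 f) A0 compf0. Qed.

Lemma zero_retract A B : retract A B -> is_zero B -> is_zero A.
Proof. by case=> s [p ps] /(zero_from p) p0; rewrite /is_zero -ps p0 comp0f. Qed.

Lemma bip_zero (I : finType) (A : I -> C) : (forall i, is_zero (A i)) -> is_zero (bip A).
Proof.
move=> A0; apply: bip_ext => i; rewrite compf0 ccompf1; exact: zero_to.
Qed.

Lemma bmap_id (I : finType) (A : I -> C) (f : forall i, chom (A i) (A i)) :
  (forall i, f i = cid1 _) -> bmap f = cid1 (bip A).
Proof. by move=> e; apply: bip_ext => i; rewrite bpr_bmap e ccomp1f ccompf1. Qed.

Lemma bmap_eq (I : finType) (A B : I -> C) (f g : forall i, chom (A i) (B i)) :
  (forall i, f i = g i) -> bmap f = bmap g.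
Proof. by move=> e; apply: bip_ext => i; rewrite !bpr_bmap e. Qed.

Lemma bmap_iso (I : finType) (A B : I -> C) (f : forall i, chom (A i) (B i)) :
  (forall i, is_iso (f i)) -> is_iso (bmap f).
Proof.
move=> fi; exists (bmap (fun i => projT1 (cid (fi i)))).
by rewrite -!bmapM; split; apply: bmap_id => i; case: (cid _) => g [].
Qed.

(* Idempotents split, as ker is total. *)
Section Image.
Variables (A : C) (g : chom A A) (gg : g \oc g = g).

Definition im : C := ker (cid1 A - g).
Definition inc : chom im A := kin (cid1 A - g).

Fact prj_subproof : (cid1 A - g) \oc g = 0.
Proof. by rewrite compDl ccomp1f compNf gg subrr. Qed.

Definition prj : chom A im := klift prj_subproof.

Lemma inc_prj : inc \oc prj = g.
Proof. exact: kliftK. Qed.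

Lemma g_inc : g \oc inc = inc.
Proof.
have := kin0 (cid1 A - g); rewrite compDl ccomp1f compNf => /eqP.
by rewrite subr_eq0 => /eqP.
Qed.

Lemma prj_inc : prj \oc inc = cid1 im.
Proof. by apply: kin_mono; rewrite ccompA inc_prj g_inc ccompf1. Qed.

Lemma prj_g : prj \oc g = prj.
Proof. by apply: kin_mono; rewrite ccompA inc_prj gg -inc_prj. Qed.

Lemma im_zero : g = 0 -> is_zero im.
Proof. by move=> g0; rewrite /is_zero -prj_inc -prj_g g0 compf0 comp0f. Qed.

End Image.
End Zero.

(** The closure properties used throughout. They hold for locally free modules on a scheme and are
    inherited by binary complexes and by objects with automorphisms. The retract property of short
    exact sequences is what makes a retract of an acyclic complex acyclic. *)
Record nice (E : excat) : Prop := Nice {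
  nice_zero : forall Z : E, is_zero Z -> ex_in Z;
  nice_retract : forall A B : E, ex_in B -> retract A B -> ex_in A;
  nice_bip : forall (I : finType) (A : I -> E), (forall i, ex_in (A i)) -> ex_in (bip A);
  nice_split : forall (A B D : E) (f : chom A B) (g : chom B D) (p : chom B A)
    (s : chom D B), p \oc f = cid1 A -> g \oc s = cid1 D -> g \oc f = 0 ->
    f \oc p + s \oc g = cid1 B -> ex_ses f g;
  nice_ker : forall (A B D : E) (f : chom A B) (g : chom B D), ex_ses f g ->
    [/\ g \oc f = 0,
        forall Y (h : chom Y B), g \oc h = 0 -> exists k, f \oc k = h
      & forall Y (u v : chom Y A), f \oc u = f \oc v -> u = v];
  nice_ses_retract : forall (A B D A' B' D' : E) (f : chom A B) (g : chom B D)
    (f' : chom A' B') (g' : chom B' D') (sA : chom A' A) (sB : chom B' B)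
    (sD : chom D' D) (pA : chom A A') (pB : chom B B') (pD : chom D D'),
    pA \oc sA = cid1 A' -> pB \oc sB = cid1 B' -> pD \oc sD = cid1 D' ->
    f \oc sA = sB \oc f' -> g \oc sB = sD \oc g' ->
    f' \oc pA = pB \oc f -> g' \oc pB = pD \oc g -> ex_ses f g -> ex_ses f' g';
  nice_ses_bip : forall (I : finType) (A B D : I -> E) (f : forall i, chom (A i) (B i))
    (g : forall i, chom (B i) (D i)), (forall i, ex_ses (f i) (g i)) ->
    ex_ses (bmap f) (bmap g) }.

Lemma nice_proper (E : excat) : nice E -> ex_proper E.
Proof.
move=> nE; split; first exact: nice_zero nE.
move=> Z B D f g Z0 [h [hg gh]].
apply: (nice_split nE (p := 0) (s := h)) => //.
- by rewrite comp0f Z0.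
- by rewrite (zero_from f) // compf0.
- by rewrite compf0 add0r.
Qed.

Lemma nice_iso (E : excat) (A B : E) (f : chom A B) :
  nice E -> is_iso f -> ex_in A -> ex_in B.
Proof.
move=> nE [g [gf fg]] A_in; apply: (nice_retract nE A_in).
by exists g, f.
Qed.

Section AcyclicTheory.
Variables (E : excat) (nE : nice E).

Lemma bhom_iso (P Q : bcx E) (f : bhom P Q) :
  (forall k, is_iso (f k)) -> @is_iso (bcx_cat E) P Q f.
Proof.
move=> fi; pose h k := projT1 (cid (fi k)).
have hf k : h k \oc f k = cid1 _ by rewrite /h; case: (cid _) => ? [].
have fh k : f k \oc h k = cid1 _ by rewrite /h; case: (cid _) => ? [].
have hd k : h k \oc bd Q k = bd P k \oc h k.+1.
  by symmetry; apply: iso_square (fh k.+1) (hf k) _; rewrite bh_d.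
have ht k : h k \oc bt Q k = bt P k \oc h k.+1.
  by symmetry; apply: iso_square (fh k.+1) (hf k) _; rewrite bh_t.
by exists (BHom hd ht : @chom (bcx_cat E) Q P); split; apply: bhomP => k.
Qed.

Lemma iso_bh (P Q : bcx_acat E) (f : chom P Q) :
  is_iso f -> forall k, is_iso (bh f k).
Proof.
case=> g [gf fg] k; exists (bh g k); split.
- exact: (congr1 (fun h : bhom P P => h k) gf).
- exact: (congr1 (fun h : bhom Q Q => h k) fg).
Qed.

(** The idempotent [s k \oc p k] of the acyclic complex induces an idempotent [z k] on its cycles;
    the images of the [z k] are the cycles of the retract. *)
Lemma acyclic_retract (P Q : nat -> E) (dP : forall k, chom (P k.+1) (P k))
    (dQ : forall k, chom (Q k.+1) (Q k)) (s : forall k, chom (P k) (Q k))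
    (p : forall k, chom (Q k) (P k)) :
  (forall k, p k \oc s k = cid1 _) -> (forall k, s k \oc dP k = dQ k \oc s k.+1) ->
  (forall k, p k \oc dQ k = dP k \oc p k.+1) ->
  acyclic (E := E) dQ -> acyclic (E := E) dP.
Proof.
move=> ps sd pd [Z [i [q [Z_in dE i0 ses]]]].
have mono k Y (u v : chom Y (Z k)) : i k \oc u = i k \oc v -> u = v.
  case: k u v => [|k] u v e; last by have [_ _] := nice_ker nE (ses k); apply.
  by case: i0 => j [ji _]; rewrite -(ccomp1f u) -(ccomp1f v) -ji -!ccompA e.
have [e eE] : exists e : forall k, chom (Q k) (Q k), forall k, e k = s k \oc p k.
  by exists (fun k => s k \oc p k).
have ed k : e k \oc dQ k = dQ k \oc e k.+1.
  by rewrite !eE -ccompA pd !ccompA sd.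
(* For positive degrees [i] is a kernel of [q] one degree below, and that map kills [e \oc i] since
   [e] commutes with the differential; in degree 0 the map [i] is invertible. *)
have lift k : exists z : chom (Z k) (Z k), i k \oc z = e k \oc i k.
  case: k => [|k].
    case: i0 => j [ji ij]; exists (j \oc (e 0%N \oc i 0%N)).
    by rewrite ccompA ij ccomp1f.
  have [gf ke _] := nice_ker nE (ses k).
  have [|z zE] := ke _ (e k.+1 \oc i k.+1); last by exists z.
  by apply: mono; rewrite compf0 !ccompA -dE -ed dE -!ccompA gf !compf0.
have [z zE] : exists z : forall k, chom (Z k) (Z k), forall k, i k \oc z k = e k \oc i k.
  by exists (fun k => projT1 (cid (lift k))) => k; case: (cid _).
have ee k : e k \oc e k = e k.
  by rewrite !eE ccompA (comp_eqr (ps k)) ccompf1.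
have zz k : z k \oc z k = z k.
  by apply: mono; rewrite ccompA zE (comp_eqr (zE k)) ccompA ee.
have qe k : q k \oc e k.+1 = z k \oc q k.
  by apply: mono; rewrite !ccompA -dE -ed zE (comp_eqr (esym (dE k))).
exists (fun k => im (z k)), (fun k => p k \oc i k \oc inc (z k)),
  (fun k => prj (zz k) \oc q k \oc s k.+1); split.
- by move=> k; apply: nice_retract nE _ _ (Z_in k) _; exists (inc (z k)), (prj (zz k)); apply: prj_inc.
- move=> k; rewrite !ccompA (comp_eqr (inc_prj (zz k))) (comp_eqr (zE k)) !ccompA.
  rewrite eE !ccompA ps ccomp1f (comp_eqr (esym (dE k))) pd.
  by rewrite (comp_eqr (ps k.+1)) ccompf1.
- case: i0 => j [ji ij]; exists (prj (zz 0%N) \oc j \oc s 0%N); split.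
    rewrite !ccompA (comp_eqr (erefl (s 0%N \oc p 0%N))) -eE (comp_eqr (esym (zE 0%N))).
    by rewrite !ccompA (comp_eqr ji) ccompf1 prj_g prj_inc.
  rewrite !ccompA (comp_eqr (inc_prj (zz 0%N))) (comp_eqr (zE 0%N)) !ccompA.
  by rewrite (comp_eqr ij) ccompf1 eE !ccompA ps ccomp1f ps.
- move=> k.
  apply: (nice_ses_retract nE (sA := inc (z k.+1)) (sB := s k.+1) (sD := inc (z k))
    (pA := prj (zz k.+1)) (pB := p k.+1) (pD := prj (zz k)) _ _ _ _ _ _ _ (ses k)).
  + exact: prj_inc.
  + exact: ps.
  + exact: prj_inc.
  + by rewrite !ccompA -eE -zE -ccompA g_inc.
  + rewrite !ccompA inc_prj -qe eE !ccompA.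
    by rewrite (comp_eqr (ps _)) ccompf1.
  + rewrite -ccompA inc_prj (comp_eqr (zE _)) eE !ccompA ps ccomp1f.
    by [].
  + rewrite (comp_eqr (erefl (s k.+1 \oc p k.+1))) -eE (comp_eqr (qe _)) ccompA.
    by rewrite prj_g.
Qed.

Lemma acyclic_bip (I : finType) (P : I -> nat -> E)
    (d : forall i k, chom (P i k.+1) (P i k)) :
  (forall i, acyclic (E := E) (d i)) ->
  acyclic (E := E) (P := fun k => bip (fun i => P i k)) (fun k => bmap (fun i => d i k)).
Proof.
move=> acy; pose Z i := projT1 (cid (acy i)).
have acy1 i : exists (j : forall k, chom (Z i k) (P i k)) (q : forall k, chom (P i k.+1) (Z i k)),
    [/\ forall k, ex_in (Z i k), forall k, d i k = j k \oc q k, is_iso (j 0%N)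
      & forall k, ex_ses (j k.+1) (q k)] by rewrite /Z; case: (cid _).
pose j i := projT1 (cid (acy1 i)).
have acy2 i : exists (q : forall k, chom (P i k.+1) (Z i k)),
    [/\ forall k, ex_in (Z i k), forall k, d i k = j i k \oc q k, is_iso (j i 0%N)
      & forall k, ex_ses (j i k.+1) (q k)] by rewrite /j; case: (cid _).
pose q i := projT1 (cid (acy2 i)).
have acy3 i : [/\ forall k, ex_in (Z i k), forall k, d i k = j i k \oc q i k, is_iso (j i 0%N)
      & forall k, ex_ses (j i k.+1) (q i k)] by rewrite /q; case: (cid _).
exists (fun k => bip (fun i => Z i k)), (fun k => bmap (fun i => j i k)),
  (fun k => bmap (fun i => q i k)); split.
- by move=> k; apply: nice_bip nE _ _ _ => i; case: (acy3 i).
- by move=> k; rewrite -bmapM; apply: bmap_eq => i; case: (acy3 i).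
- by apply: bmap_iso => i; case: (acy3 i).
- by move=> k; apply: nice_ses_bip nE _ _ _ _ _ _ _ => i; case: (acy3 i).
Qed.

Lemma Bq_nice : nice (Bq E).
Proof.
split.
- exact: (Bq_proper (nice_proper nE)).1.
- move=> P Q [Q_in [N Q0] aQ tQ] [s [p ps]].
  have psk k : bh p k \oc bh s k = cid1 (gr P k).
    exact: (congr1 (fun h : bhom P P => h k) ps).
  split.
  + by move=> k; apply: nice_retract nE _ _ (Q_in k) _; exists (bh s k), (bh p k).
  + exists N => k Nk; apply: zero_retract (Q0 k Nk).
    by exists (bh s k), (bh p k).
  + by apply: acyclic_retract psk _ _ aQ => k; rewrite bh_d.
  + by apply: acyclic_retract psk _ _ tQ => k; rewrite bh_t.
- move=> I A A_in; split.
  + by move=> k; apply: nice_bip nE _ _ _ => i; case: (A_in i).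
  + have A0 i : exists N, forall k, (N <= k)%N -> is_zero (gr (A i) k) by case: (A_in i).
    exists (\max_i projT1 (cid (A0 i))) => k Nk; apply: bip_zero => i.
    case: (cid (A0 i)) (leq_bigmax (F := fun i => projT1 (cid (A0 i))) i) => N /= AN.
    by move=> iN; apply: AN; apply: leq_trans Nk.
  + by apply: (acyclic_bip (d := fun i => @bd _ (A i))) => i; case: (A_in i).
  + by apply: (acyclic_bip (d := fun i => @bt _ (A i))) => i; case: (A_in i).
- move=> A B D f g p s pf gs gf fpsg k.
  apply: (nice_split nE (p := bh p k) (s := bh s k)).
  + exact: (congr1 (fun h : bhom A A => h k) pf).
  + exact: (congr1 (fun h : bhom D D => h k) gs).
  + exact: (congr1 (fun h : bhom A D => h k) gf).
  + exact: (congr1 (fun h : bhom B B => h k) fpsg).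
- move=> A B D f g ses; split.
  + by apply: bhomP => k; have [] := nice_ker nE (ses k).
  + move=> Y h gh.
    have lift k : exists u, bh f k \oc u = bh h k.
      have [_ + _] := nice_ker nE (ses k); apply.
      exact: (congr1 (fun h : bhom Y D => h k) gh).
    pose u k := projT1 (cid (lift k)).
    have uE k : bh f k \oc u k = bh h k by rewrite /u; case: (cid _).
    have mono k : forall Y (u v : chom Y (gr A k)), bh f k \oc u = bh f k \oc v -> u = v.
      by have [] := nice_ker nE (ses k).
    have ud k : u k \oc bd Y k = bd A k \oc u k.+1.
      by apply: mono; rewrite !ccompA uE bh_d bh_d (comp_eqr (uE _)).
    have ut k : u k \oc bt Y k = bt A k \oc u k.+1.
      by apply: mono; rewrite !ccompA uE bh_t bh_t (comp_eqr (uE _)).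
    by exists (BHom ud ut : @chom (bcx_cat E) Y A); apply: bhomP.
  + move=> Y u v fuv; apply: bhomP => k.
    have [_ _] := nice_ker nE (ses k); apply.
    exact: (congr1 (fun h : bhom Y B => h k) fuv).
- move=> A B D A' B' D' f g f' g' sA sB sD pA pB pD eA eB eD e1 e2 e3 e4 ses k.
  apply: (nice_ses_retract nE (sA := bh sA k) (sB := bh sB k) (sD := bh sD k)
    (pA := bh pA k) (pB := bh pB k) (pD := bh pD k) _ _ _ _ _ _ _ (ses k)).
  + exact: (congr1 (fun h : bhom _ _ => h k) eA).
  + exact: (congr1 (fun h : bhom _ _ => h k) eB).
  + exact: (congr1 (fun h : bhom _ _ => h k) eD).
  + exact: (congr1 (fun h : bhom _ _ => h k) e1).
  + exact: (congr1 (fun h : bhom _ _ => h k) e2).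
  + exact: (congr1 (fun h : bhom _ _ => h k) e3).
  + exact: (congr1 (fun h : bhom _ _ => h k) e4).
- move=> I A B D f g ses k.
  have bmk (U V : I -> bcx E) (h : forall i, bhom (U i) (V i)) :
      bh (@bmap (bcx_acat E) I U V h) k = bmap (fun i => h i k).
    by rewrite /bmap bh_sum.
  rewrite !bmk; apply: nice_ses_bip nE _ _ _ _ _ _ _ => i; exact: ses.
Qed.

End AcyclicTheory.

Lemma Bn_nice (E : excat) n : nice E -> nice (Bn E n).
Proof. by move=> nE; elim: n => //= n; apply: Bq_nice. Qed.

(** * Objects with commuting automorphisms *)

Section AutObjects.
Variable C : category.

(* An object with commuting automorphisms. The family of automorphisms is infinite so
   that it can be shifted when its first member is turned into a differential; in the
   applications all but finitely many of them are the identity. *)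
Record aobj := AObj {
  aob :> C;
  act : nat -> chom aob aob;
  actC : forall i j, act i \oc act j = act j \oc act i;
  act_iso : forall i, is_iso (act i) }.

Record ahom (V W : aobj) := AHom {
  ahf :> chom V W;
  ahP : forall i, ahf \oc act V i = act W i \oc ahf }.

Lemma ahomP (V W : aobj) (f g : ahom V W) : f = g :> chom V W -> f = g.
Proof.
case: f g => [f fP] [g gP] /= e; rewrite -{}e in gP *.
by congr AHom; apply: Prop_irrelevance.
Qed.

Definition ahom1 (V : aobj) : ahom V V.
Proof. by exists (cid1 _) => i; rewrite ccomp1f ccompf1. Defined.

Definition ahomM (V W Z : aobj) (g : ahom W Z) (f : ahom V W) : ahom V Z.
Proof. by exists (g \oc f) => i; rewrite -ccompA ahP !ccompA ahP. Defined.

Definition aq_cat : category.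
Proof.
refine (@Category aobj ahom ahom1 ahomM _ _ _) => *; apply: ahomP => /=.
- exact: ccompA.
- exact: ccomp1f.
- exact: ccompf1.
Defined.

Lemma ahom_iso (V W : aq_cat) (f : chom V W) : is_iso (ahf f) -> is_iso f.
Proof.
case=> g [gf fg].
have gP i : g \oc act W i = act V i \oc g.
  by symmetry; apply: iso_square fg gf _; rewrite ahP.
by exists (AHom gP : @chom aq_cat W V); split; apply: ahomP.
Qed.

Lemma iso_ahf (V W : aq_cat) (f : chom V W) : is_iso f -> is_iso (ahf f).
Proof.
case=> g [gf fg]; exists (ahf g); split.
- exact: (congr1 (@ahf _ _) gf).
- exact: (congr1 (@ahf _ _) fg).
Qed.

(** The first automorphism is split off as an endomorphism [ahead] of the object that keeps the
    others, so that it can serve as a differential; [acons] is the inverse operation. *)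
Definition atail (W : aobj) : aobj :=
  @AObj W (fun i => act W i.+1) (fun i j => actC W _ _) (fun i => act_iso W _).

Definition ahead (W : aobj) : ahom (atail W) (atail W) :=
  @AHom (atail W) (atail W) (act W 0) (fun i => actC W _ _).

Lemma ahead_iso (W : aobj) : @is_iso aq_cat (atail W) (atail W) (ahead W).
Proof. by apply: ahom_iso; exact: (act_iso W 0%N). Qed.

Section Cons.
Variables (W : aobj) (a : ahom W W).
Hypothesis a_iso : @is_iso aq_cat W W a.

Definition acons_act (i : nat) : chom W W := if i is j.+1 then act W j else a.

Fact acons_actC i j : acons_act i \oc acons_act j = acons_act j \oc acons_act i.
Proof.
by case: i j => [|i] [|j] //=; [exact: ahP | symmetry; exact: ahP | exact: actC].
Qed.

Fact acons_act_iso i : is_iso (acons_act i).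
Proof. by case: i => [|i]; [exact: iso_ahf a_iso | exact: act_iso]. Qed.

Definition acons : aobj := AObj acons_actC acons_act_iso.

End Cons.
End AutObjects.

Arguments act {C}.

Section AutFunctor.
Variables (C D : category) (F : functor C D).

Definition aqF_ob (W : aobj C) : aobj D.
Proof.
exists (F W) (fun i => fmap F (act W i)) => [i j|i]; first by rewrite -!fmapM actC.
by apply: functor_iso; apply: act_iso.
Defined.

Definition aqF_map (V W : aobj C) (f : ahom V W) : ahom (aqF_ob V) (aqF_ob W).
Proof. by exists (fmap F f) => i /=; rewrite -!fmapM ahP. Defined.

Definition aqF : functor (aq_cat C) (aq_cat D).
Proof.
refine (@Functor (aq_cat C) (aq_cat D) aqF_ob aqF_map _ _) => *; apply: ahomP => /=.
- exact: fmap1.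
- exact: fmapM.
Defined.

End AutFunctor.

Section AutAdditive.
Variable C : acat.

Definition ahom0 (V W : aobj C) : ahom V W.
Proof. by exists 0 => i; rewrite comp0f compf0. Defined.

Definition ahomN (V W : aobj C) (f : ahom V W) : ahom V W.
Proof. by exists (- (f : chom V W)) => i; rewrite compNf compfN ahP. Defined.

Definition ahomD (V W : aobj C) (f g : ahom V W) : ahom V W.
Proof. by exists ((f : chom V W) + (g : chom V W)) => i; rewrite compDl compDr !ahP. Defined.

Definition aq_pacat : pacat.
Proof.
refine (@PACat (aq_cat C) ahom0 ahomN ahomD _ _ _ _ _ _).
- by move=> P Q f g h; apply: ahomP; rewrite /= addrA.
- by move=> P Q f g; apply: ahomP; rewrite /= addrC.
- by move=> P Q f; apply: ahomP; rewrite /= add0r.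
- by move=> P Q f; apply: ahomP; rewrite /= addNr.
- by move=> P Q R g h f; apply: ahomP; rewrite /= compDl.
- by move=> P Q R g f h; apply: ahomP; rewrite /= compDr.
Defined.

Lemma ahf_sum (V W : aq_pacat) (I : finType) (P : pred I) (f : I -> chom V W) :
  ahf (\sum_(i | P i) f i) = \sum_(i | P i) ahf (f i).
Proof. exact: (big_morph (fun f : chom V W => ahf f)). Qed.

Definition aq_bip (I : finType) (W : I -> aobj C) : aobj C.
Proof.
exists (bip (fun i => aob (W i))) (fun j => bmap (fun i => act (W i) j)) => [j k|j].
  by rewrite -!bmapM; apply: bmap_eq => i; apply: actC.
by apply: bmap_iso => i; apply: act_iso.
Defined.

Definition aq_bin (I : finType) (W : I -> aobj C) i : ahom (W i) (aq_bip W).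
Proof. by exists (bin (fun i => aob (W i)) i) => j; rewrite /= bmap_bin. Defined.

Definition aq_bpr (I : finType) (W : I -> aobj C) i : ahom (aq_bip W) (W i).
Proof. by exists (bpr (fun i => aob (W i)) i) => j; rewrite /= bpr_bmap. Defined.

Section Kernel.
Variables (V W : aobj C) (f : ahom V W).

Fact aq_ker_subproof i : f \oc (act V i \oc kin f) = 0.
Proof. by rewrite ccompA ahP -ccompA kin0 compf0. Qed.

Definition aq_ker : aobj C.
Proof.
exists (ker f) (fun i => klift (aq_ker_subproof i)) => [i j|i].
  apply: kin_mono.
  by rewrite !ccompA !kliftK -!ccompA !kliftK !ccompA actC.
have [b [bA Ab]] := act_iso V i.
have fb0 : f \oc (b \oc kin f) = 0.
  have [c [cA _]] := act_iso W i.
  by rewrite ccompA (iso_square Ab cA (ahP f i)) -ccompA kin0 compf0.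
exists (klift fb0); split; apply: kin_mono;
  by rewrite !ccompA kliftK -ccompA kliftK ccompA ?bA ?Ab ccomp1f ccompf1.
Defined.

Definition aq_kin : ahom aq_ker V.
Proof. by exists (kin f) => i; rewrite /= kliftK. Defined.

Definition aq_klift (D : aobj C) (g : ahom D V) (fg : ahomM f g = ahom0 D W) : ahom D aq_ker.
Proof.
exists (klift (congr1 (@ahf _ _ _) fg)) => i; apply: kin_mono.
by rewrite /= !ccompA !kliftK -ccompA kliftK ahP.
Defined.

End Kernel.

Definition aq_acat : acat.
Proof.
refine (@ACat aq_pacat aq_bip aq_bin aq_bpr _ _ _ aq_ker aq_kin _ aq_klift _ _).
- by move=> I A i; apply: ahomP; rewrite /= bpr_bin.
- by move=> I A i j ij; apply: ahomP; rewrite /= bpr_bin0.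
- by move=> I A; apply: ahomP; rewrite ahf_sum /= bin_bpr.
- by move=> A B f; apply: ahomP; rewrite /= kin0.
- by move=> A B f D g fg; apply: ahomP; rewrite /= kliftK.
- move=> A B f D u v uv; apply: ahomP; apply: kin_mono.
  exact: (congr1 (@ahf _ _ _) uv).
Defined.

Lemma ahf_bmap (I : finType) (V W : I -> aq_acat) (f : forall i, chom (V i) (W i)) :
  ahf (bmap f) = bmap (fun i => ahf (f i)).
Proof. by rewrite /bmap ahf_sum. Qed.

Lemma ahf_bmx (I J : finType) (V : I -> aq_acat) (W : J -> aq_acat)
    (M : forall i j, chom (V i) (W j)) :
  ahf (bmx M) = bmx (fun i j => ahf (M i j)).
Proof. by rewrite /bmx ahf_sum; apply: eq_bigr => i _; rewrite ahf_sum. Qed.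

End AutAdditive.

Definition Aq (E : excat) : excat := {|
  ex_cat := aq_acat E;
  ex_in := fun W : aobj E => ex_in (aob W);
  ex_ses := fun (U V W : aobj E) (f : ahom U V) (g : ahom V W) => ex_ses (ahf f) (ahf g) |}.

Lemma Aq_nice (E : excat) : nice E -> nice (Aq E).
Proof.
move=> nE; split.
- move=> Z Z0; apply: nice_zero nE _ _; exact: (congr1 (@ahf _ _ _) Z0).
- move=> A B B_in [s [p ps]]; apply: nice_retract nE _ _ B_in _.
  exists (ahf s), (ahf p); exact: (congr1 (@ahf _ _ _) ps).
- by move=> I A A_in; apply: nice_bip nE _ _ _.
- move=> A B D f g p s pf gs gf e; apply: (nice_split nE (p := ahf p) (s := ahf s)).
  + exact: (congr1 (@ahf _ _ _) pf).
  + exact: (congr1 (@ahf _ _ _) gs).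
  + exact: (congr1 (@ahf _ _ _) gf).
  + exact: (congr1 (@ahf _ _ _) e).
- move=> A B D f g ses; have [gf fe mono] := nice_ker nE ses; split.
  + exact: ahomP.
  + move=> Y h gh; have [k kE] := fe _ _ (congr1 (@ahf _ _ _) gh).
    have kP i : k \oc act Y i = act A i \oc k.
      by apply: mono; rewrite !ccompA kE !ahP (comp_eqr kE).
    by exists (AHom kP : @chom (aq_cat E) Y A); apply: ahomP.
  + by move=> Y u v uv; apply: ahomP; apply: mono; exact: (congr1 (@ahf _ _ _) uv).
- move=> A B D A' B' D' f g f' g' sA sB sD pA pB pD eA eB eD e1 e2 e3 e4 ses.
  apply: (nice_ses_retract nE (sA := ahf sA) (sB := ahf sB) (sD := ahf sD)
    (pA := ahf pA) (pB := ahf pB) (pD := ahf pD) _ _ _ _ _ _ _ ses).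
  + exact: (congr1 (@ahf _ _ _) eA).
  + exact: (congr1 (@ahf _ _ _) eB).
  + exact: (congr1 (@ahf _ _ _) eD).
  + exact: (congr1 (@ahf _ _ _) e1).
  + exact: (congr1 (@ahf _ _ _) e2).
  + exact: (congr1 (@ahf _ _ _) e3).
  + exact: (congr1 (@ahf _ _ _) e4).
- move=> I A B D f g ses; rewrite /= !ahf_bmap.
  by apply: nice_ses_bip nE _ _ _ _ _ _ _ => i; apply: ses.
Qed.

(* zeta and xi interchange binary complexes of objects with automorphisms and binary
   complexes with automorphisms. *)
Section Interchange.
Variable C : acat.

Definition zeta_act (P : bcx (aq_acat C)) (j : nat) :
  @bhom C (@BCx C (fun k => aob (P k)) (fun k => ahf (bd P k)) (fun k => ahf (bt P k))
    (fun k => congr1 (@ahf _ _ _) (bd2 P k)) (fun k => congr1 (@ahf _ _ _) (bt2 P k)))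
   (@BCx C (fun k => aob (P k)) (fun k => ahf (bd P k)) (fun k => ahf (bt P k))
    (fun k => congr1 (@ahf _ _ _) (bd2 P k)) (fun k => congr1 (@ahf _ _ _) (bt2 P k))).
Proof. by exists (fun k => act (P k) j) => k; rewrite /= ahP. Defined.

Definition zeta (P : bcx (aq_acat C)) : aobj (bcx_acat C).
Proof.
exists (@BCx C (fun k => aob (P k)) (fun k => ahf (bd P k)) (fun k => ahf (bt P k))
    (fun k => congr1 (@ahf _ _ _) (bd2 P k)) (fun k => congr1 (@ahf _ _ _) (bt2 P k)))
  (@zeta_act P) => [i j|i]; first by apply: bhomP => k; apply: actC.
(* Being an isomorphism does not involve the exact structure, so the trivial one is supplied. *)
by apply: (@bhom_iso (@ExCat C (fun=> True) (fun _ _ _ _ _ => True))) => k; apply: act_iso.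
Defined.

Definition xi_gr (W : aobj (bcx_acat C)) (k : nat) : aobj C.
Proof.
exists (gr (aob W) k) (fun i => bh (act W i) k) => [i j|i].
  exact: (congr1 (fun f : bhom (aob W) (aob W) => f k) (actC W i j)).
exact: (@iso_bh (@ExCat C (fun=> True) (fun _ _ _ _ _ => True))) (act_iso W i) k.
Defined.

Definition xi (W : aobj (bcx_acat C)) : bcx (aq_acat C).
Proof.
unshelve refine (@BCx (aq_acat C) (xi_gr W) _ _ _ _).
- by move=> k; exists (bd (aob W) k) => i /=; rewrite bh_d.
- by move=> k; exists (bt (aob W) k) => i /=; rewrite bh_t.
- by move=> k; apply: ahomP; apply: bd2.
- by move=> k; apply: ahomP; apply: bt2.
Defined.

End Interchange.

(** * Additive invariants with values in an abelian group *)

Section Additive.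
Variables (X : excat) (dg : X -> Prop) (G : abgroup) (chi : X -> G).

(** The predicate [dg] is a parameter because the vanishing condition changes when an invariant is
    pulled back along [zeta] or [two_aut]. *)
Definition additive_inv : Prop :=
  (forall (A B D : X) (f : chom A B) (g : chom B D), ex_in A -> ex_in B -> ex_in D ->
    ex_ses f g -> chi B = abD (chi A) (chi D)) /\
  (forall A : X, ex_in A -> dg A -> chi A = ab0).

End Additive.

Section AbGroup.
Variable G : abgroup.
Implicit Types x y z : G.

Lemma abD0 x : abD x ab0 = x.
Proof. by rewrite abDC ab0D. Qed.

Lemma abDN x : abD x (abN x) = ab0.
Proof. by rewrite abDC abND. Qed.

Lemma abDKl x y : abD (abN x) (abD x y) = y.
Proof. by rewrite abDA abND ab0D. Qed.

Lemma abDI x y z : abD x y = abD x z -> y = z.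
Proof. by move=> e; rewrite -(abDKl x y) e abDKl. Qed.

Lemma abN_uniq x y : abD x y = ab0 -> y = abN x.
Proof. by move=> e; apply: (@abDI x); rewrite abDN. Qed.

Lemma abN0 : abN ab0 = ab0 :> G.
Proof. by symmetry; apply: abN_uniq; rewrite ab0D. Qed.

Lemma abNN x : abN (abN x) = x.
Proof. by symmetry; apply: abN_uniq; rewrite abND. Qed.

Lemma abDACA x y z t : abD (abD x y) (abD z t) = abD (abD x z) (abD y t).
Proof. by rewrite -!abDA [abD y (abD z t)]abDA [abD y z]abDC -abDA. Qed.

Lemma abND_distr x y : abN (abD x y) = abD (abN x) (abN y).
Proof. by symmetry; apply: abN_uniq; rewrite abDACA !abDN ab0D. Qed.

End AbGroup.

Section AdditiveTheory.
Variables (X : excat) (nX : nice X) (dg : X -> Prop) (G : abgroup) (chi : X -> G).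
Hypothesis chiA : additive_inv dg chi.

Lemma chi_zero (A : X) : is_zero A -> chi A = ab0.
Proof.
move=> A0; have A_in := nice_zero nX A0.
have ses : @ex_ses X A A A 0 (cid1 A).
  by apply: (nice_proper nX).2 => //; apply: is_iso1.
have e := chiA.1 _ _ _ _ _ A_in A_in A_in ses.
by apply: (@abDI _ (chi A)); rewrite -e abD0.
Qed.

Lemma chi_iso (A B : X) (f : chom A B) : is_iso f -> ex_in A -> chi A = chi B.
Proof.
move=> fi A_in; have B_in := nice_iso nX fi A_in.
have Z0 := zob_zero X.
have ses : @ex_ses X (zob X) A B 0 f by apply: (nice_proper nX).2.
have Z_in := nice_zero nX Z0.
by rewrite (chiA.1 _ _ _ _ _ Z_in A_in B_in ses) (chi_zero Z0) ab0D.
Qed.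

Lemma chi_split (A B D : X) (f : chom A B) (g : chom B D) (p : chom B A) (s : chom D B) :
  p \oc f = cid1 A -> g \oc s = cid1 D -> g \oc f = 0 -> f \oc p + s \oc g = cid1 B ->
  ex_in B -> chi B = abD (chi A) (chi D).
Proof.
move=> pf gs gf e B_in; apply: (chiA.1 _ _ _ f g) => //.
- by apply: nice_retract nX _ _ B_in _; exists f, p.
- by apply: nice_retract nX _ _ B_in _; exists s, g.
- exact: nice_split nX _ _ _ _ _ _ _ pf gs gf e.
Qed.

End AdditiveTheory.

(** * Subquotients of binary complexes *)

Section Contractible.
Variables (E : excat) (nE : nice E) (P : nat -> E) (d : forall k, chom (P k.+1) (P k)).
Variable h : forall k, chom (P k) (P k.+1).
Hypotheses (P_in : forall k, ex_in (P k)) (d2 : forall k, d k \oc d k.+1 = 0).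
Hypotheses (dh0 : d 0 \oc h 0 = cid1 _)
  (dh : forall k, d k.+1 \oc h k.+1 + h k \oc d k = cid1 _).

Lemma contraction_dhd k : d k \oc h k \oc d k = d k.
Proof.
case: k => [|k]; first by rewrite dh0 ccomp1f.
have -> : d k.+1 \oc h k.+1 = cid1 _ - h k \oc d k by rewrite -(dh k) addrK.
by rewrite compDl ccomp1f compNf -ccompA d2 compf0 subr0.
Qed.

Definition cyc (k : nat) : E := if k is k'.+1 then ker (d k') else P 0.

Definition cyc_in (k : nat) : chom (cyc k) (P k) :=
  if k is k'.+1 return chom (cyc k) (P k) then kin (d k') else cid1 _.

Definition cyc_pr (k : nat) : chom (P k.+1) (cyc k) :=
  if k is k'.+1 return chom (P k.+1) (cyc k) then klift (d2 k') else d 0.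

Lemma cyc_inpr k : cyc_in k \oc cyc_pr k = d k.
Proof. by case: k => [|k]; rewrite /= ?ccomp1f ?kliftK. Qed.

Lemma cyc_mono k Y (u v : chom Y (cyc k)) : cyc_in k \oc u = cyc_in k \oc v -> u = v.
Proof. by case: k u v => [|k] u v /=; [rewrite !ccomp1f | exact: kin_mono]. Qed.

Lemma cyc_dh k : d k \oc h k \oc cyc_in k = cyc_in k.
Proof.
case: k => [|k] /=; first by rewrite dh0 ccomp1f.
have -> : d k.+1 \oc h k.+1 = cid1 _ - h k \oc d k by rewrite -(dh k) addrK.
by rewrite compDl ccomp1f compNf -ccompA kin0 compf0 subr0.
Qed.

Fact cyc_retr_subproof k : d k \oc (cid1 _ - h k \oc d k) = 0.
Proof. by rewrite compDr ccompf1 compfN ccompA contraction_dhd subrr. Qed.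

(** The map [1 - h d] projects onto the cycles, and [h] restricted to the cycles is a section of the
    next map onto cycles; so all sequences of cycles split. *)
Lemma contractible_acyclic : acyclic (E := E) d.
Proof.
exists cyc, cyc_in, cyc_pr; split.
- case=> [|k]; first exact: P_in.
  apply: nice_retract nE _ _ (P_in k.+1) _; exists (kin (d k)), (klift (cyc_retr_subproof k)).
  apply: kin_mono; rewrite ccompA kliftK compDl compNf -ccompA kin0 compf0 subr0.
  by rewrite ccomp1f ccompf1.
- by move=> k; rewrite cyc_inpr.
- exact: is_iso1.
- move=> k; apply: (nice_split nE (p := klift (cyc_retr_subproof k)) (s := h k \oc cyc_in k)).
  + apply: kin_mono; rewrite ccompA kliftK compDl compNf -ccompA kin0 compf0 subr0.
    by rewrite ccomp1f ccompf1.
  + by apply: cyc_mono; rewrite !ccompA cyc_inpr cyc_dh ccompf1.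
  + by apply: cyc_mono; rewrite ccompA cyc_inpr kin0 compf0.
  + by rewrite kliftK -ccompA cyc_inpr subrK.
Qed.

End Contractible.

(* The subquotient of a binary "complex" cut out by a family g of idempotents *)
Section Subquotient.
Variables (C : acat) (X : nat -> C) (d t : forall k, chom (X k.+1) (X k)).

(** The compression [g d g] squares to zero, while [d] itself need not: the zeroth face map of a
    simplicial object squares to zero on the normalised part. Compressing one fixed [d] by varying
    idempotents makes every step of a filtration live on the same graded object. *)
Definition subq_d (g : forall k, chom (X k) (X k)) (d : forall k, chom (X k.+1) (X k)) :=
  forall k, g k \oc d k \oc g k.+1 \oc d k.+1 \oc g k.+2 = 0.

Definition contr (g : forall k, chom (X k) (X k)) (d : forall k, chom (X k.+1) (X k)) :=
  exists h : forall k, chom (X k) (X k.+1),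
    [/\ forall k, g k.+1 \oc h k \oc g k = h k,
        g 0 \oc d 0 \oc h 0 = g 0
      & forall k, g k.+1 \oc d k.+1 \oc h k.+1 + h k \oc d k \oc g k.+1 = g k.+1].

Record subq (g : forall k, chom (X k) (X k)) : Prop := Subq {
  sq_id : forall k, g k \oc g k = g k;
  sq_d : subq_d g d;
  sq_t : subq_d g t }.

Section Split.
Variables (g : forall k, chom (X k) (X k)) (sg : subq g).

Fact spl_subproof (e : forall k, chom (X k.+1) (X k)) k : subq_d g e ->
  (prj (sq_id sg k) \oc e k \oc inc (g k.+1)) \oc
  (prj (sq_id sg k.+1) \oc e k.+1 \oc inc (g k.+2)) = 0.
Proof.
move=> e0; rewrite !ccompA (comp_eqr (inc_prj _)).
rewrite -(prj_g (sq_id sg k)) -(g_inc (g k.+2)).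
transitivity (prj (sq_id sg k) \oc (g k \oc e k \oc g k.+1 \oc e k.+1 \oc g k.+2) \oc inc (g k.+2)).
  by rewrite !ccompA.
by rewrite e0 compf0 comp0f.
Qed.

Definition spl : bcx C := {|
  gr := fun k => im (g k);
  bd := fun k => prj (sq_id sg k) \oc d k \oc inc (g k.+1);
  bt := fun k => prj (sq_id sg k) \oc t k \oc inc (g k.+1);
  bd2 := fun k => spl_subproof k (sq_d sg);
  bt2 := fun k => spl_subproof k (sq_t sg) |}.

End Split.
End Subquotient.

Section SplTheory.
Variables (E : excat) (nE : nice E).

Section In.
Variables (X : nat -> E) (d t : forall k, chom (X k.+1) (X k)).
Variable g : forall k, chom (X k) (X k).

(** Contractibility is recorded in place of acyclicity since it passes to extensions by a
    formula. *)
Record good : Prop := Good {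
  gd_sq : subq d t g;
  gd_in : forall k, ex_in (X k);
  gd_bd : exists N, forall k, (N <= k)%N -> g k = 0;
  gd_d : contr g d;
  gd_t : contr g t }.

Lemma spl_in (gd : good) : @ex_in (Bq E) (spl (gd_sq gd)).
Proof.
pose gg := sq_id (gd_sq gd).
have Y_in k : ex_in (im (g k)).
  apply: nice_retract nE _ _ (gd_in gd k) _; exists (inc (g k)), (prj (gg k)).
  exact: prj_inc.
have acy (e : forall k, chom (X k.+1) (X k)) : subq_d g e -> contr g e ->
    acyclic (E := E) (fun k => prj (gg k) \oc e k \oc inc (g k.+1)).
  move=> e0 [h [hg h0 hS]].
  pose cj k l (u : chom (X l) (X k)) := prj (gg k) \oc u \oc inc (g l).
  have cjM k l m (u : chom (X l) (X k)) (v : chom (X m) (X l)) :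
      cj _ _ u \oc cj _ _ v = cj _ _ (u \oc g l \oc v).
    by rewrite /cj !ccompA (comp_eqr (inc_prj _)).
  have cjl k l (u : chom (X l) (X k)) : cj _ _ (g k \oc u) = cj _ _ u.
    by rewrite /cj ccompA prj_g.
  have cjr k l (u : chom (X l) (X k)) : cj _ _ (u \oc g l) = cj _ _ u.
    by rewrite /cj -!ccompA g_inc.
  have cj1 k : cj _ _ (g k) = cid1 (im (g k)) by rewrite /cj prj_g prj_inc.
  have hl k : g k.+1 \oc h k = h k by rewrite -hg !ccompA gg.
  have hr k : h k \oc g k = h k by rewrite -hg -!ccompA gg.
  apply: (contractible_acyclic nE (h := fun k => cj _ _ (h k))) => //.
  - by move=> k; exact: (spl_subproof (gd_sq gd) k e0).
  - by rewrite -[X in X \oc _]/(cj _ _ (e 0%N)) cjM -ccompA hl -cjl ccompA h0 cj1.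
  - move=> k; rewrite -[X in X \oc _ + _]/(cj _ _ (e k.+1)) -[X in _ + _ \oc X]/(cj _ _ (e k)).
    rewrite !cjM hr -(ccompA (e _)) hl -cjl -[in X in _ + X]cjr ccompA.
    by rewrite /cj -compDl -compDr hS prj_g prj_inc.
split.
- exact: Y_in.
- have [N gN] := gd_bd gd; exists N => k Nk; exact: im_zero (gg k) (gN k Nk).
- exact: acy (sq_d (gd_sq gd)) (gd_d gd).
- exact: acy (sq_t (gd_sq gd)) (gd_t gd).
Qed.

End In.

Section Extension.
Variables (X : nat -> E) (d t : forall k, chom (X k.+1) (X k)).
Variables g g1 g2 : forall k, chom (X k) (X k).
Hypotheses (gE : forall k, g k = g1 k + g2 k)
  (g12 : forall k, g1 k \oc g2 k = 0) (g21 : forall k, g2 k \oc g1 k = 0)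
  (gg1 : forall k, g1 k \oc g1 k = g1 k) (gg2 : forall k, g2 k \oc g2 k = g2 k).

Lemma g_g1 k : g k \oc g1 k = g1 k.
Proof. by rewrite gE compDl gg1 g21 addr0. Qed.
Lemma g1_g k : g1 k \oc g k = g1 k.
Proof. by rewrite gE compDr gg1 g12 addr0. Qed.
Lemma g_g2 k : g k \oc g2 k = g2 k.
Proof. by rewrite gE compDl gg2 g12 add0r. Qed.
Lemma g2_g k : g2 k \oc g k = g2 k.
Proof. by rewrite gE compDr gg2 g21 add0r. Qed.

(** With [a] the component of [e] from the quotient part [g2] to the sub part [g1], the contractions
    of the two parts combine to [h1 + h2 - h1 a h2]. *)
Lemma contr_ext (e : forall k, chom (X k.+1) (X k)) :
  (forall k, g2 k \oc e k \oc g1 k.+1 = 0) -> subq_d g e ->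
  contr g1 e -> contr g2 e -> contr g e.
Proof.
move=> e21 e0 [h1 [h1g h10 h1S]] [h2 [h2g h20 h2S]].
pose a k := g1 k \oc e k \oc g2 k.+1.
have aE k : a k = g1 k \oc e k \oc g2 k.+1 by [].
clearbody a.
have h1l k : g1 k.+1 \oc h1 k = h1 k by rewrite -h1g !ccompA gg1.
have h1r k : h1 k \oc g1 k = h1 k by rewrite -h1g -!ccompA gg1.
have h2l k : g2 k.+1 \oc h2 k = h2 k by rewrite -h2g !ccompA gg2.
have h2r k : h2 k \oc g2 k = h2 k by rewrite -h2g -!ccompA gg2.
have al k : g1 k \oc a k = a k by rewrite aE !ccompA gg1.
have ar k : a k \oc g2 k.+1 = a k by rewrite aE -!ccompA gg2.
have gdg k : g k \oc e k \oc g k.+1 =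
    g1 k \oc e k \oc g1 k.+1 + a k + g2 k \oc e k \oc g2 k.+1.
  by rewrite !gE !compDr !compDl e21 addr0 aE addrA.
pose H k : chom (X k) (X k.+1) := h1 k + h2 k - h1 k \oc a k \oc h2 k.
have Hl k : g k.+1 \oc H k = H k.
  rewrite /H compDr compfN compDr !ccompA -h1l -h2l !ccompA g_g1 g_g2.
  by rewrite ?g_g1.
have Hr k : H k \oc g k = H k.
  by rewrite /H compDl compNf compDl -h1r -h2r -!ccompA g1_g g2_g.
have gdl k Y (u : chom Y (X k.+1)) : g k \oc e k \oc g k.+1 \oc u =
    g1 k \oc e k \oc g1 k.+1 \oc u + a k \oc u + g2 k \oc e k \oc g2 k.+1 \oc u.
  by rewrite gdg !compDl.
have gdr k Y (u : chom (X k) Y) : u \oc (g k \oc e k \oc g k.+1) =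
    u \oc (g1 k \oc e k \oc g1 k.+1) + u \oc a k + u \oc (g2 k \oc e k \oc g2 k.+1).
  by rewrite gdg !compDr.
have DH k : g k \oc e k \oc H k = g1 k \oc e k \oc h1 k + g2 k \oc e k \oc h2 k +
    (g1 k - g1 k \oc e k \oc h1 k) \oc a k \oc h2 k.
  have z1 : g k \oc e k \oc g k.+1 \oc h1 k = g1 k \oc e k \oc h1 k.
    rewrite gdl -(ccompA _ (g1 _) (h1 _)) h1l -ar -[h1 k in X in _ + X + _]h1l.
    rewrite -[h1 k in X in _ + X]h1l !ccompA.
    by rewrite !(comp_eqr (g21 _)) !compf0 !comp0f !addr0.
  have z2 : g k \oc e k \oc g k.+1 \oc h2 k = a k \oc h2 k + g2 k \oc e k \oc h2 k.
    rewrite gdl -(ccompA _ (g2 _) (h2 _)) h2l -[h2 k in X in X + _ + _]h2l !ccompA.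
    by rewrite (comp_eqr (g12 _)) compf0 comp0f add0r.
  rewrite -Hl !ccompA /H compDr compDr compfN !ccompA z1 z2.
  rewrite compDl compNf compDl compNf al.
  by rewrite [a k \oc h2 k + _]addrC !addrA.
have HD k : H k \oc e k \oc g k.+1 = h1 k \oc e k \oc g1 k.+1 + h2 k \oc e k \oc g2 k.+1 +
    h1 k \oc a k \oc (g2 k.+1 - h2 k \oc e k \oc g2 k.+1).
  have z1 : h1 k \oc (g k \oc e k \oc g k.+1) = h1 k \oc e k \oc g1 k.+1 + h1 k \oc a k.
    rewrite gdr !ccompA h1r -[h1 k in X in _ + _ + X]h1r.
    by rewrite (comp_eqr (g12 _)) compf0 !comp0f addr0.
  have z2 : h2 k \oc (g k \oc e k \oc g k.+1) = h2 k \oc e k \oc g2 k.+1.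
    rewrite gdr !ccompA -[h2 k in X in X + _ + _]h2r (comp_eqr (g21 _)) compf0 !comp0f add0r.
    by rewrite -al -[h2 k in X in X + _]h2r ccompA (comp_eqr (g21 _)) compf0 comp0f add0r h2r.
  have -> : H k \oc e k \oc g k.+1 = H k \oc (g k \oc e k \oc g k.+1) by rewrite -[in LHS]Hr !ccompA.
  rewrite /H compDl compNf compDl -(ccompA (h1 k \oc a k)) z1 z2.
  rewrite [in RHS]compDr compfN -(ccompA (h1 k) (a k) (g2 _)) ar !ccompA.
  by rewrite -!addrA; congr (_ + _); rewrite addrCA.
exists H; split.
- by move=> k; rewrite Hl Hr.
- by rewrite DH h10 h20 subrr !comp0f addr0 gE.
- move=> k; rewrite DH HD.
  have -> : g1 k.+1 - g1 k.+1 \oc e k.+1 \oc h1 k.+1 = h1 k \oc e k \oc g1 k.+1.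
    by rewrite -[X in X - _]h1S addrAC subrr add0r.
  have -> : g2 k.+1 - h2 k \oc e k \oc g2 k.+1 = g2 k.+1 \oc e k.+1 \oc h2 k.+1.
    by rewrite -[X in X - _]h2S addrK.
  (* The two leftover terms cancel by the component of [g e g e g = 0] that leads from [g2] to
     [g1]. *)
  have z : h1 k \oc e k \oc g1 k.+1 \oc a k.+1 \oc h2 k.+1 +
      h1 k \oc a k \oc (g2 k.+1 \oc e k.+1 \oc h2 k.+1) = 0.
    have z' : g1 k \oc (g k \oc e k \oc g k.+1 \oc e k.+1 \oc g k.+2) \oc g2 k.+2 = 0.
      by rewrite e0 compf0 comp0f.
    rewrite !ccompA g1_g -!ccompA g_g2 !ccompA gE compDr !compDl in z'.
    have z'' : h1 k \oc (g1 k \oc e k \oc g1 k.+1 \oc e k.+1 \oc g2 k.+2 +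
      g1 k \oc e k \oc g2 k.+1 \oc e k.+1 \oc g2 k.+2) \oc h2 k.+1 = 0.
      by rewrite z' compf0 comp0f.
    rewrite -[RHS]z'' compDr compDl !aE !ccompA !h1r; congr (_ + _).
      by rewrite (comp_eqr (gg1 _)).
    by rewrite (comp_eqr (gg2 _)) -[in LHS]h2l !ccompA.
  rewrite [RHS]gE -[X in _ = X + _]h1S -[X in _ = _ + X]h2S.
  by rewrite addrACA z addr0 addrACA.
Qed.

Hypotheses (d21 : forall k, g2 k \oc d k \oc g1 k.+1 = 0)
  (t21 : forall k, g2 k \oc t k \oc g1 k.+1 = 0).

Lemma good_ext : subq d t g -> good d t g1 -> good d t g2 -> good d t g.
Proof.
move=> sg gd1 gd2; split.
- exact: sg.
- exact: gd_in gd1.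
- have [N gN] := gd_bd gd1; have [M gM] := gd_bd gd2; exists (maxn N M) => k.
  by rewrite geq_max => /andP[Nk Mk]; rewrite gE gN // gM // addr0.
- exact: contr_ext d21 (sq_d sg) (gd_d gd1) (gd_d gd2).
- exact: contr_ext t21 (sq_t sg) (gd_t gd1) (gd_t gd2).
Qed.

Section Chi.
Variables (dg : Bq E -> Prop) (G : abgroup) (chi : bcx E -> G).
Hypothesis chiA : additive_inv (X := Bq E) dg chi.

(** Images of [g1], [g] and [g2] form a sequence that the idempotents split in each degree; the
    vanishing of the components from [g1] to [g2] makes its maps chain maps. *)
Lemma chi_ext (sg : subq d t g) (gd1 : good d t g1) (gd2 : good d t g2) :
  chi (spl sg) = abD (chi (spl (gd_sq gd1))) (chi (spl (gd_sq gd2))).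
Proof.
have gd := good_ext sg gd1 gd2.
pose gg := sq_id sg.
have gi1 k : g k \oc inc (g1 k) = inc (g1 k).
  by rewrite -[in LHS](g_inc (g1 k)) ccompA g_g1 g_inc.
have g2p k : g2 k \oc inc (g k) = inc (g2 k) \oc (prj (sq_id (gd_sq gd2) k) \oc inc (g k)).
  by rewrite ccompA inc_prj.
have fP (e : forall k, chom (X k.+1) (X k)) k : g2 k \oc e k \oc g1 k.+1 = 0 ->
    (prj (gg k) \oc inc (g1 k)) \oc (prj (sq_id (gd_sq gd1) k) \oc e k \oc inc (g1 k.+1)) =
    (prj (gg k) \oc e k \oc inc (g k.+1)) \oc (prj (gg k.+1) \oc inc (g1 k.+1)).
  move=> e21; rewrite !ccompA !(comp_eqr (inc_prj _)) (comp_eqr (gi1 _)).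
  have eg : g k \oc (e k \oc g1 k.+1) = g1 k \oc (e k \oc g1 k.+1).
    by rewrite gE compDl [X in _ + X]ccompA e21 addr0.
  rewrite -(g_inc (g1 k.+1)) !ccompA -[in LHS](ccompA (prj _)) -(ccompA _ _ (g1 k.+1)).
  rewrite -[in RHS](ccompA (prj _)) -[in RHS](prj_g (gg k)) -[in RHS](ccompA (prj _)) eg.
  by rewrite !ccompA.
have qP (e : forall k, chom (X k.+1) (X k)) k : g2 k \oc e k \oc g1 k.+1 = 0 ->
    (prj (sq_id (gd_sq gd2) k) \oc inc (g k)) \oc (prj (gg k) \oc e k \oc inc (g k.+1)) =
    (prj (sq_id (gd_sq gd2) k) \oc e k \oc inc (g2 k.+1)) \oc
    (prj (sq_id (gd_sq gd2) k.+1) \oc inc (g k.+1)).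
  move=> e21; rewrite !ccompA !(comp_eqr (inc_prj _)).
  have pg : prj (sq_id (gd_sq gd2) k) \oc g k = prj (sq_id (gd_sq gd2) k).
    by rewrite -{1}(prj_g (sq_id (gd_sq gd2) k)) -ccompA g2_g prj_g.
  have eg : g2 k \oc e k \oc g k.+1 = g2 k \oc e k \oc g2 k.+1.
    by rewrite gE compDr e21 add0r.
  rewrite pg -(g_inc (g k.+1)) !ccompA (comp_eqr (g2_g _)).
  rewrite -(prj_g (sq_id (gd_sq gd2) k)) -!(ccompA (prj _)) !ccompA.
  by rewrite -(ccompA (prj _)) -(ccompA (prj _)) eg !ccompA.
pose f : bhom (spl (gd_sq gd1)) (spl sg) :=
  @BHom _ (spl (gd_sq gd1)) (spl sg) (fun k => prj (gg k) \oc inc (g1 k))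
    (fun k => fP d k (d21 k)) (fun k => fP t k (t21 k)).
pose q : bhom (spl sg) (spl (gd_sq gd2)) :=
  @BHom _ (spl sg) (spl (gd_sq gd2)) (fun k => prj (sq_id (gd_sq gd2) k) \oc inc (g k))
    (fun k => qP d k (d21 k)) (fun k => qP t k (t21 k)).
apply: (chiA.1 _ _ _ f q).
- exact: spl_in.
(* The complex [spl] depends on a proof of [subq], and [good_ext] contains a different one than
   [sg]. *)
- by have := spl_in gd; rewrite (Prop_irrelevance (gd_sq gd) sg).
- exact: spl_in.
move=> k; apply: (nice_split nE (p := prj (sq_id (gd_sq gd1) k) \oc inc (g k))
   (s := prj (gg k) \oc inc (g2 k))) => /=.
- by rewrite !ccompA (comp_eqr (inc_prj _)) (comp_eqr (gi1 k)) prj_inc.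
- have gi2 : g k \oc inc (g2 k) = inc (g2 k).
    by rewrite -[in LHS](g_inc (g2 k)) ccompA g_g2 g_inc.
  by rewrite !ccompA (comp_eqr (inc_prj _)) (comp_eqr gi2) prj_inc.
- rewrite !ccompA (comp_eqr (inc_prj _)) (comp_eqr (gi1 k)).
  rewrite -(prj_g (sq_id (gd_sq gd2) k)) -(g_inc (g1 k)) !ccompA.
  by rewrite (comp_eqr (g21 _)) compf0 comp0f.
- rewrite !ccompA !(comp_eqr (inc_prj _)) -compDl -compDr.
  have -> : g1 k + g2 k = g k by rewrite gE.
  by rewrite prj_g prj_inc.
Qed.

End Chi.
End Extension.

Section Chi.
Variables (dg : Bq E -> Prop) (G : abgroup) (chi : bcx E -> G).
Hypothesis dgP : forall P : bcx E, (forall k, bd P k = bt P k) -> dg P.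
Hypothesis chiA : additive_inv (X := Bq E) dg chi.

Lemma chi_spl_zero (X : nat -> E) (d t : forall k, chom (X k.+1) (X k))
    (g : forall k, chom (X k) (X k)) (sg : subq d t g) :
  (forall k, g k = 0) -> chi (spl sg) = ab0.
Proof.
move=> g0; apply: (chi_zero (Bq_nice nE) chiA).
by apply: bhomP => k; exact: (im_zero (sq_id sg k) (g0 k)).
Qed.

Section BcxSpl.
Variables (X : nat -> E) (d t : forall k, chom (X k.+1) (X k)).
Variables (g : forall k, chom (X k) (X k)) (sg : subq d t g).
Variables (M : bcx E) (f : forall k, chom (M k) (X k)) (f' : forall k, chom (X k) (M k)).
Hypotheses (f'f : forall k, f' k \oc f k = cid1 _) (ff' : forall k, f k \oc f' k = g k).
Hypotheses (fd : forall k, f k \oc bd M k = g k \oc d k \oc f k.+1)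
  (ft : forall k, f k \oc bt M k = g k \oc t k \oc f k.+1).

Lemma bcx_spl_iso : exists u : @chom (bcx_cat E) M (spl sg), is_iso u.
Proof.
pose gg := sq_id sg.
have uP (e : forall k, chom (X k.+1) (X k)) (b : forall k, chom (M k.+1) (M k)) k :
    f k \oc b k = g k \oc e k \oc f k.+1 ->
    (prj (gg k) \oc f k) \oc b k = (prj (gg k) \oc e k \oc inc (g k.+1)) \oc (prj (gg k.+1) \oc f k.+1).
  move=> fb; rewrite -ccompA fb !ccompA prj_g (comp_eqr (inc_prj _)).
  have gf : g k.+1 \oc f k.+1 = f k.+1 by rewrite -ff' -ccompA f'f ccompf1.
  by rewrite (comp_eqr gf).
exists (@BHom _ M (spl sg) (fun k => prj (gg k) \oc f k) (fun k => uP d _ k (fd k))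
  (fun k => uP t _ k (ft k))).
apply: bhom_iso => k /=; exists (f' k \oc inc (g k)); split.
- have f'g : f' k \oc g k = f' k by rewrite -ff' ccompA f'f ccomp1f.
  by rewrite ccompA (comp_eqr (inc_prj _)) f'g f'f.
- by rewrite ccompA (comp_eqr (ff' _)) prj_g prj_inc.
Qed.

Lemma chi_bcx_spl : @ex_in (Bq E) M -> chi M = chi (spl sg).
Proof.
move=> M_in; have [u ui] := bcx_spl_iso.
exact: (chi_iso (Bq_nice nE) chiA ui M_in).
Qed.

(** The variant of [chi_bcx_spl] in which membership is known for the subquotient instead of [M]; it
    serves for the normalisation. *)
Lemma chi_spl_bcx : @ex_in (Bq E) (spl sg) -> chi M = chi (spl sg).
Proof.
move=> spl_in; have [u [v [vu uv]]] := bcx_spl_iso.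
symmetry; apply: (chi_iso (X := Bq E) (Bq_nice nE) chiA (f := v)) => //.
by exists u.
Qed.

End BcxSpl.

(* The two-term complex W -> W with differentials a and b in degrees j + 1 and j *)
Definition cell_g (W : E) (j k : nat) : chom W W :=
  if (k == j) || (k == j.+1) then cid1 W else 0.

Section Cell.
Variables (X : nat -> E) (d t : forall k, chom (X k.+1) (X k)).
Variables (g : forall k, chom (X k) (X k)) (j : nat).
Variables (W : E) (f : forall k, chom (X k) W) (f' : forall k, chom W (X k)).
Hypotheses (ff0 : f j \oc f' j = cid1 _) (ff1 : f j.+1 \oc f' j.+1 = cid1 _)
  (g0 : g j = f' j \oc f j) (g1 : g j.+1 = f' j.+1 \oc f j.+1)
  (gn : forall k, k != j -> k != j.+1 -> g k = 0).

Lemma cell_gg k : g k \oc g k = g k.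
Proof.
have [->|kj] := eqVneq k j; first by rewrite g0 ccompA (comp_eqr ff0) ccompf1.
have [->|kj1] := eqVneq k j.+1; first by rewrite g1 ccompA (comp_eqr ff1) ccompf1.
by rewrite gn // compf0.
Qed.

Lemma cell_subq : subq d t g.
Proof.
have sq (e : forall k, chom (X k.+1) (X k)) : subq_d g e.
  move=> k; have [kj|kj] := eqVneq k j.
    by rewrite (gn (k := k.+2)) ?compf0 //; lia.
  have [kj1|kj1] := eqVneq k j.+1.
    by rewrite (gn (k := k.+2)) ?compf0 //; lia.
  by rewrite gn // !comp0f.
split; [exact: cell_gg | exact: sq | exact: sq].
Qed.

Lemma cell_contr (e : forall k, chom (X k.+1) (X k)) :
  is_iso (f j \oc e j \oc f' j.+1) -> contr g e.
Proof.
move=> [b [bi ib]].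
have key0 : g j \oc e j \oc (f' j.+1 \oc b \oc f j) = g j.
  transitivity (f' j \oc (f j \oc e j \oc f' j.+1 \oc b) \oc f j).
    by rewrite g0 !ccompA.
  by rewrite ib ccompf1.
have key1 : f' j.+1 \oc b \oc f j \oc e j \oc g j.+1 = g j.+1.
  transitivity (f' j.+1 \oc (b \oc (f j \oc e j \oc f' j.+1)) \oc f j.+1).
    by rewrite g1 !ccompA.
  by rewrite bi ccompf1.
exists (fun k => if k == j then f' k.+1 \oc b \oc f k else 0); split.
- move=> k; have [->|kj] := eqVneq k j; last by rewrite compf0 comp0f.
  by rewrite g0 g1 !ccompA (comp_eqr ff1) (comp_eqr ff0) !ccompf1.
- have [j0|j0] := eqVneq 0%N j; last by rewrite compf0 gn.
  by move: key0; rewrite -j0.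
- move=> k; have [kj|kj] := eqVneq k.+1 j.
    have -> : (k == j) = false by lia.
    rewrite !comp0f addr0.
    by move: key0; rewrite -kj.
  rewrite compf0 add0r; have [->|kj1] := eqVneq k j; first exact: key1.
  by rewrite !comp0f gn //; lia.
Qed.

Lemma cell_good : (forall k, ex_in (X k)) -> is_iso (f j \oc d j \oc f' j.+1) ->
  is_iso (f j \oc t j \oc f' j.+1) -> good d t g.
Proof.
move=> X_in di ti; split=> //.
- exact: cell_subq.
- by exists j.+2 => k kj; apply: gn; lia.
- exact: cell_contr.
- exact: cell_contr.
Qed.

End Cell.

Section CellComplex.
Variables (W : E) (W_in : ex_in W).

Lemma cell_g0 j : cell_g W j j = cid1 W \oc cid1 W.
Proof. by rewrite /cell_g eqxx ccomp1f. Qed.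
Lemma cell_g1 j : cell_g W j j.+1 = cid1 W \oc cid1 W.
Proof. by rewrite /cell_g eqxx orbT ccomp1f. Qed.
Lemma cell_gn j k : k != j -> k != j.+1 -> cell_g W j k = 0.
Proof. by rewrite /cell_g => /negbTE -> /negbTE ->. Qed.

Lemma cell_subqW j (a b : chom W W) :
  subq (X := fun=> W) (fun=> a) (fun=> b) (cell_g W j).
Proof.
apply: (@cell_subq (fun=> W) _ _ _ j W (fun=> cid1 W) (fun=> cid1 W)).
- exact: ccomp1f.
- exact: ccomp1f.
- exact: cell_g0.
- exact: cell_g1.
- exact: cell_gn.
Qed.

Definition cell (j : nat) (a b : chom W W) : bcx E := spl (cell_subqW j a b).

Lemma cell_goodW j (a b : chom W W) : is_iso a -> is_iso b ->
  good (X := fun=> W) (fun=> a) (fun=> b) (cell_g W j).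
Proof.
move=> ai bi; apply: (@cell_good (fun=> W) _ _ _ j W (fun=> cid1 W) (fun=> cid1 W)) => //.
- exact: ccomp1f.
- exact: ccomp1f.
- exact: cell_g0.
- exact: cell_g1.
- exact: cell_gn.
- by rewrite ccomp1f ccompf1.
- by rewrite ccomp1f ccompf1.
Qed.

Lemma cell_in j (a b : chom W W) : is_iso a -> is_iso b -> @ex_in (Bq E) (cell j a b).
Proof.
move=> ai bi; have := spl_in (cell_goodW j ai bi).
by rewrite (Prop_irrelevance (gd_sq _) (cell_subqW j a b)).
Qed.

Lemma chi_cell_diag j (a : chom W W) : is_iso a -> chi (cell j a a) = ab0.
Proof. by move=> ai; apply: chiA.2; [exact: cell_in | exact: dgP]. Qed.

Section CellChi.
Variables (X : nat -> E) (d t : forall k, chom (X k.+1) (X k)).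
Variables (g : forall k, chom (X k) (X k)) (j : nat).
Variables (f : forall k, chom (X k) W) (f' : forall k, chom W (X k)).
Hypotheses (ff0 : f j \oc f' j = cid1 _) (ff1 : f j.+1 \oc f' j.+1 = cid1 _)
  (g0 : g j = f' j \oc f j) (g1 : g j.+1 = f' j.+1 \oc f j.+1)
  (gn : forall k, k != j -> k != j.+1 -> g k = 0).

Lemma chi_cell (a b : chom W W) (sg : subq d t g) : f j \oc d j \oc f' j.+1 = a ->
  f j \oc t j \oc f' j.+1 = b -> is_iso a -> is_iso b -> chi (spl sg) = chi (cell j a b).
Proof.
move=> da tb ai bi; symmetry.
have gg := sq_id sg.
have M_in := cell_in j ai bi.
pose e0 k : cell_g W j k \oc cell_g W j k = cell_g W j k := sq_id (cell_subqW j a b) k.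
pose i k := inc (cell_g W j k).
pose p k := prj (e0 k).
have ip k : i k \oc p k = cell_g W j k by apply: inc_prj.
have pi k : p k \oc i k = cid1 _ by apply: prj_inc.
have gi k : cell_g W j k \oc i k = i k by apply: g_inc.
have pg k : p k \oc cell_g W j k = p k by apply: prj_g.
have ff k : cell_g W j k \oc f k \oc f' k \oc cell_g W j k = cell_g W j k.
  rewrite /cell_g; case: ifP => [|_]; last by rewrite compf0.
  by case/orP=> /eqP->; rewrite ccomp1f ccompf1.
have fg k : f' k \oc cell_g W j k \oc f k = g k.
  rewrite /cell_g; have [->|kj] := eqVneq k j; first by rewrite ccompf1 g0.
  have [->|kj1] := eqVneq k j.+1; first by rewrite ccompf1 g1.
  by rewrite compf0 comp0f gn.
have key (e : forall k, chom (X k.+1) (X k)) c k : f j \oc e j \oc f' j.+1 = c ->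
    f' k \oc i k \oc (p k \oc c \oc i k.+1) = g k \oc e k \oc (f' k.+1 \oc i k.+1).
  move=> ec.
  have key0 : f' k \oc cell_g W j k \oc c \oc cell_g W j k.+1 =
      g k \oc e k \oc f' k.+1 \oc cell_g W j k.+1.
    have [kj|kj] := eqVneq k j.
      by rewrite kj cell_g0 cell_g1 ccomp1f !ccompf1 g0 -ec !ccompA.
    have [kj1|kj1] := eqVneq k j.+1.
      by rewrite (cell_gn (j := j) (k := k.+1)) ?compf0 //; lia.
    by rewrite cell_gn // gn // compf0 !comp0f.
  by rewrite !ccompA (comp_eqr (ip k)) -(gi k.+1) !ccompA key0.
apply: (@chi_bcx_spl X d t g sg (cell j a b) (fun k => f' k \oc i k) (fun k => p k \oc f k)).
- move=> k; rewrite -(pg k) -(gi k).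
  transitivity (p k \oc (cell_g W j k \oc f k \oc f' k \oc cell_g W j k) \oc i k).
    by rewrite !ccompA.
  by rewrite ff pg pi.
- by move=> k; rewrite !ccompA (comp_eqr (ip k)) fg.
- by move=> k; exact: key.
- by move=> k; exact: key.
- exact: M_in.
Qed.

End CellChi.

Lemma two_term_in (a : chom W W) : is_iso a -> @ex_in (Bq E) (two_term a).
Proof.
move=> ai; split.
- by case=> [|[|k]] //; apply: nice_zero nE _ _; exact: zob_zero.
- by exists 2 => -[|[|k]] // _; exact: zob_zero.
- by apply: two_term_acyclic => //; exact: nice_proper.
- by apply: two_term_acyclic => //; [exact: nice_proper | exact: is_iso1].
Qed.

Lemma chi_two_term (a : chom W W) : is_iso a -> chi (two_term a) = chi (cell 0 a (cid1 W)).
Proof.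
move=> ai; apply: (@chi_bcx_spl _ _ _ _ (cell_subqW 0 a (cid1 W)) (two_term a)
  (fun k => if k is k'.+2 return chom (two_gr W k) W then 0 else cid1 W)
  (fun k => if k is k'.+2 return chom W (two_gr W k) then 0 else cid1 W)).
- by case=> [|[|k]] /=; rewrite ?ccomp1f // compf0 zob_zero.
- by case=> [|[|k]] /=; rewrite ?ccomp1f // compf0.
- by case=> [|[|k]] /=; rewrite ?ccomp1f ?ccompf1 ?compf0.
- by case=> [|[|k]] /=; rewrite ?ccomp1f ?ccompf1 ?compf0.
- exact: two_term_in.
Qed.

End CellComplex.
End Chi.
End SplTheory.

(** * Multiplicativity on two-term complexes *)

Section ThreeTerm.
Variables (E : excat) (nE : nice E).
Variables (dg : Bq E -> Prop) (G : abgroup) (chi : bcx E -> G).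
Hypothesis dgP : forall P : bcx E, (forall k, bd P k = bt P k) -> dg P.
Hypothesis chiA : additive_inv (X := Bq E) dg chi.
Variables (W : E) (W_in : ex_in W).

Section Relation.
Variables (a c : chom W W) (ai : is_iso a) (ci : is_iso c) (i : nat).

Let X : E := bip (fun _ : bool => W).
Let x : chom W X := bin (fun _ : bool => W) true.
Let y : chom W X := bin (fun _ : bool => W) false.
Let px : chom X W := bpr (fun _ : bool => W) true.
Let py : chom X W := bpr (fun _ : bool => W) false.

Fact three_pxx : px \oc x = cid1 W. Proof. exact: bpr_bin. Qed.
Fact three_pyy : py \oc y = cid1 W. Proof. exact: bpr_bin. Qed.
Fact three_pxy : px \oc y = 0. Proof. exact: bpr_bin0. Qed.
Fact three_pyx : py \oc x = 0. Proof. exact: bpr_bin0. Qed.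
Fact three_xy : x \oc px + y \oc py = cid1 X.
Proof. by rewrite -bin_bpr big_bool. Qed.

Definition tri (u v w : chom X X) (k : nat) : chom X X :=
  if k == i then u else if k == i.+1 then v else if k == i.+2 then w else 0.

Lemma tri0 u v w : tri u v w i = u. Proof. by rewrite /tri eqxx. Qed.
Lemma tri1 u v w : tri u v w i.+1 = v.
Proof. by rewrite /tri eqxx ifF //; lia. Qed.
Lemma tri2 u v w : tri u v w i.+2 = w.
Proof. by rewrite /tri eqxx ifF ?ifF //; lia. Qed.
Lemma tri_n u v w k : k != i -> k != i.+1 -> k != i.+2 -> tri u v w k = 0.
Proof. by rewrite /tri => /negbTE -> /negbTE -> /negbTE ->. Qed.

Lemma triP (u v w : chom X X) k (Q : nat -> chom X X -> Prop) :
  Q i u -> Q i.+1 v -> Q i.+2 w ->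
  (k != i -> k != i.+1 -> k != i.+2 -> Q k 0) -> Q k (tri u v w k).
Proof.
move=> Qu Qv Qw Qn; rewrite /tri; have [->//|ki] := eqVneq k i.
have [->//|ki1] := eqVneq k i.+1; have [->//|ki2] := eqVneq k i.+2; exact: Qn.
Qed.

Definition three_u (a : chom W W) : chom X W := a \oc px + py.
Definition three_v (a c : chom W W) : chom W X := y \oc (a \oc c) - x \oc c.

Fact three_ux b : three_u b \oc x = b.
Proof. by rewrite /three_u compDl -ccompA three_pxx three_pyx addr0 ccompf1. Qed.
Fact three_uy b : three_u b \oc y = cid1 W.
Proof. by rewrite /three_u compDl -ccompA three_pxy three_pyy compf0 add0r. Qed.
Fact three_vx b e : px \oc three_v b e = - e.
Proof. by rewrite /three_v compDr compfN !ccompA three_pxy three_pxx !comp0f add0r ccomp1f. Qed.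
Fact three_vy b e : py \oc three_v b e = b \oc e.
Proof. by rewrite /three_v compDr compfN !ccompA three_pyy three_pyx !comp0f subr0 ccomp1f. Qed.
Fact three_uv b e : three_u b \oc three_v b e = 0.
Proof. by rewrite /three_v compDr compfN !ccompA three_ux three_uy ccomp1f subrr. Qed.

(* x in degrees i, i + 1 is a copy of the complex given by a, and y in degrees i + 1,
   i + 2 one of the complex given by a c; the remaining entries 1 : y -> x and - c : y -> x
   of d exhibit y, x as a copy of the complex given by 1, and x, y as one given by c. *)
Definition three_d (a c : chom W W) (k : nat) : chom X X :=
  if k == i then x \oc three_u a else three_v a c \oc py.

Let xp := x \oc px.
Let yp := y \oc py.
Let g := tri xp (cid1 X) yp.

Lemma three_dd (b e : chom W W) : subq_d g (three_d b e).
Proof.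
move=> k; have [->|ki] := eqVneq k i; last first.
  have [->|ki1] := eqVneq k i.+1; first by rewrite [g i.+3]tri_n ?compf0 //; lia.
  have [->|ki2] := eqVneq k i.+2; first by rewrite [g i.+4]tri_n ?compf0 //; lia.
  by rewrite [g k]tri_n // !comp0f.
rewrite [g i]tri0 [g i.+1]tri1 [g i.+2]tri2 ccompf1 /three_d eqxx ifF; last lia.
by rewrite /xp !ccompA (comp_eqr three_pxx) ccompf1 (comp_eqr (three_uv _ _)) compf0 !comp0f.
Qed.

Let X_in : ex_in X.
Proof. exact: nice_bip nE _ _ _. Qed.

(** Two filtrations of the same complex [W <- W + W <- W]: the subcomplex with [x] in degrees [i],
    [i + 1] leaves the cell of [a \oc c], and the subcomplex with [x] in degree [i] and [y] in
    degree [i + 1] leaves the cell of [c]. The latter subcomplex is given by 1 for both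
    differentials and contributes nothing. *)
Lemma chi_three_term :
  abD (chi (cell i a (cid1 W))) (chi (cell i.+1 (a \oc c) (cid1 W))) =
  chi (cell i.+1 c (cid1 W)).
Proof.
have i1 : is_iso (cid1 W) by apply: is_iso1.
have gg k : g k \oc g k = g k.
  apply: (@triP _ _ _ k (fun _ u => u \oc u = u)) => [|||_ _ _].
  - by rewrite /xp ccompA (comp_eqr three_pxx) ccompf1.
  - by rewrite ccomp1f.
  - by rewrite /yp ccompA (comp_eqr three_pyy) ccompf1.
  - by rewrite compf0.
have sg : subq (X := fun=> X) (three_d a c) (three_d (cid1 W) (cid1 W)) g.
  by split; [exact: gg | exact: three_dd | exact: three_dd].
have ii1 : i.+1 == i = false by lia.
have ii2 : i.+2 == i.+1 = false by lia.
have xpp : xp \oc xp = xp by rewrite /xp ccompA (comp_eqr three_pxx) ccompf1.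
have ypp : yp \oc yp = yp by rewrite /yp ccompA (comp_eqr three_pyy) ccompf1.
have xyp : xp \oc yp = 0 by rewrite /xp /yp ccompA (comp_eqr three_pxy) compf0 comp0f.
have yxp : yp \oc xp = 0 by rewrite /xp /yp ccompA (comp_eqr three_pyx) compf0 comp0f.
have xyD : xp + yp = cid1 X by apply: three_xy.
have d0 b e : three_d b e i = x \oc three_u b by rewrite /three_d eqxx.
have d1 b e : three_d b e i.+1 = three_v b e \oc py by rewrite /three_d ii1.
have e1 b e : px \oc three_d b e i \oc x = b.
  by rewrite d0 ccompA three_pxx ccomp1f three_ux.
have e2 b e : py \oc three_d b e i.+1 \oc y = b \oc e.
  by rewrite d1 ccompA three_vy -ccompA three_pyy ccompf1.
have e3 b e : px \oc three_d b e i \oc y = cid1 W.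
  by rewrite d0 ccompA three_pxx ccomp1f three_uy.
have e4 b e : px \oc three_d b e i.+1 \oc (- y) = e.
  by rewrite compfN d1 ccompA three_vx -ccompA three_pyy ccompf1 opprK.
pose g1 := tri xp xp 0; pose g2 := tri 0 yp yp.
pose h1 := tri xp yp 0; pose h2 := tri 0 xp yp.
pose f1 k := if k == i then px else py; pose f1' k := if k == i then x else y.
(* The sign turns the entry [- c] of the differential into [c]. *)
pose f2 k := if k == i.+1 then px else - py; pose f2' k := if k == i.+1 then x else - y.
have iac : is_iso (a \oc c) by apply: iso_comp.
have i11 : is_iso (cid1 W \oc cid1 W) by rewrite ccomp1f.
have tn u v k : k != i -> k != i.+1 -> tri u v 0 k = 0.
  by rewrite /tri => /negbTE -> /negbTE ->; case: ifP.
have tn' u v k : k != i.+1 -> k != i.+2 -> tri 0 u v k = 0.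
  by rewrite /tri => /negbTE -> /negbTE ->; case: ifP.
have gd1 : good (X := fun=> X) (three_d a c) (three_d (cid1 W) (cid1 W)) g1.
  apply: (@cell_good E (fun=> X) _ _ g1 i W (fun=> px) (fun=> x)); rewrite ?e1 //.
  + exact: three_pxx.
  + exact: three_pxx.
  + exact: tri0.
  + exact: tri1.
  + exact: tn.
have gd2 : good (X := fun=> X) (three_d a c) (three_d (cid1 W) (cid1 W)) g2.
  apply: (@cell_good E (fun=> X) _ _ g2 i.+1 W (fun=> py) (fun=> y)); rewrite ?e2 //.
  + exact: three_pyy.
  + exact: three_pyy.
  + exact: tri1.
  + exact: tri2.
  + exact: tn'.
have hd1 : good (X := fun=> X) (three_d a c) (three_d (cid1 W) (cid1 W)) h1.
  apply: (@cell_good E (fun=> X) _ _ h1 i W f1 f1'); rewrite /f1 /f1' ?eqxx ?ii1 ?e3 //.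
  + exact: three_pxx.
  + exact: three_pyy.
  + exact: tri0.
  + exact: tri1.
  + exact: tn.
have hd2 : good (X := fun=> X) (three_d a c) (three_d (cid1 W) (cid1 W)) h2.
  apply: (@cell_good E (fun=> X) _ _ h2 i.+1 W f2 f2'); rewrite /f2 /f2' ?eqxx ?ii2 ?e4 //.
  + exact: three_pxx.
  + by rewrite compNf compfN opprK three_pyy.
  + exact: tri1.
  + by rewrite /h2 tri2 compNf compfN opprK.
  + exact: tn'.
have trD u v w u' v' w' k : tri (u + u') (v + v') (w + w') k = tri u v w k + tri u' v' w' k.
  by rewrite /tri; do 3! (case: ifP => // _); rewrite addr0.
have tr0 u v w u' v' w' k : u \oc u' = 0 -> v \oc v' = 0 -> w \oc w' = 0 ->
    tri u v w k \oc tri u' v' w' k = 0.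
  by rewrite /tri; do 3! (case: ifP => // _); rewrite comp0f.
have trg u v w k : u \oc u = u -> v \oc v = v -> w \oc w = w ->
    tri u v w k \oc tri u v w k = tri u v w k.
  by rewrite /tri; do 3! (case: ifP => // _); rewrite comp0f.
have sub (u v w u' v' w' : chom X X) (b e : chom W W) k :
    u \oc three_d b e i \oc v' = 0 -> v \oc three_d b e i.+1 \oc w' = 0 ->
    tri u v w k \oc three_d b e k \oc tri u' v' w' k.+1 = 0.
  move=> z0 z1; have [->|ki] := eqVneq k i; first by rewrite tri0 tri1.
  have [->|ki1] := eqVneq k i.+1; first by rewrite tri1 tri2.
  have [->|ki2] := eqVneq k i.+2; first by rewrite [tri _ _ _ i.+3]tri_n ?compf0 //; lia.
  by rewrite tri_n // !comp0f.
have A1 : chi (spl sg) = abD (chi (spl (gd_sq gd1))) (chi (spl (gd_sq gd2))).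
  apply: (chi_ext nE _ _ _ _ _ _ _ chiA) => k.
  - by rewrite -trD addr0 add0r xyD.
  - by apply: tr0; rewrite ?compf0 ?comp0f.
  - by apply: tr0; rewrite ?compf0 ?comp0f.
  - by apply: trg; rewrite ?compf0.
  - by apply: trg; rewrite ?compf0.
  - by apply: sub; rewrite ?compf0 ?comp0f.
  - by apply: sub; rewrite ?compf0 ?comp0f.
have A2 : chi (spl sg) = abD (chi (spl (gd_sq hd1))) (chi (spl (gd_sq hd2))).
  apply: (chi_ext nE _ _ _ _ _ _ _ chiA) => k.
  - by rewrite -trD addr0 add0r [yp + xp]addrC xyD.
  - by apply: tr0; rewrite ?compf0 ?comp0f.
  - by apply: tr0; rewrite ?compf0 ?comp0f.
  - by apply: trg; rewrite ?compf0.
  - by apply: trg; rewrite ?compf0.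
  - by apply: sub; rewrite ?compf0 ?comp0f.
  - by apply: sub; rewrite ?compf0 ?comp0f.
have B1 : chi (spl (gd_sq gd1)) = chi (cell i a (cid1 W)).
  apply: (chi_cell nE chiA W_in (g := g1) (j := i) (f := fun=> px) (f' := fun=> x));
    rewrite ?e1 //.
  + exact: three_pxx.
  + exact: three_pxx.
  + exact: tri0.
  + exact: tri1.
  + exact: tn.
have B2 : chi (spl (gd_sq gd2)) = chi (cell i.+1 (a \oc c) (cid1 W)).
  apply: (chi_cell nE chiA W_in (g := g2) (j := i.+1) (f := fun=> py) (f' := fun=> y));
    rewrite ?e2 ?ccomp1f //.
  + exact: three_pyy.
  + exact: three_pyy.
  + exact: tri1.
  + exact: tri2.
  + exact: tn'.
have B3 : chi (spl (gd_sq hd1)) = chi (cell i (cid1 W) (cid1 W)).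
  apply: (chi_cell nE chiA W_in (g := h1) (j := i) (f := f1) (f' := f1'));
    rewrite /f1 /f1' ?eqxx ?ii1 ?e3 //.
  + exact: three_pxx.
  + exact: three_pyy.
  + exact: tri0.
  + exact: tri1.
  + exact: tn.
have B4 : chi (spl (gd_sq hd2)) = chi (cell i.+1 c (cid1 W)).
  apply: (chi_cell nE chiA W_in (g := h2) (j := i.+1) (f := f2) (f' := f2'));
    rewrite /f2 /f2' ?eqxx ?ii2 ?e4 //.
  + exact: three_pxx.
  + by rewrite compNf compfN opprK three_pyy.
  + exact: tri1.
  + by rewrite /h2 tri2 compNf compfN opprK.
  + exact: tn'.
rewrite -B1 -B2 -A1 A2 B3 B4 (chi_cell_diag nE dgP chiA) ?ab0D //.
Qed.

End Relation.

(** The three-term relation for [c = 1], whose right hand side is diagonal. *)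
Lemma chi_cell_shift (a : chom W W) i : is_iso a ->
  chi (cell i.+1 a (cid1 W)) = abN (chi (cell i a (cid1 W))).
Proof.
move=> ai; apply: abN_uniq.
have := chi_three_term ai (is_iso1 W) i; rewrite ccompf1 => ->.
by apply: (chi_cell_diag nE dgP chiA) => //; apply: is_iso1.
Qed.

Lemma chi_cell_sign (a : chom W W) i : is_iso a ->
  chi (cell i a (cid1 W)) = ab_sign i (chi (two_term a)).
Proof.
move=> ai; rewrite (chi_two_term nE chiA) //.
elim: i => [//|i IH]; rewrite chi_cell_shift // IH /ab_sign /=.
by case: (odd i) => //=; rewrite abNN.
Qed.

Lemma chi_two_term_mul (a c : chom W W) : is_iso a -> is_iso c ->
  chi (two_term (a \oc c)) = abD (chi (two_term a)) (chi (two_term c)).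
Proof.
move=> ai ci; have iac : is_iso (a \oc c) by apply: iso_comp.
rewrite !(chi_two_term nE chiA) //.
have := chi_three_term ai ci 0; rewrite !chi_cell_shift // => e.
by rewrite -[chi (cell 0 c _)]abNN -e abND_distr abNN abDA abDN ab0D.
Qed.

Lemma chi_two_term1 : chi (two_term (cid1 W)) = ab0.
Proof.
by rewrite (chi_two_term nE chiA) ?(chi_cell_diag nE dgP chiA) //; apply: is_iso1.
Qed.

End ThreeTerm.

(** * The functor on powers of an object *)

Ltac if_lia := repeat match goal with |- context [if ?b then _ else _] =>
  lazymatch b with
  | context [if _ then _ else _] => fail
  | _ => let h := fresh in case h : b
  end end; lia.

Section Powers.
Variables (C : acat) (Q : C).

Definition pw (m : nat) : C := bip (fun _ : 'I_m => Q).

(* The map that sends the summand i to the summand s i, or to 0 if s i is out of range *)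
Definition pf (m n : nat) (s : nat -> nat) : chom (pw m) (pw n) :=
  bmx (fun (i : 'I_m) (j : 'I_n) => if s i == j then cid1 Q else 0).

Definition atc (m p : nat) (a : chom Q Q) : chom (pw m) (pw m) :=
  bmap (fun i : 'I_m => if i == p :> nat then a else cid1 Q).

(** Since an index out of range encodes zero, functoriality requires that [t] keeps such indices out
    of range. *)
Lemma pfM m n l (t s : nat -> nat) :
  (forall i, (i < m -> n <= s i -> l <= t (s i))%N) ->
  pf n l t \oc pf m n s = pf m l (fun i => t (s i)).
Proof.
move=> ts; rewrite /pf bmxM; congr bmx.
apply: functional_extensionality_dep => i; apply: functional_extensionality_dep => k.
have [sn|ns] := ltnP (s i) n.
  rewrite (bigD1 (Ordinal sn)) //= eqxx ccompf1 big1 ?addr0 // => j ji.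
  by rewrite [s i == j]negbTE ?compf0 //; apply: contra ji => /eqP e; apply/eqP/val_inj; rewrite /= e.
rewrite big1 => [|j _].
  by rewrite ifF //; have := ts i (ltn_ord i) ns; have := ltn_ord k; lia.
by rewrite [s i == j]negbTE ?compf0 //; have := ltn_ord j; lia.
Qed.

Lemma pf_eq m n (s s' : nat -> nat) :
  (forall i, (i < m)%N -> s i = s' i \/ (n <= s i)%N && (n <= s' i)%N) ->
  pf m n s = pf m n s'.
Proof.
move=> ss; congr bmx.
apply: functional_extensionality_dep => i; apply: functional_extensionality_dep => k.
have [->//|/andP[si si']] := ss i (ltn_ord i).
by rewrite !ifF //; have := ltn_ord k; lia.
Qed.

Lemma pf_id m s : (forall i, (i < m)%N -> s i = i) -> pf m m s = cid1 _.
Proof.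
move=> e; apply: bip_ext => j; rewrite bpr_bmx ccompf1 (bigD1 j) //= e // eqxx ccomp1f.
rewrite big1 ?addr0 // => i ij; rewrite e // ifF ?comp0f //.
by apply: negbTE; apply: contra ij => /eqP e'; apply/eqP/val_inj.
Qed.

Lemma pf_0 m n s : (forall i, (i < m -> n <= s i)%N) -> pf m n s = 0.
Proof.
move=> e; apply: bip_ext => j; rewrite bpr_bmx compf0 big1 // => i _.
by rewrite ifF ?comp0f //; have := e i (ltn_ord i); have := ltn_ord j; lia.
Qed.

Lemma pf_bmap m n s (f : 'I_m -> chom Q Q) (g : 'I_n -> chom Q Q) :
  (forall i j, s (val i) = val j -> f i = g j) -> pf m n s \oc bmap f = bmap g \oc pf m n s.
Proof.
move=> fg; apply: bmx_bmap => i j.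
by case: eqP => [/fg ->|_]; rewrite ?ccomp1f ?ccompf1 // compf0 comp0f.
Qed.

Lemma pf_atc m n s p q a :
  (forall i, (i < m -> s i < n -> (s i == q) = (i == p))%N) ->
  pf m n s \oc atc m p a = atc n q a \oc pf m n s.
Proof.
move=> e; apply: pf_bmap => i j sij.
by rewrite -sij e // ?sij // ltn_ord.
Qed.

Lemma atc1 m p : atc m p (cid1 Q) = cid1 _.
Proof. by apply: bmap_id => i; case: ifP. Qed.

Lemma atc_iso m p a : is_iso a -> is_iso (atc m p a).
Proof. by move=> ai; apply: bmap_iso => i; case: ifP => // _; apply: is_iso1. Qed.

End Powers.

Lemma im_map_iso (C : acat) (A : C) (g : chom A A) (gg : g \oc g = g) (a : chom A A) :
  a \oc g = g \oc a -> is_iso a -> is_iso (prj gg \oc a \oc inc g).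
Proof.
move=> ag [b [ba ab]]; exists (prj gg \oc b \oc inc g).
have bg : b \oc g = g \oc b by symmetry; apply: iso_square ab ba (esym ag).
split; rewrite !ccompA (comp_eqr (inc_prj _)).
- by rewrite (comp_eqr bg) !ccompA prj_g (comp_eqr ba) ccompf1 prj_inc.
- by rewrite (comp_eqr ag) !ccompA prj_g (comp_eqr ab) ccompf1 prj_inc.
Qed.

(* The operators on F (Q^m) given by omitting a summand (u), by the part depending on it
   (v = 1 - u), and by a degeneracy after a face map (t) *)
Section Operators.
Variables (C D : acat) (F : functor C D) (Q : C).

Definition opu (m j : nat) := fmap F (pf Q m m (fun x => if x == j then m else x)).
Definition opv (m j : nat) := cid1 (F (pw Q m)) - opu m j.
Definition opt (m j : nat) := fmap F (pf Q m m (fun x => if x == j then j.+1 else x)).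

Fixpoint vprod_rec m j : chom (F (pw Q m)) (F (pw Q m)) :=
  if j is j'.+1 then vprod_rec m j' \oc opv m j else cid1 _.

(** As [opt] is a degeneracy after a face map, this is the classical projection of a simplicial
    object onto its normalised part. *)
Fixpoint wprod_rec m j : chom (F (pw Q m)) (F (pw Q m)) :=
  if j is j'.+1 then wprod_rec m j' \oc (cid1 _ - opt m j) else cid1 _.

(* Locked, to keep rewriting with ccompA from unfolding the products *)
Fact prod_key : unit. Proof. by []. Qed.
Definition vprod m j := locked_with prod_key (vprod_rec m j).
Definition wprod m j := locked_with prod_key (wprod_rec m j).

Lemma vprod0 m : vprod m 0 = cid1 _.
Proof. by rewrite /vprod unlock. Qed.

Lemma vprodS m j : vprod m j.+1 = vprod m j \oc opv m j.+1.
Proof. by rewrite /vprod !unlock. Qed.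

Lemma wprod0 m : wprod m 0 = cid1 _.
Proof. by rewrite /wprod unlock. Qed.

Lemma wprodS m j : wprod m j.+1 = wprod m j \oc (cid1 _ - opt m j.+1).
Proof. by rewrite /wprod !unlock. Qed.

Lemma FpfM m n l (t s : nat -> nat) :
  (forall i, (i < m -> n <= s i -> l <= t (s i))%N) ->
  fmap F (pf Q n l t) \oc fmap F (pf Q m n s) = fmap F (pf Q m l (fun i => t (s i))).
Proof. by move=> ts; rewrite -fmapM pfM. Qed.

Lemma Fpf_eq m n (s s' : nat -> nat) :
  (forall i, (i < m)%N -> s i = s' i \/ (n <= s i)%N && (n <= s' i)%N) ->
  fmap F (pf Q m n s) = fmap F (pf Q m n s').
Proof. by move=> e; rewrite (pf_eq _ e). Qed.

Lemma opuu m j : opu m j \oc opu m j = opu m j.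
Proof. by rewrite /opu FpfM; [apply: Fpf_eq => i im|move=> i im]; if_lia. Qed.

Lemma opuC m i j : opu m i \oc opu m j = opu m j \oc opu m i.
Proof. by rewrite /opu !FpfM; try (move=> k km; if_lia); apply: Fpf_eq => k km; if_lia. Qed.

Lemma oput m j : opu m j \oc opt m j = opt m j.
Proof. by rewrite /opu /opt FpfM; [apply: Fpf_eq => i im|move=> i im]; if_lia. Qed.

Lemma optu m j : opt m j \oc opu m j = opu m j.
Proof. by rewrite /opu /opt FpfM; [apply: Fpf_eq => i im|move=> i im]; if_lia. Qed.

Lemma optuC m i j : (i < j)%N -> opt m j \oc opu m i = opu m i \oc opt m j.
Proof. by move=> ij; rewrite /opu /opt !FpfM; try (move=> k km; if_lia); apply: Fpf_eq => k km; if_lia. Qed.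

Lemma opvu m j : opv m j \oc opu m j = 0.
Proof. by rewrite /opv compDl ccomp1f compNf opuu subrr. Qed.

Lemma opuv m j : opu m j \oc opv m j = 0.
Proof. by rewrite /opv compDr ccompf1 compfN opuu subrr. Qed.

Lemma opvv m j : opv m j \oc opv m j = opv m j.
Proof. by rewrite {2}/opv compDr ccompf1 compfN opvu subr0. Qed.

Lemma opuvC m i j : opu m i \oc opv m j = opv m j \oc opu m i.
Proof. by rewrite /opv compDr compDl ccompf1 ccomp1f compfN compNf opuC. Qed.

Lemma opu_vprod m i j : opu m i \oc vprod m j = vprod m j \oc opu m i.
Proof.
elim: j => [|j IH]; first by rewrite vprod0 ccomp1f ccompf1.
by rewrite vprodS ccompA IH -!ccompA opuvC.
Qed.

Lemma opv_vprod m i j : opv m i \oc vprod m j = vprod m j \oc opv m i.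
Proof. by rewrite /opv compDl compDr ccomp1f ccompf1 compNf compfN opu_vprod. Qed.

Lemma vprod_u m i j : (0 < i <= j)%N -> vprod m j \oc opu m i = 0.
Proof.
elim: j => [|j IH]; first by lia.
move=> /andP[i0]; rewrite leq_eqVlt ltnS => /orP[/eqP->|ij]; rewrite vprodS.
  by rewrite -ccompA opvu compf0.
by rewrite -ccompA -opuvC ccompA IH ?comp0f // i0.
Qed.

Lemma vprodK m i j : (0 < i <= j)%N -> vprod m j \oc opv m i = vprod m j.
Proof. by move=> ij; rewrite /opv compDr ccompf1 compfN vprod_u // subr0. Qed.

Lemma vprod_vprod m i j : (i <= j)%N -> vprod m j \oc vprod m i = vprod m j.
Proof.
elim: i => [|i IH] ij; rewrite ?vprod0 ?vprodS; first by rewrite ccompf1.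
by rewrite ccompA IH ?vprodK //; lia.
Qed.

(** The factor [v] kills the matching [t], because [t = u t]. Together with [wprod_v] this says that
    [vprod m j] and [wprod m j] have the same kernel. So the normalisation, the image of [wprod], is
    isomorphic to the image of [vprod], which consists of cross-effects. *)
Lemma vprod_w m i j : (i <= j)%N -> vprod m j \oc wprod m i = vprod m j.
Proof.
elim: i => [|i IH] ij; rewrite ?wprod0 ?wprodS; first by rewrite ccompf1.
rewrite ccompA IH; last lia.
by rewrite compDr ccompf1 compfN -oput ccompA vprod_u ?comp0f ?subr0 //; lia.
Qed.

Lemma wprod_u m i j : (0 < i <= j)%N -> wprod m j \oc opu m i = 0.
Proof.
elim: j => [|j IH]; first by lia.
move=> /andP[i0]; rewrite leq_eqVlt ltnS => /orP[/eqP->|ij]; rewrite wprodS.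
  by rewrite -ccompA compDl ccomp1f compNf optu subrr compf0.
rewrite -ccompA compDl compNf optuC // ccomp1f -[X in X - _]ccompf1 -compfN -compDr.
by rewrite ccompA IH ?comp0f // i0.
Qed.

Lemma wprod_v m i j : (i <= j)%N -> wprod m j \oc vprod m i = wprod m j.
Proof.
elim: i => [|i IH] ij; rewrite ?vprod0 ?vprodS; first by rewrite ccompf1.
rewrite ccompA IH; last lia.
by rewrite /opv compDr ccompf1 compfN wprod_u ?subr0 //; lia.
Qed.

Lemma wprod_u0 m j : wprod m j \oc opu m 0 = opu m 0 \oc wprod m j.
Proof.
elim: j => [|j IH]; first by rewrite wprod0 ccomp1f ccompf1.
rewrite wprodS -ccompA compDl compNf optuC // ccomp1f -[X in X - _]ccompf1 -compfN -compDr.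
by rewrite ccompA IH -ccompA.
Qed.

Lemma wprod_v0 m j : wprod m j \oc opv m 0 = opv m 0 \oc wprod m j.
Proof. by rewrite /opv compDl compDr ccomp1f ccompf1 compNf compfN wprod_u0. Qed.

(* The face map that adds the summand j + 1 to the summand j, or omits the last one *)
Definition opd (k j : nat) := fmap F (pf Q k.+1 k (fun x => if (x <= j)%N then x else x.-1)).

Lemma opt_opd k j : (0 < j <= k)%N ->
  opt k.+1 j = fmap F (pf Q k k.+1 (fun x => if (x < j)%N then x else x.+1)) \oc opd k j.
Proof.
by move=> jk; rewrite /opt /opd FpfM; [apply: Fpf_eq => i ik|move=> i ik]; if_lia.
Qed.

Lemma opd_opt k j : (0 < j <= k)%N -> opd k j \oc opt k.+1 j = opd k j.
Proof.
by move=> jk; rewrite /opt /opd FpfM; [apply: Fpf_eq => i ik|move=> i ik]; if_lia.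
Qed.

Lemma opd_optC k i j : (0 < i < j)%N -> (j <= k)%N ->
  opd k j \oc opt k.+1 i = opt k i \oc opd k j.
Proof.
move=> ij jk; rewrite /opt /opd !FpfM; try (move=> x xk; if_lia).
by apply: Fpf_eq => x xk; if_lia.
Qed.

(** The face map [opd k j] moves past the factors with smaller index until it meets
    [1 - opt k.+1 j], which it kills. *)
Lemma opd_wprod k j n : (0 < j <= k)%N -> (j <= n)%N -> opd k j \oc wprod k.+1 n = 0.
Proof.
move=> jk; elim: n => [|n IH]; first by lia.
rewrite leq_eqVlt ltnS => /orP[/eqP jn|jn]; last by rewrite !wprodS ccompA IH ?comp0f.
have dw i : (i < j)%N -> opd k j \oc wprod k.+1 i = wprod k i \oc opd k j.
  elim: i => [|i IHi] ij; first by rewrite !wprod0 ccomp1f ccompf1.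
  rewrite !wprodS ccompA IHi; last lia.
  rewrite -!ccompA compDl compDr compNf compfN opd_optC ?ccomp1f ?ccompf1 //; lia.
rewrite !wprodS ccompA dw; last lia.
by rewrite -ccompA compDr ccompf1 compfN -jn opd_opt // subrr compf0.
Qed.

(** Each [opt] factors through a face map that kills [f], so every factor [1 - opt] fixes [f]. *)
Lemma wprod_id k n Y (f : chom Y (F (pw Q k.+1))) : (n <= k)%N ->
  (forall j, (0 < j <= k)%N -> opd k j \oc f = 0) -> wprod k.+1 n \oc f = f.
Proof.
move=> nk df; elim: n nk => [|n IH] nk; first by rewrite wprod0 ccomp1f.
rewrite wprodS -ccompA compDl ccomp1f compNf opt_opd; last lia.
by rewrite -ccompA df ?compf0 ?subr0 ?IH //; lia.
Qed.

Lemma wprod_idem k : wprod k.+1 k \oc wprod k.+1 k = wprod k.+1 k.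
Proof. by apply: wprod_id => // j jk; apply: opd_wprod => //; lia. Qed.

Lemma opu_atc m p j a : opu m j \oc fmap F (atc m p a) = fmap F (atc m p a) \oc opu m j.
Proof. by rewrite /opu -!fmapM (pf_atc (q := p)) // => i im; if_lia. Qed.

Lemma opv_atc m p j a : opv m j \oc fmap F (atc m p a) = fmap F (atc m p a) \oc opv m j.
Proof. by rewrite /opv compDl compDr ccomp1f ccompf1 compNf compfN opu_atc. Qed.

Lemma vprod_atc m p j a : vprod m j \oc fmap F (atc m p a) = fmap F (atc m p a) \oc vprod m j.
Proof.
elim: j => [|j IH]; first by rewrite vprod0 ccomp1f ccompf1.
by rewrite vprodS -ccompA opv_atc ccompA IH -ccompA.
Qed.

Lemma opu0_atc m a : opu m 0 \oc fmap F (atc m 0 a) = opu m 0.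
Proof.
rewrite /opu -fmapM; congr fmap; apply: bip_ext => j.
rewrite /pf ccompA !bpr_bmx comp_suml; apply: eq_bigr => i _.
rewrite -ccompA /atc bpr_bmap ccompA.
case: eqP => [ij|_]; last by rewrite !comp0f.
by rewrite ifF ?ccompf1 //; have := ltn_ord j; have := ltn_ord i; move: ij; case: eqP => //; lia.
Qed.

(* The cross-effect cr_(i+1) F (Q, ..., Q), as the image of an idempotent on F (Q^(i+1)) *)
Definition crE i := opv i.+1 0 \oc vprod i.+1 i.

Lemma crE_idem i : crE i \oc crE i = crE i.
Proof.
rewrite /crE {1}opv_vprod ccompA (comp_eqr (opvv _ _)).
by rewrite -opv_vprod -ccompA vprod_vprod.
Qed.

Lemma crE_atc i a : fmap F (atc i.+1 0 a) \oc crE i = crE i \oc fmap F (atc i.+1 0 a).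
Proof. by rewrite /crE ccompA -opv_atc -!ccompA vprod_atc. Qed.

Definition crC i := im (crE i).
Definition cr_at i a : chom (crC i) (crC i) :=
  prj (crE_idem i) \oc fmap F (atc i.+1 0 a) \oc inc (crE i).

Lemma cr_at_iso i a : is_iso a -> is_iso (cr_at i a).
Proof. by move=> ai; apply: im_map_iso; [exact: crE_atc | apply: functor_iso; apply: atc_iso]. Qed.

End Operators.

(** * The filtration of the normalisation *)

Section Filtration.
Variables (E : excat) (nE : nice E).
Variables (dg : Bq E -> Prop) (G : abgroup) (chi : bcx E -> G).
Hypothesis dgP : forall P : bcx E, (forall k, bd P k = bt P k) -> dg P.
Hypothesis chiA : additive_inv (X := Bq E) dg chi.
Variables (F : functor E E) (Q : E) (a : chom Q Q) (ai : is_iso a).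
Hypothesis F0 : forall A B : E, fmap F (0 : chom A B) = 0.
Hypothesis FQ_in : forall m, ex_in (F (pw Q m)).

Let X k := F (pw Q k.+1).

(* The zeroth face map, for the differential b *)
Definition opd0 (b : chom Q Q) k : chom (F (pw Q k.+2)) (F (pw Q k.+1)) :=
  fmap F (pf Q k.+2 k.+1 predn \oc atc k.+2 1 b).

Section Cells.

(* The maps that identify the i-th graded piece with cr_(i+1) F (Q, ..., Q) in degrees
   i + 1 and i; only their values at k = i, i + 1 matter. *)
Definition gpr i k : chom (F (pw Q k.+1)) (crC F Q i) :=
  prj (crE_idem F Q i) \oc fmap F (if k == i then pf Q k.+1 i.+1 id
    else pf Q k.+1 i.+1 (fun x => if x == 0 then i.+1 else x.-1)).

Definition gin i k : chom (crC F Q i) (F (pw Q k.+1)) :=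
  wprod F Q k.+1 k \oc
    fmap F (if k == i then pf Q i.+1 k.+1 id else pf Q i.+1 k.+1 S) \oc inc (crE F Q i).

(** In degree [k] the normalised part is the sum of a [v]-part, in which all [k + 1] summands occur,
    and a [u]-part, which does not see the summand 0: copies of the cross-effects in [k + 1] and in
    [k] variables. A piece joins the [v]-part of degree [i] to the [u]-part of degree [i + 1], both
    being the cross-effect in [i + 1] variables. *)
Definition piece i k : chom (F (pw Q k.+1)) (F (pw Q k.+1)) :=
  if k == i then wprod F Q k.+1 k \oc opv F Q k.+1 0
  else if k == i.+1 then wprod F Q k.+1 k \oc opu F Q k.+1 0 else 0.

Variable i : nat.
Let sh := fmap F (pf Q i.+2 i.+1 (fun x => if x == 0 then i.+1 else x.-1)).
Let up := fmap F (pf Q i.+1 i.+2 S).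
Let w := wprod F Q i.+2 i.+1.
Let V := vprod F Q i.+2 i.+1.

Lemma sh_v j : opv F Q i.+1 j \oc sh = sh \oc opv F Q i.+2 j.+1.
Proof.
rewrite /opv compDl compDr ccomp1f ccompf1 compNf compfN; congr (_ - _).
by rewrite /opu /sh !FpfM; try (move=> x xk; if_lia); apply: Fpf_eq => x xk; if_lia.
Qed.

(** The map [sh] drops the summand 0 and renumbers the others, so the operators [v] at 1, ...,
    [i + 1] become those at 0, ..., [i]. *)
Lemma sh_E : crE F Q i \oc sh = sh \oc V.
Proof.
have vs n : opv F Q i.+1 0 \oc vprod F Q i.+1 n \oc sh = sh \oc vprod F Q i.+2 n.+1.
  elim: n => [|n IH]; first by rewrite vprodS !vprod0 ccompf1 sh_v ccomp1f.
  by rewrite [in LHS]vprodS ccompA -ccompA sh_v ccompA IH -ccompA -vprodS.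
exact: vs.
Qed.

Lemma sh_up : sh \oc up = cid1 _.
Proof.
rewrite /sh /up FpfM ?pf_id ?fmap1 // => x xk; if_lia.
Qed.

Lemma up_sh : up \oc sh = opu F Q i.+2 0.
Proof.
by rewrite /sh /up /opu FpfM; [apply: Fpf_eq => x xk|move=> x xk]; if_lia.
Qed.

(** The zeroth face map lets [b] act on the summand 1 and adds it to the summand 0. Once the latter
    is omitted, only the renumbering is left, with [b] on the new summand 0; this is why the
    automorphism acts through the first variable of the cross-effect. *)
Lemma opd0_u b : opd0 b i \oc opu F Q i.+2 0 = fmap F (atc i.+1 0 b) \oc sh.
Proof.
rewrite /opd0 /opu /sh -!fmapM -(pf_atc (p := 1)); last by move=> x xk; if_lia.
rewrite -ccompA -(pf_atc (p := 1)); last by move=> x xk; if_lia.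
rewrite ccompA pfM; last by move=> x xk; if_lia.
by congr (fmap F (_ \oc _)); apply: pf_eq => x xk; if_lia.
Qed.

Lemma Vw : V \oc w = V. Proof. exact: vprod_w. Qed.
Lemma wV : w \oc V = w. Proof. exact: wprod_v. Qed.

Lemma crE_w : crE F Q i \oc wprod F Q i.+1 i = crE F Q i.
Proof. by rewrite /crE -ccompA vprod_w. Qed.

Lemma gprE0 : gpr i i = prj (crE_idem F Q i).
Proof. by rewrite /gpr eqxx pf_id // fmap1 ccompf1. Qed.

Lemma ginE0 : gin i i = wprod F Q i.+1 i \oc inc (crE F Q i).
Proof. by rewrite /gin eqxx pf_id // fmap1 ccompf1. Qed.

Lemma gprE1 : gpr i i.+1 = prj (crE_idem F Q i) \oc sh.
Proof. by rewrite /gpr ifF //; lia. Qed.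

Lemma ginE1 : gin i i.+1 = w \oc up \oc inc (crE F Q i).
Proof. by rewrite /gin ifF //; lia. Qed.

Lemma prjE : prj (crE_idem F Q i) = prj (crE_idem F Q i) \oc crE F Q i.
Proof. by rewrite prj_g. Qed.

Lemma gpr_gin0 : gpr i i \oc gin i i = cid1 _.
Proof. by rewrite gprE0 ginE0 prjE ccompA (comp_eqr crE_w) -prjE prj_inc. Qed.

Lemma prj_sh_wup : prj (crE_idem F Q i) \oc sh \oc w \oc up = prj (crE_idem F Q i).
Proof.
rewrite [in LHS]prjE (comp_eqr sh_E) ccompA (comp_eqr Vw).
by rewrite -(ccompA _ sh V) -sh_E ccompA (comp_eqr sh_up) ccompf1 -prjE.
Qed.

Lemma gpr_gin1 : gpr i i.+1 \oc gin i i.+1 = cid1 _.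
Proof. by rewrite gprE1 ginE1 !ccompA prj_sh_wup prj_inc. Qed.

Lemma piece0 : piece i i = gin i i \oc gpr i i.
Proof.
rewrite /piece eqxx gprE0 ginE0 -ccompA inc_prj /crE opv_vprod ccompA.
by rewrite wprod_v.
Qed.

Lemma piece1 : piece i i.+1 = gin i i.+1 \oc gpr i i.+1.
Proof.
rewrite /piece ifF ?eqxx; last lia.
rewrite gprE1 ginE1 ccompA (comp_eqr (inc_prj _)) (comp_eqr sh_E) ccompA (comp_eqr up_sh).
by rewrite -/w -ccompA opu_vprod ccompA wV.
Qed.

Lemma piece_n k : k != i -> k != i.+1 -> piece i k = 0.
Proof. by rewrite /piece => /negbTE -> /negbTE ->. Qed.

Lemma piece_d b : gpr i i \oc opd0 b i \oc gin i i.+1 = cr_at F i b.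
Proof.
rewrite gprE0 ginE1 /cr_at !ccompA; congr (_ \oc _).
have up0 : up = opu F Q i.+2 0 \oc up by rewrite -up_sh -ccompA sh_up ccompf1.
rewrite up0 !ccompA [_ \oc w \oc _](comp_eqr (wprod_u0 F Q i.+2 i.+1)) ccompA.
rewrite (comp_eqr (opd0_u b)) ccompA [in LHS]prjE.
rewrite -[_ \oc crE F Q i \oc _]ccompA -crE_atc ccompA (comp_eqr sh_E) ccompA (comp_eqr Vw).
rewrite -(ccompA _ sh V) -sh_E ccompA (comp_eqr sh_up) ccompf1 -ccompA crE_atc ccompA.
by rewrite -prjE.
Qed.

Lemma cr_at1 : cr_at F i (cid1 Q) = cid1 _.
Proof. by rewrite /cr_at atc1 fmap1 ccompf1 prj_inc. Qed.

Lemma piece_good : good (X := X) (opd0 a) (opd0 (cid1 Q)) (piece i).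
Proof.
apply: (@cell_good E X _ _ (piece i) i _ (gpr i) (gin i)).
- exact: gpr_gin0.
- exact: gpr_gin1.
- exact: piece0.
- exact: piece1.
- exact: piece_n.
- by move=> k; apply: FQ_in.
- by rewrite piece_d; apply: cr_at_iso.
- by rewrite piece_d cr_at1; apply: is_iso1.
Qed.

Lemma crC_in : ex_in (crC F Q i).
Proof.
apply: nice_retract nE _ _ (FQ_in i.+1) _.
by exists (inc (crE F Q i)), (prj (crE_idem F Q i)); apply: prj_inc.
Qed.

Lemma chi_piece : chi (spl (gd_sq piece_good)) = ab_sign i (chi (two_term (cr_at F i a))).
Proof.
have ci := cr_at_iso F i ai.
rewrite -(chi_cell_sign nE dgP chiA crC_in i ci).
apply: (chi_cell nE chiA crC_in (g := piece i) (j := i) (f := gpr i) (f' := gin i)).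
- exact: gpr_gin0.
- exact: gpr_gin1.
- exact: piece0.
- exact: piece1.
- exact: piece_n.
- exact: piece_d.
- by rewrite piece_d cr_at1.
- exact: ci.
- exact: is_iso1.
Qed.

End Cells.

(* M is the normalisation of the simplicial object with entries F (Q^(k+1)). *)
Variables (M : bcx E) (M_bd : exists N, forall k, (N <= k)%N -> is_zero (M k))
  (kap : forall k, chom (M k) (F (pw Q k.+1))).
Hypotheses
  (kap_mono : forall k Y (u v : chom Y (M k)), kap k \oc u = kap k \oc v -> u = v)
  (kap_d : forall k j, (0 < j <= k)%N -> opd F Q k j \oc kap k = 0)
  (kap_lift : forall k Y (f : chom Y (F (pw Q k.+1))),
    (forall j, (0 < j <= k)%N -> opd F Q k j \oc f = 0) -> exists h, kap k \oc h = f)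
  (kap_bd : forall k, kap k \oc bd M k = opd0 a k \oc kap k.+1)
  (kap_bt : forall k, kap k \oc bt M k = opd0 (cid1 Q) k \oc kap k.+1).

Let w k := wprod F Q k.+1 k.

Lemma kapW : exists kw : forall k, chom (F (pw Q k.+1)) (M k),
  (forall k, kap k \oc kw k = w k) /\ (forall k, kw k \oc kap k = cid1 _).
Proof.
have lift k : exists h, kap k \oc h = w k.
  by apply: kap_lift => j jk; apply: opd_wprod => //; case/andP: jk.
exists (fun k => projT1 (cid (lift k))).
have kE k : kap k \oc projT1 (cid (lift k)) = w k by case: (cid _).
split=> // k; apply: kap_mono; rewrite ccompA kE ccompf1 wprod_id // => j.
exact: kap_d.
Qed.

(** The sum of the pieces below [i]. It is the whole normalised part in degrees below [i], so it
    exhausts a bounded complex. *)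
Definition fil i k : chom (F (pw Q k.+1)) (F (pw Q k.+1)) :=
  if (k < i)%N then w k else if k == i then w k \oc opu F Q k.+1 0 else 0.

Lemma w_fil i k : w k \oc fil i k = fil i k.
Proof.
rewrite /fil; case: ifP => _; first exact: wprod_idem.
by case: ifP => _; rewrite ?compf0 // ccompA wprod_idem.
Qed.

Lemma filD i k : fil i.+1 k = fil i k + piece i k.
Proof.
rewrite /fil /piece ltnS leq_eqVlt.
have [->|ki] := eqVneq k i.
  rewrite ltnn /= /opv compDr ccompf1 compfN -/(w i) addrC subrK //.
case: ltnP => ki'; rewrite /= ?addr0.
  by rewrite ifF ?addr0 //; lia.
by rewrite add0r.
Qed.

Lemma wu k : w k \oc opu F Q k.+1 0 = opu F Q k.+1 0 \oc w k.
Proof. exact: wprod_u0. Qed.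

Lemma wv k : w k \oc opv F Q k.+1 0 = opv F Q k.+1 0 \oc w k.
Proof. exact: wprod_v0. Qed.

Lemma ww k : w k \oc w k = w k.
Proof. exact: wprod_idem. Qed.

Lemma wpu k : w k \oc opu F Q k.+1 0 \oc (w k \oc opu F Q k.+1 0) = w k \oc opu F Q k.+1 0.
Proof. by rewrite {2}wu ccompA (comp_eqr (opuu _ _ _ _)) -ccompA -wu ccompA ww. Qed.

Lemma wpv k : w k \oc opv F Q k.+1 0 \oc (w k \oc opv F Q k.+1 0) = w k \oc opv F Q k.+1 0.
Proof. by rewrite {2}wv ccompA (comp_eqr (opvv _ _ _ _)) -ccompA -wv ccompA ww. Qed.

Lemma wpuv k : w k \oc opu F Q k.+1 0 \oc (w k \oc opv F Q k.+1 0) = 0.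
Proof. by rewrite wv ccompA (comp_eqr (opuv _ _ _ _)) compf0 comp0f. Qed.

Lemma wpvu k : w k \oc opv F Q k.+1 0 \oc (w k \oc opu F Q k.+1 0) = 0.
Proof. by rewrite wu ccompA (comp_eqr (opvu _ _ _ _)) compf0 comp0f. Qed.

Lemma fil_idem i k : fil i k \oc fil i k = fil i k.
Proof.
rewrite /fil; case: ifP => _; first exact: wprod_idem.
by case: ifP => _; rewrite ?compf0 // wpu.
Qed.

Lemma piece_idem i k : piece i k \oc piece i k = piece i k.
Proof.
rewrite /piece; case: ifP => _; first exact: wpv.
by case: ifP => _; rewrite ?compf0 // wpu.
Qed.

Lemma fil_piece i k : fil i k \oc piece i k = 0.
Proof.
rewrite /fil /piece; have [->|ki] := eqVneq k i; first by rewrite ltnn wpuv.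
case: ltnP => ki'; last by rewrite comp0f.
by rewrite ifF ?compf0 //; lia.
Qed.

Lemma piece_fil i k : piece i k \oc fil i k = 0.
Proof.
rewrite /fil /piece; have [->|ki] := eqVneq k i; first by rewrite ltnn wpvu.
case: ltnP => ki'; last by rewrite compf0.
by rewrite ifF ?comp0f //; lia.
Qed.

Lemma opd0_w b : (forall k, exists h, kap k \oc h = opd0 b k \oc kap k.+1) ->
  forall k, w k \oc opd0 b k \oc w k.+1 = opd0 b k \oc w k.+1.
Proof.
have [kw [kapkw kwkap]] := kapW; move=> bP k; have [h hE] := bP k.
by rewrite -!kapkw !ccompA (comp_eqr (esym hE)) ccompA (comp_eqr (kwkap k)) ccompf1 hE.
Qed.

Lemma opd0_opd0 b (e : forall k, chom (M k.+1) (M k)) :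
  (forall k, kap k \oc e k = opd0 b k \oc kap k.+1) ->
  (forall k, e k \oc e k.+1 = 0) -> forall k, opd0 b k \oc opd0 b k.+1 \oc w k.+2 = 0.
Proof.
have [kw [kapkw kwkap]] := kapW; move=> eP e0 k.
by rewrite -kapkw ccompA (comp_eqr (esym (eP k.+1))) ccompA -eP (comp_eqr (e0 k)) compf0 comp0f.
Qed.

Lemma fil_subq_d b (e : forall k, chom (M k.+1) (M k)) i :
  (forall k, kap k \oc e k = opd0 b k \oc kap k.+1) ->
  (forall k, e k \oc e k.+1 = 0) -> subq_d (X := X) (fil i) (opd0 b).
Proof.
move=> eP e0.
have wd := opd0_w (fun k => ex_intro _ (e k) (eP k)).
have wdd := opd0_opd0 eP e0.
have fd k : fil i k \oc opd0 b k \oc fil i k.+1 = opd0 b k \oc fil i k.+1.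
  have [ki|ki] := ltnP k i.
    rewrite {1}/fil ki -(w_fil i k.+1) !ccompA wd.
    by [].
  by rewrite [fil i k.+1]/fil ifF ?ifF ?compf0 //; lia.
move=> k; transitivity (opd0 b k \oc (fil i k.+1 \oc opd0 b k.+1 \oc fil i k.+2)).
  by rewrite (fd k) !ccompA.
by rewrite (fd k.+1) -(w_fil i k.+2) !ccompA wdd comp0f.
Qed.

Lemma fil_subq i : subq (X := X) (opd0 a) (opd0 (cid1 Q)) (fil i).
Proof.
split; first exact: fil_idem.
- exact: fil_subq_d kap_bd (@bd2 _ M).
- exact: fil_subq_d kap_bt (@bt2 _ M).
Qed.

Lemma fil00 k : fil 0 k = 0.
Proof.
rewrite /fil ltn0; case: k => [|k] //=.
(* In degree 0 the operator [opu] on [F (pw Q 1)] is [F] of the zero map. *)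
rewrite /opu pf_0 ?F0 ?compf0 // => i i0; if_lia.
Qed.

Lemma piece_d_fil i b k : piece i k \oc opd0 b k \oc fil i k.+1 = 0.
Proof.
have [ki|ki] := ltnP k i; last by rewrite /fil ifF ?ifF ?compf0 //; lia.
by rewrite /piece ifF ?ifF ?comp0f //; lia.
Qed.

Lemma fil_good i : good (X := X) (opd0 a) (opd0 (cid1 Q)) (fil i).
Proof.
elim: i => [|i IH].
  have c0 b : contr (X := X) (fil 0) (opd0 b).
    by exists (fun k => 0); split=> *; rewrite !fil00 !(compf0, comp0f) ?addr0.
  split; [exact: fil_subq | by move=> k; apply: FQ_in | | exact: c0 | exact: c0].
  by exists 0%N => k _; apply: fil00.
apply: (good_ext (filD i) _ _ _ _ _ _ (fil_subq i.+1) IH (piece_good i)) => k.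
- exact: fil_piece.
- exact: piece_fil.
- exact: fil_idem.
- exact: piece_idem.
- exact: piece_d_fil.
- exact: piece_d_fil.
Qed.

Lemma chi_fil i : chi (spl (fil_subq i)) =
  \big[@abD G / ab0]_(j < i) ab_sign j (chi (two_term (cr_at F j a))).
Proof.
elim: i => [|i IH].
  by rewrite big_ord0 (chi_spl_zero nE chiA) //; exact: fil00.
rewrite big_ord_recr /= -IH -chi_piece.
have := chi_ext nE (filD i) (@fil_piece i) (@piece_fil i) (@fil_idem i) (@piece_idem i)
  (@piece_d_fil i a) (@piece_d_fil i (cid1 Q)) chiA (fil_subq i.+1) (fil_good i) (piece_good i).
by rewrite (Prop_irrelevance (gd_sq (fil_good i)) (fil_subq i)).
Qed.

Theorem chi_normalisation : exists N0, forall N, (N0 <= N)%N ->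
  chi M = \big[@abD G / ab0]_(i < N) ab_sign i (chi (two_term (cr_at F i a))).
Proof.
have [N0 MN] := M_bd; exists N0 => N NN; rewrite -chi_fil.
have [kw [kapkw kwkap]] := kapW.
have filw k : fil N k = w k.
  rewrite /fil; case: ltnP => // Nk.
  have w0 : w k = 0 by rewrite -kapkw (zero_to (kw k)) ?compf0 //; apply: MN; lia.
  by rewrite w0 comp0f; case: ifP.
apply: (chi_spl_bcx nE chiA (sg := fil_subq N) (f := kap) (f' := kw)) => // [k|k|k|].
- by rewrite kapkw filw.
- by rewrite filw -kapkw -!ccompA -kap_bd (ccompA (kw k)) kwkap ccomp1f.
- by rewrite filw -kapkw -!ccompA -kap_bt (ccompA (kw k)) kwkap ccomp1f.
- by have := spl_in nE (fil_good N); rewrite (Prop_irrelevance (gd_sq _) (fil_subq N)).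
Qed.

End Filtration.

(** * Iterated differences *)

Section Differences.
Variable G : abgroup.
Implicit Types g h : nat -> G.

Definition dif g (k : nat) : G := abD (g k.+1) (abN (g k)).

(* The value at - 1 of a function that is polynomial in the sense of poly *)
Fixpoint ext (n : nat) g : G :=
  if n is n'.+1 then abD (g 0) (abN (ext n' (dif g))) else ab0.

Fixpoint poly (n : nat) g : Prop :=
  if n is n'.+1 then poly n' (dif g) else forall k, g k = ab0.

Lemma iter_difS n g k : iter n dif (dif g) k = dif (iter n dif g) k.
Proof. by rewrite -iterSr iterS. Qed.

Lemma poly_iter n g : poly n g <-> forall k, iter n dif g k = ab0.
Proof. by elim: n g => [//|n IH] g; rewrite /= IH; split=> e k; move: (e k); rewrite iter_difS. Qed.

Lemma dif0 g : (forall k, g k = ab0) -> forall k, dif g k = ab0.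
Proof. by move=> g0 k; rewrite /dif !g0 abDN. Qed.

Lemma poly_ext_eq n g h : (forall k, g k = h k) -> poly n g -> poly n h.
Proof. by move=> e; have -> : g = h by apply: functional_extensionality_dep. Qed.

Lemma ext_eq n g h : (forall k, g k = h k) -> ext n g = ext n h.
Proof. by move=> e; have -> : g = h by apply: functional_extensionality_dep. Qed.

Lemma ext0 n g : (forall k, g k = ab0) -> ext n g = ab0.
Proof.
elim: n g => [//|n IH] g g0 /=; rewrite g0 IH ?abDN //; exact: dif0.
Qed.

Lemma ext_stable n m g : poly n g -> (n <= m)%N -> ext m g = ext n g.
Proof.
elim: n m g => [|n IH] [|m] g //=; first by move=> g0 _; rewrite (ext0 m (dif0 g0)) g0 abDN.
by move=> pg nm; rewrite IH.
Qed.

Lemma poly_le n m g : poly n g -> (n <= m)%N -> poly m g.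
Proof.
elim: n m g => [|n IH] m g /=.
  by elim: m g => [//|m IHm] g g0 _ /=; apply: IHm => //; apply: dif0.
by case: m => [//|m] pg nm /=; apply: IH.
Qed.

(** Newton's formula at $-1$, where the binomial coefficients are $\binom{-1}{i} = (-1)^i$. *)
Lemma ext_sum n g :
  ext n g = \big[@abD G / ab0]_(i < n) ab_sign i (iter i dif g 0).
Proof.
elim: n g => [|n IH] g; first by rewrite big_ord0.
rewrite big_ord_recl /= IH; congr abD.
rewrite (big_morph (@abN G) (id1 := ab0) (op1 := @abD G)); first last.
- exact: abN0.
- exact: abND_distr.
apply: eq_bigr => i _; rewrite /ab_sign /= iter_difS.
by case: (odd i) => //=; rewrite abNN.
Qed.

Lemma ext_shift n g : poly n g -> ext n (fun k => g k.+1) = g 0.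
Proof.
elim: n g => [|n IH] g /=; first by move=> g0; rewrite g0.
move=> pg; rewrite (IH (dif g)) // /dif abND_distr abNN.
by rewrite abDA abDN ab0D.
Qed.

Lemma poly_extend n g : poly n g -> poly n (fun k => if k is k'.+1 then g k' else ext n g).
Proof.
elim: n g => [|n IH] g /=; first by move=> g0 [|k].
move=> /IH; apply: poly_ext_eq => -[|k] //.
by rewrite /dif abND_distr abNN abDA abDN ab0D.
Qed.

Lemma poly_add n g h : poly n g -> poly n h -> poly n (fun k => abD (g k) (h k)).
Proof.
elim: n g h => [|n IH] g h /=; first by move=> g0 h0 k; rewrite g0 h0 ab0D.
move=> pg ph; apply: poly_ext_eq (IH _ _ pg ph) => k.
by rewrite /dif abND_distr abDACA.
Qed.

(** A difference with step [k] is a sum of [k] differences with step 1, each of which is polynomial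
    of lower degree along the progression. The induction runs over all starting points [c] at
    once. *)
Lemma poly_affine n g k c : poly n g -> poly n (fun l => g (c + k * l)%N).
Proof.
elim: n g c => [|n IH] g c /=; first by move=> g0 l.
move=> pg.
have key j : poly n (fun l => abD (g (c + k * l + j)%N) (abN (g (c + k * l)%N))).
  elim: j => [|j IHj].
    apply: (poly_le (n := 0)) => // l; by rewrite addn0 abDN.
  have := poly_add (IH _ (c + j)%N pg) IHj; apply: poly_ext_eq => l.
  rewrite /dif abDA; congr abD.
  have -> : (c + j + k * l = c + k * l + j)%N by lia.
  by rewrite -abDA abND abD0 addnS.
by apply: poly_ext_eq (key k) => l; rewrite /dif mulnS; congr (abD (g _) _); lia.
Qed.

(** The reparametrisation [l |-> (k + 1)(l + 1) - 1] fixes $-1$. With the arguments shifted by one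
    and the extrapolated value put at 0, it becomes multiplication by [k + 1], which fixes 0. *)
Lemma ext_mul n g k : poly n g -> ext n (fun l => g (k.+1 * l.+1).-1) = ext n g.
Proof.
move=> pg.
by have := ext_shift (poly_affine k.+1 0 (poly_extend pg)); rewrite muln0.
Qed.

End Differences.

Section TwoTermChi.
Variables (E : excat) (nE : nice E).
Variables (dg : Bq E -> Prop) (G : abgroup) (chi : bcx E -> G).
Hypothesis dgP : forall P : bcx E, (forall k, bd P k = bt P k) -> dg P.
Hypothesis chiA : additive_inv (X := Bq E) dg chi.

Lemma two_term_map_iso (V W : E) (A : chom V V) (B : chom W W) (f : chom V W)
    (fAB : f \oc A = B \oc f) : is_iso f -> @is_iso (bcx_cat E) _ _ (two_term_map fAB).
Proof. by move=> fi; apply: bhom_iso => -[|[|k]] //=; apply: is_iso1. Qed.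

Lemma chi_two_term_iso (V W : E) (A : chom V V) (B : chom W W) (f : chom V W) :
  f \oc A = B \oc f -> is_iso f -> is_iso A -> ex_in V ->
  chi (two_term A) = chi (two_term B).
Proof.
move=> fAB fi Ai V_in; apply: (chi_iso (Bq_nice nE) chiA (two_term_map_iso fAB fi)).
exact: two_term_in.
Qed.

Lemma chi_two_term_split (V V1 V2 : E) (A : chom V V) (A1 : chom V1 V1) (A2 : chom V2 V2)
    (f : chom V1 V) (q : chom V V2) (p : chom V V1) (s : chom V2 V) :
  f \oc A1 = A \oc f -> q \oc A = A2 \oc q -> p \oc A = A1 \oc p -> s \oc A2 = A \oc s ->
  p \oc f = cid1 _ -> q \oc s = cid1 _ -> q \oc f = 0 -> f \oc p + s \oc q = cid1 _ ->
  is_iso A -> ex_in V -> chi (two_term A) = abD (chi (two_term A1)) (chi (two_term A2)).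
Proof.
move=> fA qA pA sA pf qs qf fpsq Ai V_in.
apply: (chi_split (Bq_nice nE) chiA (f := two_term_map fA) (g := two_term_map qA)
  (p := two_term_map pA) (s := two_term_map sA)).
- by apply: bhomP => -[|[|k]] //=; rewrite ccomp1f.
- by apply: bhomP => -[|[|k]] //=; rewrite ccomp1f.
- by apply: bhomP => -[|[|k]] //=; rewrite ccomp1f; exact: zob_zero.
- by apply: bhomP => -[|[|k]] //=; rewrite ccomp1f zob_zero addr0.
- exact: two_term_in.
Qed.

Definition im_map (V : E) (e : chom V V) (ee : e \oc e = e) (A : chom V V) :
  chom (im e) (im e) := prj ee \oc A \oc inc e.

Lemma im_mapE (V : E) (e : chom V V) (ee : e \oc e = e) (A : chom V V) :
  A \oc e = e \oc A ->
  inc e \oc im_map ee A = A \oc inc e /\ im_map ee A \oc prj ee = prj ee \oc A.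
Proof.
move=> Ae; split; rewrite /im_map ?ccompA.
- by rewrite inc_prj -Ae -ccompA g_inc.
- by rewrite (comp_eqr (inc_prj ee)) (comp_eqr Ae) ccompA prj_g.
Qed.

Lemma im_map_ex_in (V : E) (e : chom V V) : e \oc e = e -> ex_in V -> ex_in (im e).
Proof.
move=> ee V_in; apply: nice_retract nE _ _ V_in _.
by exists (inc e), (prj ee); apply: prj_inc.
Qed.

Lemma chi_im_add (V : E) (A e e1 e2 : chom V V) (ee : e \oc e = e) (ee1 : e1 \oc e1 = e1)
    (ee2 : e2 \oc e2 = e2) :
  e = e1 + e2 -> e1 \oc e2 = 0 -> e2 \oc e1 = 0 ->
  A \oc e1 = e1 \oc A -> A \oc e2 = e2 \oc A -> is_iso A -> ex_in V ->
  chi (two_term (im_map ee A)) =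
  abD (chi (two_term (im_map ee1 A))) (chi (two_term (im_map ee2 A))).
Proof.
move=> eE e12 e21 Ae1 Ae2 Ai V_in.
have Ae : A \oc e = e \oc A by rewrite eE compDl compDr Ae1 Ae2.
have [iA pA] := im_mapE ee Ae; have [iA1 pA1] := im_mapE ee1 Ae1.
have [iA2 pA2] := im_mapE ee2 Ae2.
have i1 : e \oc inc e1 = inc e1.
  by rewrite -[in LHS](g_inc e1) ccompA eE compDl ee1 e21 addr0 g_inc.
have i2 : e \oc inc e2 = inc e2.
  by rewrite -[in LHS](g_inc e2) ccompA eE compDl ee2 e12 add0r g_inc.
apply: (chi_two_term_split (f := prj ee \oc inc e1) (q := prj ee2 \oc inc e)
  (p := prj ee1 \oc inc e) (s := prj ee \oc inc e2)).
- by rewrite -ccompA iA1 !ccompA pA.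
- by rewrite -ccompA iA !ccompA pA2.
- by rewrite -ccompA iA !ccompA pA1.
- by rewrite -ccompA iA2 !ccompA pA.
- by rewrite ccompA (comp_eqr (inc_prj ee)) (comp_eqr i1) prj_inc.
- by rewrite ccompA (comp_eqr (inc_prj ee)) (comp_eqr i2) prj_inc.
- rewrite ccompA (comp_eqr (inc_prj ee)) (comp_eqr i1) -(prj_g ee2) -(g_inc e1).
  by rewrite ccompA (comp_eqr e21) compf0 comp0f.
- rewrite !ccompA (comp_eqr (inc_prj ee1)) (comp_eqr (inc_prj ee2)) -compDl -compDr.
  have -> : e1 + e2 = e by rewrite eE.
  by rewrite prj_g prj_inc.
- by apply: im_map_iso.
- exact: im_map_ex_in.
Qed.

Lemma chi_im_iso (V V' : E) (A e : chom V V) (ee : e \oc e = e) (A' e' : chom V' V')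
    (ee' : e' \oc e' = e') (f : chom V V') (f' : chom V' V) :
  f \oc e = e' \oc f -> f' \oc e' = e \oc f' -> f' \oc f \oc e = e -> f \oc f' \oc e' = e' ->
  f \oc A = A' \oc f -> A \oc e = e \oc A -> A' \oc e' = e' \oc A' -> is_iso A -> ex_in V ->
  chi (two_term (im_map ee A)) = chi (two_term (im_map ee' A')).
Proof.
move=> fe fe' f'f ff' fA Ae Ae' Ai V_in.
have [iA pA] := im_mapE ee Ae; have [iA' pA'] := im_mapE ee' Ae'.
apply: (chi_two_term_iso (f := prj ee' \oc f \oc inc e)).
- by rewrite -ccompA iA !ccompA pA' (comp_eqr fA) !ccompA.
- exists (prj ee \oc f' \oc inc e'); split.
    rewrite !ccompA (comp_eqr (inc_prj ee')) (comp_eqr fe') !ccompA prj_g.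
    by rewrite -(g_inc e) !ccompA -(ccompA (prj ee)) -(ccompA (prj ee)) f'f prj_g prj_inc.
  rewrite !ccompA (comp_eqr (inc_prj ee)) (comp_eqr fe) !ccompA prj_g.
  by rewrite -(g_inc e') !ccompA -(ccompA (prj ee')) -(ccompA (prj ee')) ff' prj_g prj_inc.
- by apply: im_map_iso.
- exact: im_map_ex_in.
Qed.

Section CrossEffectClasses.
Variables (F : functor E E) (Q : E) (a : chom Q Q) (ai : is_iso a).
Hypothesis FQ_in : forall m, ex_in (F (pw Q m)).

Let A m := fmap F (atc m 0 a).
Let Ai m : is_iso (A m).
Proof. by apply: functor_iso; apply: atc_iso. Qed.

Lemma vprod_idem m j : vprod F Q m j \oc vprod F Q m j = vprod F Q m j.
Proof. exact: vprod_vprod. Qed.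

Definition chi_pow k := chi (two_term (fmap F (atc k.+1 0 a))).

Definition chi_v m j := chi (two_term (im_map (vprod_idem m j) (fmap F (atc m 0 a)))).

(** Splitting by [u + v = 1] at the summand [j + 1]: the [v]-part is the next product, and the
    [u]-part is the same product on a power with one summand less. So each further factor [v] takes
    a difference. *)
Lemma chi_v_dif j k : chi_v (j + k).+1 j = iter j (@dif G) chi_pow k.
Proof.
elim: j k => [|j IH] k.
  rewrite /= /chi_v /chi_pow; apply: (chi_two_term_iso (f := inc _)).
  - by have [] := im_mapE (vprod_idem k.+1 0) (esym (vprod_atc F k.+1 0 0 a)).
  - exists (prj (vprod_idem k.+1 0)); split; first exact: prj_inc.
    by rewrite inc_prj vprod0.
  - by apply: im_map_iso; rewrite ?vprod_atc.
  - by apply: im_map_ex_in => //; apply: vprod_idem.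
rewrite iterS /dif -!IH addnS addSn; set m := (j + k).+1.
have uu : vprod F Q m.+1 j \oc opu F Q m.+1 j.+1 \oc (vprod F Q m.+1 j \oc opu F Q m.+1 j.+1)
    = vprod F Q m.+1 j \oc opu F Q m.+1 j.+1.
  have Vu := esym (opu_vprod F Q m.+1 j.+1 j).
  by rewrite {2}Vu ccompA (comp_eqr (opuu _ _ _ _)) -ccompA -Vu ccompA vprod_idem.
have uA : A m.+1 \oc (vprod F Q m.+1 j \oc opu F Q m.+1 j.+1) =
    vprod F Q m.+1 j \oc opu F Q m.+1 j.+1 \oc A m.+1.
  by rewrite ccompA -vprod_atc -!ccompA opu_atc.
have -> : chi_v m.+1 j = abD (chi_v m.+1 j.+1) (chi (two_term (im_map uu (A m.+1)))).
  apply: chi_im_add => //.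
  - by rewrite vprodS /opv compDr ccompf1 compfN subrK.
  - rewrite vprodS -(opu_vprod F Q m.+1 j.+1 j) ccompA (comp_eqr (opvu _ _ _ _)).
    by rewrite compf0 comp0f.
  - rewrite vprodS -(opv_vprod F Q m.+1 j.+1 j) ccompA (comp_eqr (opuv _ _ _ _)).
    by rewrite compf0 comp0f.
  - by rewrite vprod_atc.
have -> : chi (two_term (im_map uu (A m.+1))) = chi_v m j.
  (* Omitting the summand [j + 1] and inserting a zero there identify the image of [u] with
     [F (pw Q m)]. *)
  pose dr := fmap F (pf Q m.+1 m (fun x => if x == j.+1 then m else if (x <= j)%N then x else x.-1)).
  pose ins := fmap F (pf Q m m.+1 (fun x => if (x <= j)%N then x else x.+1)).
  have jm : (j < m)%N by rewrite /m; lia.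
  have drins : dr \oc ins = cid1 _.
    by rewrite /dr /ins FpfM ?pf_id ?fmap1 // => x xm; if_lia.
  have insdr : ins \oc dr = opu F Q m.+1 j.+1.
    by rewrite /dr /ins /opu FpfM; [apply: Fpf_eq => x xm|move=> x xm]; if_lia.
  have dru : dr \oc opu F Q m.+1 j.+1 = dr by rewrite -insdr ccompA drins ccomp1f.
  have uins : opu F Q m.+1 j.+1 \oc ins = ins by rewrite -insdr -ccompA drins ccompf1.
  have drv i : (i <= j)%N -> opv F Q m i \oc dr = dr \oc opv F Q m.+1 i.
    move=> ij; rewrite /opv compDl compDr ccomp1f ccompf1 compNf compfN; congr (_ - _).
    by rewrite /opu /dr !FpfM; try (move=> x xm; if_lia); apply: Fpf_eq => x xm; if_lia.
  have insv i : (i <= j)%N -> opv F Q m.+1 i \oc ins = ins \oc opv F Q m i.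
    move=> ij; rewrite /opv compDl compDr ccomp1f ccompf1 compNf compfN; congr (_ - _).
    by rewrite /opu /ins !FpfM; try (move=> x xm; if_lia); apply: Fpf_eq => x xm; if_lia.
  have drV i : (i <= j)%N -> vprod F Q m i \oc dr = dr \oc vprod F Q m.+1 i.
    elim: i => [|i IHi] ij; first by rewrite !vprod0 ccomp1f ccompf1.
    by rewrite !vprodS -ccompA drv // ccompA IHi ?ccompA //; lia.
  have insV i : (i <= j)%N -> vprod F Q m.+1 i \oc ins = ins \oc vprod F Q m i.
    elim: i => [|i IHi] ij; first by rewrite !vprod0 ccomp1f ccompf1.
    by rewrite !vprodS -ccompA insv // ccompA IHi ?ccompA //; lia.
  apply: (@chi_im_iso _ _ _ _ uu _ _ (vprod_idem m j) dr ins).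
  - by rewrite -opu_vprod ccompA dru drV.
  - by rewrite -insV // -ccompA uins.
  - by rewrite insdr ccompA opu_vprod -ccompA opuu.
  - by rewrite drins ccomp1f.
  - by rewrite /dr /A -!fmapM (pf_atc (q := 0)) // => x xm; if_lia.
  - exact: uA.
  - by rewrite vprod_atc.
  - exact: Ai.
  - exact: FQ_in.
by rewrite -abDA abDN abD0.
Qed.

Lemma v0_idem m j : opv F Q m 0 \oc vprod F Q m j \oc (opv F Q m 0 \oc vprod F Q m j) =
  opv F Q m 0 \oc vprod F Q m j.
Proof.
by rewrite {1}opv_vprod ccompA (comp_eqr (opvv _ _ _ _)) -opv_vprod -ccompA vprod_idem.
Qed.

(** On the part that does not see the summand 0 the automorphism is the identity, so that part
    contributes a diagonal complex. *)
Lemma chi_v_v0 m j : chi_v m j = chi (two_term (im_map (v0_idem m j) (fmap F (atc m 0 a)))).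
Proof.
have u0 : opu F Q m 0 \oc vprod F Q m j \oc (opu F Q m 0 \oc vprod F Q m j) =
    opu F Q m 0 \oc vprod F Q m j.
  by rewrite {1}opu_vprod ccompA (comp_eqr (opuu _ _ _ _)) -opu_vprod -ccompA vprod_idem.
have VA : A m \oc vprod F Q m j = vprod F Q m j \oc A m by rewrite vprod_atc.
have -> : chi_v m j = abD (chi (two_term (im_map (v0_idem m j) (fmap F (atc m 0 a)))))
    (chi (two_term (im_map u0 (A m)))).
  apply: chi_im_add => //.
  - by rewrite /opv compDl ccomp1f compNf subrK.
  - by rewrite opv_vprod ccompA (comp_eqr (opvu _ _ _ _)) compf0 comp0f.
  - by rewrite opu_vprod ccompA (comp_eqr (opuv _ _ _ _)) compf0 comp0f.
  - by rewrite ccompA -opv_atc -!ccompA VA.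
  - by rewrite ccompA -opu_atc -!ccompA VA.
have -> : im_map u0 (A m) = cid1 _.
  rewrite /im_map -(g_inc (opu F Q m 0 \oc vprod F Q m j)) !ccompA.
  have AU : A m \oc opu F Q m 0 = opu F Q m 0 by rewrite -opu_atc opu0_atc.
  by rewrite (comp_eqr AU) -ccompA -(ccompA (prj _)) (ccompA (opu _ _ _ _)) g_inc prj_inc.
rewrite (chi_two_term1 nE dgP chiA) ?abD0 //.
by apply: im_map_ex_in.
Qed.

Lemma chi_cr_dif i : chi (two_term (cr_at F i a)) = iter i (@dif G) chi_pow 0.
Proof.
rewrite -(chi_v_dif i 0) addn0 chi_v_v0.
by rewrite /cr_at /im_map (Prop_irrelevance (v0_idem i.+1 i) (crE_idem F Q i)).
Qed.

Variable r : nat.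
Hypothesis F_deg : forall m, (r < m)%N -> opv F Q m 0 \oc vprod F Q m r = 0.

(** By [F_deg] the [r]-th difference is the class of a zero object. *)
Lemma poly_chi_pow : poly r chi_pow.
Proof.
apply/poly_iter => k; rewrite -chi_v_dif chi_v_v0.
apply: (chi_zero (Bq_nice nE) chiA); apply: bhomP => -[|[|l]] /=; last exact: zob_zero.
- by apply: (im_zero (v0_idem _ _)); apply: F_deg; lia.
- by apply: (im_zero (v0_idem _ _)); apply: F_deg; lia.
Qed.

Hypothesis F0 : forall A B : E, fmap F (0 : chom A B) = 0.

Theorem chi_normalisation_ext (M : bcx E) (kap : forall k, chom (M k) (F (pw Q k.+1))) :
  (exists N, forall k, (N <= k)%N -> is_zero (M k)) ->
  (forall k Y (u v : chom Y (M k)), kap k \oc u = kap k \oc v -> u = v) ->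
  (forall k j, (0 < j <= k)%N -> opd F Q k j \oc kap k = 0) ->
  (forall k Y (f : chom Y (F (pw Q k.+1))),
    (forall j, (0 < j <= k)%N -> opd F Q k j \oc f = 0) -> exists h, kap k \oc h = f) ->
  (forall k, kap k \oc bd M k = opd0 F a k \oc kap k.+1) ->
  (forall k, kap k \oc bt M k = opd0 F (cid1 Q) k \oc kap k.+1) ->
  chi M = ext r chi_pow.
Proof.
move=> M_bd k1 k2 k3 k4 k5.
have [N0 e] := chi_normalisation nE dgP chiA ai F0 FQ_in M_bd k1 k2 k3 k4 k5.
(* The filtration needs at least [N0] terms and the extrapolation has [r]; the maximum serves both,
   since additional terms do not change the extrapolation of a polynomial. *)
rewrite (e (maxn N0 r)) ?leq_maxl // -(ext_stable poly_chi_pow (leq_maxr N0 r)) ext_sum.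
by apply: eq_bigr => i _; rewrite chi_cr_dif.
Qed.

End CrossEffectClasses.
End TwoTermChi.

(** * The normalisation for two-term complexes *)

Section GammaCoordinates.
Variables (C : acat) (Q : C).

Definition tg_out p : chom (two_gr Q p) Q :=
  if p is p'.+2 return chom (two_gr Q p) Q then 0 else cid1 Q.

Definition tg_in p : chom Q (two_gr Q p) :=
  if p is p'.+2 return chom Q (two_gr Q p) then 0 else cid1 Q.

(* The summand of Gamma_k of a two-term complex that is the summand i of Q^(k+1): the
   constant map to [0] for i = 0, and the map to [1] that jumps at i for i > 0 *)
Definition gcoord k (s : surj k) (i : nat) : bool :=
  (surj_dim s == (0 < i)%N) &&
  [forall x : 'I_k.+1, surj_fun s x == ((0 < i) && (i <= x))%N :> nat].

Lemma gcoordP k (s : surj k) i : reflect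
  (surj_dim s = (0 < i)%N /\ forall x : 'I_k.+1, surj_fun s x = ((0 < i) && (i <= x))%N)
  (gcoord s i).
Proof.
apply: (iffP andP) => [[/eqP e /forallP f]|[e f]]; split=> //; last first.
- by apply/forallP => x; apply/eqP.
- by rewrite e.
- by move=> x; apply/eqP.
Qed.

Lemma gcoord_ex k i : (i <= k)%N -> exists s : surj k, gcoord s i.
Proof.
move=> ik.
have [||y yi|s es fs] := @surj_exists k (0 < i)%N (fun x => (0 < i) && (i <= x))%N.
- by move=> x y; lia.
- by move=> x; lia.
- case: y yi => [|y] yi; first by exists ord0 => /=; lia.
  have i0 : (0 < i)%N by lia.
  by exists (Ordinal (ik : (i < k.+1)%N)) => /=; lia.
- by exists s; apply/gcoordP.
Qed.

Lemma gcoord_inj k (s t : surj k) i : gcoord s i -> gcoord t i -> s = t.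
Proof.
move=> /gcoordP[es fs] /gcoordP[et ft]; apply: surj_inj; first by rewrite es et.
by move=> x; rewrite fs ft.
Qed.

Lemma gcoord_le k (s : surj k) i : gcoord s i -> (i <= k)%N.
Proof.
move=> /gcoordP[es fs]; have [_ sj _] := surjP s.
have [|x sx] := sj (0 < i)%N; first by rewrite es.
by have := ltn_ord x; move: sx; rewrite fs; case: i {es fs} => //= i; lia.
Qed.

Lemma gcoord_uniq k (s : surj k) i j : gcoord s i -> gcoord s j -> i = j.
Proof.
move=> si sj; have := gcoord_le si; have := gcoord_le sj.
move/gcoordP: si => [ei fi]; move/gcoordP: sj => [ej fj] jk ik.
have e0 : (0 < i)%N = (0 < j)%N by move: ei; rewrite ej; lia.
have := fi (inord i); have := fi (inord j); rewrite !fj !inordK //; lia.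
Qed.

Lemma gcoord_dim k (s : surj k) : (surj_dim s <= 1)%N -> exists i, gcoord s i.
Proof.
move=> s1; have [ms sj bs] := surjP s.
have [d0|d0] := posnP (surj_dim s).
  by exists 0%N; apply/gcoordP; split=> // x; have := bs x; rewrite d0 /=; lia.
have d1 : surj_dim s = 1%N by lia.
have ex1 : exists n, [exists x : 'I_k.+1, (x == n :> nat) && (surj_fun s x == 1%N)].
  have [|x sx] := sj 1%N; first by rewrite d1.
  by exists x; apply/existsP; exists x; rewrite eqxx sx.
exists (ex_minn ex1); case: ex_minnP => n /existsP[x /andP[/eqP xn /eqP sx]] nmin.
have n0 : (0 < n)%N.
  rewrite lt0n; apply/eqP => n0; have := surj_fun0 s; have -> : ord0 = x by apply: val_inj; rewrite /= xn n0.
  by rewrite sx.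
apply/gcoordP; rewrite n0 d1; split=> // y /=.
have sy1 : (surj_fun s y <= 1)%N by rewrite -d1.
have [ny|yn] := leqP n y.
  by have := ms x y; rewrite sx xn => /(_ ny); lia.
case: (posnP (surj_fun s y)) => // sy; exfalso.
have := nmin y; have -> : [exists x0 : 'I_k.+1, (x0 == y :> nat) && (surj_fun s x0 == 1%N)].
  by apply/existsP; exists y; rewrite eqxx /=; apply/eqP; lia.
by move=> /(_ isT); lia.
Qed.

Lemma tg_inout p : (p <= 1)%N -> tg_in p \oc tg_out p = cid1 _.
Proof. by case: p => [|[|p]] //= _; rewrite ccomp1f. Qed.

Lemma tg_outin p : (p <= 1)%N -> tg_out p \oc tg_in p = cid1 _.
Proof. by case: p => [|[|p]] //= _; rewrite ccomp1f. Qed.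

Lemma gcoord_dim1 k (s : surj k) i : gcoord s i -> (surj_dim s <= 1)%N.
Proof. by move=> /gcoordP[-> _]; case: (0 < i)%N. Qed.

(** Coordinates on [Gam] of a two-term complex: surjections onto [[p]] with [p > 1] carry zero
    objects, so [gam'] below is inverse to this matrix. *)
Definition gam k : chom (Gam (two_gr Q) k) (pw Q k.+1) :=
  bmx (fun (s : surj k) (i : 'I_k.+1) => if gcoord s i then tg_out (surj_dim s) else 0).

Definition gam' k : chom (pw Q k.+1) (Gam (two_gr Q) k) :=
  bmx (fun (i : 'I_k.+1) (s : surj k) => if gcoord s i then tg_in (surj_dim s) else 0).

Lemma bmx_eq (I J : finType) (A : I -> C) (B : J -> C) (M N : forall i j, chom (A i) (B j)) :
  (forall i j, M i j = N i j) -> bmx M = bmx N.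
Proof.
move=> e; congr bmx; apply: functional_extensionality_dep => i.
by apply: functional_extensionality_dep => j.
Qed.

Lemma bmx_delta (I : finType) (A : I -> C) (M : forall i j, chom (A i) (A j)) :
  (forall i, M i i = cid1 _) -> (forall i j, i != j -> M i j = 0) -> bmx M = cid1 _.
Proof.
move=> M1 M0; apply: bip_ext => j; rewrite bpr_bmx ccompf1 (bigD1 j) //= M1 ccomp1f.
by rewrite big1 ?addr0 // => i ij; rewrite M0 ?comp0f.
Qed.

Lemma gam_gam' k : gam k \oc gam' k = cid1 _.
Proof.
rewrite /gam /gam' bmxM; apply: bmx_delta => [i|i j ij].
  have [s si] := gcoord_ex (ltn_ord i : (i <= k)%N).
  rewrite (bigD1 s) //= si tg_outin ?(gcoord_dim1 si) // big1 ?addr0 // => t ts.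
  case: ifP => ti; last by rewrite comp0f.
  by case/eqP: ts; apply: gcoord_inj ti si.
rewrite big1 // => s _; case: ifP => sj; last by rewrite comp0f.
case: ifP => si; last by rewrite compf0.
by case/eqP: ij; apply: val_inj; apply: gcoord_uniq si sj.
Qed.

Lemma gam'_gam k : gam' k \oc gam k = cid1 _.
Proof.
rewrite /gam /gam' bmxM; apply: bmx_delta => [s|s t st].
  have [d1|d1] := leqP (surj_dim s) 1.
    have [i si] := gcoord_dim d1.
    have ik : (i < k.+1)%N by have := gcoord_le si; lia.
    rewrite (bigD1 (Ordinal ik)) //= si tg_inout // big1 ?addr0 // => j ji.
    case: ifP => sj; last by rewrite comp0f.
    by case/eqP: ji; apply: val_inj; apply: gcoord_uniq sj si.
  rewrite big1 => [|i _].
    by case: (surj_dim s) d1 => [|[|p]] //= _; rewrite zob_zero.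
  case: ifP => si; last by rewrite comp0f.
  by have := gcoord_dim1 si; lia.
rewrite big1 // => i _; case: ifP => ti; last by rewrite comp0f.
case: ifP => si; last by rewrite compf0.
by case/eqP: st; apply: gcoord_inj si ti.
Qed.

(** The column [i] of [gam'] has a single possibly non-zero entry, at the surjection with coordinate
    [i]. A simplicial operator can thus be compared with a map of powers one column at a time. *)
Lemma gam'_mx k l (M : chom (Gam (two_gr Q) k) (Gam (two_gr Q) l))
    (Me : forall s t, chom (two_gr Q (surj_dim s)) (two_gr Q (surj_dim t)))
    (N : chom (pw Q k.+1) (pw Q l.+1)) (sg : nat -> nat) (c : nat -> chom Q Q) :
  M = bmx Me ->
  N = bmx (fun (i : 'I_k.+1) (j : 'I_l.+1) => if sg i == j then c i else 0) ->
  (forall (i : 'I_k.+1) (s : surj k) (t : surj l), gcoord s i ->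
    Me s t \oc tg_in (surj_dim s) =
    if gcoord t (sg i) then tg_in (surj_dim t) \oc c i else 0) ->
  M \oc gam' k = gam' l \oc N.
Proof.
move=> -> -> e; rewrite /gam' !bmxM; apply: bmx_eq => i t.
have [s si] := gcoord_ex (ltn_ord i : (i <= k)%N).
rewrite (bigD1 s) //= si (e i s t si) big1 ?addr0; last first.
  move=> s' s's; case: ifP => s'i; last by rewrite compf0.
  by case/eqP: s's; apply: gcoord_inj s'i si.
case: ifP => ti.
  have il : (sg i < l.+1)%N by have := gcoord_le ti; lia.
  rewrite (bigD1 (Ordinal il)) //= ti eqxx big1 ?addr0 // => j ji.
  by rewrite ifF ?comp0f //; apply/negP => tj; case/eqP: ji; apply: val_inj; apply: gcoord_uniq tj ti.
rewrite big1 // => j _; case: eqP => [ij|]; last by rewrite compf0.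
by rewrite -ij ti comp0f.
Qed.

Lemma gid_in p q : (p <= 1)%N -> gid (two_gr Q) p q \oc tg_in p = if p == q then tg_in q else 0.
Proof.
move=> p1; have [->|/eqP pq] := eqVneq p q; first by rewrite gid1 ccomp1f.
by rewrite gid_neq // comp0f.
Qed.

(** Restricting the map that jumps at [i] along the face that misses [j] gives a jump at [i] or
    [i - 1]. For [j > 0] a jump stays a jump, so no differential arises. *)
Fact face_jump (i j : nat) : (0 < j)%N -> let s := if (i <= j)%N then i else i.-1 in
  (0 < s)%N = (0 < i)%N /\
  forall x, ((0 < i) && (i <= bump j x) = (0 < s) && (s <= x))%N.
Proof.
move=> j0 /=; split=> [|x]; first by case: (leqP i j) => ij; lia.
by rewrite /bump; case: (leqP i j) => ij; case: (leqP j x) => jx; lia.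
Qed.

Lemma gam'_face (d : forall k, chom (two_gr Q k.+1) (two_gr Q k)) k j : (0 < j <= k.+1)%N ->
  Gam_act d (face (k := k.+1) j) \oc gam' k.+1 =
  gam' k \oc pf Q k.+2 k.+1 (fun x => if (x <= j)%N then x else x.-1).
Proof.
move=> jk; apply: (gam'_mx (sg := fun x => if (x <= j)%N then x else x.-1) (c := fun=> cid1 Q)
  (erefl _) (erefl _)) => i s t si.
have [] := face_jump (i : nat) (proj1 (andP jk)).
set i' := (if (_ <= _)%N then _ else _) => i'0 bumpE.
have s1 := gcoord_dim1 si; move/gcoordP: si => [es fs].
have ff x : surj_fun s (face (k := k.+1) j x) = ((0 < i') && (i' <= x))%N.
  by rewrite fs faceE bumpE.
rewrite /Gam_entry; case: (gcoordP t i') => [[et ft]|nt].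
  rewrite gentry_id => [|x]; last by rewrite ff ft.
  by rewrite gid_in // ifT ?ccompf1 // et es i'0 eqxx.
have [e1|ne1] := pselect (forall x, surj_fun s (face (k := k.+1) j x) = surj_fun t x).
  rewrite gentry_id // gid_in // ifF //; apply/negP => /eqP e; case: nt.
  by split=> [|x]; [rewrite -e es i'0 | rewrite -e1 ff].
rewrite gentry_0 ?comp0f // => /(_ ord0); rewrite ff /=; lia.
Qed.

Lemma pf_atc_bmx m n s p b :
  pf Q m n s \oc atc m p b =
  bmx (fun (i : 'I_m) (j : 'I_n) => if s i == j then (if i == p :> nat then b else cid1 Q) else 0).
Proof.
apply: bip_ext => j; rewrite ccompA !bpr_bmx comp_suml; apply: eq_bigr => i _.
by rewrite -ccompA bpr_bmap ccompA; case: (s i == j); rewrite ?ccomp1f ?comp0f.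
Qed.

Lemma gam'_face0 (b : chom Q Q) k :
  Gam_act (two_d b) (face (k := k.+1) 0) \oc gam' k.+1 =
  gam' k \oc (pf Q k.+2 k.+1 predn \oc atc k.+2 1 b).
Proof.
rewrite pf_atc_bmx; apply: (gam'_mx (sg := predn)
  (c := fun i => if i == 1%N :> nat then b else cid1 Q) (erefl _) (erefl _)) => i s t si.
have s1 := gcoord_dim1 si; move/gcoordP: si => [es fs].
have [t0 tj tb] := surjP t.
have ff x : surj_fun s (face (k := k.+1) 0 x) = ((0 < i) && (i <= x.+1))%N.
  by rewrite fs faceE /bump /= add1n.
(* Along the face that misses 0, the map that jumps at 1 becomes constant with value 1. It misses 0,
   and this is the only case in which the differential [b] enters. *)
rewrite /Gam_entry; have [i1|i1] := eqVneq (i : nat) 1%N.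
  have e0 : ~ (forall x, surj_fun s (face (k := k.+1) 0 x) = surj_fun t x).
    by move=> /(_ ord0); rewrite ff i1 surj_fun0.
  rewrite i1 /=; case: gcoordP => [[et ft]|nt].
    rewrite gentry_d => [|x]; last by rewrite ff i1 ft.
    by move: et es; rewrite i1 /=; move=> -> ->; rewrite gdiffE /= ccomp1f ccompf1.
  have [e1|ne1] := pselect (forall x, surj_fun s (face (k := k.+1) 0 x) = (surj_fun t x).+1).
    case: nt; have ft x : surj_fun t x = 0%N by move: (e1 x); rewrite ff i1 /= => -[].
    split=> //; case: (posnP (surj_dim t)) => // dt.
    by have [x] := tj 1%N dt; rewrite ft.
  by rewrite gentry_0 ?comp0f.
rewrite ccompf1.
have i'0 : (0 < i.-1)%N = (0 < i)%N by move: i1; case: (nat_of_ord i) => [|[]].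
have ff' x : surj_fun s (face (k := k.+1) 0 x) = ((0 < i.-1) && (i.-1 <= x))%N.
  by rewrite ff; move: i1; case: (nat_of_ord i) => [|[]].
case: gcoordP => [[et ft]|nt].
  rewrite gentry_id => [|x]; last by rewrite ff' ft.
  by rewrite gid_in // ifT // et es i'0 eqxx.
have [e1|ne1] := pselect (forall x, surj_fun s (face (k := k.+1) 0 x) = surj_fun t x).
  rewrite gentry_id // gid_in // ifF //; apply/negP => /eqP e; case: nt.
  by split=> [|x]; [rewrite -e es i'0 | rewrite -e1 ff'].
rewrite gentry_0 ?comp0f // => /(_ ord0); rewrite ff' /=.
by case: (i.-1).
Qed.

Lemma gam_face (d : forall k, chom (two_gr Q k.+1) (two_gr Q k)) k j : (0 < j <= k.+1)%N ->
  gam k \oc Gam_act d (face (k := k.+1) j) =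
  pf Q k.+2 k.+1 (fun x => if (x <= j)%N then x else x.-1) \oc gam k.+1.
Proof.
move=> jk; symmetry; apply: iso_square (gam'_gam k.+1) (gam_gam' k) _.
exact: gam'_face.
Qed.

Lemma gam_face0 (b : chom Q Q) k :
  gam k \oc Gam_act (two_d b) (face (k := k.+1) 0) =
  pf Q k.+2 k.+1 predn \oc atc k.+2 1 b \oc gam k.+1.
Proof. by symmetry; apply: iso_square (gam'_gam k.+1) (gam_gam' k) _; apply: gam'_face0. Qed.

Lemma gam_map (f : chom Q Q) k :
  gam k \oc Gam_map (two_map f) k = bmap (fun _ : 'I_k.+1 => f) \oc gam k.
Proof.
apply: bmx_bmap => s i; case: ifP => _; last by rewrite comp0f compf0.
by case: (surj_dim s) => [|[|p]] /=; rewrite ?ccomp1f ?ccompf1 ?comp0f ?compf0.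
Qed.

End GammaCoordinates.

(** * Two-term complexes with automorphisms *)

Section TwoTermAut.
Variable C : acat.

Fact two_aut_comm (W : aobj C) j : act W j.+1 \oc act W 0 = act W 0 \oc act W j.+1.
Proof. exact: actC. Qed.

(** One automorphism is traded for one dimension; [m] iterations give the cube of dimension [m],
    still carrying the remaining automorphisms. *)
Definition two_aut (W : aobj C) : aobj (bcx_acat C).
Proof.
exists (two_term (act W 0)) (fun j => two_term_map (two_aut_comm W j)) => [i j|i].
  by apply: bhomP => -[|[|k]] //=; apply: actC.
apply: (@bhom_iso (@ExCat C (fun=> True) (fun _ _ _ _ _ => True))) => -[|[|k]] /=.
- exact: act_iso.
- exact: act_iso.
- exact: is_iso1.
Defined.

Definition two_aut_map (V W : aobj C) (f : ahom V W) : ahom (two_aut V) (two_aut W).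
Proof.
exists (two_term_map (ahP f 0) : @chom (bcx_cat C) (two_term (act V 0)) (two_term (act W 0))).
by move=> i; apply: bhomP => -[|[|k]] //=; apply: ahP.
Defined.

Lemma bhom_iso' (P Q : bcx_acat C) (f : chom P Q) : (forall k, is_iso (bh f k)) -> is_iso f.
Proof. exact: (@bhom_iso (@ExCat C (fun=> True) (fun _ _ _ _ _ => True))). Qed.

Lemma two_aut_map_iso (V W : aq_cat C) (f : chom V W) : is_iso f ->
  @is_iso (aq_cat (bcx_acat C)) (two_aut V) (two_aut W) (two_aut_map f).
Proof.
move=> /iso_ahf fi; apply: ahom_iso; apply: bhom_iso' => -[|[|k]] //=.
exact: is_iso1.
Qed.

Lemma zeta_xi_iso (W : aobj (bcx_acat C)) :
  exists f : @chom (aq_cat (bcx_acat C)) (zeta (xi W)) W, is_iso f.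
Proof.
pose c k : chom (gr (aob (zeta (xi W))) k) (gr (aob W) k) := cid1 (gr (aob W) k).
have cd k : c k \oc bd (aob (zeta (xi W))) k = bd (aob W) k \oc c k.+1.
  by rewrite /c ccomp1f ccompf1.
have ct k : c k \oc bt (aob (zeta (xi W))) k = bt (aob W) k \oc c k.+1.
  by rewrite /c ccomp1f ccompf1.
pose f0 : @bhom C (aob (zeta (xi W))) (aob W) := BHom cd ct.
have fP i : ccomp (c := bcx_cat C) f0 (act (zeta (xi W)) i) =
    ccomp (c := bcx_cat C) (act W i) f0.
  by apply: bhomP => k; rewrite /= /c ccomp1f ccompf1.
exists (AHom (V := zeta (xi W)) (W := W) fP).
by apply: ahom_iso; apply: bhom_iso' => k; apply: is_iso1.
Qed.

Lemma zeta_two_term_iso (V : aobj C) (b : ahom V V) (bi : @is_iso (aq_cat C) V V b) :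
  exists f : @chom (aq_cat (bcx_acat C)) (zeta (@two_term (aq_acat C) V b)) (two_aut (acons bi)),
    is_iso f.
Proof.
pose P : bcx C := aob (zeta (@two_term (aq_acat C) V b)).
pose R : bcx C := two_term (act (acons bi) 0).
pose f0 k : chom (gr P k) (gr R k) :=
  if k is k'.+2 return chom (gr P k) (gr R k) then 0 else cid1 (aob V).
have zz : is_zero (aob (zob (aq_acat C))) := congr1 (@ahf _ _ _) (zob_zero (aq_acat C)).
have cd k : f0 k \oc bd P k = bd R k \oc f0 k.+1.
  by case: k => [|k] /=; rewrite ?ccomp1f ?ccompf1 // compf0 comp0f.
have ct k : f0 k \oc bt P k = bt R k \oc f0 k.+1.
  by case: k => [|k] /=; rewrite ?ccomp1f ?ccompf1 // compf0 comp0f.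
pose f1 : @bhom C P R := BHom cd ct.
have fP i : ccomp (c := bcx_cat C) f1 (act (zeta (@two_term (aq_acat C) V b)) i) =
    ccomp (c := bcx_cat C) (act (two_aut (acons bi)) i) f1.
  by apply: bhomP => -[|[|k]] /=; rewrite ?ccomp1f ?ccompf1 ?comp0f.
exists (AHom (V := zeta (@two_term (aq_acat C) V b)) (W := two_aut (acons bi)) fP).
apply: ahom_iso; apply: bhom_iso' => -[|[|k]] /=; try exact: is_iso1.
by apply: zero_iso => //; apply: zob_zero.
Qed.

End TwoTermAut.

Section ZetaChi.
Variables (E : excat) (nE : nice E).
Variables (dg : Aq (Bq E) -> Prop) (G : abgroup) (chi : aobj (bcx_acat E) -> G).
Hypothesis chiA : additive_inv (X := Aq (Bq E)) dg chi.

Lemma zeta_in (P : bcx (aq_acat E)) : @ex_in (Bq (Aq E)) P -> @ex_in (Aq (Bq E)) (zeta P).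
Proof.
case=> P_in [N PN] aP tP.
have acy (d : forall k, @chom (aq_acat E) (P k.+1) (P k)) : acyclic (E := Aq E) d ->
    acyclic (E := E) (P := fun k => aob (P k)) (fun k => ahf (d k)).
  case=> Z [i [p [Z_in dE i0 ses]]].
  exists (fun k => aob (Z k)), (fun k => ahf (i k)), (fun k => ahf (p k)); split=> //.
  - by move=> k; rewrite dE.
  - exact: iso_ahf i0.
split.
- exact: P_in.
- by exists N => k Nk; exact: (congr1 (@ahf _ _ _) (PN k Nk)).
- exact: acy aP.
- exact: acy tP.
Qed.

Section ZetaMap.
Variables (A B : bcx (aq_acat E)) (f : bhom A B).

Definition zeta_bhom : bhom (aob (zeta A)) (aob (zeta B)) :=
  @BHom E (aob (zeta A)) (aob (zeta B)) (fun k => ahf (f k))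
    (fun k => congr1 (@ahf _ _ _) (bh_d f k)) (fun k => congr1 (@ahf _ _ _) (bh_t f k)).

Fact zeta_bhomP i : ccomp (c := bcx_cat E) zeta_bhom (act (zeta A) i) =
  ccomp (c := bcx_cat E) (act (zeta B) i) zeta_bhom.
Proof. by apply: bhomP => k /=; rewrite ahP. Qed.

Definition zeta_map : ahom (zeta A) (zeta B) := AHom (V := zeta A) (W := zeta B) zeta_bhomP.

End ZetaMap.

(** This transports the results on binary complexes to complexes whose entries carry automorphisms,
    with [Aq E] as the exact category. *)
Lemma chi_zeta_additive :
  additive_inv (X := Bq (Aq E)) (fun P => dg (zeta P)) (fun P => chi (zeta P)).
Proof.
split=> [A B D f g A_in B_in D_in ses|A A_in]; last by apply: chiA.2; apply: zeta_in.
apply: (chiA.1 _ _ _ (zeta_map f) (zeta_map g)); try exact: zeta_in.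
by move=> k; exact: (ses k).
Qed.

Lemma two_aut_in (W : aobj E) : ex_in (aob W) -> @ex_in (Aq (Bq E)) (two_aut W).
Proof. by move=> W_in; apply: (two_term_in nE W_in); apply: act_iso. Qed.

Lemma chi_two_aut_iso (V W : aq_cat E) (f : chom V W) : is_iso f -> ex_in (aob V) ->
  chi (two_aut V) = chi (two_aut W).
Proof.
move=> fi V_in; apply: (chi_iso (Aq_nice (Bq_nice nE)) chiA (two_aut_map_iso fi)).
exact: two_aut_in.
Qed.

(** As [two_aut] is exact, an invariant pulls back to one of a dimension less; this drives the
    induction on the dimension. *)
Lemma chi_two_aut_additive (dg' : Aq E -> Prop) :
  (forall W, dg' W -> dg (two_aut W)) -> additive_inv (X := Aq E) dg' (fun W => chi (two_aut W)).
Proof.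
move=> dgW; split=> [A B D f g A_in B_in D_in ses|A A_in dA].
  apply: (chiA.1 _ _ _ (two_aut_map f) (two_aut_map g)); try exact: two_aut_in.
  case=> [|[|k]] /=; try exact: ses.
  apply: (nice_proper nE).2; first exact: zob_zero.
  exact: is_iso1.
by apply: chiA.2; [exact: two_aut_in | exact: dgW].
Qed.

End ZetaChi.

Section AutPowers.
Variables (C : acat) (F : functor C C).

Definition FP_head k (W : aobj C) :
    ahom (aqF F (@pw (aq_acat C) (atail W) k.+1)) (aqF F (@pw (aq_acat C) (atail W) k.+1)) :=
  fmap (aqF F) (@atc (aq_acat C) (atail W) k.+1 0 (ahead W)).

Lemma FP_head_iso k (W : aobj C) : @is_iso (aq_cat C) _ _ (FP_head k W).
Proof. apply: functor_iso; exact: (@atc_iso (aq_acat C) _ _ _ _ (ahead_iso W)). Qed.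

(* F (W^(k+1)), where the first automorphism acts on the summand 0 only *)
Definition FP k (W : aobj C) : aobj C := acons (FP_head_iso k W).

Lemma ahf_pf (W : aobj C) m n s :
  ahf (@pf (aq_acat C) W m n s) = pf (aob W) m n s.
Proof. by rewrite ahf_bmx; apply: bmx_eq => i j; case: ifP. Qed.

Lemma ahf_atc (W : aobj C) m p (a : ahom W W) :
  ahf (@atc (aq_acat C) W m p a) = atc m p (ahf a).
Proof. by rewrite ahf_bmap; apply: bmap_eq => i; case: ifP. Qed.

Lemma ahfM (U V W : aq_acat C) (g : chom V W) (f : chom U V) :
  ahf (g \oc f) = ahf g \oc ahf f.
Proof. by []. Qed.

Lemma ahf_opu (W : aobj C) m j : ahf (@opu (aq_acat C) (aq_acat C) (aqF F) W m j) = opu F (aob W) m j.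
Proof. by rewrite /= ahf_pf. Qed.

Lemma ahf_opv (W : aobj C) m j : ahf (@opv (aq_acat C) (aq_acat C) (aqF F) W m j) = opv F (aob W) m j.
Proof. by rewrite /opv -ahf_opu. Qed.

Lemma ahf_vprod (W : aobj C) m j :
  ahf (@vprod (aq_acat C) (aq_acat C) (aqF F) W m j) = vprod F (aob W) m j.
Proof. by elim: j => [|j IH]; rewrite ?vprod0 // !vprodS ahfM IH ahf_opv. Qed.

End AutPowers.

Section NFExt.
Variables (E : excat) (nE : nice E).
Variables (dg : Aq (Bq E) -> Prop) (G : abgroup) (chi : aobj (bcx_acat E) -> G).
Hypothesis dgP : forall W : aobj (bcx_acat E), (forall k, bd (aob W) k = bt (aob W) k) -> dg W.
Hypothesis chiA : additive_inv (X := Aq (Bq E)) dg chi.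
Variables (F : functor E E) (r : nat).
Hypothesis F0 : forall A B : E, fmap F (0 : chom A B) = 0.
Hypothesis F_deg : forall Q m, (r < m)%N -> opv F Q m 0 \oc vprod F Q m r = 0.
Hypothesis F_in : forall A : E, ex_in A -> ex_in (F A).

Section Object.
Variables (W : aobj E) (W_in : ex_in (aob W)).
Hypothesis N_in : @ex_in (Bq E) (NFGam F (two_term (act W 0))).

Let Q : aq_acat E := atail W.
Let F' : functor (Aq E) (Aq E) := aqF F.
Let M : bcx (aq_acat E) := xi (aqF (NFGam F) (two_aut W)).
Let chi' (P : bcx (aq_acat E)) : G := chi (zeta P).

Let chi'A : additive_inv (X := Bq (Aq E)) (fun P => dg (zeta P)) chi'.
Proof. exact: chi_zeta_additive. Qed.

Let dgP' (P : bcx (aq_acat E)) : (forall k, bd P k = bt P k) -> dg (zeta P).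
Proof. by move=> e; apply: dgP => k /=; rewrite e. Qed.

Let pw_in (V : aobj E) m : ex_in (aob V) -> ex_in (aob (@pw (aq_acat E) V m)).
Proof. by move=> V_in; apply: nice_bip nE _ _ _. Qed.

Let FQ_in m : @ex_in (Aq E) (F' (pw Q m)).
Proof. by apply: F_in; apply: pw_in. Qed.

Let F0' (A B : Aq E) : fmap F' (0 : chom A B) = 0.
Proof. by apply: ahomP; apply: F0. Qed.

Let F_deg' m : (r < m)%N -> opv F' Q m 0 \oc vprod F' Q m r = 0.
Proof.
by move=> rm; apply: ahomP; rewrite ahfM ahf_opv ahf_vprod F_deg.
Qed.

Let kap0 k : chom (Nob F (two_gr (aob W)) k) (F (pw (aob W) k.+1)) :=
  fmap F (gam (aob W) k) \oc kin (bpair (@Nface E F (two_gr (aob W)) k)).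

Lemma kap0P k j : kap0 k \oc act (M k) j = act (F' (@pw (aq_acat E) Q k.+1)) j \oc kap0 k.
Proof.
rewrite /kap0 /= -ccompA NmapE !ccompA -!fmapM; congr (fmap F _ \oc _).
exact: gam_map.
Qed.

Let kap k : @chom (aq_acat E) (M k) (F' (pw Q k.+1)) :=
  @AHom E (M k) (F' (@pw (aq_acat E) Q k.+1)) (kap0 k) (@kap0P k).

Lemma kap0_mono k Y (u v : chom Y (Nob F (two_gr (aob W)) k)) :
  kap0 k \oc u = kap0 k \oc v -> u = v.
Proof.
rewrite /kap0 -!ccompA => /(congr1 (fun z => fmap F (gam' (aob W) k) \oc z)).
by rewrite !ccompA -!fmapM gam'_gam fmap1 !ccomp1f => /kin_mono.
Qed.

Lemma Nface_gam k (i : 'I_k.+1) :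
  fmap F (gam (aob W) k) \oc Nface F (two_gr (aob W)) (k := k.+1) i =
  opd F (aob W) k.+1 i.+1 \oc fmap F (gam (aob W) k.+1).
Proof.
by rewrite /Nface /opd -!fmapM (@gam_face _ (aob W) (fun=> 0) k i.+1 (ltn_ord i)).
Qed.

(** The computation of the normalisation over the exact category [Aq E], for the object [atail W]
    and its automorphism [ahead W]; [zeta] and [xi] translate between the two kinds of complexes. *)
Lemma chi_NF_tt : chi (aqF (NFGam F) (two_aut W)) = ext r (fun k => chi (two_aut (FP F k W))) /\
  poly r (fun k => chi (two_aut (FP F k W))).
Proof.
have powE k : @chi_pow (Aq E) G chi' F' Q (ahead W) k = chi (two_aut (FP F k W)).
  have [f fi] := zeta_two_term_iso (FP_head_iso F k W).
  apply: (chi_iso (Aq_nice (Bq_nice nE)) chiA fi).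
  apply: zeta_in; apply: (two_term_in (Aq_nice nE)); first exact: FQ_in.
  exact: FP_head_iso.
have nA := Aq_nice nE.
have hi : @is_iso (aq_cat E) _ _ (ahead W) := ahead_iso W.
split; last first.
  by apply: poly_ext_eq powE _; apply: (poly_chi_pow nA dgP' chi'A hi FQ_in F_deg').
rewrite -(ext_eq r powE).
have [f fi] := zeta_xi_iso (aqF (NFGam F) (two_aut W)).
have -> : chi (aqF (NFGam F) (two_aut W)) = chi' M.
  have [f' [f'f ff']] := fi.
  apply: (chi_iso (X := Aq (Bq E)) (Aq_nice (Bq_nice nE)) chiA (f := f')); first by exists f.
  exact: N_in.
apply: (chi_normalisation_ext nA dgP' chi'A hi FQ_in F_deg' F0' (kap := kap)).
- have [_ [N NP] _ _] := N_in; exists N => k Nk; apply: ahomP; exact: NP.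
- move=> k Y u v uv; apply: ahomP; apply: kap0_mono; exact: (congr1 (@ahf _ _ _) uv).
- case=> [|k] [|j] // jk; apply: ahomP; rewrite /= ahf_pf /kap0 ccompA.
  rewrite -[X in X \oc _](Nface_gam (Ordinal (jk : (j < k.+1)%N))).
  by rewrite -ccompA Nface_kin compf0.
- move=> k Y f1 f1d.
  have f0 : bpair (@Nface E F (two_gr (aob W)) k) \oc (fmap F (gam' (aob W) k) \oc ahf f1) = 0.
    apply: bpair_eq0; case: k f1 f1d => [|k] f1 f1d [j jk] //; rewrite ccompA.
    have -> : Nface F (two_gr (aob W)) (Ordinal jk) \oc fmap F (gam' (aob W) k.+1) =
        fmap F (gam' (aob W) k) \oc opd F (aob W) k.+1 j.+1.
      have e := Nface_gam (Ordinal jk); move: (Nface F _ _) e => nf e.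
      rewrite -[nf]ccomp1f -(fmap1 F) -gam'_gam fmapM -!ccompA.
      by rewrite (ccompA (fmap F (gam (aob W) k))) e -!ccompA -fmapM gam_gam' fmap1 ccompf1.
    rewrite -ccompA.
    have := congr1 (@ahf _ _ _) (f1d j.+1 jk); rewrite /= ahf_pf => ->.
    exact: compf0.
  have kl : kap0 k \oc klift f0 = ahf f1.
    by rewrite /kap0 -ccompA kliftK ccompA -fmapM gam_gam' fmap1 ccomp1f.
  have klP i : klift f0 \oc act Y i = act (M k) i \oc klift f0.
    by apply: kap0_mono; rewrite !ccompA kl kap0P (comp_eqr kl); exact: (ahP f1 i).
  by exists (@AHom E Y (M k) (klift f0) klP); apply: ahomP.
- move=> k; apply: ahomP; rewrite /= ahf_pf ahf_atc /kap0 -ccompA NdiffE !ccompA -!fmapM.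
  by rewrite gam_face0.
- move=> k; apply: ahomP; rewrite /= ahf_pf ahf_atc /kap0 -ccompA NdiffE !ccompA -!fmapM.
  by rewrite gam_face0.
Qed.

End Object.
End NFExt.

(** * Vanishing in the higher directions *)

Section Multiplicativity.
Variables (E : excat) (nE : nice E).
Variables (dg : Aq (Bq E) -> Prop) (G : abgroup) (chi : aobj (bcx_acat E) -> G).
Hypothesis dgP : forall W : aobj (bcx_acat E), (forall k, bd (aob W) k = bt (aob W) k) -> dg W.
Hypothesis chiA : additive_inv (X := Aq (Bq E)) dg chi.

Lemma chi_two_aut_acons (V : aobj E) (x : ahom V V) (xi : @is_iso (aq_cat E) V V x) :
  ex_in (aob V) -> chi (two_aut (acons xi)) = chi (zeta (@two_term (aq_acat E) V x)).
Proof.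
move=> V_in; have [f fi] := zeta_two_term_iso xi.
symmetry; apply: (chi_iso (Aq_nice (Bq_nice nE)) chiA fi).
by apply: zeta_in; apply: (two_term_in (Aq_nice nE)).
Qed.

Lemma chi_two_aut_mul (Q : E) (f f1 f2 : nat -> chom Q Q) c c1 c2 i i1 i2 : ex_in Q ->
  (forall j, f j.+1 = f1 j.+1) -> (forall j, f j.+1 = f2 j.+1) -> f 0 = f1 0 \oc f2 0 ->
  chi (two_aut (@AObj E Q f c i)) =
  abD (chi (two_aut (@AObj E Q f1 c1 i1))) (chi (two_aut (@AObj E Q f2 c2 i2))).
Proof.
move=> Q_in e1 e2 e0.
pose V := atail (@AObj E Q f c i).
have P1 j : f1 0 \oc act V j = act V j \oc f1 0 by rewrite /= e1 c1.
have P2 j : f2 0 \oc act V j = act V j \oc f2 0 by rewrite /= e2 c2.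
pose x1 : @chom (aq_acat E) V V := @AHom E V V (f1 0) P1.
pose x2 : @chom (aq_acat E) V V := @AHom E V V (f2 0) P2.
have x1i : @is_iso (aq_cat E) V V x1 by apply: ahom_iso; apply: i1.
have x2i : @is_iso (aq_cat E) V V x2 by apply: ahom_iso; apply: i2.
have x12i : @is_iso (aq_cat E) V V (x1 \oc x2) by apply: iso_comp.
(* A family agrees with [acons] of its head pointwise, so the identity map is used as an
   isomorphism. *)
have red (g : nat -> chom Q Q) cg ig (y : @chom (aq_acat E) V V) (yi : @is_iso (aq_cat E) V V y) :
    (forall j, g j.+1 = f j.+1) -> g 0 = ahf y ->
    chi (two_aut (@AObj E Q g cg ig)) = chi (two_aut (acons yi)).
  move=> gS g0.
  have P j : cid1 Q \oc act (@AObj E Q g cg ig) j = act (acons yi) j \oc cid1 Q.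
    by rewrite ccomp1f ccompf1; case: j => [|j] //=; rewrite gS.
  apply: (chi_two_aut_iso nE chiA (f := @AHom E (@AObj E Q g cg ig) (acons yi) (cid1 Q) P)) => //.
  by apply: ahom_iso; apply: is_iso1.
rewrite (red _ _ _ _ x12i) // (red f1 _ _ _ x1i) // (red f2 _ _ _ x2i) //.
rewrite !chi_two_aut_acons //.
apply: (chi_two_term_mul (Aq_nice nE) _ (chi_zeta_additive chiA) (W := V)) => //.
by move=> P e; apply: dgP => k /=; rewrite e.
Qed.

End Multiplicativity.

(** * Bilinearity on powers indexed by a finite set *)

Section Grid.
Variables (D : excat) (nD : nice D).
Variables (dg : Aq (Bq (Bq D)) -> Prop) (G : abgroup) (chi : aobj (bcx_acat (bcx_acat D)) -> G).
Hypothesis dgP : forall W : aobj (bcx_acat (bcx_acat D)),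
  (forall k, bd (aob W) k = bt (aob W) k) -> dg W.
Hypothesis dgP' : forall W : aobj (bcx_acat D),
  (forall k, bd (aob W) k = bt (aob W) k) -> dg (two_aut W).
Hypothesis chiA : additive_inv (X := Aq (Bq (Bq D))) dg chi.
Variables (F : functor D D) (F_in : forall A : D, ex_in A -> ex_in (F A)).
Variables (Q : aobj D) (Q_in : ex_in (aob Q)).

Let chi_two_aut_additive' :
  additive_inv (X := Aq (Bq D)) (fun W => forall k, bd (aob W) k = bt (aob W) k) (fun W => chi (two_aut W)).
Proof. by apply: (chi_two_aut_additive (Bq_nice nD) chiA). Qed.

Definition sel (I : Type) (s t : pred I) (j : nat) (i : I) : bool :=
  if j is j'.+1 then (if j' is _.+1 then true else t i) else s i.

Definition sel_act (I : finType) (s t : pred I) (j : nat) :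
    chom (bip (fun _ : I => aob Q)) (bip (fun _ : I => aob Q)) :=
  bmap (fun i => if sel s t j i then act Q j else cid1 (aob Q)).

Fact sel_actC (I : finType) (s t : pred I) i j :
  fmap F (sel_act s t i) \oc fmap F (sel_act s t j) = fmap F (sel_act s t j) \oc fmap F (sel_act s t i).
Proof.
rewrite -!fmapM -!bmapM; congr fmap; apply: bmap_eq => k.
by case: ifP => _; case: ifP => _; rewrite ?ccomp1f ?ccompf1 //; apply: actC.
Qed.

Fact sel_act_iso (I : finType) (s t : pred I) j : is_iso (fmap F (sel_act s t j)).
Proof.
apply: functor_iso; apply: bmap_iso => i; case: ifP => _; [exact: act_iso | exact: is_iso1].
Qed.

(* F (Q^I), where the first automorphism acts on the summands in s and the second one on
   those in t *)
Definition grid (I : finType) (s t : pred I) : aobj D :=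
  @AObj D _ _ (@sel_actC I s t) (@sel_act_iso I s t).

Definition chi_grid (I : finType) (s t : pred I) : G := chi (two_aut (two_aut (grid s t))).

Lemma grid_in (I : finType) (s t : pred I) : ex_in (aob (grid s t)).
Proof. by apply: F_in; apply: nice_bip nD _ _ _. Qed.

Lemma chi_two_aut2_iso (V W : aq_cat D) (f : chom V W) : is_iso f -> ex_in (aob V) ->
  chi (two_aut (two_aut V)) = chi (two_aut (two_aut W)).
Proof.
have a : additive_inv (X := Aq D) (fun=> False) (fun W => chi (two_aut (two_aut W))).
  by apply: (chi_two_aut_additive nD chi_two_aut_additive').
exact: (chi_iso (Aq_nice nD) a).
Qed.

Lemma chi_grid_perm (I J : finType) (f : J -> I) (g : I -> J) (s t : pred I) (s' t' : pred J) :
  cancel f g -> cancel g f -> (forall j, s' j = s (f j)) -> (forall j, t' j = t (f j)) ->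
  chi_grid s' t' = chi_grid s t.
Proof.
move=> fK gK es et.
pose M (i : J) (j : I) : chom (aob Q) (aob Q) := if f i == j then cid1 (aob Q) else 0.
pose N (j : I) (i : J) : chom (aob Q) (aob Q) := if f i == j then cid1 (aob Q) else 0.
have MP k : fmap F (bmx M) \oc act (grid s' t') k = act (grid s t) k \oc fmap F (bmx M).
  rewrite /= -!fmapM; congr fmap; apply: bmx_bmap => i j; rewrite /M.
  case: eqP => [<-|_]; last by rewrite comp0f compf0.
  by rewrite ccomp1f ccompf1; case: k => [|[|k]] /=; rewrite ?es ?et.
apply: (chi_two_aut2_iso (f := @AHom D (grid s' t') (grid s t) _ MP)); last exact: grid_in.
apply: ahom_iso; apply: functor_iso; exists (bmx N); split; rewrite bmxM; apply: bmx_delta.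
- move=> i; rewrite (bigD1 (f i)) //= /M /N eqxx ccomp1f big1 ?addr0 // => j ji.
  by rewrite eq_sym (negbTE ji) comp0f.
- move=> i j ij; rewrite big1 // => k _; rewrite /M /N.
  case: eqP => [e1|_]; last by rewrite comp0f.
  case: eqP => [e2|_]; last by rewrite compf0.
  by case/eqP: ij; apply: (can_inj fK); rewrite e1 e2.
- move=> i; rewrite (bigD1 (g i)) //= /M /N gK eqxx ccomp1f big1 ?addr0 // => j ji.
  rewrite ifF ?comp0f //; apply: contraNF ji => /eqP <-; by rewrite fK.
- move=> i j ij; rewrite big1 // => k _; rewrite /M /N.
  case: eqP => [e1|_]; last by rewrite comp0f.
  case: eqP => [e2|_]; last by rewrite compf0.
  by case/eqP: ij; rewrite -e1 -e2.
Qed.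

Lemma sel_actD (I : finType) (s1 t1 s2 t2 s t : pred I) k :
  (forall i, sel s t k i = sel s1 t1 k i (+) sel s2 t2 k i) ->
  (forall i, ~~ (sel s1 t1 k i && sel s2 t2 k i)) ->
  sel_act s t k = sel_act s1 t1 k \oc sel_act s2 t2 k.
Proof.
move=> e d; rewrite -bmapM; apply: bmap_eq => i; rewrite e; move: (d i).
by case: sel; case: sel => //= _; rewrite ?ccomp1f ?ccompf1.
Qed.

Lemma chi_gridDl (I : finType) (s1 s2 s t : pred I) :
  (forall i, s i = s1 i (+) s2 i) -> (forall i, ~~ (s1 i && s2 i)) ->
  chi_grid s t = abD (chi_grid s1 t) (chi_grid s2 t).
Proof.
move=> e d; apply: (chi_two_aut_mul nD _ chi_two_aut_additive') => //.
- by apply: F_in; apply: nice_bip nD _ _ _.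
- by rewrite -fmapM; congr fmap; apply: sel_actD.
Qed.

(** The second automorphism is the outer differential, so multiplicativity is applied to
    automorphisms of a two-term complex, one level above [chi_gridDl]. *)
Lemma chi_gridDr (I : finType) (s t1 t2 t : pred I) :
  (forall i, t i = t1 i (+) t2 i) -> (forall i, ~~ (t1 i && t2 i)) ->
  chi_grid s t = abD (chi_grid s t1) (chi_grid s t2).
Proof.
move=> e d; rewrite /chi_grid.
apply: (@chi_two_aut_mul (Bq D) (Bq_nice nD) dg G chi dgP chiA (two_term (act (grid s t) 0))
  (act (two_aut (grid s t))) (act (two_aut (grid s t1))) (act (two_aut (grid s t2)))) => //.
- exact: (two_aut_in nD (grid_in s t)).
- by move=> j; apply: (@bhomP D (two_term _) (two_term _)) => -[|[|k]].
- by move=> j; apply: (@bhomP D (two_term _) (two_term _)) => -[|[|k]].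
- have e1 : act (grid s t) 1 = act (grid s t1) 1 \oc act (grid s t2) 1.
    by rewrite /= -fmapM; congr fmap; apply: sel_actD.
  by apply: (@bhomP D (two_term _) (two_term _)) => -[|[|k]] //=; rewrite ccomp1f.
Qed.

Lemma chi_grid0l (I : finType) (t : pred I) : chi_grid (fun=> false) t = ab0.
Proof. by apply: (@abDI _ (chi_grid (fun=> false) t)); rewrite abD0; symmetry; apply: chi_gridDl. Qed.

Lemma chi_grid0r (I : finType) (s : pred I) : chi_grid s (fun=> false) = ab0.
Proof. by apply: (@abDI _ (chi_grid s (fun=> false))); rewrite abD0; symmetry; apply: chi_gridDr. Qed.

Lemma chi_grid_eq (I : finType) (s t s' t' : pred I) : (forall i, s i = s' i) ->
  (forall i, t i = t' i) -> chi_grid s t = chi_grid s' t'.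
Proof. by move=> es et; apply: (@chi_grid_perm _ _ id id). Qed.

Lemma chi_grid_row_col l k :
  chi_grid (fun p : 'I_l.+1 * 'I_k.+1 => p.1 == ord0) (fun p : 'I_l.+1 * 'I_k.+1 => p.2 == ord0) =
  chi_grid (fun p : 'I_l.+1 * 'I_k.+1 => p == (ord0, ord0)) (fun=> true).
Proof.
have key m : (m <= k.+1)%N ->
    chi_grid (fun p : 'I_l.+1 * 'I_k.+1 => (p.1 == ord0) && (p.2 < m)%N) (fun p : 'I_l.+1 * 'I_k.+1 => p.2 == ord0) =
    chi_grid (fun p : 'I_l.+1 * 'I_k.+1 => p == (ord0, ord0)) (fun p : 'I_l.+1 * 'I_k.+1 => (p.2 < m)%N).
  elim: m => [_|m IH mk].
    rewrite (@chi_grid_eq _ _ _ (fun=> false) (fun p : 'I_l.+1 * 'I_k.+1 => p.2 == ord0)); last by [].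
      rewrite chi_grid0l (@chi_grid_eq _ _ _ (fun p : 'I_l.+1 * 'I_k.+1 => p == (ord0, ord0)) (fun=> false)) //.
      by rewrite chi_grid0r.
    by move=> p; rewrite ltn0 andbF.
  pose o := Ordinal mk.
  rewrite (@chi_gridDl _ (fun p : 'I_l.+1 * 'I_k.+1 => (p.1 == ord0) && (p.2 < m)%N)
    (fun p : 'I_l.+1 * 'I_k.+1 => (p.1 == ord0) && (p.2 == o))).
  - rewrite (IH (ltnW mk)) [RHS](@chi_gridDr _ _
      (fun p : 'I_l.+1 * 'I_k.+1 => (p.2 < m)%N) (fun p : 'I_l.+1 * 'I_k.+1 => p.2 == o)).
    + congr abD.
      pose sw (i : 'I_k.+1) := if i == ord0 then o else if i == o then ord0 else i.
      have swK : involutive sw.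
        move=> i; rewrite /sw; case: (eqVneq i ord0) => [->|i0].
          by case: eqVneq => [->//|_]; rewrite eqxx.
        by case: (eqVneq i o) => [->|io]; rewrite ?eqxx // (negbTE i0) (negbTE io).
      pose f (p : 'I_l.+1 * 'I_k.+1) := (p.1, sw p.2).
      have fK : involutive f by move=> [p q]; rewrite /f /= swK.
      apply: (chi_grid_perm fK fK) => -[p q] /=.
      * rewrite /f xpair_eqE /sw; congr (_ && _).
        case: (eqVneq q ord0) => [->|q0]; first by rewrite eq_sym.
        by case: (eqVneq q o) => // qo; rewrite (negbTE q0).
      * rewrite /sw; case: (eqVneq q ord0) => [_|q0]; first by rewrite eqxx.
        case: (eqVneq q o) => [qo|qo]; last by rewrite (negbTE qo).
        by rewrite -qo eq_sym (negbTE q0).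
    + move=> p; rewrite -val_eqE /=; lia.
    + by move=> p; rewrite -val_eqE /=; lia.
  - move=> p; case: (p.1 == ord0) => //=; rewrite -val_eqE /=; lia.
  - by move=> p; case: (p.1 == ord0) => //=; rewrite -val_eqE /=; lia.
have := key k.+1 (leqnn _).
rewrite (@chi_grid_eq _ _ _ (fun p : 'I_l.+1 * 'I_k.+1 => p.1 == ord0) (fun p : 'I_l.+1 * 'I_k.+1 => p.2 == ord0)) //.
  move=> ->; apply: chi_grid_eq => // p; exact: ltn_ord.
by move=> p; rewrite ltn_ord andbT.
Qed.

(** When the second automorphism acts everywhere, only the number of summands matters. The form
    [.-1.+1] provides the successor that the later extrapolation along [(k + 1)(l + 1) - 1]
    expects. *)
Lemma chi_grid_line l k :
  chi_grid (fun p : 'I_l.+1 * 'I_k.+1 => p == (ord0, ord0)) (fun=> true) =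
  chi_grid (fun i : 'I_(k.+1 * l.+1).-1.+1 => i == ord0) (fun=> true).
Proof.
have Nl (p : 'I_l.+1 * 'I_k.+1) : (p.1 * k.+1 + p.2 < (k.+1 * l.+1).-1.+1)%N.
  case: p => -[p pl] [q qk] /=; nia.
pose f p := Ordinal (Nl p).
pose g (i : 'I_(k.+1 * l.+1).-1.+1) : 'I_l.+1 * 'I_k.+1 :=
  (inord (i %/ k.+1), inord (i %% k.+1)).
have fK : cancel f g.
  move=> [p q]; rewrite /f /g /= divnMDl // divn_small ?ltn_ord // addn0.
  by rewrite modnMDl modn_small ?ltn_ord // !inord_val.
have gK : cancel g f.
  move=> i; apply: val_inj; rewrite /f /g /= !inordK ?ltn_pmod //.
    by rewrite -divn_eq.
  by rewrite ltn_divLR //; case: i => i /=; nia.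
apply: (chi_grid_perm fK gK) => // p.
rewrite -(can_eq fK); congr (_ == _); exact: val_inj.
Qed.

End Grid.

Definition id_functor (C : category) : functor C C :=
  @Functor C C id (fun A B f => f) (fun A => erefl) (fun A B D g f => erefl).

Section BipTwoTerm.
Variables (C : acat) (I : finType) (Q : C) (a : chom Q Q).

Let P : bcx_acat C := bip (a := bcx_acat C) (fun _ : I => two_term a).
Let R : bcx_acat C := two_term (bmap (fun _ : I => a)).

Let f0 k : chom (gr P k) (gr R k) :=
  if k is k'.+2 return chom (gr P k) (gr R k) then 0 else cid1 (bip (fun _ : I => Q)).

Fact bip_two_term_d k : f0 k \oc bd P k = bd R k \oc f0 k.+1.
Proof.
case: k => [|k]; first by rewrite /= ccomp1f ccompf1.
have z : is_zero (gr P k.+2) by apply: (bip_zero (C := C)) => i; apply: zob_zero.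
by rewrite [LHS](zero_from _ z) [RHS](zero_from _ z).
Qed.

Fact bip_two_term_t k : f0 k \oc bt P k = bt R k \oc f0 k.+1.
Proof.
case: k => [|k]; first by rewrite /= ccomp1f ccompf1 bmap1.
have z : is_zero (gr P k.+2) by apply: (bip_zero (C := C)) => i; apply: zob_zero.
by rewrite [LHS](zero_from _ z) [RHS](zero_from _ z).
Qed.

Definition bip_two_term : chom P R := @BHom C P R _ bip_two_term_d bip_two_term_t.

Lemma bip_two_term_iso : is_iso bip_two_term.
Proof.
apply: bhom_iso' => -[|[|k]] /=; try exact: is_iso1.
by apply: zero_iso; [apply: bip_zero => i; apply: zob_zero | apply: zob_zero].
Qed.

Lemma bip_two_term_map (b : I -> chom Q Q) (c : chom (bip (fun _ : I => Q)) (bip (fun _ : I => Q)))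
    (ba : forall i, b i \oc a = a \oc b i)
    (ca : c \oc bmap (fun _ : I => a) = bmap (fun _ : I => a) \oc c) : c = bmap b ->
  bip_two_term \oc bmap (C := bcx_acat C)
    (fun i => two_term_map (ba i) : @chom (bcx_acat C) (two_term a) (two_term a)) =
  (two_term_map ca : chom R R) \oc bip_two_term.
Proof.
move=> cb; apply: (@bhomP C P R) => k.
have -> : bh (bip_two_term \oc bmap (C := bcx_acat C)
      (fun i => two_term_map (ba i) : @chom (bcx_acat C) (two_term a) (two_term a))) k =
    f0 k \oc bmap (fun i => two_map (b i) k).
  rewrite /= /bmap bh_sum; congr (_ \oc _).
case: k => [|[|k]]; try by rewrite /= ccomp1f ccompf1 cb.
have z : is_zero (gr P k.+2) by apply: (bip_zero (C := C)) => i; apply: zob_zero.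
by rewrite [LHS](zero_from _ z) [RHS](zero_from _ z).
Qed.

End BipTwoTerm.

Section BipBip.
Variables (C : acat) (I J : finType) (Q : C).

Let bip2 := bip (fun _ : I => bip (fun _ : J => Q)).
Let bipX := bip (fun _ : I * J => Q).

Definition bip_flat : chom bip2 bipX :=
  bpair (fun p : I * J => bpr (fun _ : J => Q) p.2 \oc bpr (fun _ : I => bip (fun _ : J => Q)) p.1).

Lemma bip_flat_iso : is_iso bip_flat.
Proof.
pose g : chom bipX bip2 := bpair (fun i : I => bpair (fun j : J => bpr (fun _ : I * J => Q) (i, j))).
exists g; split.
  apply: bip_ext => i; rewrite ccompA bpr_bpair ccompf1; apply: bip_ext => j.
  by rewrite ccompA !bpr_bpair.
by apply: bip_ext => -[i j]; rewrite ccompA bpr_bpair ccompf1 /= -ccompA !bpr_bpair.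
Qed.

Lemma bip_flat_map (b : I -> J -> chom Q Q) (c : I * J -> chom Q Q) : (forall i j, b i j = c (i, j)) ->
  bip_flat \oc bmap (fun i => bmap (b i)) = bmap c \oc bip_flat.
Proof.
move=> e; apply: bip_ext => -[i j].
rewrite !ccompA bpr_bmap bpr_bpair -[RHS]ccompA bpr_bpair /= -e.
by rewrite -ccompA bpr_bmap !ccompA bpr_bmap.
Qed.

End BipBip.

Lemma act_aqF (C D : category) (F : functor C D) (W : aobj C) j : act (aqF F W) j = fmap F (act W j).
Proof. by []. Qed.

Section ActFP.
Variables (C : acat) (F : functor C C).

Lemma act_FP0 k (W : aobj C) : act (FP F k W) 0 = fmap F (atc k.+1 0 (act W 0)).
Proof. exact: (congr1 (fmap F) (ahf_atc _ _ _)). Qed.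

Lemma act_FPS k (W : aobj C) j : act (FP F k W) j.+1 = fmap F (bmap (fun _ : 'I_k.+1 => act W j.+1)).
Proof. by []. Qed.

End ActFP.

Section Vanishing.
Variables (D : excat) (nD : nice D).
Variables (dg : Aq (Bq (Bq D)) -> Prop) (G : abgroup) (chi : aobj (bcx_acat (bcx_acat D)) -> G).
Hypothesis dgP : forall W : aobj (bcx_acat (bcx_acat D)),
  (forall k, bd (aob W) k = bt (aob W) k) -> dg W.
Hypothesis dgP' : forall W : aobj (bcx_acat D),
  (forall k, bd (aob W) k = bt (aob W) k) -> dg (two_aut W).
Hypothesis chiA : additive_inv (X := Aq (Bq (Bq D))) dg chi.
Variables (F : functor D D) (r : nat).
Hypothesis F0 : forall A B : D, fmap F (0 : chom A B) = 0.
Hypothesis F_deg : forall Q m, (r < m)%N -> opv F Q m 0 \oc vprod F Q m r = 0.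
Hypothesis F_in : forall A : D, ex_in A -> ex_in (F A).
Hypothesis NF0 : forall A B : bcx_acat D, fmap (NFGam F) (0 : chom A B) = 0.
Hypothesis NF_deg : forall Q m, (r < m)%N -> opv (NFGam F) Q m 0 \oc vprod (NFGam F) Q m r = 0.
Hypothesis NF_in : forall A : Bq D, ex_in A -> @ex_in (Bq D) (NFGam F A).
Hypothesis NNF_in : forall A : Bq (Bq D), ex_in A -> @ex_in (Bq (Bq D)) (NFGam (NFGam F) A).
Variables (Q : aobj D) (Q_in : ex_in (aob Q)).

Let chi_two_aut' (W : aobj (bcx_acat D)) := chi (two_aut W).

Let chi_two_aut'A : additive_inv (X := Aq (Bq D)) (fun W => forall k, bd (aob W) k = bt (aob W) k) chi_two_aut'.
Proof. by apply: (chi_two_aut_additive (Bq_nice nD) chiA). Qed.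

(** A power of a two-term complex is the two-term complex of the power. The first automorphism, now
    the differential, acts on all summands, and the next one on the summand 0 only. *)
Let Qk k : aobj D := grid (id_functor D) Q (fun=> true) (fun i : 'I_k.+1 => i == ord0).

Let Qk_in k : ex_in (aob (Qk k)).
Proof. by apply: nice_bip nD _ _ _. Qed.

Let NF_two_term_in (W : aobj D) : ex_in (aob W) -> @ex_in (Bq D) (NFGam F (two_term (act W 0))).
Proof. by move=> W_in; apply: NF_in; apply: two_aut_in. Qed.

(** This exhibits each term of the outer extrapolation as the class of a normalisation over
    $Q^{k+1}$, to which [chi_NF_tt] applies again. *)
Lemma chi_FP_tt k : chi (two_aut (FP (NFGam F) k (two_aut Q))) = chi (two_aut (aqF (NFGam F) (two_aut (Qk k)))).
Proof.
pose u := bip_two_term 'I_k.+1 (act Q 0).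
have uP j : fmap (NFGam F) u \oc act (FP (NFGam F) k (two_aut Q)) j =
    act (aqF (NFGam F) (two_aut (Qk k))) j \oc fmap (NFGam F) u.
  case: j => [|j].
    rewrite act_FP0 act_aqF -!fmapM; congr fmap.
    have cm (i : 'I_k.+1) : (if i == 0%N :> nat then act Q 1 else cid1 (aob Q)) \oc act Q 0 =
        act Q 0 \oc (if i == 0%N :> nat then act Q 1 else cid1 (aob Q)).
      by case: ifP => _; rewrite ?ccomp1f ?ccompf1 //; apply: actC.
    rewrite -(bip_two_term_map cm) //; congr (_ \oc _); apply: bmap_eq => i.
    by apply: (@bhomP D (two_term _) (two_term _)) => -[|[|l]] /=; case: ifP.
  rewrite act_FPS act_aqF -!fmapM; congr fmap.
  by rewrite -(bip_two_term_map (fun=> two_aut_comm Q j.+1)).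
apply: (chi_two_aut_iso (Bq_nice nD) chiA
  (f := @AHom (bcx_cat D) (FP (NFGam F) k (two_aut Q)) (aqF (NFGam F) (two_aut (Qk k))) _ uP)).
  by apply: ahom_iso; apply: functor_iso; apply: bip_two_term_iso.
apply: NF_in; apply: (nice_bip (Bq_nice nD)) => i; exact: (two_aut_in nD Q_in).
Qed.

(** A power of a power is indexed by a rectangle, with the first automorphism on a row and the
    second one on a column. *)
Lemma chi_FP_Qk k l : chi (two_aut (two_aut (FP F l (Qk k)))) =
  chi_grid chi F Q (fun p : 'I_l.+1 * 'I_k.+1 => p.1 == ord0) (fun p => p.2 == ord0).
Proof.
pose u := bip_flat 'I_l.+1 'I_k.+1 (aob Q).
pose V := grid F Q (fun p : 'I_l.+1 * 'I_k.+1 => p.1 == ord0) (fun p => p.2 == ord0).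
have uP j : fmap F u \oc act (FP F l (Qk k)) j = act V j \oc fmap F u.
  case: j => [|j].
    rewrite act_FP0 -!fmapM; congr fmap.
    rewrite /sel_act /= -(bip_flat_map (b := fun i j => if i == ord0 then act Q 0 else cid1 (aob Q))) //.
    congr (_ \oc _); apply: bmap_eq => i; rewrite -val_eqE /=.
    by case: ifP => //= _; rewrite bmap1.
  rewrite act_FPS -!fmapM; congr fmap.
  by rewrite /sel_act -(bip_flat_map (b := fun i j' =>
    if sel (fun=> true) (fun i : 'I_k.+1 => i == ord0) j.+1 j' then act Q j.+1 else cid1 (aob Q))).
apply: (chi_two_aut2_iso nD dgP' chiA (f := @AHom D (FP F l (Qk k)) V _ uP)).
  by apply: ahom_iso; apply: functor_iso; apply: bip_flat_iso.
by apply: F_in; apply: nice_bip nD _ _ _ => i; apply: nice_bip nD _ _ _.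
Qed.

Lemma chi_FP_grid l : chi (two_aut (two_aut (FP F l Q))) =
  chi_grid chi F Q (fun i : 'I_l.+1 => i == ord0) (fun=> true).
Proof.
pose V := grid F Q (fun i : 'I_l.+1 => i == ord0) (fun=> true).
have uP j : cid1 _ \oc act (FP F l Q) j = act V j \oc cid1 _.
  rewrite ccomp1f ccompf1; case: j => [|[|j]] //.
  by rewrite act_FP0.
apply: (chi_two_aut2_iso nD dgP' chiA (f := @AHom D (FP F l Q) V _ uP)).
  by apply: ahom_iso; apply: is_iso1.
by apply: F_in; apply: nice_bip nD _ _ _.
Qed.

(* The right hand side is the first term of the extrapolation ext r that computes the left
   hand side. Its k-th term only involves automorphisms of a power of Q indexed by a
   rectangle with k + 1 columns, and bilinearity and invariance under permutations rewrite
   the inner extrapolation as one along the progression (k + 1) (l + 1) - 1, whose value at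
   l = - 1 does not depend on k. So all terms agree. *)
Lemma chi_NF_NF : chi (aqF (NFGam (NFGam F)) (two_aut (two_aut Q))) = chi (two_aut (aqF (NFGam F) (two_aut Q))).
Proof.
have two_autQ_in := two_aut_in nD Q_in.
have [e pol] := chi_NF_tt nD (fun W h => h) chi_two_aut'A F0 F_deg F_in Q_in (NF_two_term_in Q_in).
have ek k : chi (two_aut (FP (NFGam F) k (two_aut Q))) = chi (two_aut (aqF (NFGam F) (two_aut Q))).
  rewrite chi_FP_tt.
  have [e' _] := chi_NF_tt nD (fun W h => h) chi_two_aut'A F0 F_deg F_in (Qk_in k) (NF_two_term_in (Qk_in k)).
  apply: (etrans e'); apply: (etrans _ (esym e)).
  rewrite -(ext_mul k pol); apply: ext_eq => l; rewrite /chi_two_aut'.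
  rewrite chi_FP_Qk chi_FP_grid (chi_grid_row_col nD dgP dgP' chiA F_in Q_in).
  exact: (chi_grid_line nD dgP' chiA F_in Q_in).
have [-> pol'] := chi_NF_tt (Bq_nice nD) dgP chiA NF0 NF_deg NF_in two_autQ_in
  (NNF_in (two_aut_in (Bq_nice nD) two_autQ_in)).
(* The sequence is constant by [ek], and [ext_shift] evaluates the extrapolation of a constant
   polynomial sequence. *)
by rewrite (ext_eq r ek); apply: (ext_shift (poly_ext_eq ek pol')).
Qed.

End Vanishing.

(** * Degrees of functors *)

Section PolynomialMaps.
Variables (U V : zmodType).
Implicit Types phi psi : U -> V.

(* Polynomial of degree less than n: all n-fold iterated differences vanish *)
Fixpoint pdeg n phi : Prop :=
  if n is n'.+1 then forall g, pdeg n' (fun f => phi (f + g) - phi f) else forall f, phi f = 0.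

Lemma pdeg_eq n phi psi : (forall f, phi f = psi f) -> pdeg n phi -> pdeg n psi.
Proof.
elim: n phi psi => [|n IH] phi psi e /=; first by move=> h f; rewrite -e.
by move=> h g; apply: IH (h g) => f; rewrite !e.
Qed.

Lemma pdeg_add n phi psi : pdeg n phi -> pdeg n psi -> pdeg n (fun f => phi f + psi f).
Proof.
elim: n phi psi => [|n IH] phi psi /= h k; first by move=> f; rewrite h k addr0.
move=> g; apply: pdeg_eq (IH _ _ (h g) (k g)) => f /=; by rewrite opprD addrACA.
Qed.

End PolynomialMaps.

Lemma pdeg_comp (U U' V V' : zmodType) n (phi : U -> V) (psi : U' -> V') (l : U' -> U) (m : V -> V') :
  (forall f g, l (f + g) = l f + l g) -> (forall v w, m (v - w) = m v - m w) -> m 0 = 0 ->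
  (forall f, psi f = m (phi (l f))) -> pdeg n phi -> pdeg n psi.
Proof.
move=> lD mB m0; elim: n phi psi => [|n IH] phi psi e /= h; first by move=> f; rewrite e h m0.
by move=> g; apply: IH (h (l g)) => f /=; rewrite !e lD mB.
Qed.

Lemma pdeg_inj (U V V' : zmodType) n (phi : U -> V) (m : V -> V') :
  (forall v w, m (v - w) = m v - m w) -> (forall v, m v = 0 -> v = 0) ->
  pdeg n (fun f => m (phi f)) -> pdeg n phi.
Proof.
move=> mB m0; elim: n phi => [|n IH] phi /= h; first by move=> f; apply: m0; apply: h.
by move=> g; apply: IH; apply: pdeg_eq (h g) => f /=; rewrite mB.
Qed.

Definition degree_le (C D : acat) (F : functor C D) (r : nat) : Prop :=
  forall A B : C, pdeg r.+1 (fun f : chom A B => fmap F f).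

Section DegreeIdempotents.
Variables (C D : acat) (F : functor C D).

Section Vs.
Variables (A : C) (Z : zmodType).
Implicit Types (s : seq (chom A A)) (psi : chom A A -> Z).

(** Iterated differences of [psi] with steps [e x], written through [1 - e] so that for [psi = F]
    they become composition with operators of the form [1 - F (1 - e)]. *)
Fixpoint Vs s psi (x : chom A A) : Z :=
  if s is e :: s' then Vs s' psi x - Vs s' psi ((cid1 A - e) \oc x) else psi x.

Fixpoint orth s : Prop :=
  if s is e :: s' then (forall e', e' \in s' -> e' \oc e = 0) /\ orth s' else True.

Lemma Vs_shift s psi g x : (forall e, e \in s -> e \oc g = 0) ->
  Vs s (fun y => psi (y + g)) x = Vs s psi (x + g).
Proof.
elim: s x => [//|e s IH] x eg /=; rewrite !IH; first last.
- by move=> e' es; apply: eg; rewrite inE es orbT.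
- by move=> e' es; apply: eg; rewrite inE es orbT.
congr (_ - Vs _ _ _); rewrite compDr; congr (_ + _).
by rewrite compDl ccomp1f compNf eg ?subr0 // inE eqxx.
Qed.

Lemma Vs_sub s psi psi' x : Vs s (fun y => psi y - psi' y) x = Vs s psi x - Vs s psi' x.
Proof.
elim: s x => [//|e s IH] x /=; rewrite !IH; by rewrite !opprD !opprK addrACA.
Qed.

(** As [x] is the sum of [(1 - e) x] and [e x], and the later operators do not see [e x] by
    orthogonality, one step of [Vs] is one difference of [psi] in the direction [e x]. *)
Lemma Vs0 s psi x : orth s -> pdeg (size s) psi -> Vs s psi x = 0.
Proof.
elim: s psi x => [|e s IH] psi x /=; first by move=> _ ->.
move=> [es os] h.
have := IH _ ((cid1 A - e) \oc x) os (h (e \oc x)); rewrite Vs_sub Vs_shift.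
  by rewrite compDl ccomp1f compNf subrK.
by move=> e' e's; rewrite ccompA es // comp0f.
Qed.

End Vs.

Fixpoint vlist (A : C) (s : seq (chom A A)) : chom (F A) (F A) :=
  if s is e :: s' then vlist s' \oc (cid1 _ - fmap F (cid1 A - e)) else cid1 _.

Lemma Vs_vlist (A : C) (s : seq (chom A A)) x :
  Vs s (fun y => fmap F y) x = vlist s \oc fmap F x.
Proof.
elim: s x => [|e s IH] x /=; first by rewrite ccomp1f.
by rewrite !IH fmapM -ccompA compDl ccomp1f compNf compDr compfN.
Qed.

Lemma vlist0 r (A : C) (s : seq (chom A A)) : degree_le F r -> orth s -> size s = r.+1 -> vlist s = 0.
Proof.
move=> Fr os sr; rewrite -[vlist s]ccompf1 -(fmap1 F) -Vs_vlist.
by apply: Vs0 => //; rewrite sr; apply: Fr.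
Qed.

Variable Q : C.

Definition proj_at (m i : nat) : chom (pw Q m) (pw Q m) :=
  bmap (fun j : 'I_m => if j == i :> nat then cid1 Q else 0).

Lemma proj_at_orth m i j : i <> j -> proj_at m i \oc proj_at m j = 0.
Proof.
move=> ij; rewrite -bmapM; apply: bip_ext => k; rewrite bpr_bmap compf0.
case: eqP => [ki|_]; last by rewrite !comp0f.
by rewrite ifF ?compf0 ?comp0f //; apply/eqP; rewrite ki.
Qed.

Lemma pf_omit m i : pf Q m m (fun x => if x == i then m else x) = cid1 _ - proj_at m i.
Proof.
apply: bip_ext => j; rewrite bpr_bmx compDr compfN bpr_bmap ccompf1 (bigD1 j) //= big1 ?addr0.
  case: (eqVneq (j : nat) i) => [ji|ji]; last by rewrite eqxx ccomp1f comp0f subr0.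
  by rewrite ccomp1f subrr ifF ?comp0f //; have := ltn_ord j; lia.
move=> k kj; rewrite ifF ?comp0f //; have := ltn_ord j; have : k <> j :> nat by move=> e; case/eqP: kj; apply: val_inj.
by if_lia.
Qed.

(** The [r + 1] factors [v] belong to orthogonal projections of the power, so their product is an
    [(r + 1)]-fold difference of [F]. *)
Lemma degree_le_opv r m : degree_le F r -> opv F Q m 0 \oc vprod F Q m r = 0.
Proof.
move=> Fr.
pose s := fix s j := if j is j'.+1 then proj_at m j :: s j' else [::].
have vE j : vprod F Q m j = vlist (s j).
  elim: j => [|j IH]; first by rewrite vprod0.
  by rewrite vprodS IH /= /opv /opu pf_omit.
have sz j : size (s j) = j by elim: j => //= j ->.
have sI j e : e \in s j -> exists2 i, (0 < i <= j)%N & e = proj_at m i.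
  elim: j => [|j IH] //=; rewrite inE => /orP[/eqP->|/IH[i ij ->]]; first by exists j.+1; rewrite ?leqnn.
  by exists i => //; lia.
have os j : orth (s j).
  elim: j => [|j IH] //=; split=> // e' /sI[i ij ->]; apply: proj_at_orth; lia.
rewrite opv_vprod vE /opv /opu pf_omit.
apply: (vlist0 (s := proj_at m 0 :: s r) Fr) => //=; last by rewrite sz.
by split=> // e' /sI[i ij ->]; apply: proj_at_orth; lia.
Qed.

End DegreeIdempotents.

Section DegreeNFGam.
Variables (C : acat) (F : functor C C).

Lemma Gam_mapD (P Q : nat -> C) (f g : forall k, chom (P k) (Q k)) k :
  Gam_map (fun k => f k + g k) k = Gam_map f k + Gam_map g k.
Proof.
rewrite /Gam_map /bmap -big_split; apply: eq_bigr => s _.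
by rewrite compDr compDl.
Qed.

Lemma NFGam0 : (forall A B : C, fmap F (0 : chom A B) = 0) ->
  forall A B : bcx_acat C, fmap (NFGam F) (0 : chom A B) = 0.
Proof.
move=> F0 A B; apply: bhomP => k; apply: kin_mono; rewrite compf0.
apply: (etrans (NmapE F (fun k => 0 : chom (A k) (B k)) k)).
suff -> : Gam_map (fun k => 0 : chom (A k) (B k)) k = 0 by rewrite F0 comp0f.
by rewrite /Gam_map /bmap big1 // => s _; rewrite compf0 comp0f.
Qed.

(** The map $NF\Gamma(f)$ is the restriction of $F(\Gamma f)$ to a kernel and $\Gamma f$ is additive
    in $f$, so the degree does not grow. *)
Lemma degree_le_NFGam r : degree_le F r -> degree_le (NFGam F) r.
Proof.
move=> Fr A B.
have key n (phi : chom A B -> chom (NFGam F A) (NFGam F B)) :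
    (forall k, pdeg n (fun f => bh (phi f) k)) -> pdeg n phi.
  elim: n phi => [|n IH] phi h /=; first by move=> f; apply: bhomP => k; apply: h.
  by move=> g; apply: IH => k; apply: (h k g).
apply: key => k.
apply: (@pdeg_inj _ _ _ _ _ (fun v => kin (bpair (@Nface C F B k)) \oc v)).
- by move=> v w; rewrite compDr compfN.
- by move=> v v0; apply: kin_mono; rewrite v0 compf0.
apply: (pdeg_comp (l := fun f : chom A B => Gam_map (bh f) k)
  (m := fun v => v \oc kin (bpair (@Nface C F A k)))) (Fr _ _).
- by move=> f g; apply: Gam_mapD.
- by move=> v w; rewrite compDl compNf.
- exact: comp0f.
- by move=> f; apply: NmapE.
Qed.

End DegreeNFGam.

Lemma iter_NFGam0 (E : excat) (F : functor E E) n : (forall A B : E, fmap F (0 : chom A B) = 0) ->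
  forall A B : Bn E n, fmap (iter_NFGam F n) (0 : chom A B) = 0.
Proof. by move=> F0; elim: n => [//|n IH]; apply: NFGam0. Qed.

Lemma degree_le_iter_NFGam (E : excat) (F : functor E E) n r :
  degree_le F r -> degree_le (iter_NFGam F n) r.
Proof. by move=> Fr; elim: n => [//|n IH]; apply: degree_le_NFGam. Qed.

(** * The degree of the exterior power *)

Section ExteriorDegree.
Variables (X : ringed_space) (r : nat) (Lambda : forall E : omod X, ext_power r E).

Lemma ext_functor0 : (0 < r)%N -> forall A B : PX X, fmap (ext_functor Lambda) (0 : chom A B) = 0.
Proof.
move=> r_gt0 A B; apply: ext_uniq => U x; rewrite /= /ext_map ext_liftE /=.
pose y : 'I_r -> (B : omod X) U := fun=> 0.
have e : replace y (Ordinal r_gt0) 0 = y.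
  by apply: functional_extensionality_dep => k; rewrite /replace; case: ifP.
have := am_lin (wedge (Lambda B)) y (Ordinal r_gt0) 1 0 0.
by rewrite scaler0 addr0 e scale1r -[LHS]addr0 => /addrI.
Qed.

(* The coordinates outside b are constant, so that the degree is at most #|b|. *)
Lemma am_pdeg (A B : omod X) (w : alt_map r B (Lambda B)) U (x : 'I_r -> A U) (b : pred 'I_r)
    (c : 'I_r -> B U) n : (#|b| <= n)%N ->
  pdeg n.+1 (fun f : @chom (PX X) A B => w U (fun k => if b k then oh f U (x k) + c k else c k)).
Proof.
elim: n b c => [|n IH] b c bn.
  have b0 k : b k = false.
    by move: bn; rewrite leqn0 => /eqP/card0_eq/(_ k); rewrite unfold_in.
  move=> g f; apply/eqP; rewrite subr_eq0; apply/eqP; congr am.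
  by apply: functional_extensionality_dep => k; rewrite b0.
move=> g.
(* The step by [g] is made one coordinate at a time. By multilinearity each change adds a term in
   which that coordinate has become constant, so the induction hypothesis applies to it. *)
pose c' (s : seq 'I_r) k := if b k && (k \in s) then oh g U (x k) + c k else c k.
have key s : pdeg n.+1 (fun f : @chom (PX X) A B =>
    w U (fun k => if b k then oh f U (x k) + c' s k else c k) -
    w U (fun k => if b k then oh f U (x k) + c k else c k)).
  elim: s => [|j s IHs].
    apply: (@pdeg_eq _ _ _ (fun=> 0)); last by elim: (n.+1) => //= m IHm _; apply: pdeg_eq IHm => f; rewrite subr0.
    move=> f; apply/esym/eqP; rewrite subr_eq0; apply/eqP; congr am.
    by apply: functional_extensionality_dep => k; rewrite /c' in_nil andbF.
  have [bj|bj] := boolP (b j && (j \notin s)); last first.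
    suff -> : c' (j :: s) = c' s by [].
    apply: functional_extensionality_dep => k; rewrite /c' inE.
    by case: eqP => // ->; move: bj; case: (b j) => //=; rewrite negbK => ->.
  move/andP: bj => [bj js].
  pose b' k := b k && (k != j).
  pose d k := if k == j then oh g U (x j) else if b k then c' s k else c k.
  have b'n : (#|b'| <= n)%N.
    have : (#|b'| < #|b|)%N; last by lia.
    apply/proper_card/properP; split; first by apply/fintype.subsetP => k; rewrite !unfold_in => /andP[].
    by exists j; rewrite !unfold_in // eqxx andbF.
  apply: pdeg_eq (pdeg_add (IH b' d b'n) IHs) => f /=; rewrite addrA; congr (_ - _).
  pose y k := if b k then oh f U (x k) + c' s k else c k.
  have e1 : (fun k => if b k then oh f U (x k) + c' (j :: s) k else c k) =
      replace y j (1 *: oh g U (x j) + y j).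
    apply: functional_extensionality_dep => k; rewrite /replace /y /c' inE scale1r.
    case: eqP => [->|_] //; rewrite bj (negbTE js) /=.
    by rewrite addrCA.
  have e2 : replace y j (y j) = y.
    by apply: functional_extensionality_dep => k; rewrite /replace; case: eqP => // ->.
  rewrite e1 am_lin scale1r e2; congr (_ + _); congr am.
  apply: functional_extensionality_dep => k; rewrite /replace /y /b' /d.
  by case: eqP => [->|_]; rewrite ?andbF //= andbT; case: (b k).
apply: pdeg_eq (key (enum 'I_r)) => f /=; congr (_ - _); congr am.
apply: functional_extensionality_dep => k; rewrite /c' mem_enum andbT.
by case: (b k) => //; rewrite addrA.
Qed.

Lemma ext_functor_degree : degree_le (ext_functor Lambda) r.
Proof.
move=> A B.
have key n (phi : @chom (PX X) A B -> @chom (PX X) (ext_functor Lambda A) (ext_functor Lambda B)) :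
    (forall U x, pdeg n (fun f => oh (phi f) U (wedge (Lambda A) U x))) -> pdeg n phi.
  elim: n phi => [|n IH] phi h /=; first by move=> f; apply: ext_uniq => U x; rewrite h.
  by move=> g; apply: IH => U x; apply: (h U x g).
apply: key => U x.
have h := @am_pdeg A B (wedge (Lambda B)) U x xpredT (fun=> 0) r.
apply: pdeg_eq (h _) => [f /=|]; last by rewrite -[X in (_ <= X)%N]card_ord max_card.
rewrite /ext_map ext_liftE /=; congr am.
by apply: functional_extensionality_dep => k; rewrite addr0.
Qed.

End ExteriorDegree.

(** * Locally free modules *)

(** Multilinearity of the determinant in the rows. *)
Lemma det_addmx (R : comPzRingType) n (A B : 'M[R]_n) :
  \det (A + B) = \sum_(J : {set 'I_n}) \det (\matrix_(i, j) (if i \in J then A i j else B i j)).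
Proof.
rewrite /determinant exchange_big; apply: eq_bigr => s _.
rewrite -big_distrr /=; congr (_ * _).
under eq_bigr => i _ do rewrite mxE.
rewrite bigA_distr; apply: eq_bigr => J _; apply: eq_bigr => i _; by rewrite mxE.
Qed.

Section LocalRing.
Variable X : scheme.
Local Open Scope classical_set_scope.

Lemma prime_ideal_exp (A : comPzRingType) (p : set A) f k : prime_ideal p -> p (f ^+ k) -> p f.
Proof.
case=> _ _ _ p1 pM; elim: k => [|k IH]; first by rewrite expr0.
by rewrite exprS => /pM[].
Qed.

Lemma prime_ideal_sum (A : comPzRingType) (p : set A) (I : finType) (a : I -> A) :
  prime_ideal p -> (forall i, p (a i)) -> p (\sum_i a i).
Proof. by case=> p0 pD _ _ _ pa; elim/big_ind: _. Qed.

(* The stalks of the structure sheaf are local rings. *)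
Lemma scheme_local (U : opens X) (x : X) (I : finType) (c : I -> sring U) :
  oset U x -> \sum_i c i = 1 ->
  exists (V : opens X) (VU : V `<=` U) (i : I) (b : sring V), oset V x /\ rres VU (c i) * b = 1.
Proof.
move=> Ux c1; have [U0 U0x [A [alpha [p]]]] := scheme_affine x.
set D := fun f : A => [set x | oset U0 x /\ ~ p x f] => -[pP _ openP locP].
have D_open f : open (D f).
  by apply: (openP _ _).2 => [y []|y yf] //; exists f.
have UU0 : open (oset U `&` oset U0) by apply: openI; apply: oset_open.
have [f [_ xf] fU] : exists2 f, D f x & D f `<=` oset U `&` oset U0.
  by apply: (openP _ _).1 => // y [].
pose W := Opens (D_open f).
have WU0 : W `<=` U0 by move=> y [].
have WU : W `<=` U by move=> y /fU[].
have [_ locf loc0] := locP f W WU0 erefl.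
pose al a := rres WU0 (alpha a).
have alM a b : al (a * b) = al a * al b by rewrite /al !rmorphM.
have alX a k : al (a ^+ k) = al a ^+ k by rewrite /al !rmorphXn.
have cW i : {am : A * nat | al f ^+ am.2 * rres WU (c i) = al am.1}.
  by apply: cid; have [a [m e]] := locf (rres WU (c i)); exists (a, m).
pose a i := (sval (cW i)).1; pose m i := (sval (cW i)).2.
have cWE i : al f ^+ m i * rres WU (c i) = al (a i) := svalP (cW i).
have pX := pP x U0x; have [_ _ pM' p1 pM] := pX.
(* Otherwise, clearing denominators in $\sum_i c_i = 1$ gives $f^k(f^M - b) = 0$ with [b] in the
   prime ideal of [x], which would then contain [f]. *)
have [i pai] : exists i, ~ p x (a i).
  apply: contrapT => /forallNP npa.
  have pa i : p x (a i) by apply: contrapT; apply: npa.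
  pose M := (\sum_i m i)%N.
  pose b := \sum_i f ^+ (M - m i) * a i.
  have pb : p x b by apply: prime_ideal_sum => // i; apply: pM'.
  have : al (f ^+ M - b) = 0.
    have -> : al (f ^+ M - b) = al (f ^+ M) - \sum_i al (f ^+ (M - m i) * a i).
      by rewrite /al !rmorphB !raddf_sum.
    rewrite -[al (f ^+ M)]mulr1 -[X in _ * X](rmorph1 (rres WU)) -c1 raddf_sum mulr_sumr -sumrB.
    rewrite big1 // => i _; rewrite alM -cWE mulrA -alX -alM -exprD subnK ?subrr //.
    by rewrite /M (bigD1 i) //= leq_addr.
  case/loc0 => k fk.
  have : p x (f ^+ k * (f ^+ M - b)) by rewrite fk; case: pX.
  case/pM => [/prime_ideal_exp//|pfb]; first by move/(_ pX).
  apply: xf; apply: (prime_ideal_exp (k := M) pX).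
  by rewrite -(subrK b (f ^+ M)); case: pX => _ pD _ _ _; apply: pD.
have fai : ~ p x (f * a i) by case/pM.
pose V := Opens (D_open (f * a i)).
have VU0 : V `<=` U0 by move=> y [].
have VW : V `<=` W by move=> y [U0y nf]; split=> // pf; apply: nf;
  rewrite mulrC; case: (pP y U0y) => _ _ h _ _; apply: h.
have VU : V `<=` U by move=> y /VW/WU.
have [[g ge] _ _] := locP (f * a i) V VU0 erefl.
(* As [f ^+ m * c = a] and [g] inverts [f * a], the inverse of [c] is [f ^+ m.+1 * g]. *)
exists V, VU, i, (rres VW (al f) ^+ (m i).+1 * g); split => //.
rewrite -ge [alpha _]rmorphM rmorphM /= -(rres_comp WU0 VW VU0 (alpha f)) -(rres_comp WU0 VW VU0 (alpha (a i))).
rewrite -[rres WU0 (alpha (a i))]cWE !rmorphM !rmorphXn /= (rres_comp WU VW VU) exprS.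
rewrite !mulrA; congr (_ * _); rewrite -[LHS]mulrA; exact: mulrC.
Qed.

End LocalRing.

Section LocallyFree.
Variable X : ringed_space.
Local Open Scope classical_set_scope.

Definition has_basis (E : omod X) (U : opens X) (J : finType) (e : J -> E U) : Prop :=
  forall (V : opens X) (VU : V `<=` U) (s : E V),
    exists! a : J -> sring V, s = \sum_j a j *: mres VU (e j).

Lemma has_basis_res (E : omod X) (U W : opens X) (WU : W `<=` U) (J : finType) (e : J -> E U) :
  has_basis e -> has_basis (fun j => mres WU (e j)).
Proof.
move=> eb V VW s; have VU : V `<=` U := subset_trans VW WU.
have eE (a : J -> sring V) : \sum_j a j *: mres VW (mres WU (e j)) = \sum_j a j *: mres VU (e j).
  by apply: eq_bigr => j _; rewrite (mres_comp WU VW VU).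
have [a [ae au]] := eb V VU s; exists a; rewrite /unique eE; split=> // b; rewrite eE; exact: au.
Qed.

Lemma has_basis_locally_free (E : omod X) :
  (forall x : X, exists2 U : opens X, oset U x &
    exists (J : finType) (e : J -> E U), has_basis e) -> locally_free E.
Proof.
move=> h x; have [U Ux [J [e eb]]] := h x; exists U => //.
exists #|J|, (fun i => e (enum_val i)) => V VU s; have [a [ae au]] := eb V VU s.
have reE (b : 'I_#|J| -> sring V) :
    \sum_i b i *: mres VU (e (enum_val i)) = \sum_j b (enum_rank j) *: mres VU (e j).
  by rewrite (reindex_onto (@enum_rank J) (@enum_val J predT)) /=;
    [apply: eq_big => j; rewrite ?enum_rankK ?eqxx | move=> i _; rewrite enum_valK].
exists (fun i => a (enum_val i)); split.
  by rewrite reE ae; apply: eq_bigr => j _; rewrite enum_rankK.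
move=> b; rewrite reE => /au ab; apply: functional_extensionality_dep => i.
by rewrite (congr1 (fun f => f (enum_val i)) ab) enum_valK.
Qed.

Lemma locally_free_basis (E : omod X) : locally_free E ->
  forall x : X, exists2 U : opens X, oset U x & exists (m : nat) (e : 'I_m -> E U), has_basis e.
Proof. by []. Qed.

Definition basis_mx (E : omod X) (U : opens X) m (e : 'I_m -> E U) (M : 'M[sring U]_m) (i : 'I_m) : E U :=
  \sum_j M i j *: e j.

Lemma mres_basis_mx (E : omod X) (U V : opens X) (VU : V `<=` U) m (e : 'I_m -> E U) M i :
  mres VU (basis_mx e M i) = basis_mx (fun j => mres VU (e j)) (map_mx (rres VU) M) i.
Proof.
rewrite /basis_mx (big_morph (fun s => mres VU s) (mresD (E := E) VU) (mres0 E VU)).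
apply: eq_bigr => j _; rewrite mxE -[X in mres VU X]addr0 mres_lin mres0 addr0 //.
Qed.

Lemma has_basis_mx (E : omod X) (U : opens X) m (e : 'I_m -> E U) (M N : 'M[sring U]_m) :
  M *m N = 1%:M -> N *m M = 1%:M -> has_basis e -> has_basis (basis_mx e M).
Proof.
move=> MN NM eb V VU s.
pose M' := map_mx (rres VU) M; pose N' := map_mx (rres VU) N.
have MN' : M' *m N' = 1%:M by rewrite -map_mxM MN map_mx1.
have NM' : N' *m M' = 1%:M by rewrite -map_mxM NM map_mx1.
have E1 (a : 'I_m -> sring V) : \sum_i a i *: mres VU (basis_mx e M i) =
    \sum_j ((\row_i a i) *m M') 0 j *: mres VU (e j).
  under eq_bigr => i _ do rewrite mres_basis_mx /basis_mx scaler_sumr.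
  rewrite exchange_big; apply: eq_bigr => j _; rewrite !mxE scaler_suml.
  by apply: eq_bigr => i _; rewrite scalerA [in RHS]mxE.
have [a [ae au]] := eb V VU s.
exists (fun i => ((\row_i a i) *m N') 0 i); split.
  rewrite E1 ae; apply: eq_bigr => j _.
  have -> : \row_i ((\row_i a i) *m N') 0 i = (\row_i a i) *m N' by apply/rowP => i; rewrite mxE.
  by rewrite -mulmxA NM' mulmx1 mxE.
move=> b; rewrite E1 => /au ab; apply: functional_extensionality_dep => i.
have -> : \row_i a i = (\row_i b i) *m M' by apply/rowP => j; rewrite mxE (congr1 (fun f => f j) ab).
by rewrite -mulmxA MN' mulmx1 mxE.
Qed.

End LocallyFree.

Lemma ohZ (X : ringed_space) (E F : omod X) (f : ohom E F) U a (s : E U) : f U (a *: s) = a *: f U s.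
Proof. by rewrite -[a *: s]addr0 oh_lin oh0 addr0. Qed.

Lemma oh_sumr (X : ringed_space) (E F : omod X) (f : ohom E F) U (I : finType) (s : I -> E U) :
  f U (\sum_i s i) = \sum_i f U (s i).
Proof. exact: (big_morph (fun t => f U t) (ohD f (U := U)) (oh0 f U)). Qed.

Lemma ohB (X : ringed_space) (E F : omod X) (f : ohom E F) U (s t : E U) : f U (s - t) = f U s - f U t.
Proof. by rewrite ohD -scaleN1r ohZ scaleN1r. Qed.

Lemma mresB (X : ringed_space) (E : omod X) (U V : opens X) (VU : (V `<=` U)%classic) (s t : E U) :
  mres VU (s - t) = mres VU s - mres VU t.
Proof. by rewrite mresD mresN. Qed.

Section Retract.
Variable X : scheme.
Local Open Scope classical_set_scope.

(* If M is the matrix of the idempotent s p, then 1 = det (M + (1 - M)) is the sum of the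
   determinants of the matrices that mix rows of M and 1 - M; near x one of these is a unit,
   and the rows taken from M give a basis of A. *)
Lemma locally_free_retract (A B : PX X) : locally_free B -> retract A B -> locally_free A.
Proof.
move=> B_lf [s [p ps]]; apply: has_basis_locally_free => x.
have [U Ux [m [e eb]]] := locally_free_basis B_lf x.
have psE V (t : (A : omod X) V) : oh p V (oh s V t) = t.
  exact: (congr1 (fun h : ohom A A => h V t) ps).
pose g V (t : (B : omod X) V) : (B : omod X) V := oh s V (oh p V t).
have UU : U `<=` U by [].
have unfold_basis (t : (B : omod X) U) : {a : 'I_m -> sring U | t = \sum_j a j *: e j}.
  apply: cid; have [a [ae _]] := eb U UU t; exists a; rewrite {1}ae.
  by apply: eq_bigr => j _; rewrite mres_id.
have uniq_basis (a b : 'I_m -> sring U) : \sum_j a j *: e j = \sum_j b j *: e j -> a = b.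
  move=> ab; have [c [_ cu]] := eb U UU (\sum_j a j *: e j).
  apply: (etrans (y := c)); [symmetry|]; apply: cu; rewrite ?ab.
    by rewrite -ab; apply: eq_bigr => j _; rewrite mres_id.
  by apply: eq_bigr => j _; rewrite mres_id.
have [M ME] : exists M : 'M_m, forall i, g U (e i) = basis_mx e M i.
  exists (\matrix_(i, j) sval (unfold_basis (g U (e i))) j) => i.
  rewrite (svalP (unfold_basis (g U (e i)))).
  by apply: eq_bigr => j _; rewrite mxE.
pose MJ (J : {set 'I_m}) := \matrix_(i, j) (if i \in J then M i j else (1%:M - M) i j).
have detJ : \sum_(J : {set 'I_m}) \det (MJ J) = 1.
  by rewrite -det_addmx addrC subrK det1.
have [V [VU [J [b [Vx bJ]]]]] := scheme_local Ux detJ.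
pose N := map_mx (rres VU) (MJ J).
have Nb : N *m (b *: \adj N) = 1%:M.
  by rewrite -scalemxAr mul_mx_adj scale_scalar_mx mulrC det_map_mx bJ.
have bN : (b *: \adj N) *m N = 1%:M.
  by rewrite -scalemxAl mul_adj_mx scale_scalar_mx mulrC det_map_mx bJ.
have fb := has_basis_mx Nb bN (has_basis_res VU eb).
set f := basis_mx _ N in fb.
have fE i : f i = if i \in J then g V (mres VU (e i)) else mres VU (e i) - g V (mres VU (e i)).
  have gE : g V (mres VU (e i)) = mres VU (g U (e i)) by rewrite /g !oh_res.
  rewrite gE -mresB /f -mres_basis_mx.
  suff -> : basis_mx e (MJ J) i = if i \in J then g U (e i) else e i - g U (e i) by case: ifP.
  rewrite ME /basis_mx; case: ifP => iJ.
    by apply: eq_bigr => j _; rewrite mxE iJ.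
  have -> : e i - \sum_j M i j *: e j = \sum_j (1%:M - M) i j *: e j.
    under [RHS]eq_bigr => j _ do rewrite !mxE scalerBl.
    rewrite sumrB; congr (_ - _).
    by rewrite (bigD1 i) //= eqxx scale1r big1 ?addr0 // => j ji; rewrite eq_sym (negbTE ji) scale0r.
  by apply: eq_bigr => j _; rewrite mxE iJ.
have pf i : oh p V (f i) = if i \in J then oh p V (mres VU (e i)) else 0.
  by rewrite fE; case: ifP => _; rewrite ?ohB /g psE ?subrr.
exists V => //; exists {i : 'I_m | i \in J}, (fun j => oh p V (mres VU (e (val j)))) => W WV t.
have [a [ae au]] := fb W WV (oh s W t).
have sumJ (c : 'I_m -> sring W) (v : 'I_m -> (A : omod X) W) :
    (forall i, i \notin J -> c i *: v i = 0) ->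
    \sum_i c i *: v i = \sum_(j : {i | i \in J}) c (val j) *: v (val j).
  move=> v0; rewrite -(big_sub (mem J) (fun i => c i *: v i)) /= [RHS]big_mkcond.
  by apply: eq_bigr => i _; case: ifP => // /negbT /v0.
exists (fun j => a (val j)); split.
  rewrite -{1}(psE W t) ae oh_sumr.
  under eq_bigr => i _ do rewrite ohZ oh_res pf.
  rewrite (sumJ a (fun i => mres WV (if i \in J then oh p V (mres VU (e i)) else 0))).
    by apply: eq_bigr => -[j jJ] _; rewrite /= jJ.
  by move=> i /negbTE -> /=; rewrite mres0 scaler0.
move=> c ce.
(* Extended by zero, [c] gives coordinates of [s t] in the basis [f], and uniqueness is available
   for that basis. *)
pose c' i := if insub i is Some j then c j else 0.
have c'E j : c' (val j) = c j by rewrite /c' valK.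
have -> : a = c'; last by apply: functional_extensionality_dep => j; rewrite c'E.
apply: au; rewrite ce oh_sumr.
rewrite (eq_bigr (fun j => c' (val j) *: mres WV (f (val j)))); last first.
  by move=> [j jJ] _; rewrite ohZ -c'E /= fE jJ /g !oh_res.
rewrite -(big_sub (mem J) (fun i => c' i *: mres WV (f i))) /= [LHS]big_mkcond.
apply: eq_bigr => i _; case: ifP => // iJ; rewrite /c' insubF ?scale0r //.
Qed.

End Retract.

(** * Exactness properties of locally free modules *)

Section PXNice.
Variable X : ringed_space.
Local Open Scope classical_set_scope.

Lemma common_nbhd (I : finType) (Q : I -> opens X -> Prop) (x : X) :
  (forall i (U V : opens X), V `<=` U -> Q i U -> Q i V) ->
  (forall i, exists2 U : opens X, oset U x & Q i U) ->
  exists2 U : opens X, oset U x & forall i, Q i U.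
Proof.
move=> Qmono Qx.
have key (s : seq I) : exists2 U : opens X, oset U x & forall i, i \in s -> Q i U.
  elim: s => [|i s [U Ux QU]]; first by exists (Opens openT).
  have [V Vx QV] := Qx i.
  exists (Opens (openI (oset_open U) (oset_open V))); first by split.
  move=> j; rewrite inE => /orP[/eqP ->|js].
    by apply: Qmono QV => y [].
  by apply: Qmono (QU j js) => y [].
by have [U Ux QU] := key (enum I); exists U => // i; apply: QU; rewrite mem_enum.
Qed.

Lemma locally_free_bip (I : finType) (E : I -> PX X) :
  (forall i, locally_free (E i)) -> locally_free (bip E).
Proof.
move=> E_lf; apply: has_basis_locally_free => x.
pose Q i (U : opens X) := exists (m : nat) (e : 'I_m -> (E i : omod X) U), has_basis e.
have [i U V VU [m [e eb]]|i|U Ux QU] := @common_nbhd I Q x.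
- by exists m, (fun j => mres VU (e j)); apply: has_basis_res.
- by have [U Ux [m [e eb]]] := locally_free_basis (E_lf i) x; exists U => //; exists m, e.
exists U => //.
pose m i := projT1 (cid (QU i)).
pose e i : 'I_(m i) -> (E i : omod X) U := projT1 (cid (projT2 (cid (QU i)))).
have eb i : has_basis (e i) := projT2 (cid (projT2 (cid (QU i)))).
exists {i : I & 'I_(m i)}, (fun p => oh (bin E (tag p)) U (e (tag p) (tagged p))).
move=> V VU s.
pose a i := projT1 (cid (eb i V VU (s i))).
have aP i : s i = \sum_j a i j *: mres VU (e i j) := (projT2 (cid (eb i V VU (s i)))).1.
have au i b : s i = \sum_j b j *: mres VU (e i j) -> a i = b := (projT2 (cid (eb i V VU (s i)))).2 b.
have sumE (b : {i : I & 'I_(m i)} -> sring V) i :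
    (\sum_p b p *: mres VU (oh (bin E (tag p)) U (e (tag p) (tagged p))) : omod_bip E V) i =
    \sum_j b (Tagged (fun i => 'I_(m i)) j) *: mres VU (e i j).
  rewrite omod_bip_sum.
  rewrite (eq_bigr (fun p : {i : I & 'I_(m i)} =>
    b p *: (oh (bin E (tag p)) V (mres VU (e (tag p) (tagged p))) : omod_bip E V) i)); last first.
    by move=> p _; rewrite oh_res.
  pose G (k : I) (j : 'I_(m k)) := b (Tagged (fun i => 'I_(m i)) j) *:
    (oh (bin E k) V (mres VU (e k j)) : omod_bip E V) i.
  rewrite (eq_bigr (fun p : {i : I & 'I_(m i)} => G (tag p) (tagged p))); last by move=> [].
  rewrite -(sig_big_dep (J := fun i => 'I_(m i)) xpredT (fun=> xpredT) G) (bigD1 i) //= [X in _ + X]big1 ?addr0.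
    by apply: eq_bigr => j _; rewrite /G /= delta_sec_id.
  move=> k /eqP ki; rewrite big1 // => j _; rewrite /G /= delta_sec_neq ?scaler0 //.
exists (fun p => a (tag p) (tagged p)); split.
  by apply: functional_extensionality_dep => i; rewrite sumE aP.
move=> b sb; apply: functional_extensionality_dep => -[i j] /=.
rewrite (au i (fun j => b (Tagged (fun i => 'I_(m i)) j))) //.
by rewrite -sumE -sb.
Qed.

Lemma short_exact_split (A B D : PX X) (f : chom A B) (g : chom B D) (p : chom B A) (s : chom D B) :
  p \oc f = cid1 A -> g \oc s = cid1 D -> g \oc f = 0 -> f \oc p + s \oc g = cid1 B -> short_exact f g.
Proof.
move=> pf gs gf e.
have pfE U (t : (A : omod X) U) : oh p U (oh f U t) = t := congr1 (fun h : ohom A A => h U t) pf.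
have gsE U (t : (D : omod X) U) : oh g U (oh s U t) = t := congr1 (fun h : ohom D D => h U t) gs.
have gfE U (t : (A : omod X) U) : oh g U (oh f U t) = 0 := congr1 (fun h : ohom A D => h U t) gf.
have eE U (t : (B : omod X) U) : oh f U (oh p U t) + oh s U (oh g U t) = t :=
  congr1 (fun h : ohom B B => h U t) e.
split=> [U t u|U t|U t x Ux].
- by move=> /(congr1 (oh p U)); rewrite !pfE.
- split=> [gt0|[u <-]]; last exact: gfE.
  by exists (oh p U t); rewrite -[RHS]eE gt0 oh0 addr0.
- by exists U, (fun y h => h), (oh s U t); rewrite gsE mres_id.
Qed.

Lemma short_exact_ker (A B D : PX X) (f : chom A B) (g : chom B D) : short_exact f g ->
  [/\ g \oc f = 0,
      forall (Y : PX X) (h : chom Y B), g \oc h = 0 -> exists k, f \oc k = h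
    & forall (Y : PX X) (u v : chom Y A), f \oc u = f \oc v -> u = v].
Proof.
case=> f_inj fg _; split.
- by apply: ohomP => U s /=; apply/fg; exists s.
- move=> Y h gh.
  have ghE U (s : (Y : omod X) U) : oh g U (oh h U s) = 0 := congr1 (fun h : ohom Y D => h U s) gh.
  pose k U (s : (Y : omod X) U) := projT1 (cid ((fg U (oh h U s)).1 (ghE U s))).
  have kE U s : oh f U (k U s) = oh h U s := projT2 (cid ((fg U (oh h U s)).1 (ghE U s))).
  have k_lin U a s t : k U (a *: s + t) = a *: k U s + k U t.
    by apply: (f_inj U); rewrite oh_lin !kE oh_lin.
  have k_res (U V : opens X) (VU : V `<=` U) s : k V (mres VU s) = mres VU (k U s).
    by apply: (f_inj V); rewrite oh_res !kE oh_res.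
  by exists (OHom k_lin k_res); apply: ohomP => U s; apply: kE.
- move=> Y u v fuv; apply: ohomP => U s; apply: (f_inj U).
  exact: (congr1 (fun h : ohom Y B => h U s) fuv).
Qed.

Lemma short_exact_retract (A B D A' B' D' : PX X) (f : chom A B) (g : chom B D)
    (f' : chom A' B') (g' : chom B' D') (sA : chom A' A) (sB : chom B' B)
    (sD : chom D' D) (pA : chom A A') (pB : chom B B') (pD : chom D D') :
  pA \oc sA = cid1 A' -> pB \oc sB = cid1 B' -> pD \oc sD = cid1 D' ->
  f \oc sA = sB \oc f' -> g \oc sB = sD \oc g' ->
  f' \oc pA = pB \oc f -> g' \oc pB = pD \oc g -> short_exact f g -> short_exact f' g'.
Proof.
move=> eA eB eD e1 e2 e3 e4 [f_inj fg g_surj].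
have EA U t : oh pA U (oh sA U t) = t := congr1 (fun h : ohom A' A' => h U t) eA.
have EB U t : oh pB U (oh sB U t) = t := congr1 (fun h : ohom B' B' => h U t) eB.
have ED U t : oh pD U (oh sD U t) = t := congr1 (fun h : ohom D' D' => h U t) eD.
have E1 U t : oh f U (oh sA U t) = oh sB U (oh f' U t) := congr1 (fun h : ohom A' B => h U t) e1.
have E2 U t : oh g U (oh sB U t) = oh sD U (oh g' U t) := congr1 (fun h : ohom B' D => h U t) e2.
have E3 U t : oh f' U (oh pA U t) = oh pB U (oh f U t) := congr1 (fun h : ohom A B' => h U t) e3.
have E4 U t : oh g' U (oh pB U t) = oh pD U (oh g U t) := congr1 (fun h : ohom B D' => h U t) e4.
split=> [U t u|U t|U t x Ux].
- move=> /(congr1 (oh sB U)); rewrite -!E1 => /f_inj /(congr1 (oh pA U)).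
  by rewrite !EA.
- split=> [gt0|[u <-]].
    have /fg[u fu] : oh g U (oh sB U t) = 0 by rewrite E2 gt0 oh0.
    by exists (oh pA U u); rewrite E3 fu EB.
  rewrite -(ED _ (oh g' U _)) -E2 -E1.
  by have -> : oh g U (oh f U (oh sA U u)) = 0; [apply/fg; exists (oh sA U u) | rewrite oh0].
- have [V [VU [u [Vx gu]]]] := g_surj U (oh sD U t) x Ux.
  by exists V, VU, (oh pB V u); rewrite E4 gu oh_res ED.
Qed.

Lemma bmapE (I : finType) (A B : I -> PX X) (f : forall i, chom (A i) (B i)) U (s : omod_bip A U) :
  oh (bmap f) U s = (fun i => oh (f i) U (s i)) :> omod_bip B U.
Proof.
apply: functional_extensionality_dep => i.
exact: (congr1 (fun h : ohom (omod_bip A) (B i) => h U s) (bpr_bmap f i)).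
Qed.

Lemma short_exact_bip (I : finType) (A B D : I -> PX X) (f : forall i, chom (A i) (B i))
    (g : forall i, chom (B i) (D i)) :
  (forall i, short_exact (f i) (g i)) -> short_exact (bmap f) (bmap g).
Proof.
move=> ses; split=> [U s t|U s|U s x Ux].
- rewrite !bmapE => e; apply: functional_extensionality_dep => i.
  by have [f_inj _ _] := ses i; apply: (f_inj U); apply: (congr1 (fun h : omod_bip B U => h i) e).
- split=> [|[t <-]].
    rewrite bmapE => e.
    have ex i : exists t, oh (f i) U t = s i.
      have [_ fg _] := ses i; apply/fg.
      exact: (congr1 (fun h : omod_bip D U => h i) e).
    exists (fun i => projT1 (cid (ex i))); rewrite bmapE.
    apply: functional_extensionality_dep => i; exact: (projT2 (cid (ex i))).
  rewrite !bmapE; apply: functional_extensionality_dep => i.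
  by have [_ fg _] := ses i; apply/fg; exists (t i).
- pose Q i (V : opens X) := exists (VU : V `<=` U) (t : (B i : omod X) V),
    oh (g i) V t = mres VU (s i).
  have [i V W WV [VU [t te]]|i|V Vx QV] := @common_nbhd I Q x.
  + exists (subset_trans WV VU), (mres WV t).
    by rewrite oh_res te (mres_comp VU WV (subset_trans WV VU)).
  + have [_ _ g_surj] := ses i; have [V [VU [t [Vx te]]]] := g_surj U (s i) x Ux.
    by exists V => //; exists VU, t.
  (* The inclusion of [V] in [U] comes from some member of the family; for an empty family [U]
     itself serves. *)
  have [[i0 _]|I0] := pselect (exists i : I, true).
    have [VU _] := QV i0.
    have ex i : exists t : (B i : omod X) V, oh (g i) V t = mres VU (s i).
      have [VU' [t te]] := QV i; exists t; rewrite te; congr mres; exact: Prop_irrelevance.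
    exists V, VU, (fun i => projT1 (cid (ex i))); split=> //.
    rewrite bmapE; apply: functional_extensionality_dep => i; exact: (projT2 (cid (ex i))).
  exists U, (fun y h => h), (fun i => 0); split=> //.
  by apply: functional_extensionality_dep => i; case: I0; exists i.
Qed.

End PXNice.

Lemma PX_nice (X : scheme) : nice (PX X).
Proof.
split.
- exact: (@PX_proper X).1.
- by move=> A B; apply: locally_free_retract.
- exact: locally_free_bip.
- exact: short_exact_split.
- exact: short_exact_ker.
- exact: short_exact_retract.
- exact: short_exact_bip.
Qed.

(** * Cross-effects *)

Section BiprodMaps.
Variable C : acat.
Implicit Types A B D : C.

Definition bin1 A B : chom A (biprod A B) := bin (bool_fam A B) true.
Definition bin2 A B : chom B (biprod A B) := bin (bool_fam A B) false.

Lemma bpr1_bin1 A B : bpr1 A B \oc bin1 A B = cid1 A. Proof. exact: (bpr_bin (bool_fam A B) true). Qed.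
Lemma bpr2_bin2 A B : bpr2 A B \oc bin2 A B = cid1 B. Proof. exact: (bpr_bin (bool_fam A B) false). Qed.
Lemma bpr2_bin1 A B : bpr2 A B \oc bin1 A B = 0. Proof. by apply: (@bpr_bin0 C _ (bool_fam A B) true false). Qed.
Lemma bpr1_bin2 A B : bpr1 A B \oc bin2 A B = 0. Proof. by apply: (@bpr_bin0 C _ (bool_fam A B) false true). Qed.

Lemma biprod_ext D A B (f g : chom D (biprod A B)) :
  bpr1 A B \oc f = bpr1 A B \oc g -> bpr2 A B \oc f = bpr2 A B \oc g -> f = g.
Proof. by move=> e1 e2; apply: bip_ext => -[]. Qed.

Lemma bpr1_pairing D A B (f : chom D A) (g : chom D B) : bpr1 A B \oc pairing f g = f.
Proof. exact: (@bpr_bpair C _ _ (bool_fam A B) _ true). Qed.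

Lemma bpr2_pairing D A B (f : chom D A) (g : chom D B) : bpr2 A B \oc pairing f g = g.
Proof. exact: (@bpr_bpair C _ _ (bool_fam A B) _ false). Qed.

Lemma biprod_bin_bpr A B : bin1 A B \oc bpr1 A B + bin2 A B \oc bpr2 A B = cid1 (biprod A B).
Proof.
by rewrite -(bin_bpr (bool_fam A B)) big_bool.
Qed.

Lemma biprod_map_bin1 A B A' B' (f : chom A A') (g : chom B B') :
  biprod_map f g \oc bin1 A B = bin1 A' B' \oc f.
Proof. exact: (bmap_bin (bool_map f g) true). Qed.

Lemma biprod_map_bin2 A B A' B' (f : chom A A') (g : chom B B') :
  biprod_map f g \oc bin2 A B = bin2 A' B' \oc g.
Proof. exact: (bmap_bin (bool_map f g) false). Qed.

Lemma biprod_map0 A B A' B' (g : chom B B') :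
  biprod_map (0 : chom A A') g = bin2 A' B' \oc g \oc bpr2 A B.
Proof.
apply: biprod_ext; rewrite (bpr1_map, bpr2_map) !ccompA.
- by rewrite bpr1_bin2 !comp0f.
- by rewrite bpr2_bin2 ccomp1f.
Qed.

End BiprodMaps.

Section CrossSplit.
Variables (C : acat) (T : category) (G : functor (prod_cat C T) C).

Definition reduced : Prop := forall (X Y : prod_cat C T) (t : chom X.2 Y.2),
  @fmap _ _ G X Y (0, t) = 0.

Let CT2 := prod_cat C (prod_cat C T).

Definition sum_functor : functor CT2 (prod_cat C T).
Proof.
refine (@Functor CT2 (prod_cat C T) (fun X => (biprod X.1 X.2.1, X.2.2))
  (fun X Y f => (biprod_map f.1 f.2.1, f.2.2)) _ _) => *; rewrite /=.
- by rewrite biprod_map1.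
- by rewrite biprod_mapM.
Defined.

Definition fst_functor : functor CT2 (prod_cat C T).
Proof. by refine (@Functor CT2 (prod_cat C T) (fun X => (X.1, X.2.2)) (fun X Y f => (f.1, f.2.2)) _ _). Defined.

Definition snd_functor : functor CT2 (prod_cat C T).
Proof. by refine (@Functor CT2 (prod_cat C T) (fun X => (X.2.1, X.2.2)) (fun X Y f => (f.2.1, f.2.2)) _ _). Defined.

(** With zero in the first variable the morphism factors through the projection to the second
    summand, and [G] of that projection vanishes on the kernel that defines the cross-effect. *)
Lemma cr_step_reduced (X Y : CT2) (t : chom X.2 Y.2) : @fmap _ _ (cr_step G) X Y (0, t) = 0.
Proof.
apply: kin_mono; rewrite compf0; apply: (etrans (cr_mapE G _)); rewrite /cr_sum /= biprod_map0.
have -> : (bin2 Y.1 Y.2.1 \oc t.1 \oc bpr2 X.1 X.2.1, t.2) =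
    @ccomp (prod_cat C T) (biprod X.1 X.2.1, X.2.2) (X.2.1, X.2.2) (biprod Y.1 Y.2.1, Y.2.2)
      (bin2 Y.1 Y.2.1 \oc t.1, t.2) (bpr2 X.1 X.2.1, cid1 X.2.2) by rewrite /= ccompf1.
by rewrite fmapM -ccompA [X in _ \oc X]pairing_kin2 compf0.
Qed.

Hypothesis Gr : reduced.

Definition cr_sec (X : CT2) : chom (biprod (G (X.1, X.2.2)) (G (X.2.1, X.2.2))) (G (biprod X.1 X.2.1, X.2.2)) :=
  @fmap _ _ G (X.1, X.2.2) (biprod X.1 X.2.1, X.2.2) (bin1 _ _, cid1 _) \oc bpr1 _ _ +
  @fmap _ _ G (X.2.1, X.2.2) (biprod X.1 X.2.1, X.2.2) (bin2 _ _, cid1 _) \oc bpr2 _ _.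

Lemma fmapM' (X Y Z : prod_cat C T) (g : chom Y.1 Z.1) (f : chom X.1 Y.1) (g' : chom Y.2 Z.2) (f' : chom X.2 Y.2) :
  @fmap _ _ G Y Z (g, g') \oc @fmap _ _ G X Y (f, f') = @fmap _ _ G X Z (g \oc f, g' \oc f').
Proof. by rewrite -fmapM. Qed.

(** The mixed terms are values of [G] at morphisms with first component zero, which vanish as [G] is
    reduced. So the kernel [cr_step] is a direct summand. *)
Lemma cr_mor_sec (X : CT2) : cr_mor G X \oc cr_sec X = cid1 _.
Proof.
have G1 (A : C) (t : T) : @fmap _ _ G (A, t) (A, t) (cid1 A, cid1 t) = cid1 (G (A, t)) := fmap1 G (A, t).
apply: biprod_ext; rewrite ccompA /cr_mor (bpr1_pairing, bpr2_pairing) ccompf1 compDr !ccompA.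
- rewrite !(fmapM' (Y := (biprod X.1 X.2.1, X.2.2))) /= bpr1_bin1 bpr1_bin2 !ccomp1f.
  rewrite (Gr (X := (X.2.1, X.2.2)) (Y := (X.1, X.2.2))) comp0f addr0.
  by rewrite (G1 X.1 X.2.2) ccomp1f.
- rewrite !(fmapM' (Y := (biprod X.1 X.2.1, X.2.2))) /= bpr2_bin2 bpr2_bin1 !ccomp1f.
  rewrite (Gr (X := (X.1, X.2.2)) (Y := (X.2.1, X.2.2))) comp0f add0r.
  by rewrite (G1 X.2.1 X.2.2) ccomp1f.
Qed.

Fact cr_prj_subproof (X : CT2) : cr_mor G X \oc (cid1 _ - cr_sec X \oc cr_mor G X) = 0.
Proof. by rewrite compDr compfN ccompf1 ccompA cr_mor_sec ccomp1f subrr. Qed.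

Definition cr_prj (X : CT2) : chom (G (biprod X.1 X.2.1, X.2.2)) (cr_step G X) := klift (cr_prj_subproof X).

Lemma cr_prjE X : kin (cr_mor G X) \oc cr_prj X = cid1 _ - cr_sec X \oc cr_mor G X.
Proof. exact: kliftK. Qed.

Lemma cr_prj_kin X : cr_prj X \oc kin (cr_mor G X) = cid1 _.
Proof.
apply: kin_mono; rewrite ccompA cr_prjE compDl compNf ccomp1f ccompf1 -ccompA.
by rewrite kin0 compf0 subr0.
Qed.

Lemma cr_mor_nat (X Y : CT2) (f : chom X Y) :
  cr_mor G Y \oc cr_sum G f =
  biprod_map (fmap G (fmap fst_functor f)) (fmap G (fmap snd_functor f)) \oc cr_mor G X.
Proof.
apply: biprod_ext; rewrite !ccompA (bpr1_map, bpr2_map) /cr_mor.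
- rewrite bpr1_pairing -ccompA bpr1_pairing /cr_sum.
  rewrite (fmapM' (Y := (biprod Y.1 Y.2.1, Y.2.2))) (fmapM' (Y := (X.1, X.2.2))) /=.
  by rewrite bpr1_map ccomp1f ccompf1.
- rewrite bpr2_pairing -ccompA bpr2_pairing /cr_sum.
  rewrite (fmapM' (Y := (biprod Y.1 Y.2.1, Y.2.2))) (fmapM' (Y := (X.2.1, X.2.2))) /=.
  by rewrite bpr2_map ccomp1f ccompf1.
Qed.

Lemma cr_sec_nat (X Y : CT2) (f : chom X Y) :
  cr_sec Y \oc biprod_map (fmap G (fmap fst_functor f)) (fmap G (fmap snd_functor f)) =
  cr_sum G f \oc cr_sec X.
Proof.
rewrite /cr_sec compDl compDr -!ccompA bpr1_map bpr2_map !ccompA /cr_sum.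
apply: (congr2 +%R); apply: (congr1 (fun z => z \oc _)).
- apply: (etrans (fmapM' (X := (X.1, X.2.2)) (Y := (Y.1, Y.2.2)) (Z := (biprod Y.1 Y.2.1, Y.2.2)) _ _ _ _)).
  rewrite (fmapM' (Y := (biprod X.1 X.2.1, X.2.2))) /=.
  by rewrite biprod_map_bin1 ccomp1f ccompf1.
- apply: (etrans (fmapM' (X := (X.2.1, X.2.2)) (Y := (Y.2.1, Y.2.2)) (Z := (biprod Y.1 Y.2.1, Y.2.2)) _ _ _ _)).
  rewrite (fmapM' (Y := (biprod X.1 X.2.1, X.2.2))) /=.
  by rewrite biprod_map_bin2 ccomp1f ccompf1.
Qed.

Lemma cr_prj_nat (X Y : CT2) (f : chom X Y) :
  fmap (cr_step G) f \oc cr_prj X = cr_prj Y \oc cr_sum G f.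
Proof.
apply: kin_mono; rewrite ccompA.
apply: (etrans (congr1 (fun z => z \oc cr_prj X) (cr_mapE G f))).
rewrite -ccompA cr_prjE ccompA cr_prjE.
rewrite compDl compDr ccomp1f ccompf1 compNf compfN; congr (_ - _).
by rewrite ccompA -cr_sec_nat -!ccompA cr_mor_nat.
Qed.

End CrossSplit.

Section CrossChi.
Variables (E : excat) (nE : nice E) (dg : Aq E -> Prop) (A : abgroup) (chi : aobj E -> A).
Hypothesis chiA : additive_inv (X := Aq E) dg chi.
Variables (T : category) (G : functor (prod_cat E T) E) (Gr : reduced G).
Variable X : aobj (prod_cat E (prod_cat E T)).
Hypothesis GX_in : ex_in (G (biprod (aob X).1 (aob X).2.1, (aob X).2.2)).

Definition abiprod (V W : aobj E) : aobj E.
Proof.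
exists (biprod (aob V) (aob W)) (fun j => biprod_map (act V j) (act W j)) => [i j|i].
  by rewrite -!biprod_mapM !(actC _ i j).
have [a [aV Va]] := act_iso V i; have [b [bW Wb]] := act_iso W i.
by exists (biprod_map a b); rewrite -!biprod_mapM aV Va bW Wb !biprod_map1.
Defined.

Lemma chi_abiprod (V W : aobj E) : ex_in (biprod (aob V) (aob W)) ->
  chi (abiprod V W) = abD (chi V) (chi W).
Proof.
move=> VW_in.
have P1 j : bin1 (aob V) (aob W) \oc act V j = act (abiprod V W) j \oc bin1 (aob V) (aob W).
  by rewrite /= biprod_map_bin1.
have P2 j : bin2 (aob V) (aob W) \oc act W j = act (abiprod V W) j \oc bin2 (aob V) (aob W).
  by rewrite /= biprod_map_bin2.
have P3 j : bpr1 (aob V) (aob W) \oc act (abiprod V W) j = act V j \oc bpr1 (aob V) (aob W).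
  by rewrite /= bpr1_map.
have P4 j : bpr2 (aob V) (aob W) \oc act (abiprod V W) j = act W j \oc bpr2 (aob V) (aob W).
  by rewrite /= bpr2_map.
apply: (@chi_split (Aq E) (Aq_nice nE) dg A chi chiA V (abiprod V W) W
  (@AHom E V (abiprod V W) _ P1) (@AHom E (abiprod V W) W _ P4)
  (@AHom E (abiprod V W) V _ P3) (@AHom E W (abiprod V W) _ P2)); last exact: VW_in; apply: ahomP.
- exact: bpr1_bin1.
- exact: bpr2_bin2.
- exact: bpr2_bin1.
- exact: biprod_bin_bpr.
Qed.

(** All maps of the defining splitting of the cross-effect are natural and hence commute with the
    automorphisms. *)
Lemma chi_cr_step :
  chi (aqF G (aqF (sum_functor E T) X)) = abD (chi (aqF (cr_step G) X))
    (abD (chi (aqF G (aqF (fst_functor E T) X))) (chi (aqF G (aqF (snd_functor E T) X)))).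
Proof.
pose B := aqF G (aqF (sum_functor E T) X).
pose V := aqF G (aqF (fst_functor E T) X).
pose W := aqF G (aqF (snd_functor E T) X).
pose R := aqF (cr_step G) X.
have P1 j : kin (cr_mor G (aob X)) \oc act R j = act B j \oc kin (cr_mor G (aob X)).
  exact: cr_mapE.
have P2 j : cr_mor G (aob X) \oc act B j = act (abiprod V W) j \oc cr_mor G (aob X).
  exact: cr_mor_nat.
have P3 j : cr_prj Gr (aob X) \oc act B j = act R j \oc cr_prj Gr (aob X).
  by rewrite cr_prj_nat.
have P4 j : cr_sec G (aob X) \oc act (abiprod V W) j = act B j \oc cr_sec G (aob X).
  exact: cr_sec_nat.
rewrite -chi_abiprod.
  apply: (@chi_split (Aq E) (Aq_nice nE) dg A chi chiA R B (abiprod V W)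
    (@AHom E R B _ P1) (@AHom E B (abiprod V W) _ P2)
    (@AHom E B R _ P3) (@AHom E (abiprod V W) B _ P4)); last exact: GX_in; apply: ahomP.
  - exact: cr_prj_kin.
  - exact: cr_mor_sec.
  - exact: kin0.
  - by rewrite /= cr_prjE subrK.
apply: nice_retract nE _ _ GX_in _; exists (cr_sec G (aob X)), (cr_mor G (aob X)).
exact: cr_mor_sec.
Qed.

End CrossChi.

Lemma diag_hom_iso (C : category) i (A B : C) (f : chom A B) : is_iso f -> is_iso (diag_hom i f).
Proof. by case=> g [gf fg]; exists (diag_hom i g); rewrite -!diag_homM gf fg !diag_hom1. Qed.

Lemma prod_iso (C D : category) (X Y : prod_cat C D) (f : chom X Y) :
  is_iso f.1 -> is_iso f.2 -> is_iso f.
Proof.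
case: f => f1 f2 /= [g1 [gf1 fg1]] [g2 [gf2 fg2]].
by exists (g1, g2); rewrite /= gf1 fg1 gf2 fg2.
Qed.

Section CrossPow.
Variables (E : excat) (nE : nice E) (F : functor E E).
Hypothesis F0 : forall A B : E, fmap F (0 : chom A B) = 0.
Hypothesis F_in : forall A : E, ex_in A -> ex_in (F A).

Lemma cross_effect_reduced i : reduced (T := pow_cat E i) (cross_effect F i).
Proof. by case: i => [|i] X Y t; [apply: F0 | apply: cr_step_reduced]. Qed.

Fixpoint all_in i : pow_cat E i -> Prop :=
  if i is j.+1 then fun X => ex_in X.1 /\ all_in X.2 else fun=> True.

Lemma all_in_diag i (A : E) : ex_in A -> all_in (diag_ob i A).
Proof. by move=> A_in; elim: i. Qed.

Lemma biprod_in (A B : E) : ex_in A -> ex_in B -> ex_in (biprod A B).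
Proof. by move=> A_in B_in; apply: nice_bip nE _ _ _ => -[]. Qed.

Lemma cross_effect_in i (X : pow_cat E i.+1) : all_in X -> ex_in (cross_effect F i X).
Proof.
elim: i X => [|i IH] X; first by case=> X_in _; apply: F_in.
case=> X1 [X2 X3].
have S_in : ex_in (cross_effect F i (biprod X.1 X.2.1, X.2.2)).
  by apply: IH; split=> //; apply: biprod_in.
apply: nice_retract nE _ _ S_in _.
exists (kin (cr_mor (T := pow_cat E i) (cross_effect F i) X)), (cr_prj (@cross_effect_reduced i) X).
exact: cr_prj_kin.
Qed.

Section Objects.
Variable Q : aobj E.

Definition cr_act i k j : chom ((pw (aob Q) k.+1, diag_ob i (aob Q)) : pow_cat E i.+1)
    ((pw (aob Q) k.+1, diag_ob i (aob Q)) : pow_cat E i.+1) :=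
  if j is 0 then (atc k.+1 0 (act Q 0), diag_hom i (cid1 (aob Q)))
  else (bmap (fun _ : 'I_k.+1 => act Q j), diag_hom i (act Q j)).

Fact cr_actC i k j l : cr_act i k j \oc cr_act i k l = cr_act i k l \oc cr_act i k j.
Proof.
case: j l => [|j] [|l] //=; congr pair; rewrite -?diag_homM -?bmapM ?ccomp1f ?ccompf1 //.
- by apply: bmap_eq => x; case: ifP => _; rewrite ?ccomp1f ?ccompf1 // actC.
- by apply: bmap_eq => x; case: ifP => _; rewrite ?ccomp1f ?ccompf1 // actC.
- by apply: bmap_eq => x; apply: actC.
- by rewrite actC.
Qed.

Fact cr_act_iso i k j : is_iso (cr_act i k j).
Proof.
apply: (@prod_iso E (pow_cat E i)); case: j => [|j] /=.
- by apply: atc_iso; apply: act_iso.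
- by apply: bmap_iso => x; apply: act_iso.
- by apply: diag_hom_iso; apply: is_iso1.
- by apply: diag_hom_iso; apply: act_iso.
Qed.

(* (Q^(k+1), Q, ..., Q), where the first automorphism acts on one summand of the first
   variable only *)
Definition cr_var i k : aobj (pow_cat E i.+1) := AObj (@cr_actC i k) (@cr_act_iso i k).

Definition cr_obj i k : aobj E := aqF (cross_effect F i) (cr_var i k).

Definition crJ_act i j : chom (diag_ob i.+1 (aob Q)) (diag_ob i.+1 (aob Q)) :=
  if j is 0 then (act Q 0, diag_hom i (cid1 (aob Q))) else diag_hom i.+1 (act Q j).

Fact crJ_actC i j l : crJ_act i j \oc crJ_act i l = crJ_act i l \oc crJ_act i j.
Proof.
case: j l => [|j] [|l] //=; congr pair; rewrite -?diag_homM ?ccomp1f ?ccompf1 ?(actC _ j.+1 l.+1) //;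
  exact: actC.
Qed.

Fact crJ_act_iso i j : is_iso (crJ_act i j).
Proof.
case: j => [|j]; last by apply: diag_hom_iso; apply: act_iso.
apply: (@prod_iso E (pow_cat E i)); first exact: act_iso.
by apply: diag_hom_iso; apply: is_iso1.
Qed.

Definition crJ i : aobj E := aqF (cross_effect F i) (AObj (@crJ_actC i) (@crJ_act_iso i)).

Hypothesis Q_in : ex_in (aob Q).

Lemma cr_obj_in i k : ex_in (aob (cr_obj i k)).
Proof. by apply: cross_effect_in; split; [apply: nice_bip nE _ _ _ | apply: all_in_diag]. Qed.

Variables (dg : Aq (Bq E) -> Prop) (G : abgroup) (chi : aobj (bcx_acat E) -> G).
Hypothesis dgP : forall W : aobj (bcx_acat E), (forall k, bd (aob W) k = bt (aob W) k) -> dg W.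
Hypothesis chiA : additive_inv (X := Aq (Bq E)) dg chi.

Let chi' (W : aobj E) : G := chi (two_aut W).
Let dg' (W : Aq E) : Prop := act (W : aobj E) 0 = cid1 _.

Let chi'A : additive_inv (X := Aq E) dg' chi'.
Proof. by apply: (chi_two_aut_additive nE chiA) => W e; apply: dgP => k /=; rewrite e. Qed.

Lemma pw_biprod_iso k : exists u : chom (biprod (pw (aob Q) k.+1) (aob Q)) (pw (aob Q) k.+2),
  is_iso u /\ forall (a : 'I_k.+2 -> chom (aob Q) (aob Q)) (b : 'I_k.+1 -> chom (aob Q) (aob Q)) c,
    (forall i : 'I_k.+1, a (widen_ord (leqnSn k.+1) i) = b i) -> a ord_max = c ->
    u \oc biprod_map (bmap b) c = bmap a \oc u.
Proof.
pose w := @widen_ord k.+1 k.+2 (leqnSn k.+1).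
pose B := biprod (pw (aob Q) k.+1) (aob Q).
pose P := pw (aob Q) k.+2.
pose v : chom P B := pairing (bpair (fun i : 'I_k.+1 => bpr (fun _ : 'I_k.+2 => aob Q) (w i)))
  (bpr (fun _ : 'I_k.+2 => aob Q) ord_max).
pose u0 (j : 'I_k.+2) : chom B (aob Q) :=
  if insub (j : nat) is Some i then bpr (fun _ : 'I_k.+1 => aob Q) i \oc bpr1 _ _ else bpr2 _ _.
have u0w i : u0 (w i) = bpr (fun _ : 'I_k.+1 => aob Q) i \oc bpr1 _ _.
  by rewrite /u0 /= valK.
have u0m : u0 ord_max = bpr2 _ _.
  by rewrite /u0 insubF //= ltnn.
have ordP (j : 'I_k.+2) : (exists i, j = w i) \/ j = ord_max.
  have [jk|jk] := ltnP j k.+1; [left; exists (Ordinal jk) | right]; apply: val_inj => //=.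
  by have := ltn_ord j; lia.
exists (bpair u0); split.
  exists v; split.
    apply: biprod_ext; rewrite ccompA (bpr1_pairing, bpr2_pairing) ccompf1.
      by apply: bip_ext => i; rewrite ccompA !bpr_bpair u0w.
    by rewrite bpr_bpair u0m.
  apply: bip_ext => j; rewrite ccompA bpr_bpair ccompf1.
  case: (ordP j) => [[i ->]|->]; rewrite (u0w, u0m) -?ccompA (bpr1_pairing, bpr2_pairing) //.
  by rewrite bpr_bpair.
move=> a b c ab am; apply: bip_ext => j; rewrite !ccompA bpr_bmap bpr_bpair -ccompA bpr_bpair.
case: (ordP j) => [[i ->]|->].
  by rewrite u0w ab -ccompA bpr1_map !ccompA bpr_bmap.
by rewrite u0m bpr2_map am.
Qed.

(** Split one summand off the power in the first variable. The part on that single summand has the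
    identity as its first automorphism, so it is diagonal and its class vanishes. *)
Lemma chi_cr_objS i k : chi' (cr_obj i k.+1) = abD (chi' (cr_obj i.+1 k)) (chi' (cr_obj i k)).
Proof.
pose T := pow_cat E i.
pose X : aobj (prod_cat E (prod_cat E T)) := cr_var i.+1 k.
pose crF : functor (prod_cat E T) E := cross_effect F i.
have S_in : ex_in (cross_effect F i (biprod (aob X).1 (aob X).2.1, (aob X).2.2)).
  apply: cross_effect_in; split; last exact: all_in_diag.
  by apply: biprod_in => //; apply: nice_bip nE _ _ _.
have := chi_cr_step nE chi'A (@cross_effect_reduced i) (X := X) S_in.
have -> : chi' (aqF crF (aqF (snd_functor E T) X)) = ab0.
  apply: chi'A.2; first by apply: cross_effect_in; split=> //; apply: all_in_diag.
  rewrite /dg' act_aqF -(fmap1 (cross_effect F i)); congr fmap.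
  by rewrite act_aqF /= diag_hom1.
rewrite abD0.
have -> : chi' (aqF crF (aqF (fst_functor E T) X)) =
    chi' (cr_obj i k).
  have P j : cid1 _ \oc act (aqF crF (aqF (fst_functor E T) X)) j =
      act (cr_obj i k) j \oc cid1 _.
    by rewrite ccomp1f ccompf1; case: j.
  apply: (chi_two_aut_iso nE chiA
    (f := @AHom E (aqF crF (aqF (fst_functor E T) X)) (cr_obj i k) _ P)).
    by apply: ahom_iso; apply: is_iso1.
  exact: cr_obj_in.
move=> <-; symmetry.
have [u [ui uP]] := pw_biprod_iso k.
pose v : @chom (prod_cat E T) (aob (aqF (sum_functor E T) X)) (aob (cr_var i k.+1)) :=
  (u, cid1 (diag_ob i (aob Q))).
have vP j : fmap (cross_effect F i) v \oc act (aqF crF (aqF (sum_functor E T) X))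
    j = act (cr_obj i k.+1) j \oc fmap (cross_effect F i) v.
  rewrite !act_aqF -!fmapM; congr fmap; case: j => [|j]; rewrite /v /= ccomp1f ccompf1; congr pair.
    by apply: uP => // i'; rewrite /=.
  by apply: uP.
apply: (chi_two_aut_iso nE chiA
    (f := @AHom E (aqF crF (aqF (sum_functor E T) X)) (cr_obj i k.+1) _ vP));
  last exact: S_in.
apply: ahom_iso; apply: (functor_iso (cross_effect F i)); apply: (@prod_iso E T) => //; exact: is_iso1.
Qed.

(** The cross-effects defined by kernels thus have the same iterated differences as the images
    [crC]; comparing the classes in this way spares an isomorphism between the two constructions. *)
Lemma chi_cr_obj_iter i k : iter i (@dif G) (fun l => chi' (cr_obj 0 l)) k = chi' (cr_obj i k).
Proof.
elim: i k => [//|i IH] k; rewrite iterS /dif !IH chi_cr_objS.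
by rewrite -abDA abDN abD0.
Qed.

Lemma chi_crJ i : chi' (cr_obj i 0) = chi' (crJ i).
Proof.
pose u : chom (pw (aob Q) 1) (aob Q) := bpr (fun _ : 'I_1 => aob Q) ord0.
have ui : is_iso u.
  exists (bin (fun _ : 'I_1 => aob Q) ord0); split; last exact: bpr_bin.
  by rewrite -[RHS](bin_bpr (fun _ : 'I_1 => aob Q)) big_ord1.
pose v : @chom (pow_cat E i.+1) (aob (cr_var i 0)) (diag_ob i.+1 (aob Q)) := (u, cid1 (diag_ob i (aob Q))).
have vP j : fmap (cross_effect F i) v \oc act (cr_obj i 0) j = act (crJ i) j \oc fmap (cross_effect F i) v.
  rewrite !act_aqF -!fmapM; congr fmap; case: j => [|j]; rewrite /v /= ccomp1f ccompf1; congr pair;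
    by rewrite bpr_bmap.
apply: (chi_two_aut_iso nE chiA (f := @AHom E (cr_obj i 0) (crJ i) _ vP)); last exact: cr_obj_in.
apply: ahom_iso; apply: (functor_iso (cross_effect F i)); apply: (@prod_iso E (pow_cat E i)) => //; exact: is_iso1.
Qed.

Lemma chi_FP_cr_obj k : chi (two_aut (FP F k Q)) = chi' (cr_obj 0 k).
Proof.
have P j : cid1 _ \oc act (FP F k Q) j = act (cr_obj 0 k) j \oc cid1 _.
  by rewrite ccomp1f ccompf1; case: j => [|j] //; rewrite act_FP0.
apply: (chi_two_aut_iso nE chiA (f := @AHom E (FP F k Q) (cr_obj 0 k) _ P)); last exact: (cr_obj_in 0 k).
by apply: ahom_iso; apply: is_iso1.
Qed.

Lemma chi_NF_cr r : degree_le F r -> @ex_in (Bq E) (NFGam F (two_term (act Q 0))) ->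
  chi (aqF (NFGam F) (two_aut Q)) = \big[@abD G / ab0]_(i < r) ab_sign i (chi (two_aut (crJ i))).
Proof.
move=> Fr N_in.
have [-> _] := chi_NF_tt nE dgP chiA F0 (fun Q' m _ => degree_le_opv Q' m Fr) F_in Q_in N_in.
rewrite (ext_eq r chi_FP_cr_obj) ext_sum; apply: eq_bigr => i _.
by rewrite chi_cr_obj_iter chi_crJ.
Qed.

End Objects.
End CrossPow.

(** * Cubes *)

(** In degree 0 the normalisation for the complex [1 : A -> A] contains [F A] as a retract. So
    preservation of membership, given in dimension [n], descends to all lower dimensions. *)
Lemma NFGam_in_base (D : excat) (nD : nice D) (F : functor D D) :
  (forall A : Bq D, ex_in A -> @ex_in (Bq D) (NFGam F A)) -> forall A : D, ex_in A -> ex_in (F A).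
Proof.
move=> NF_in A A_in.
have T_in : @ex_in (Bq D) (two_term (cid1 A)) by apply: (two_term_in nD A_in); apply: is_iso1.
have [N_in _ _ _] := NF_in _ T_in.
apply: nice_retract nD _ _ (N_in 0%N) _.
have z : bpair (@Nface D F (two_gr A) 0) \oc
    fmap F (gam' A 0 \oc bin (fun _ : 'I_1 => A) ord0) = 0.
  by apply: bpair_eq0 => -[].
exists (klift z), (fmap F (bpr (fun _ : 'I_1 => A) ord0 \oc gam A 0) \oc kin _).
rewrite -ccompA kliftK -fmapM -(fmap1 F); congr fmap.
by rewrite -ccompA (ccompA (gam A 0)) gam_gam' ccomp1f bpr_bin.
Qed.

Section Diagonal.
Variable E : excat.

Lemma zero_diagonal_dir m i (P : Bn E m) : is_zero P -> (i < m)%N -> diagonal_dir i P.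
Proof.
elim: m P => [//|m IH] P P0 im /=; have Pk := Bq_zero P0.
case: eqP => [_ k|/eqP im']; first by rewrite (zero_from (bd P k)) // (zero_from (bt P k)).
move=> k; apply: IH; [exact: Pk | lia].
Qed.

(** A diagonal direction survives in degrees 0 and 1, and the zero objects in the other degrees are
    diagonal in every direction. *)
Lemma two_aut_diagonal m (W : aobj (Bn E m)) : diagonal (aob W) -> @diagonal E m.+1 (aob (two_aut W)).
Proof.
case=> i im di; exists i; first by lia.
rewrite /= ifF; last by lia.
case=> [|[|k]] //=; apply: zero_diagonal_dir im; exact: zob_zero.
Qed.

Lemma outer_diagonal m (W : aobj (Bn E m.+1)) :
  (forall k, bd (aob W : bcx (Bn E m)) k = bt (aob W : bcx (Bn E m)) k) -> diagonal (aob W).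
Proof. by move=> e; exists m => //=; rewrite eqxx. Qed.

End Diagonal.

Section CubeR.
Variables (E : excat) (nE : nice E).

(* [P; A_1, ..., A_m] with the automorphisms A_(m+1), A_(m+2), ... *)
Fixpoint cubeR m (W : aobj E) : aobj (Bn E m) := if m is m'.+1 then two_aut (cubeR m' W) else W.

Lemma cubeR_in m (W : aobj E) : ex_in (aob W) -> ex_in (aob (cubeR m W)).
Proof. by move=> W_in; elim: m => [//|m IH]; exact: (two_aut_in (Bn_nice m nE) IH). Qed.

Variables (F : functor E E) (r n : nat).
Hypothesis F0 : forall A B : E, fmap F (0 : chom A B) = 0.
Hypothesis Fr : degree_le F r.
Hypothesis F_in : forall A : Bn E n, ex_in A -> ex_in (iter_NFGam F n A).

Lemma iter_NFGam_in m : (m <= n)%N -> forall A : Bn E m, ex_in A -> ex_in (iter_NFGam F m A).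
Proof.
elim: n F_in => [|k IH] Fk; first by case: m.
rewrite leq_eqVlt => /orP[/eqP ->//|mk]; apply: IH; last by lia.
exact: (NFGam_in_base (Bn_nice k nE) Fk).
Qed.

(** The outermost direction is peeled off by [chi_NF_NF], which replaces the invariant by its
    composite with [two_aut]; hence the induction over all [chi]. *)
Lemma chi_cubeR m : (m < n)%N ->
  forall (G : abgroup) (chi : aobj (Bn E m.+1) -> G),
  additive_inv (X := Aq (Bn E m.+1)) (fun W : aobj (Bn E m.+1) => diagonal (aob W)) chi ->
  forall Q : aobj E, ex_in (aob Q) ->
  chi (aqF (iter_NFGam F m.+1) (cubeR m.+1 Q)) =
  \big[@abD G / ab0]_(i < r) ab_sign i (chi (cubeR m.+1 (crJ F Q i))).
Proof.
elim: m => [|m IH] mn G chi chiA Q Q_in.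
  apply: (chi_NF_cr nE F0 (iter_NFGam_in (leq0n n)) Q_in (@outer_diagonal E 0) chiA Fr).
  by apply: (iter_NFGam_in mn); apply: (two_aut_in nE Q_in).
have nD := Bn_nice m nE.
have H k Q' l : (r < l)%N -> opv (iter_NFGam F k) Q' l 0 \oc vprod (iter_NFGam F k) Q' l r = 0.
  by move=> _; apply: degree_le_opv; apply: degree_le_iter_NFGam.
have e := chi_NF_NF nD (@outer_diagonal E m.+1)
  (fun W h => two_aut_diagonal (outer_diagonal h)) chiA (@iter_NFGam0 E F m F0) (H m)
  (iter_NFGam_in (ltnW (ltnW mn))) (@iter_NFGam0 E F m.+1 F0) (H m.+1)
  (iter_NFGam_in (ltnW mn)) (iter_NFGam_in mn) (cubeR_in m Q_in).
apply: (etrans e).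
apply: (IH (ltnW mn) G (fun W => chi (two_aut W))) => //.
apply: (@chi_two_aut_additive (Bn E m.+1) (Bn_nice m.+1 nE) _ _ _ chiA).
exact: (@two_aut_diagonal E m.+1).
Qed.

End CubeR.

Lemma chi_cube_full (E : excat) (nE : nice E) (F : functor E E) (r n : nat)
    (G : abgroup) (chi : aobj (Bn E n) -> G) (Q : aobj E) : (0 < n)%N ->
  (forall A B : E, fmap F (0 : chom A B) = 0) -> degree_le F r ->
  (forall A : Bn E n, ex_in A -> ex_in (iter_NFGam F n A)) ->
  additive_inv (X := Aq (Bn E n)) (fun W : aobj (Bn E n) => diagonal (aob W)) chi ->
  ex_in (aob Q) ->
  chi (aqF (iter_NFGam F n) (cubeR n Q)) =
  \big[@abD G / ab0]_(i < r) ab_sign i (chi (cubeR n (crJ F Q i))).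
Proof.
case: n chi => // m chi _ F0 Fr F_in chiA Q_in.
exact: (chi_cubeR nE F0 Fr F_in (ltnSn m) chiA Q_in).
Qed.

(** * Comparison with the cubes of the statement *)

Section CubeCompare.
Variable E : excat.

(** The clause on endomorphisms is needed for the induction: in the next dimension an endomorphism
    becomes the differential. *)
Lemma cube_iso m (P : autn E m) (W : aobj E) (f : chom (aut_ob P) (aob W)) : is_iso f ->
  (forall i : 'I_m, f \oc aut P i = act W i \oc f) ->
  exists u : chom (cube E m P) (aob (cubeR m W)), is_iso u /\
    forall (a : authom P P) j, f \oc (a : chom P P) = act W (m + j) \oc f ->
      u \oc @fmap (autn_cat E m) _ (cube E m) P P a = act (cubeR m W) j \oc u.
Proof.
elim: m P W f => [|m IH] P W f fi fP; first by exists f.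
have [u [ui uP]] := IH (aut_init P) W f fi (fun i => fP (widen_ord (leqnSn m) i)).
have e := uP (aut_last P) 0%N; rewrite addn0 in e.
exists (two_term_map (e (fP ord_max)) : @chom (bcx_cat (Bn E m)) (cube E m.+1 P) (aob (cubeR m.+1 W))).
split; first by apply: bhom_iso' => -[|[|k]] //=; apply: is_iso1.
move=> a j fa.
have ua := uP (aut_init_map a) j.+1; rewrite addnS in ua.
by apply: (@bhomP _ (cube E m.+1 P) (aob (cubeR m.+1 W))) => -[|[|k]] //=; apply: ua.
Qed.

Variables (n : nat) (P : autn E n).

Definition aut_ext (j : nat) : chom (aut_ob P) (aut_ob P) :=
  if insub j is Some i then aut P i else cid1 _.

Fact aut_extC i j : aut_ext i \oc aut_ext j = aut_ext j \oc aut_ext i.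
Proof.
rewrite /aut_ext; case: (insub i) => [i'|]; case: (insub j) => [j'|];
  rewrite ?ccomp1f ?ccompf1 //; exact: aut_comm.
Qed.

Fact aut_ext_iso i : is_iso (aut_ext i).
Proof. by rewrite /aut_ext; case: (insub i) => [i'|]; [apply: aut_iso | apply: is_iso1]. Qed.

Definition aobj_of : aobj E := AObj aut_extC aut_ext_iso.

Lemma aut_ext_ord (i : 'I_n) : aut_ext i = aut P i.
Proof. by rewrite /aut_ext valK. Qed.

End CubeCompare.

(** * The class in the K-group as an additive invariant *)

Section KInvariant.
Variables (E : excat) (nE : nice E) (n : nat).

(** Extended by zero to all objects, since invariants are functions on the ambient category;
    additivity is required for members only. *)
Definition kchi (P : Bn E n) : K E n :=
  if pselect (ex_in P) is left P_in then Kclass P_in else ab0.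

Lemma kchiE (P : Bn E n) (P_in : ex_in P) : kchi P = Kclass P_in.
Proof. by rewrite /kchi; case: pselect => // P_in'; rewrite (Prop_irrelevance P_in' P_in). Qed.

Lemma kchi_additive : additive_inv (X := Bn E n) (@diagonal E n) kchi.
Proof.
split=> [A B D f g A_in B_in D_in ses|A A_in dA]; rewrite !kchiE.
  apply/Kcl_eq.
  apply: (krel_trans (@krel_ses E n (BObj A_in) (BObj B_in) (BObj D_in) f g ses)).
  by apply: krel_add; apply: krel_sym; apply: Krep_rel.
by apply/Kcl_eq; apply: krel_diag.
Qed.

Lemma kchi_aob_additive : additive_inv (X := Aq (Bn E n)) (fun W : aobj (Bn E n) => diagonal (aob W))
  (fun W : aobj (Bn E n) => kchi (aob W)).
Proof.
split=> [A B D f g A_in B_in D_in ses|A A_in dA]; last exact: kchi_additive.2.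
exact: (kchi_additive.1 _ _ _ (ahf f) (ahf g)).
Qed.

Lemma kchi_iso (A B : Bn E n) (f : chom A B) : is_iso f -> ex_in A -> kchi A = kchi B.
Proof. exact: (chi_iso (Bn_nice n nE) kchi_additive). Qed.

Lemma kchi_cube (P : autn E n) (W : aobj E) (f : chom (aut_ob P) (aob W)) : is_iso f ->
  (forall i : 'I_n, f \oc aut P i = act W i \oc f) -> ex_in (aut_ob P) ->
  kchi (cube E n P) = kchi (aob (cubeR n W)).
Proof.
move=> fi fP P_in; have [u [ui _]] := cube_iso fi fP.
by apply: kchi_iso ui _; apply: cube_in => //; apply: nice_proper.
Qed.

Variables (F : functor E E) (r : nat).
Hypothesis F0 : forall A B : E, fmap F (0 : chom A B) = 0.
Hypothesis Fr : degree_le F r.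
Hypothesis n_gt0 : (0 < n)%N.
Hypothesis F_in : forall A : Bn E n, ex_in A -> ex_in (iter_NFGam F n A).

Lemma kchi_iter_NFGam_cube (P : autn E n) : ex_in (aut_ob P) ->
  kchi (iter_NFGam F n (cube E n P)) =
  \big[@abD (K E n) / ab0]_(i < r) ab_sign i (kchi (cube E n (cr_autn F P i))).
Proof.
move=> P_in; pose W := aobj_of P.
have fP (i : 'I_n) : cid1 (aut_ob P) \oc aut P i = act W i \oc cid1 (aut_ob P).
  by rewrite ccomp1f ccompf1 /= aut_ext_ord.
have [u [ui _]] := @cube_iso E n P W _ (is_iso1 _) fP.
have cP_in : ex_in (cube E n P) by apply: cube_in => //; apply: nice_proper.
rewrite (kchi_iso (functor_iso (iter_NFGam F n) ui) (F_in cP_in)).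
have F0_in := iter_NFGam_in nE F_in (leq0n n).
apply: (etrans (y := \big[@abD (K E n) / ab0]_(i < r) ab_sign i (kchi (aob (cubeR n (crJ F W i)))))).
  exact: (chi_cube_full nE n_gt0 F0 Fr F_in kchi_aob_additive).
apply: eq_bigr => i _; congr ab_sign; symmetry.
apply: (@kchi_cube (cr_autn F P i) (crJ F W i) (cid1 _)); first exact: is_iso1.
  move=> j; rewrite ccomp1f ccompf1 /= /cr_aut; congr fmap; rewrite /cr_arg -aut_ext_ord.
  by case: j => -[|j] jn.
by apply: (cross_effect_in nE F0 F0_in); apply: (@all_in_diag E i.+1).
Qed.

End KInvariant.

Theorem theorem2p1 (X : scheme) (qcX : compact (@setT X))
    (r n : nat) (r_gt0 : (0 < r)%N) (n_gt0 : (0 < n)%N)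
    (Lambda : forall E : omod X, ext_power r E)
    (lambda : K (PX X) n -> K (PX X) n)
    (lambdaP : is_lambda (iter_NFGam (ext_functor Lambda) n) lambda)
    (P : autn (PX X) n) (P_lf : locally_free (aut_ob P)) :
  let crP (i : 'I_r) := cr_autn (ext_functor Lambda) P i in
  exists crP_lf : forall i : 'I_r, locally_free (aut_ob (crP i)),
    lambda (cube_class P_lf) =
    \big[@abD (K (PX X) n) / ab0]_(i < r) ab_sign i (cube_class (crP_lf i)).
Proof.
move=> crP.
have nX := PX_nice X.
have F0 := @ext_functor0 X r Lambda r_gt0.
(* That the operation preserves $\mathcal{B}^n$ is contained in the defining property of
   [lambda]. *)
have F_in (A : Bn (PX X) n) : ex_in A -> ex_in (iter_NFGam (ext_functor Lambda) n A).
  by move=> A_in; have [FA_in _] := lambdaP.2 A A_in.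
have F0_in := iter_NFGam_in nX F_in (leq0n n).
have crP_lf (i : 'I_r) : locally_free (aut_ob (crP i)).
  by apply: (cross_effect_in nX F0 F0_in); apply: (@all_in_diag (PX X) i.+1).
exists crP_lf; have [FP_in e] := lambdaP.2 _ (cube_in (@PX_proper X) P_lf).
rewrite /cube_class e -kchiE.
rewrite (kchi_iter_NFGam_cube nX F0 (@ext_functor_degree X r Lambda) n_gt0 F_in P_lf).
by apply: eq_bigr => i _; rewrite -kchiE.
Qed.
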